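(* Let $(X,\mathcal{O})$ be a $\sigma$-compact metrizable space without isolated points, $(T,\pi,\phi)$ a locally finite bi-infinite tree with a reference point, and $K$ a locally finite and minimal partition of $X$ parametrized by $(T,\pi,\phi)$. Let $d$ be a metric on $X$ inducing $\mathcal{O}$ with $\mathrm{diam}(X,d)=\infty$ which satisfies the basic framework, and let $M_*$ be an integer such that $d$ is $M_*$-adapted. Then for all integers $N\ge1$, $N_1\ge0$, $N_2\ge N_1+M_*$ and all $p>0$: (1) $\underline{I}_{\mathcal{E}}(N_1,N_2,N)=\overline{I}_{\mathcal{E}}(N_1,N_2,N)=\dim_{\mathrm{AR}}(X,d)$; (2) if $\underline{R}_p(N_1,N_2,N)<1$ then $\dim_{\mathrm{AR}}(X,d)\le\underline{d}^S_p(N_1,N_2,N)\le\overline{d}^S_p(N_1,N_2,N)<p$; (3) if $\overline{R}_p(N_1,N_2,N)\ge1$ then $\dim_{\mathrm{AR}}(X,d)\ge\overline{d}^S_p(N_1,N_2,N)\ge\underline{d}^S_p(N_1,N_2,N)\ge p$.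
   Context: Bi-infinite tree: $T$ countable, $\pi:T\to T$ with (T1) for all $w,v$ there exist $n,m\ge0$ with $\pi^n(w)=\pi^m(v)$, (T2) $\pi^n(w)\ne w$ for $n\ge1$; locally finite if $\#S(w)<\infty$ for all $w$, where $S(w)=\pi^{-1}(w)$, $S^k(A)=\{v:\pi^k(v)\in A\}$. Height $[w]=n-m$ where $\pi^n(w)=\pi^m(\phi)$; $(T)_n=\{w:[w]=n\}$; $\Sigma^*$ = sequences $(\omega_n)_{n\in\mathbb{Z}}$ with $\omega_n\in(T)_n$, $\pi(\omega_{n+1})=\omega_n$. Partition: a map $w\mapsto K_w$ into nonempty compact subsets of $X$ that are not single points with (P1) $\bigcup_{v\in S(w)}K_v=K_w$; (P2) $\bigcap_{m\ge0}K_{\omega_m}$ is a single point for every $\omega\in\Sigma^*$; (P3) $\bigcup_{w\in(T)_0}K_w=X$. Locally finite: each $w\in(T)_0$ has an open $U_w\supseteq K_w$ meeting only finitely many $K_v$, $v\in(T)_0$. Minimal: $O_w=K_w\setminus\bigcup_{v\in(T)_{[w]},v\ne w}K_v\ne\emptyset$ for all $w$. Scales: $g_d(w)=\mathrm{diam}(K_w,d)$; $\Lambda_s=\{w\in T:g_d(w)\le s<g_d(\pi(w))\}$; $E_s$ = pairs of distinct $w,v\in\Lambda_s$ with $K_w\cap K_v\ne\emptyset$; $\Lambda_{s,M}(w)=\{v\in\Lambda_s:l_{E_s}(w,v)\le M\}$ (graph distance); $\Lambda_{s,M}(x)=\bigcup_{w\in\Lambda_s,x\in K_w}\Lambda_{s,M}(w)$;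 $U_M(x,s)=\bigcup_{w\in\Lambda_{s,M}(x)}K_w$. Uniformly finite: $\sup\{\#\Lambda_{s,1}(w):s>0,w\in\Lambda_s\}<\infty$. Thick: there is $\alpha>0$ such that each $w$ has $x\in K_w$ with $U_1(x,\alpha g_d(\pi(w)))\subseteq K_w$. $M$-adapted: there are $\alpha_1,\alpha_2>0$ with $B_d(x,\alpha_1s)\subseteq U_M(x,s)\subseteq B_d(x,\alpha_2s)$ for all $x\in X$, $s>0$. Basic framework: $\sup_w\#S(w)<\infty$, $d$ uniformly finite, thick, $M$-adapted for some $M$, and $g_d(w)\asymp r^{[w]}$ for some $r\in(0,1)$. Energies: $J^h_m$ = pairs of distinct $w,v\in(T)_m$ with $K_w\cap K_v\ne\emptyset$; $J^h_{N,m}=\{(w,v)\in(T)_m^2:0<l_{J^h_m}(w,v)\le N\}$; $\Gamma_n(w)=\{v\in(T)_{[w]}:l_{J^h_{[w]}}(w,v)\le n\}$; $\mathcal{E}_{p,k,w}(N_1,N_2,N)=\inf\{\frac12\sum_{(x,y)\in J^h_{N,[w]+k}}|f(x)-f(y)|^p:f:(T)_{[w]+k}\to\mathbb{R}, f=1$ on $S^k(\Gamma_{N_1}(w))$, $f=0$ off $S^k(\Gamma_{N_2}(w))\}$; $\mathcal{E}_{p,k}=\sup_{w\in T}\mathcal{E}_{p,k,w}$; $\overline{I}_{\mathcal{E}}=\inf\{p:\limsup_k\mathcal{E}_{p,k}=0\}$, $\underline{I}_{\mathcal{E}}=\inf\{p:\liminf_k\mathcal{E}_{p,k}=0\}$;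 $\overline{N}_*=\limsup_k\sup_w\#(S^k(w))^{1/k}$, $\overline{R}_p=\limsup_k\mathcal{E}_{p,k}^{1/k}$, $\underline{R}_p=\liminf_k\mathcal{E}_{p,k}^{1/k}$, $\overline{d}^S_p=p\log\overline{N}_*/(\log\overline{N}_*-\log\overline{R}_p)$, $\underline{d}^S_p=p\log\overline{N}_*/(\log\overline{N}_*-\log\underline{R}_p)$. Ahlfors regular conformal dimension: a Borel measure $\nu$ is $\alpha$-Ahlfors regular for $(X,\rho)$ if $C^{-1}s^\alpha\le\nu(B_\rho(x,s))\le Cs^\alpha$ for $x\in X$ and $r_x\le s\le\mathrm{diam}(X,\rho)$, $r_x=\inf_{y\ne x}\rho(x,y)$; $\dim_{\mathrm{AR}}(X,d)=\inf\{\alpha:$ some metric $\rho$ on $X$ admits an $\alpha$-Ahlfors regular measure and $d$ is quasisymmetric to $\rho\}$, where $d$ is quasisymmetric to $\rho$ if $\rho(x,y)/\rho(x,z)\le\theta(d(x,y)/d(x,z))$ for $x\ne z$, for some homeomorphism $\theta$ of $[0,\infty)$. *)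

(* Defs.v *)
From Stdlib Require Import Reals List ZArith Lra.
From Coquelicot Require Import Coquelicot.
Open Scope R_scope.

Definition Rbar_limsup (u : nat -> Rbar) : Rbar :=
  Rbar_glb (fun y => exists n : nat,
    y = Rbar_lub (fun z => exists k : nat, (n <= k)%nat /\ z = u k)).
Definition Rbar_liminf (u : nat -> Rbar) : Rbar :=
  Rbar_lub (fun y => exists n : nat,
    y = Rbar_glb (fun z => exists k : nat, (n <= k)%nat /\ z = u k)).

Definition abspow (t p : R) : R :=
  if Req_EM_T t 0 then 0 else Rpower (Rabs t) p.

Definition Rbar_rootk (x : Rbar) (k : nat) : Rbar :=
  match x with
  | Finite r => Finite (if Rle_dec r 0 then 0 else Rpower r (/ INR k))
  | p_infty => p_infty
  | m_infty => m_infty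
  end.

Definition Rbar_ln (x : Rbar) : Rbar :=
  match x with
  | Finite r => if Rle_dec r 0 then m_infty else Finite (ln r)
  | p_infty => p_infty
  | m_infty => m_infty
  end.

(* sum of a nonnegative family over a (possibly infinite) set:
   supremum of all finite partial sums *)
Definition sum_over {A : Type} (S : A -> Prop) (g : A -> R) : Rbar :=
  Lub_Rbar (fun s => exists l : list A,
    NoDup l /\ (forall z, In z l -> S z) /\ s = fold_right Rplus 0 (map g l)).

Definition card {A : Type} (S : A -> Prop) : Rbar :=
  Lub_Rbar (fun r => exists l : list A,
    NoDup l /\ (forall z, In z l -> S z) /\ r = INR (length l)).

(* paths: [within E n w v] iff the graph distance l_E(w,v) is <= n *)
Inductive within {A : Type} (E : A -> A -> Prop) : nat -> A -> A -> Prop :=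
| within_refl : forall n w, within E n w w
| within_step : forall n w u v, E w u -> within E n u v -> within E (S n) w v.

Section Metric.
Context {X : Type}.
Variable d : X -> X -> R.

Definition is_metric : Prop :=
  (forall x y, 0 <= d x y) /\
  (forall x y, d x y = 0 <-> x = y) /\
  (forall x y, d x y = d y x) /\
  (forall x y z, d x z <= d x y + d y z).

Definition ball (x : X) (r : R) : X -> Prop := fun y => d x y < r.

Definition metric_open (U : X -> Prop) : Prop :=
  forall x, U x -> exists e, 0 < e /\ forall y, d x y < e -> U y.

Definition diam (A : X -> Prop) : Rbar :=
  Lub_Rbar (fun r => exists x y, A x /\ A y /\ r = d x y).

Definition unbounded : Prop := forall B : R, exists x y, B < d x y.

Inductive borel : (X -> Prop) -> Prop :=
| borel_open : forall U, metric_open U -> borel U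
| borel_compl : forall A, borel A -> borel (fun x => ~ A x)
| borel_union : forall A : nat -> X -> Prop,
    (forall n, borel (A n)) -> borel (fun x => exists n, A n x)
| borel_ext : forall A B, borel A -> (forall x, A x <-> B x) -> borel B.

Fixpoint psum (m : nat -> Rbar) (n : nat) : Rbar :=
  match n with O => Finite 0 | S n' => Rbar_plus (psum m n') (m n') end.

Definition borel_measure (nu : (X -> Prop) -> Rbar) : Prop :=
  (forall A B, (forall x, A x <-> B x) -> nu A = nu B) /\
  nu (fun _ => False) = Finite 0 /\
  (forall A, borel A -> Rbar_le (Finite 0) (nu A)) /\
  (forall A : nat -> X -> Prop, (forall n, borel (A n)) ->
     (forall i j x, i <> j -> A i x -> A j x -> False) ->
     nu (fun x => exists n, A n x)
       = Rbar_lub (fun y => exists n, y = psum (fun i => nu (A i)) n)).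

Definition rx (x : X) : Rbar := Glb_Rbar (fun r => exists y, y <> x /\ r = d x y).

Definition ahlfors_regular (alpha : R) (nu : (X -> Prop) -> Rbar) : Prop :=
  exists C, 0 < C /\ forall x s, 0 < s ->
    Rbar_le (rx x) (Finite s) -> Rbar_le (Finite s) (diam (fun _ => True)) ->
    Rbar_le (Finite (/ C * Rpower s alpha)) (nu (ball x s)) /\
    Rbar_le (nu (ball x s)) (Finite (C * Rpower s alpha)).
End Metric.
Arguments is_metric {X}. Arguments ball {X}. Arguments metric_open {X}. Arguments diam {X}.
Arguments unbounded {X}. Arguments borel {X}. Arguments borel_measure {X}.
Arguments rx {X}. Arguments ahlfors_regular {X}.

Definition cont_nonneg (f : R -> R) : Prop :=
  forall t, 0 <= t -> forall e, 0 < e -> exists delta, 0 < delta /\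
    forall u, 0 <= u -> Rabs (u - t) < delta -> Rabs (f u - f t) < e.

Definition homeo_nonneg (theta : R -> R) : Prop :=
  (forall t, 0 <= t -> 0 <= theta t) /\ cont_nonneg theta /\
  exists theta', cont_nonneg theta' /\
    forall t, 0 <= t -> 0 <= theta' t /\ theta' (theta t) = t /\ theta (theta' t) = t.

Definition quasisymmetric {X : Type} (d rho : X -> X -> R) : Prop :=
  exists theta, homeo_nonneg theta /\
    forall x y z, x <> z -> rho x y / rho x z <= theta (d x y / d x z).

Definition dim_AR {X : Type} (d : X -> X -> R) : Rbar :=
  Glb_Rbar (fun alpha => exists (rho : X -> X -> R) (nu : (X -> Prop) -> Rbar),
    is_metric rho /\ borel_measure rho nu /\ ahlfors_regular rho alpha nu /\
    quasisymmetric d rho).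

Definition compact_in {X : Type} (O : (X -> Prop) -> Prop) (A : X -> Prop) : Prop :=
  forall F : (X -> Prop) -> Prop, (forall U, F U -> O U) ->
    (forall x, A x -> exists U, F U /\ U x) ->
    exists l : list (X -> Prop), (forall U, In U l -> F U) /\
      (forall x, A x -> exists U, In U l /\ U x).

Definition sigma_compact {X : Type} (O : (X -> Prop) -> Prop) : Prop :=
  exists C : nat -> X -> Prop, (forall n, compact_in O (C n)) /\
    forall x, exists n, C n x.

Definition no_isolated_points {X : Type} (O : (X -> Prop) -> Prop) : Prop :=
  forall x : X, ~ O (fun y => y = x).

Definition induces {X : Type} (d : X -> X -> R) (O : (X -> Prop) -> Prop) : Prop :=
  is_metric d /\ forall U, O U <-> metric_open d U.

Section Tree.
Context {T : Type}.
Variable pi : T -> T.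
Variable phi : T.

Definition bi_infinite_tree : Prop :=
  (exists f : T -> nat, forall a b, f a = f b -> a = b) /\
  (forall w v, exists n m : nat, Nat.iter n pi w = Nat.iter m pi v) /\
  (forall w (n : nat), (1 <= n)%nat -> Nat.iter n pi w <> w).

Definition tree_locally_finite : Prop :=
  forall w, exists l : list T, forall v, pi v = w -> In v l.

Definition level (w : T) (n : Z) : Prop :=
  exists a b : nat, Nat.iter a pi w = Nat.iter b pi phi /\ n = (Z.of_nat a - Z.of_nat b)%Z.

Definition same_level (v w : T) : Prop := exists n, level v n /\ level w n.

Definition level_plus (w v : T) (k : nat) : Prop :=
  exists n, level w n /\ level v (n + Z.of_nat k)%Z.

Definition Sk (k : nat) (A : T -> Prop) : T -> Prop := fun v => A (Nat.iter k pi v).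

Context {X : Type}.
Variable O : (X -> Prop) -> Prop.
Variable K : T -> X -> Prop.

Definition K_partition : Prop :=
  (forall w, compact_in O (K w) /\ exists x y, K w x /\ K w y /\ x <> y) /\
  (forall w x, K w x <-> exists v, pi v = w /\ K v x) /\
  (forall omega : Z -> T, (forall n, level (omega n) n) ->
     (forall n, pi (omega (n + 1)%Z) = omega n) ->
     exists x, forall y, (forall m : nat, K (omega (Z.of_nat m)) y) <-> y = x) /\
  (forall x, exists w, level w 0 /\ K w x).

Definition partition_locally_finite : Prop :=
  forall w, level w 0 -> exists U, O U /\ (forall x, K w x -> U x) /\
    exists l : list T, forall v, level v 0 -> (exists x, U x /\ K v x) -> In v l.

Definition partition_minimal : Prop :=
  forall w, exists x, K w x /\ forall v, same_level v w -> v <> w -> ~ K v x.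

Variable d : X -> X -> R.

Definition g (w : T) : R := real (diam d (K w)).

Definition Lambda (s : R) (w : T) : Prop := g w <= s < g (pi w).

Definition Es (s : R) (w v : T) : Prop :=
  Lambda s w /\ Lambda s v /\ w <> v /\ exists x, K w x /\ K v x.

Definition UM (M : nat) (x : X) (s : R) (y : X) : Prop :=
  exists w v, Lambda s w /\ K w x /\ within (Es s) M w v /\ Lambda s v /\ K v y.

Definition uniformly_finite : Prop :=
  exists B : nat, forall s, 0 < s -> forall w, Lambda s w ->
    exists l : list T, (length l <= B)%nat /\
      forall v, Lambda s v -> within (Es s) 1 w v -> In v l.

Definition thick : Prop :=
  exists alpha, 0 < alpha /\ forall w, exists x, K w x /\
    forall y, UM 1 x (alpha * g (pi w)) y -> K w y.

Definition adapted (M : nat) : Prop :=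
  exists a1 a2, 0 < a1 /\ 0 < a2 /\ forall x s, 0 < s ->
    (forall y, ball d x (a1 * s) y -> UM M x s y) /\
    (forall y, UM M x s y -> ball d x (a2 * s) y).

Definition basic_framework : Prop :=
  (exists B : nat, forall w, exists l : list T, (length l <= B)%nat /\
     forall v, pi v = w -> In v l) /\
  uniformly_finite /\ thick /\ (exists M, adapted M) /\
  (exists r C, 0 < r < 1 /\ 0 < C /\ forall w n, level w n ->
     / C * powerRZ r n <= g w <= C * powerRZ r n).

Definition Jh (m : Z) (w v : T) : Prop :=
  level w m /\ level v m /\ w <> v /\ exists x, K w x /\ K v x.

Definition JhN (N : nat) (m : Z) (wv : T * T) : Prop :=
  level (fst wv) m /\ level (snd wv) m /\ fst wv <> snd wv /\
  within (Jh m) N (fst wv) (snd wv).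

Definition Gamma (n : nat) (w : T) : T -> Prop :=
  fun v => exists m, level w m /\ level v m /\ within (Jh m) n w v.

Definition energy_w (p : R) (k : nat) (w : T) (N1 N2 N : nat) : Rbar :=
  Glb_Rbar (fun e => exists f : T -> R,
    (forall v, level_plus w v k -> Sk k (Gamma N1 w) v -> f v = 1) /\
    (forall v, level_plus w v k -> ~ Sk k (Gamma N2 w) v -> f v = 0) /\
    Finite e = Rbar_mult (Finite (/ 2))
      (sum_over (fun xy => exists m, level w m /\ JhN N (m + Z.of_nat k) xy)
                (fun xy => abspow (f (fst xy) - f (snd xy)) p))).

Definition energy (p : R) (k : nat) (N1 N2 N : nat) : Rbar :=
  Rbar_lub (fun e => exists w, e = energy_w p k w N1 N2 N).

Definition I_upper (N1 N2 N : nat) : Rbar :=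
  Glb_Rbar (fun p => 0 < p /\ Rbar_limsup (fun k => energy p k N1 N2 N) = Finite 0).
Definition I_lower (N1 N2 N : nat) : Rbar :=
  Glb_Rbar (fun p => 0 < p /\ Rbar_liminf (fun k => energy p k N1 N2 N) = Finite 0).

Definition N_star : Rbar :=
  Rbar_limsup (fun k => Rbar_lub (fun y => exists w,
    y = Rbar_rootk (card (Sk k (fun u => u = w))) k)).

Definition R_upper (p : R) (N1 N2 N : nat) : Rbar :=
  Rbar_limsup (fun k => Rbar_rootk (energy p k N1 N2 N) k).
Definition R_lower (p : R) (N1 N2 N : nat) : Rbar :=
  Rbar_liminf (fun k => Rbar_rootk (energy p k N1 N2 N) k).

Definition dS_formula (p : R) (Nst Rp : Rbar) : Rbar :=
  Rbar_div (Rbar_mult (Finite p) (Rbar_ln Nst)) (Rbar_minus (Rbar_ln Nst) (Rbar_ln Rp)).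

Definition dS_upper (p : R) (N1 N2 N : nat) : Rbar :=
  dS_formula p N_star (R_upper p N1 N2 N).
Definition dS_lower (p : R) (N1 N2 N : nat) : Rbar :=
  dS_formula p N_star (R_lower p N1 N2 N).
End Tree.

(* Main.v *)
(** Write [E_{p,k}] for the energies and call [alpha] admissible if some [alpha]-Ahlfors regular
    metric is quasisymmetric to [d].

    If [rho] is [alpha]-regular and quasisymmetric to [d], cutting off the [rho]-distance to
    [Gamma_{N1}(w)] gives test functions with
    [E_{p,k} <= C sup_w sum_{v in S^k(w)} (rho_v / rho_w)^p], where [rho_v] is the [rho]-size of
    [K_v].  The sum with exponent [alpha] is bounded because the cells contain disjoint balls, and
    [rho_v / rho_w] decays geometrically in [k]; so [E_{p,k}] decays exponentially for
    [p > alpha], and [E_{p,k} <= C (sup_w #S^k(w))^{1 - p/alpha}] for [p <= alpha] by Hoelder.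

    Conversely, let [E_{p,k}] be tiny for some large [k], and consider only the levels divisible
    by [k].  The gradients of almost optimal functions, raised to the power [p], prescribe lower
    bounds for the ratios mass of a child / mass of its parent, with small sum over the children.
    Smoothing these densities along the graph, and putting the remaining mass of each node on a
    bump deep inside it, one passes from a mass comparable at neighbours to an additive one on the
    next level, comparable with the same constant; a limit over the starting level gives an
    additive mass [mu] on the whole tree.  The metric is the cheapest chain of cells for the
    weights [sigma = mu^{1/p}].  Its lower bound comes from gluing the energy minimizers level by
    level into a function whose oscillation on [K_v] is at most [C sigma(v)].  Together with the
    measure induced by [mu] on the ends of the tree, this metric is [p]-regular and quasisymmetric
    to [d].

    Since Hoelder's inequality also gives
    [E_{q,k} <= C E_{p,k}^{q/p} (sup_w #S^k(w))^{1 - q/p}] for [q <= p], everything follows. *)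

Require Import Defs.
From Stdlib Require Import Reals List ZArith Lra Lia Psatz Classical ClassicalEpsilon.
From Stdlib Require Import ProofIrrelevance FinFun.
From Coquelicot Require Import Coquelicot.
Import Defs.
Open Scope R_scope.


(** The order in which the constants are chosen shapes the construction of the metric. The
    comparability constant [H = 2L + 2] of the masses depends on the degree of the graphs only, so
    it and all constants built from it are known before [k], and the energy threshold can be fixed
    first. This requires that only the contraction ratio and the branching number change on the
    levels divisible by [k]; hence the restatement of the hypotheses at the scales of the levels.
    Once [k] is chosen, a node has up to [B^k] children, so the floor [delta] under the prescribed
    ratios is of order [(B + 1)^-k]. The smoothing is cut off after [i0 + 1] steps, with an error of
    order [2^-i0] that must stay below [delta]; thus [i0] grows linearly in [k]. This is affordable
    because a path of [i0] children has length of order [i0 r^k], still small against the parent.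
    With the weights [mu^{1/p}], additivity of [mu] becomes [p]-regularity, and a Lipschitz bound
    for the weights becomes a lower bound on mass ratios. *)

(** * Choice, finite lists and sums, graph distance *)

Lemma fun_choice {A B : Type} (Q : A -> B -> Prop) :
  (forall a, exists b, Q a b) -> exists f : A -> B, forall a, Q a (f a).
Proof.
  intros H.
  exists (fun a => proj1_sig (constructive_indefinite_description _ (H a))).
  intros a. apply (proj2_sig (constructive_indefinite_description _ (H a))).
Qed.

Definition ind (P : Prop) : R := if excluded_middle_informative P then 1 else 0.

Lemma ind_true (P : Prop) : P -> ind P = 1.
Proof. intros H. unfold ind. destruct (excluded_middle_informative P); tauto. Qed.

Lemma ind_false (P : Prop) : ~ P -> ind P = 0.
Proof. intros H. unfold ind. destruct (excluded_middle_informative P); tauto. Qed.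

Lemma ind_bounds (P : Prop) : 0 <= ind P <= 1.
Proof. unfold ind. destruct (excluded_middle_informative P); lra. Qed.

Definition eq_dec_cl {A : Type} (x y : A) : {x = y} + {x <> y} :=
  excluded_middle_informative (x = y).

Definition cfilter {A : Type} (P : A -> Prop) (l : list A) : list A :=
  filter (fun a => if excluded_middle_informative (P a) then true else false) l.

Lemma in_cfilter {A : Type} (P : A -> Prop) l a : In a (cfilter P l) <-> In a l /\ P a.
Proof.
  unfold cfilter. rewrite filter_In.
  destruct (excluded_middle_informative (P a)); intuition congruence.
Qed.

Lemma nodup_cfilter {A : Type} (P : A -> Prop) l : NoDup l -> NoDup (cfilter P l).
Proof. apply NoDup_filter. Qed.

Definition listed {A : Type} (P : A -> Prop) (l : list A) : Prop :=
  NoDup l /\ forall a, In a l <-> P a.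

Lemma listed_sub {A : Type} (P Q : A -> Prop) l n :
  (length l <= n)%nat -> (forall a, P a -> In a l) ->
  exists l', listed P l' /\ (length l' <= n)%nat.
Proof.
  intros Hn H. exists (cfilter P (nodup eq_dec_cl l)). split; [split|].
  - apply nodup_cfilter, NoDup_nodup.
  - intros a. rewrite in_cfilter, nodup_In. firstorder.
  - eapply Nat.le_trans; [|apply Hn].
    eapply Nat.le_trans; [apply filter_length_le|].
    apply NoDup_incl_length; [apply NoDup_nodup|]. intros a. apply nodup_In.
Qed.

Lemma flat_map_length_le {A B : Type} (f : A -> list B) l n :
  (forall a, In a l -> (length (f a) <= n)%nat) ->
  (length (flat_map f l) <= length l * n)%nat.
Proof.
  induction l as [|a l IH]; intros H; simpl; [lia|].
  rewrite length_app. specialize (H a (or_introl eq_refl)) as H1.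
  assert (length (flat_map f l) <= length l * n)%nat by (apply IH; intros; apply H; now right).
  lia.
Qed.

Definition lsum {A : Type} (f : A -> R) (l : list A) : R := fold_right Rplus 0 (map f l).

Section ListSums.
Context {A : Type}.
Implicit Types (f h : A -> R) (l : list A).

Lemma lsum_cons f a l : lsum f (a :: l) = f a + lsum f l.
Proof. reflexivity. Qed.

Lemma lsum_app f l1 l2 : lsum f (l1 ++ l2) = lsum f l1 + lsum f l2.
Proof.
  induction l1 as [|a l1 IH]; [unfold lsum; simpl; lra|].
  simpl app. rewrite !lsum_cons, IH. lra.
Qed.

Lemma lsum_le f h l : (forall a, In a l -> f a <= h a) -> lsum f l <= lsum h l.
Proof.
  induction l as [|a l IH]; intros H; [unfold lsum; simpl; lra|].
  rewrite !lsum_cons. specialize (H a (or_introl eq_refl)) as H1.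
  assert (lsum f l <= lsum h l) by (apply IH; intros; apply H; now right). lra.
Qed.

Lemma lsum_ext f h l : (forall a, In a l -> f a = h a) -> lsum f l = lsum h l.
Proof. intros H. apply Rle_antisym; apply lsum_le; intros a Ha; rewrite (H a Ha); lra. Qed.

Lemma lsum_nonneg f l : (forall a, In a l -> 0 <= f a) -> 0 <= lsum f l.
Proof.
  induction l as [|a l IH]; intros H; [unfold lsum; simpl; lra|].
  rewrite lsum_cons. specialize (H a (or_introl eq_refl)) as H1.
  assert (0 <= lsum f l) by (apply IH; intros; apply H; now right). lra.
Qed.

Lemma lsum_scal c f l : lsum (fun a => c * f a) l = c * lsum f l.
Proof. induction l as [|a l IH]; [unfold lsum; simpl; lra|]. rewrite !lsum_cons, IH. lra. Qed.

Lemma lsum_plus f h l : lsum (fun a => f a + h a) l = lsum f l + lsum h l.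
Proof. induction l as [|a l IH]; [unfold lsum; simpl; lra|]. rewrite !lsum_cons, IH. lra. Qed.

Lemma lsum_const c l : lsum (fun _ => c) l = INR (length l) * c.
Proof.
  induction l as [|a l IH]; [unfold lsum; simpl; lra|].
  rewrite lsum_cons, IH. simpl length. rewrite S_INR. lra.
Qed.

Lemma lsum_le_const f c n l :
  (forall a, In a l -> f a <= c) -> 0 <= c -> (length l <= n)%nat -> lsum f l <= INR n * c.
Proof.
  intros H Hc Hn. apply Rle_trans with (lsum (fun _ => c) l).
  - apply lsum_le; assumption.
  - rewrite lsum_const. apply Rmult_le_compat_r; [lra|]. apply le_INR; assumption.
Qed.

Lemma lsum_split_in f a l : In a l -> exists l', lsum f l = f a + lsum f l' /\
  (forall b, In b l <-> b = a \/ In b l') /\ (NoDup l -> ~ In a l' /\ NoDup l') /\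
  length l = S (length l').
Proof.
  intros H. apply in_split in H. destruct H as [l1 [l2 ->]].
  exists (l1 ++ l2). rewrite !lsum_app, lsum_cons, !length_app. simpl length. repeat split.
  - lra.
  - intros Hb. apply in_app_or in Hb. simpl in Hb. rewrite in_app_iff. intuition.
  - rewrite !in_app_iff. simpl. intuition.
  - apply NoDup_remove_2 in H. exact H.
  - apply NoDup_remove_1 in H. exact H.
  - lia.
Qed.

Lemma lsum_incl f l1 l2 : NoDup l1 -> incl l1 l2 -> (forall a, In a l2 -> 0 <= f a) ->
  lsum f l1 <= lsum f l2.
Proof.
  revert l2. induction l1 as [|a l1 IH]; intros l2 Hd Hi Hf.
  - apply lsum_nonneg; assumption.
  - rewrite lsum_cons. inversion Hd as [|? ? Hna Hd1]; subst.
    destruct (lsum_split_in f a l2) as [l' [E [Hin _]]]; [apply Hi; now left|].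
    rewrite E. apply Rplus_le_compat_l. apply IH; auto.
    + intros b Hb. assert (Hb2 : In b l2) by (apply Hi; now right).
      apply Hin in Hb2. destruct Hb2 as [->|]; [contradiction|assumption].
    + intros b Hb. apply Hf. apply Hin. now right.
Qed.

Lemma lsum_in_le f a l : In a l -> (forall b, In b l -> 0 <= f b) -> f a <= lsum f l.
Proof.
  intros Ha Hf. replace (f a) with (lsum f (a :: nil)) by (unfold lsum; simpl; lra).
  apply lsum_incl; auto.
  - repeat constructor. simpl. tauto.
  - intros b [<-|[]]. assumption.
Qed.

Lemma lsum_cfilter f (P : A -> Prop) l :
  lsum f l = lsum f (cfilter P l) + lsum f (cfilter (fun a => ~ P a) l).
Proof.
  induction l as [|a l IH]; [unfold lsum; simpl; lra|].
  unfold cfilter in *. simpl.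
  destruct (excluded_middle_informative (P a)) as [Ha|Ha];
  destruct (excluded_middle_informative (~ P a)) as [Hb|Hb]; try tauto;
  rewrite !lsum_cons, IH; lra.
Qed.

Lemma lsum_cfilter_ind f (P : A -> Prop) l :
  lsum f (cfilter P l) = lsum (fun a => ind (P a) * f a) l.
Proof.
  induction l as [|a l IH]; [unfold lsum; simpl; lra|].
  rewrite lsum_cons, <- IH. unfold cfilter, ind. simpl.
  destruct (excluded_middle_informative (P a)); rewrite ?lsum_cons; lra.
Qed.

End ListSums.

Lemma lsum_map {A B : Type} (g : A -> B) (f : B -> R) l :
  lsum f (map g l) = lsum (fun a => f (g a)) l.
Proof. unfold lsum. rewrite map_map. reflexivity. Qed.

Lemma lsum_flat_map {A B : Type} (g : A -> list B) (f : B -> R) l :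
  lsum f (flat_map g l) = lsum (fun a => lsum f (g a)) l.
Proof.
  induction l as [|a l IH]; [reflexivity|].
  simpl flat_map. rewrite lsum_app, lsum_cons, IH. reflexivity.
Qed.

Lemma lsum_swap {A B : Type} (f : A -> B -> R) l m :
  lsum (fun a => lsum (fun b => f a b) m) l = lsum (fun b => lsum (fun a => f a b) l) m.
Proof.
  induction l as [|a l IH].
  - unfold lsum at 1. simpl. rewrite (lsum_ext _ (fun _ => 0)); [rewrite lsum_const; lra|].
    reflexivity.
  - rewrite lsum_cons, IH, <- lsum_plus. apply lsum_ext. intros b _. reflexivity.
Qed.

(** After exchanging the two sums, [f b] is counted once for every [a] of [V] that lists [b], and
    all these [a] lie in [back b]. *)
Lemma lsum_double_count {A B : Type} (nb : A -> list B) (back : B -> list A)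
  (f : B -> R) (V : list A) (W : list B) (L : nat) :
  NoDup V -> (forall a, In a V -> NoDup (nb a)) ->
  (forall a b, In a V -> In b (nb a) -> In b W /\ In a (back b)) ->
  (forall b, (length (back b) <= L)%nat) -> (forall b, In b W -> 0 <= f b) ->
  lsum (fun a => lsum f (nb a)) V <= INR L * lsum f W.
Proof.
  intros HV Hnb Hab HL Hf.
  apply Rle_trans with (lsum (fun a => lsum (fun b => ind (In a (back b)) * f b) W) V).
  - apply lsum_le. intros a Ha. rewrite <- lsum_cfilter_ind.
    apply lsum_incl; [auto| |].
    + intros b Hb. apply in_cfilter. apply Hab; auto.
    + intros b Hb. apply in_cfilter in Hb. apply Hf. tauto.
  - rewrite lsum_swap, <- lsum_scal. apply lsum_le. intros b Hb.
    rewrite <- (lsum_cfilter_ind (fun _ => f b) (fun a => In a (back b))), lsum_const.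
    apply Rmult_le_compat_r; [auto|]. apply le_INR.
    eapply Nat.le_trans; [|apply (HL b)].
    apply NoDup_incl_length; [apply nodup_cfilter; assumption|].
    intros a Ha. apply in_cfilter in Ha. tauto.
Qed.

Fixpoint lmax {A : Type} (f : A -> R) (x : R) (l : list A) : R :=
  match l with nil => x | a :: l' => Rmax (f a) (lmax f x l') end.

Lemma lmax_ge {A : Type} (f : A -> R) x l a : In a l -> f a <= lmax f x l.
Proof.
  induction l as [|b l IH]; simpl; intros []; subst.
  - apply Rmax_l.
  - eapply Rle_trans; [|apply Rmax_r]. auto.
Qed.

Lemma lmax_ge_init {A : Type} (f : A -> R) x l : x <= lmax f x l.
Proof. induction l; simpl; [lra|]. eapply Rle_trans; [apply IHl|apply Rmax_r]. Qed.

Lemma lmax_attained {A : Type} (f : A -> R) x l :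
  lmax f x l = x \/ exists a, In a l /\ lmax f x l = f a.
Proof.
  induction l as [|b l IH]; simpl; [now left|].
  unfold Rmax. destruct (Rle_dec (f b) (lmax f x l)).
  - destruct IH as [->|[a [Ha ->]]]; [now left|right; exists a; auto].
  - right. exists b. auto.
Qed.

Section Graph.
Context {A : Type}.
Variable E : A -> A -> Prop.

Lemma within_mono n m w v : (n <= m)%nat -> within E n w v -> within E m w v.
Proof.
  intros Hnm H. revert m Hnm. induction H as [n w|n w u v Hwu Huv IH]; intros m Hm.
  - apply within_refl.
  - destruct m as [|m]; [lia|]. apply within_step with u; auto. apply IH. lia.
Qed.

Lemma within_trans n m w u v : within E n w u -> within E m u v -> within E (n + m) w v.
Proof.
  intros H1 H2. induction H1 as [n w|n w u' u Hw Hu IH].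
  - apply within_mono with m; [lia|assumption].
  - simpl. apply within_step with u'; auto.
Qed.

Lemma within_one w v : within E 1 w v -> w = v \/ E w v.
Proof.
  intros H. inversion H as [|? ? u ? Hwu Huv]; subst; [now left|].
  inversion Huv; subst. now right.
Qed.

Lemma within_zero w v : within E 0 w v -> w = v.
Proof. intros H. inversion H; reflexivity. Qed.

Lemma within_edge w v : E w v -> within E 1 w v.
Proof. intros H. apply within_step with v; [assumption|apply within_refl]. Qed.

Lemma within_split n m w v : within E (n + m) w v ->
  exists u, within E n w u /\ within E m u v.
Proof.
  revert w. induction n as [|n IH]; intros w H.
  - exists w. split; [apply within_refl|exact H].
  - simpl in H. inversion H as [|? ? u ? Hwu Huv]; subst.
    + exists v. split; apply within_refl.
    + destruct (IH u Huv) as [u' [H1 H2]]. exists u'. split; [|assumption].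
      apply within_step with u; assumption.
Qed.

Lemma within_sym n w v : (forall a b, E a b -> E b a) -> within E n w v -> within E n v w.
Proof.
  intros Hs H. induction H as [n w|n w u v Hwu Huv IH]; [apply within_refl|].
  replace (S n) with (n + 1)%nat by lia. eapply within_trans; [apply IH|].
  apply within_edge. auto.
Qed.

Lemma within_mono_rel (E' : A -> A -> Prop) n w v :
  (forall a b, E a b -> E' a b) -> within E n w v -> within E' n w v.
Proof.
  intros HE H. induction H; [apply within_refl|]. apply within_step with u; auto.
Qed.

Lemma ball_listed (L : nat) :
  (forall w, exists l, listed (within E 1 w) l /\ (length l <= L)%nat) ->
  forall n w, exists l, listed (within E n w) l /\ (length l <= L ^ n)%nat.
Proof.
  intros H n. destruct (fun_choice _ H) as [nb Hnb]. induction n as [|n IH]; intros w.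
  - exists (w :: nil). split; [split|simpl; lia].
    + repeat constructor. simpl. tauto.
    + intros a. split.
      * intros [<-|[]]. apply within_refl.
      * intros Ha. apply within_zero in Ha. now left.
  - destruct (IH w) as [l [[Hd Hl] Hlen]].
    apply (listed_sub _ (fun _ => True) (flat_map nb l)).
    + eapply Nat.le_trans; [apply (flat_map_length_le nb l L)|].
      * intros a _. apply Hnb.
      * simpl. rewrite Nat.mul_comm. apply Nat.mul_le_mono; lia.
    + intros a Ha. replace (S n) with (n + 1)%nat in Ha by lia.
      apply within_split in Ha. destruct Ha as [u [H1 H2]].
      apply in_flat_map. exists u. split; [apply Hl; assumption|].
      apply Hnb. assumption.
Qed.

End Graph.

Lemma within_map {A B : Type} (E : A -> A -> Prop) (E' : B -> B -> Prop) (h : A -> B) n w v :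
  (forall a b, E a b -> h a = h b \/ E' (h a) (h b)) -> within E n w v ->
  within E' n (h w) (h v).
Proof.
  intros HE H. induction H as [n w|n w u v Hwu Huv IH]; [apply within_refl|].
  destruct (HE _ _ Hwu) as [->|He].
  - apply within_mono with n; [lia|assumption].
  - apply within_step with (h u); assumption.
Qed.


(** * Geometric scales *)

Definition rp (r : R) (n : Z) : R := powerRZ r n.

Section GeometricScale.
Variable r : R.
Hypothesis Hr : 0 < r < 1.

Lemma rp_pos n : 0 < rp r n.
Proof. apply powerRZ_lt; lra. Qed.

Lemma rp_plus n m : rp r (n + m) = rp r n * rp r m.
Proof. apply powerRZ_add. lra. Qed.

Lemma rp_nat n (k : nat) : rp r (n + Z.of_nat k) = rp r n * r ^ k.
Proof. rewrite rp_plus. unfold rp at 2. rewrite <- pow_powerRZ. reflexivity. Qed.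

Lemma rp_pred n : rp r (n - 1) * r = rp r n.
Proof.
  replace n with (n - 1 + Z.of_nat 1)%Z at 2 by lia. rewrite rp_nat. simpl. lra.
Qed.

Lemma pow_eventually_lt c : 0 < c -> exists k0, forall k, (k0 <= k)%nat -> r ^ k < c.
Proof.
  intros Hc. destruct (pow_lt_1_zero r) with (y := c) as [N HN]; [rewrite Rabs_pos_eq; lra|lra|].
  exists N. intros k Hk. specialize (HN k Hk). rewrite Rabs_pos_eq in HN; [assumption|].
  apply pow_le. lra.
Qed.

Lemma pow_anti n m : (n <= m)%nat -> r ^ m <= r ^ n.
Proof.
  intros H. replace m with (n + (m - n))%nat by lia. rewrite pow_add.
  assert (0 < r ^ n) by (apply pow_lt; lra).
  assert (r ^ (m - n) <= 1). { rewrite <- (pow1 (m - n)). apply pow_incr. lra. }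
  nra.
Qed.

Lemma rp_anti n m : (n <= m)%Z -> rp r m <= rp r n.
Proof.
  intros H. replace m with (n + Z.of_nat (Z.to_nat (m - n)))%Z by lia. rewrite rp_nat.
  assert (0 < rp r n) by apply rp_pos.
  assert (r ^ Z.to_nat (m - n) <= 1) by (rewrite <- (pow_O r); apply pow_anti; lia).
  nra.
Qed.

Lemma rp_small c : 0 < c -> exists n, rp r n < c /\ (0 <= n)%Z.
Proof.
  intros Hc. destruct (pow_eventually_lt c Hc) as [k Hk]. exists (Z.of_nat k). split; [|lia].
  unfold rp. rewrite <- pow_powerRZ. apply Hk. lia.
Qed.

Lemma rp_neg n : rp r (- n) = / rp r n.
Proof. unfold rp. apply powerRZ_neg'. Qed.

Lemma rp_between c t : 0 < c -> 0 < t -> exists n, c * rp r (n + 1) <= t < c * rp r n.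
Proof.
  intros Hc Ht.
  assert (Hsm : exists a, c * rp r a <= t).
  { destruct (rp_small (t / c)) as [a [Ha _]]; [apply Rdiv_lt_0_compat; lra|].
    exists a. apply Rlt_le. apply Rmult_lt_reg_r with (/ c); [apply Rinv_0_lt_compat; lra|].
    replace (c * rp r a * / c) with (rp r a) by (field; lra). exact Ha. }
  assert (Hlg : exists b, t < c * rp r b).
  { destruct (rp_small (c / t)) as [b [Hb _]]; [apply Rdiv_lt_0_compat; lra|].
    exists (- b)%Z. rewrite rp_neg. assert (0 < rp r b) by apply rp_pos.
    apply Rmult_lt_reg_r with (rp r b); [lra|].
    replace (c * / rp r b * rp r b) with c by (field; lra).
    apply Rmult_lt_compat_l with (r := t) in Hb; [|lra].
    replace (t * (c / t)) with c in Hb by (field; lra). lra. }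
  destruct Hsm as [a Ha], Hlg as [b Hb].
  assert (Hind : forall k : nat, c * rp r (b + Z.of_nat k) <= t ->
    exists n, c * rp r (n + 1) <= t < c * rp r n).
  { induction k as [|k IH]; intros Hk.
    - replace (b + Z.of_nat 0)%Z with b in Hk by lia. lra.
    - destruct (Rle_lt_dec (c * rp r (b + Z.of_nat k)) t) as [Hle|Hlt]; [auto|].
      exists (b + Z.of_nat k)%Z. split; [|assumption].
      replace (b + Z.of_nat k + 1)%Z with (b + Z.of_nat (S k))%Z by lia. assumption. }
  apply (Hind (Z.to_nat (a - b))).
  apply Rle_trans with (c * rp r a); [|assumption].
  apply Rmult_le_compat_l; [lra|]. apply rp_anti. lia.
Qed.

End GeometricScale.

Lemma iter_add {A : Type} (f : A -> A) n m x :
  Nat.iter (n + m) f x = Nat.iter n f (Nat.iter m f x).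
Proof. induction n as [|n IH]; simpl; [reflexivity|]. now rewrite IH. Qed.

Lemma iter_swap {A : Type} (f : A -> A) n x : Nat.iter n f (f x) = f (Nat.iter n f x).
Proof. induction n as [|n IH]; simpl; [reflexivity|]. now rewrite IH. Qed.


(** * Geometry of the partition at the scales of the levels *)

Lemma listed_desc {T : Type} (pi : T -> T) B : (forall w, exists l, listed (fun v => pi v = w) l /\ (length l <= B)%nat) ->
  forall k w, exists l, listed (fun v => Nat.iter k pi v = w) l /\ (length l <= B ^ k)%nat.
Proof.
  intros H k. destruct (fun_choice _ H) as [ch Hch]. induction k as [|k IH]; intros w.
  - exists (w :: nil). split; [split|simpl; lia].
    + repeat constructor. simpl. tauto.
    + intros a. simpl. split; [intros [<-|[]]; reflexivity|now left].
  - destruct (IH w) as [l [[Hd Hl] Hlen]].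
    apply (listed_sub _ (fun _ => True) (flat_map ch l)).
    + eapply Nat.le_trans; [apply (flat_map_length_le ch l B)|].
      * intros a _. apply Hch.
      * simpl. rewrite Nat.mul_comm. apply Nat.mul_le_mono; lia.
    + intros a Ha. apply in_flat_map. exists (pi a). split.
      * apply Hl. rewrite iter_swap. exact Ha.
      * apply Hch. reflexivity.
Qed.

Section Frame.
Context {T X : Type}.
Variable pi : T -> T.
Variable lev : T -> Z.
Variable K : T -> X -> Prop.
Variable d : X -> X -> R.

Definition adj (w v : T) : Prop := lev w = lev v /\ w <> v /\ exists x, K w x /\ K v x.

(** What the proof uses of the basic framework, at the scales [r ^ n] of the levels instead of
    the scales [Lambda]; unlike the hypotheses of the theorem it passes to the subtree of the
    levels divisible by [k], with [r ^ k] for [r]. *)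
Record frame (r Cd c0 ct : R) (L B M : nat) : Prop := {
  fr_r : 0 < r < 1;
  fr_Cd : 0 < Cd;
  fr_c0 : 0 < c0;
  fr_ct : 0 < ct;
  fr_met : is_metric d;
  fr_lev : forall w, lev (pi w) = (lev w - 1)%Z;
  fr_anc : forall w v, exists n m, Nat.iter n pi w = Nat.iter m pi v;
  fr_cnt : exists f : T -> nat, forall a b, f a = f b -> a = b;
  fr_up : forall w x, K w x -> K (pi w) x;
  fr_dn : forall w x, K w x -> exists v, pi v = w /\ K v x;
  fr_cov : forall x n, exists w, lev w = n /\ K w x;
  fr_min : forall w, exists x, K w x /\ forall v, lev v = lev w -> K v x -> v = w;
  fr_end : forall om : nat -> T, (forall n, pi (om (S n)) = om n) -> exists x, forall n, K (om n) x;
  fr_diam : forall w x y, K w x -> K w y -> d x y <= Cd * rp r (lev w);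
  fr_two : forall w, exists x y, K w x /\ K w y /\ rp r (lev w) <= Cd * d x y;
  fr_near : forall w v x y, lev w = lev v -> K w x -> K v y ->
    d x y < c0 * rp r (lev w) -> within adj M w v;
  fr_deg : forall w, exists l, listed (within adj 1 w) l /\ (length l <= L)%nat;
  fr_chl : forall w, exists l, listed (fun v => pi v = w) l /\ (length l <= B)%nat;
  fr_deep : forall w, exists x, K w x /\ forall y v, d x y < ct * rp r (lev w) ->
    lev v = lev w -> K v y -> v = w }.

Section TreeFacts.
Hypothesis Hlev : forall w, lev (pi w) = (lev w - 1)%Z.
Hypothesis Hup : forall w x, K w x -> K (pi w) x.
Hypothesis Hdn : forall w x, K w x -> exists v, pi v = w /\ K v x.

Lemma lev_iter n w : lev (Nat.iter n pi w) = (lev w - Z.of_nat n)%Z.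
Proof. induction n as [|n IH]; simpl Nat.iter; [lia|]. rewrite Hlev, IH. lia. Qed.

Lemma K_iter n w x : K w x -> K (Nat.iter n pi w) x.
Proof. intros H. induction n as [|n IH]; simpl; auto. Qed.

Lemma K_down n w x : K w x -> exists v, Nat.iter n pi v = w /\ K v x.
Proof.
  intros H. induction n as [|n [v [Hv Hx]]]; [exists w; auto|].
  destruct (Hdn v x Hx) as [u [Hu Hux]]. exists u. split; [|assumption].
  simpl. rewrite <- iter_swap, Hu. assumption.
Qed.

Lemma adj_sym w v : adj w v -> adj v w.
Proof. intros [H1 [H2 [x [Hx Hy]]]]. repeat split; auto. exists x; auto. Qed.

Lemma within_adj_lev n w v : within adj n w v -> lev w = lev v.
Proof. intros H. induction H as [|n w u v Hwu Huv IH]; [reflexivity|]. destruct Hwu; congruence. Qed.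

Lemma adj_share w v x : lev w = lev v -> K w x -> K v x -> within adj 1 w v.
Proof.
  intros Hl Hw Hv. destruct (classic (w = v)) as [->|Hne]; [apply within_refl|].
  apply within_edge. repeat split; auto. exists x; auto.
Qed.

Lemma within_adj_iter k n w v :
  within adj n w v -> within adj n (Nat.iter k pi w) (Nat.iter k pi v).
Proof.
  apply within_map. intros a b [Hl [Hne [x [Ha Hb]]]].
  destruct (classic (Nat.iter k pi a = Nat.iter k pi b)) as [|Hn]; [now left|right].
  repeat split; auto.
  - rewrite !lev_iter. lia.
  - exists x. split; apply K_iter; assumption.
Qed.

(** Minimality turns membership of points into ancestry: the descendants of [w] at the level of [v]
    cover [K w], and the only one that can contain [x] is [v]. *)
Lemma desc_of_unique_point k w v x :
  lev v = (lev w + Z.of_nat k)%Z -> K v x ->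
  (forall u, lev u = lev v -> K u x -> u = v) -> K w x -> Nat.iter k pi v = w.
Proof.
  intros Hl Hv Hun Hw. destruct (K_down k w x Hw) as [u [Hu Hux]].
  rewrite <- (Hun u); auto. assert (H := lev_iter k u). rewrite Hu in H. lia.
Qed.

End TreeFacts.

End Frame.

Arguments fr_r {T X pi lev K d r Cd c0 ct L B M}.
Arguments fr_Cd {T X pi lev K d r Cd c0 ct L B M}.
Arguments fr_c0 {T X pi lev K d r Cd c0 ct L B M}.
Arguments fr_ct {T X pi lev K d r Cd c0 ct L B M}.
Arguments fr_met {T X pi lev K d r Cd c0 ct L B M}.
Arguments fr_lev {T X pi lev K d r Cd c0 ct L B M}.
Arguments fr_anc {T X pi lev K d r Cd c0 ct L B M}.
Arguments fr_cnt {T X pi lev K d r Cd c0 ct L B M}.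
Arguments fr_up {T X pi lev K d r Cd c0 ct L B M}.
Arguments fr_dn {T X pi lev K d r Cd c0 ct L B M}.
Arguments fr_cov {T X pi lev K d r Cd c0 ct L B M}.
Arguments fr_min {T X pi lev K d r Cd c0 ct L B M}.
Arguments fr_end {T X pi lev K d r Cd c0 ct L B M}.
Arguments fr_diam {T X pi lev K d r Cd c0 ct L B M}.
Arguments fr_two {T X pi lev K d r Cd c0 ct L B M}.
Arguments fr_near {T X pi lev K d r Cd c0 ct L B M}.
Arguments fr_deg {T X pi lev K d r Cd c0 ct L B M}.
Arguments fr_chl {T X pi lev K d r Cd c0 ct L B M}.
Arguments fr_deep {T X pi lev K d r Cd c0 ct L B M}.

(** * The height as a function on the tree *)

Section LevelFunction.
Context {T : Type}.
Variable pi : T -> T.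
Variable phi : T.
Hypothesis Htree : bi_infinite_tree pi.

(** Two different heights of [w] would make two different iterates of [phi] coincide, which the
    absence of cycles forbids. *)
Lemma level_functional w n m : level pi phi w n -> level pi phi w m -> n = m.
Proof.
  assert (Hinj : forall p q, (p < q)%nat -> Nat.iter p pi phi <> Nat.iter q pi phi).
  { intros p q Hpq E. destruct Htree as [_ [_ H2]].
    apply (H2 (Nat.iter p pi phi) (q - p)%nat); [lia|].
    rewrite <- iter_add. replace (q - p + p)%nat with q by lia. auto. }
  assert (Hle : forall a b a' b', (a <= a')%nat -> Nat.iter a pi w = Nat.iter b pi phi ->
    Nat.iter a' pi w = Nat.iter b' pi phi -> (a' - a + b = b')%nat).
  { intros a b a' b' Ha H1 H2. replace a' with (a' - a + a)%nat in H2 by lia.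
    rewrite iter_add, H1, <- iter_add in H2.
    destruct (Nat.lt_trichotomy (a' - a + b) b') as [Hlt|[He|Hgt]]; [|exact He|].
    - destruct (Hinj _ _ Hlt H2).
    - destruct (Hinj _ _ Hgt). auto. }
  intros [a [b [H1 ->]]] [a' [b' [H2 ->]]].
  destruct (Nat.le_ge_cases a a') as [Ha|Ha].
  - specialize (Hle _ _ _ _ Ha H1 H2). lia.
  - specialize (Hle _ _ _ _ Ha H2 H1). lia.
Qed.

Lemma level_function : exists lev : T -> Z,
  (forall w n, level pi phi w n <-> n = lev w) /\ forall w, lev (pi w) = (lev w - 1)%Z.
Proof.
  destruct (fun_choice (fun w n => level pi phi w n)) as [lev Hl].
  { intros w. destruct Htree as [_ [H1 _]]. destruct (H1 w phi) as [n [m E]].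
    exists (Z.of_nat n - Z.of_nat m)%Z, n, m. auto. }
  exists lev.
  assert (Hiff : forall w n, level pi phi w n <-> n = lev w).
  { intros w n. split; [intros H; eapply level_functional; eauto|intros ->; apply Hl]. }
  split; [exact Hiff|]. intros w. symmetry. apply Hiff.
  destruct (Hl w) as [a [b [E ->]]]. exists a, (S b). split; [|lia].
  rewrite iter_swap, E. reflexivity.
Qed.

End LevelFunction.

(** * From the basic framework to the scales of the levels *)

Section FrameOfHypotheses.
Context (X : Type) (O : (X -> Prop) -> Prop)
  (T : Type) (pi : T -> T) (phi : T) (K : T -> X -> Prop)
  (d : X -> X -> R) (M : nat) (lev : T -> Z).
Hypothesis Htree : bi_infinite_tree pi.
Hypothesis HK : K_partition pi phi O K.
Hypothesis HKmin : partition_minimal pi phi K.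
Hypothesis Hd : is_metric d.
Hypothesis Hbf : basic_framework pi phi K d.
Hypothesis Had : adapted pi K d M.
Hypothesis Hlevel : forall w n, level pi phi w n <-> n = lev w.
Hypothesis Hlev : forall w, lev (pi w) = (lev w - 1)%Z.

Let adjK := adj lev K.

Lemma part_up w x : K w x -> K (pi w) x.
Proof. intros H. destruct HK as [_ [H1 _]]. apply H1. exists w. auto. Qed.

Lemma part_dn w x : K w x -> exists v, pi v = w /\ K v x.
Proof. intros H. destruct HK as [_ [H1 _]]. apply H1. assumption. Qed.

Let liter := lev_iter pi lev Hlev.
Let kiter := K_iter pi K part_up.
Let kdown := K_down pi K part_dn.

Lemma part_cov x n : exists w, lev w = n /\ K w x.
Proof.
  destruct HK as [_ [_ [_ H3]]]. destruct (H3 x) as [w [Hw Hx]]. apply Hlevel in Hw.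
  destruct (Z_le_gt_dec 0 n) as [Hn|Hn].
  - destruct (kdown (Z.to_nat n) w x Hx) as [v [Hv Hvx]]. exists v. split; [|assumption].
    assert (E := liter (Z.to_nat n) v). rewrite Hv in E. lia.
  - exists (Nat.iter (Z.to_nat (- n)) pi w). split; [|apply kiter; assumption].
    rewrite liter. lia.
Qed.

Lemma part_min w : exists x, K w x /\ forall v, lev v = lev w -> K v x -> v = w.
Proof.
  destruct (HKmin w) as [x [Hx Hv]]. exists x. split; [assumption|]. intros v Hl Hvx.
  apply NNPP. intros Hne. apply (Hv v); auto. exists (lev w). split; apply Hlevel; auto.
Qed.

(** The axiom (P2) speaks of two-sided sequences indexed by the height, so the given ray is first
    extended upwards by the ancestors of its origin. *)
Lemma part_end (om : nat -> T) : (forall n, pi (om (S n)) = om n) ->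
  exists x, forall n, K (om n) x.
Proof.
  intros Hom. destruct HK as [_ [_ [H2 _]]].
  assert (Hit : forall m n, Nat.iter m pi (om (n + m)%nat) = om n).
  { induction m as [|m IH]; intros n; [simpl; f_equal; lia|].
    rewrite <- (IH n). replace (n + S m)%nat with (S (n + m)) by lia.
    simpl. rewrite <- iter_swap, Hom. reflexivity. }
  set (j := lev (om 0%nat)).
  assert (Hlom : forall n, lev (om n) = (j + Z.of_nat n)%Z).
  { intros n. assert (E := liter n (om n)). specialize (Hit n 0%nat). simpl in Hit.
    rewrite Hit in E. fold j in E. lia. }
  set (Om := fun n : Z => if Z_le_gt_dec j n then om (Z.to_nat (n - j))
                          else Nat.iter (Z.to_nat (j - n)) pi (om 0%nat)).
  destruct (H2 Om) as [x Hx].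
  - intros n. apply Hlevel. unfold Om. destruct (Z_le_gt_dec j n).
    + rewrite Hlom. lia.
    + rewrite liter. fold j. lia.
  - intros n. unfold Om. destruct (Z_le_gt_dec j (n + 1)), (Z_le_gt_dec j n); try lia.
    + replace (Z.to_nat (n + 1 - j)) with (S (Z.to_nat (n - j))) by lia. apply Hom.
    + replace (Z.to_nat (n + 1 - j)) with 0%nat by lia.
      replace (Z.to_nat (j - n)) with 1%nat by lia. reflexivity.
    + replace (Z.to_nat (j - n)) with (S (Z.to_nat (j - (n + 1)))) by lia. reflexivity.
  - exists x. intros n. specialize (Hx x). destruct Hx as [_ Hx]. specialize (Hx eq_refl).
    (* (P2) gives membership at nonnegative heights only. The node [om (n + m)] has such a height,
       and [om n] is an ancestor of it. *)
    set (m := Z.to_nat (Z.abs j)).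
    rewrite <- (Hit m n). apply kiter.
    specialize (Hx (Z.to_nat (j + Z.of_nat (n + m)))).
    unfold Om in Hx. destruct (Z_le_gt_dec j (Z.of_nat (Z.to_nat (j + Z.of_nat (n + m))))) as [|Hgt].
    + replace (Z.to_nat (Z.of_nat (Z.to_nat (j + Z.of_nat (n + m))) - j)) with (n + m)%nat in Hx by lia.
      assumption.
    + lia.
Qed.

Section Sizes.
Variables (r C : R).
Hypothesis Hr : 0 < r < 1.
Hypothesis HC : 0 < C.
Hypothesis Hg : forall w, / C * rp r (lev w) <= g K d w <= C * rp r (lev w).

Lemma g_pos w : 0 < g K d w.
Proof.
  destruct (Hg w) as [H _]. assert (0 < / C) by (apply Rinv_0_lt_compat; assumption).
  assert (0 < rp r (lev w)) by (apply rp_pos; assumption). nra.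
Qed.

(** [g] is the [real] of an extended supremum, and [real] sends infinities to 0; positivity of [g]
    therefore forces the supremum to be finite. *)
Lemma g_lub w : is_lub_Rbar (fun t => exists x y, K w x /\ K w y /\ t = d x y) (Finite (g K d w)).
Proof.
  assert (H := g_pos w). unfold g in *. unfold diam in *.
  match goal with |- is_lub_Rbar ?E _ => assert (HL := Lub_Rbar_correct E) end.
  destruct (Lub_Rbar (fun t => exists x y, K w x /\ K w y /\ t = d x y)); simpl in *; try lra.
  exact HL.
Qed.

Lemma g_ub w x y : K w x -> K w y -> d x y <= g K d w.
Proof. intros Hx Hy. apply (proj1 (g_lub w)). exists x, y. auto. Qed.

Lemma g_half w : exists x y, K w x /\ K w y /\ g K d w <= 2 * d x y.
Proof.
  apply NNPP. intros Hn. assert (H := proj2 (g_lub w) (Finite (g K d w / 2))).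
  assert (Hp := g_pos w). enough (g K d w <= g K d w / 2) by lra. apply H.
  intros t [x [y [Hx [Hy ->]]]]. simpl. apply Rnot_lt_le. intros Hlt. apply Hn.
  exists x, y. repeat split; auto. lra.
Qed.

(** Take a tiny descendant of [w] through [x] and the point that minimality gives in it: every cell
    of the level of [w] containing that point is an ancestor of the descendant. *)
Lemma dense_open_cell w x e : K w x -> 0 < e ->
  exists y, K w y /\ d x y < e /\ forall v, lev v = lev w -> K v y -> v = w.
Proof.
  intros Hx He. assert (Hp : 0 < rp r (lev w)) by (apply rp_pos; assumption).
  destruct (pow_eventually_lt r Hr (e / (C * rp r (lev w)))) as [k Hk].
  { apply Rdiv_lt_0_compat; [assumption|]. apply Rmult_lt_0_compat; assumption. }
  specialize (Hk k (Nat.le_refl k)).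
  destruct (kdown k w x Hx) as [u [Hu Hux]].
  destruct (part_min u) as [y [Hy Huny]].
  assert (Hlu : lev u = (lev w + Z.of_nat k)%Z) by (rewrite <- Hu, liter; lia).
  exists y. repeat split.
  - rewrite <- Hu. apply kiter. assumption.
  - apply Rle_lt_trans with (g K d u); [apply g_ub; assumption|].
    apply Rle_lt_trans with (C * rp r (lev u)); [apply Hg|].
    rewrite Hlu, rp_nat by assumption.
    apply Rmult_lt_compat_l with (r := C * rp r (lev w)) in Hk;
      [|apply Rmult_lt_0_compat; assumption].
    replace (C * rp r (lev w) * (e / (C * rp r (lev w)))) with e in Hk by (field; lra). lra.
  - intros v Hl Hv. rewrite <- Hu.
    symmetry. apply (desc_of_unique_point pi lev K Hlev part_dn k v u y); auto. lia.
Qed.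

Lemma dist_sym x y : d x y = d y x.
Proof. apply Hd. Qed.

Lemma dist_tri x y z : d x z <= d x y + d y z.
Proof. apply Hd. Qed.

(** At the scale [s = r^n / C] all cells of [Lambda_s] have level at least [n], so a path in the
    graph of [Lambda_s] projects to a path of ancestors on the level [n]. The radius [a1 s] of
    adaptedness becomes [c0 r^n] with [c0 = a1 / C]. *)
Lemma near_of_adapted : exists c0, 0 < c0 /\ forall w v x y, lev w = lev v -> K w x -> K v y ->
  d x y < c0 * rp r (lev w) -> within adjK M w v.
Proof.
  destruct Had as [a1 [a2 [Ha1 [_ HB]]]]. exists (a1 / C).
  split; [apply Rdiv_lt_0_compat; assumption|].
  intros w v x y Hl Hx Hy Hxy. set (n := lev w) in *. set (s := / C * rp r n).
  assert (Hp : 0 < rp r n) by (apply rp_pos; assumption).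
  assert (HiC : 0 < / C) by (apply Rinv_0_lt_compat; assumption).
  assert (Hs : 0 < s) by (apply Rmult_lt_0_compat; assumption).
  (* The strict inequality leaves room to move [x] and [y] to points lying in a single cell of the
     level [n]; this identifies the projected endpoints as [w] and [v]. *)
  set (e := (a1 / C * rp r n - d x y) / 2).
  assert (He : 0 < e) by (unfold e; lra).
  destruct (dense_open_cell w x e Hx He) as [x' [Hx' [Hxx' Hxu]]].
  destruct (dense_open_cell v y e Hy He) as [y' [Hy' [Hyy' Hyu]]].
  destruct (HB x' s Hs) as [Hball _]. destruct (Hball y') as [w' [v' [Hw'L [Hw' [Hin [Hv'L Hv']]]]]].
  { unfold ball. apply Rle_lt_trans with (d x' x + (d x y + d y y')).
    - eapply Rle_trans; [apply (dist_tri x' x y')|]. apply Rplus_le_compat_l, dist_tri.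
    - rewrite (dist_sym x' x). unfold s. unfold e in *. unfold Rdiv in *. lra. }
  assert (Hge : forall u, Lambda pi K d s u -> (n <= lev u)%Z).
  { intros u [Hu _]. apply Z.nlt_ge. intros Hlt. destruct (Hg u) as [H _].
    assert (Ht : / C * rp r (lev u) <= / C * rp r n) by (unfold s in Hu; lra).
    apply Rmult_le_reg_l in Ht; [|assumption].
    assert (Ha := rp_anti r Hr (lev u) (n - 1)). assert (Hb := rp_pred r Hr n).
    assert (0 < rp r (n - 1)) by (apply rp_pos; assumption).
    assert (rp r (n - 1) <= rp r (lev u)) by (apply Ha; lia). nra. }
  set (h := fun u => Nat.iter (Z.to_nat (lev u - n)) pi u).
  assert (Hmap := within_map (Es pi K d s) adjK h M w' v').
  replace w with (h w'); [replace v with (h v')|].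
  - apply Hmap; [|assumption]. intros a b [Ha [Hb [_ [z [Hza Hzb]]]]].
    apply within_one. apply adj_share with z.
    + unfold h. rewrite !liter. apply Hge in Ha, Hb. lia.
    + apply kiter. assumption.
    + apply kiter. assumption.
  - apply Hyu; [|apply kiter; assumption]. unfold h. rewrite liter. apply Hge in Hv'L. lia.
  - apply Hxu; [|apply kiter; assumption]. unfold h. rewrite liter. apply Hge in Hw'L. lia.
Qed.

(** The sizes of the ancestors are unbounded, so at some step along the ancestors the size passes
    from at most [s] to more than [s]. *)
Lemma ancestor_in_Lambda s v : g K d v <= s -> exists m, Lambda pi K d s (Nat.iter m pi v).
Proof.
  intros Hv.
  assert (Hbig : exists m, s < g K d (Nat.iter m pi v)).
  { assert (Hp : 0 < rp r (lev v)) by (apply rp_pos; assumption).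
    assert (Hgp := g_pos v).
    destruct (pow_eventually_lt r Hr (/ C * rp r (lev v) / s)) as [m Hm].
    { apply Rdiv_lt_0_compat; [|lra]. apply Rmult_lt_0_compat; [|assumption].
      apply Rinv_0_lt_compat; assumption. }
    exists m. specialize (Hm m (Nat.le_refl m)). destruct (Hg (Nat.iter m pi v)) as [H _].
    eapply Rlt_le_trans; [|apply H]. rewrite liter.
    assert (E : rp r (lev v) = rp r (lev v - Z.of_nat m) * r ^ m).
    { rewrite <- rp_nat by assumption. f_equal. lia. }
    rewrite E in Hm. assert (0 < r ^ m) by (apply pow_lt; lra).
    apply Rmult_lt_compat_r with (r := s) in Hm; [|lra].
    replace (/ C * (rp r (lev v - Z.of_nat m) * r ^ m) / s * s)
      with (/ C * rp r (lev v - Z.of_nat m) * r ^ m) in Hm by (field; lra). nra. }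
  destruct Hbig as [m Hm]. induction m as [|m IH]; [simpl in Hm; lra|].
  destruct (Rle_lt_dec (g K d (Nat.iter m pi v)) s) as [Hle|Hlt]; [|auto].
  exists m. split; assumption.
Qed.

(** At the scale [s = C r^n] every cell of the level [n] has an ancestor in [Lambda_s], fewer than
    [m0] generations up. Neighbours have equal or intersecting such ancestors, of which uniform
    finiteness allows [Bu]. *)
Lemma degree_of_uniformly_finite B :
  (forall w, exists l, listed (fun v => pi v = w) l /\ (length l <= B)%nat) ->
  uniformly_finite pi K d ->
  exists L, forall w, exists l, listed (within adjK 1 w) l /\ (length l <= L)%nat.
Proof.
  intros HB [Bu HBu].
  destruct (pow_eventually_lt r Hr (/ (C * C))) as [m0 Hm0].
  { apply Rinv_0_lt_compat, Rmult_lt_0_compat; assumption. }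
  (* For each of the [Bu] ancestors there are [m0] possible generations; the base [S B] makes the
     powers monotone in the exponent even for [B = 0]. *)
  exists (Bu * (m0 * (S B) ^ m0))%nat. intros w. set (n := lev w). set (s := C * rp r n).
  assert (Hp : 0 < rp r n) by (apply rp_pos; assumption).
  assert (Hs : 0 < s) by (apply Rmult_lt_0_compat; assumption).
  destruct (ancestor_in_Lambda s w) as [mw Hmw]; [apply Hg|].
  destruct (HBu s Hs _ Hmw) as [l [Hl1 Hl2]].
  destruct (fun_choice (fun (um : T * nat) lst =>
    listed (fun v => Nat.iter (snd um) pi v = fst um) lst /\ (length lst <= B ^ snd um)%nat))
    as [D HD].
  { intros [u m]. apply listed_desc. assumption. }
  apply (listed_sub _ (fun _ => True)
    (flat_map (fun u => flat_map (fun m => D (u, m)) (seq 0 m0)) l)).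
  - eapply Nat.le_trans; [apply (flat_map_length_le _ l (m0 * S B ^ m0)%nat)|].
    + intros u _. eapply Nat.le_trans; [apply (flat_map_length_le _ _ (S B ^ m0)%nat)|].
      * intros m Hm. apply in_seq in Hm. destruct (HD (u, m)) as [_ H]. simpl in H.
        eapply Nat.le_trans; [apply H|].
        eapply Nat.le_trans; [apply (Nat.pow_le_mono_l B (S B)); lia|].
        apply Nat.pow_le_mono_r; lia.
      * rewrite length_seq. lia.
    + apply Nat.mul_le_mono_r. assumption.
  - intros v Hv. assert (Hlv := within_adj_lev lev K _ _ _ Hv). fold n in Hlv.
    destruct (ancestor_in_Lambda s v) as [mv Hmv].
    { unfold s. rewrite Hlv. apply Hg. }
    apply in_flat_map. exists (Nat.iter mv pi v). split.
    + apply Hl2; [assumption|].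
      apply within_one in Hv. destruct (classic (Nat.iter mw pi w = Nat.iter mv pi v)) as [->|Hne];
        [apply within_refl|]. apply within_edge. repeat split; try apply Hmw; try apply Hmv; auto.
      destruct Hv as [<-|[_ [_ [z [Hz1 Hz2]]]]].
      * destruct (part_min w) as [z [Hz _]]. exists z. split; apply kiter; assumption.
      * exists z. split; apply kiter; assumption.
    + apply in_flat_map. exists mv. split; [|apply HD; reflexivity].
      apply in_seq. split; [lia|]. simpl. apply Nat.nle_gt. intros Hle.
      specialize (Hm0 mv Hle). destruct Hmv as [Hv1 _]. destruct (Hg (Nat.iter mv pi v)) as [H _].
      rewrite liter, <- Hlv in H.
      assert (E : rp r n = rp r (n - Z.of_nat mv) * r ^ mv).
      { rewrite <- rp_nat by assumption. f_equal. lia. }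
      assert (Hq : 0 < rp r (n - Z.of_nat mv)) by (apply rp_pos; assumption).
      assert (Hfin : / C * rp r (n - Z.of_nat mv) <= C * (rp r (n - Z.of_nat mv) * r ^ mv)).
      { rewrite <- E. fold s. lra. }
      assert (HCC : 0 < C * C) by nra.
      apply Rmult_lt_compat_l with (r := C * C) in Hm0; [|assumption].
      rewrite Rinv_r in Hm0 by lra.
      apply Rmult_le_compat_l with (r := C) in Hfin; [|lra].
      replace (C * (/ C * rp r (n - Z.of_nat mv))) with (rp r (n - Z.of_nat mv)) in Hfin by (field; lra).
      nra.
Qed.

(** For large [k] the cells [k] levels below [w] are smaller than the thickness scale. If [u]
    contains the point given by thickness, the ancestors in [Lambda_s] of [u] and of a neighbour [v]
    meet, so [K v] lies in the set [U_1] and hence in [K w]; minimality then makes [v] a descendant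
    of [w]. *)
Lemma deep_one_of_thick : thick pi K d ->
  exists k, forall w, exists u, Nat.iter k pi u = w /\
    forall v, within adjK 1 u v -> Nat.iter k pi v = w.
Proof.
  intros [al [Hal Hth]].
  destruct (pow_eventually_lt r Hr (al / (C * C))) as [k Hk].
  { apply Rdiv_lt_0_compat; [assumption|]. nra. }
  specialize (Hk k (Nat.le_refl k)). exists k. intros w.
  destruct (Hth w) as [x [Hx HU]]. set (s := al * g K d (pi w)) in *.
  destruct (kdown k w x Hx) as [u [Hu Hux]]. exists u. split; [assumption|].
  assert (Hlu : lev u = (lev w + Z.of_nat k)%Z) by (rewrite <- Hu, liter; lia).
  assert (Hgs : forall v, lev v = lev u -> g K d v <= s).
  { intros v Hv. destruct (Hg v) as [_ H]. destruct (Hg (pi w)) as [H' _].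
    rewrite Hv, Hlu, rp_nat in H by assumption. rewrite Hlev in H'.
    assert (Hp := rp_pos r Hr (lev w)). assert (Hpr := rp_pred r Hr (lev w)).
    assert (Hp' := rp_pos r Hr (lev w - 1)).
    assert (Hle : rp r (lev w) <= rp r (lev w - 1)) by nra.
    apply Rle_trans with (al * (/ C * rp r (lev w - 1))).
    - eapply Rle_trans; [apply H|].
      apply Rle_trans with (al * (/ C * rp r (lev w))).
      + apply Rmult_lt_compat_l with (r := C * rp r (lev w)) in Hk; [|nra].
        replace (C * rp r (lev w) * (al / (C * C))) with (al * (/ C * rp r (lev w))) in Hk by (field; lra).
        lra.
      + apply Rmult_le_compat_l; [lra|]. apply Rmult_le_compat_l; [|assumption].
        left. apply Rinv_0_lt_compat; assumption.
    - unfold s. apply Rmult_le_compat_l; [lra|assumption]. }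
  intros v Hv. assert (Hlv := within_adj_lev lev K _ _ _ Hv).
  destruct (ancestor_in_Lambda s u) as [mu Hmu]; [apply Hgs; reflexivity|].
  destruct (ancestor_in_Lambda s v) as [mv Hmv]; [apply Hgs; auto|].
  destruct (part_min v) as [y [Hy Huny]].
  apply (desc_of_unique_point pi lev K Hlev part_dn k w v y); auto; [lia|].
  apply HU. exists (Nat.iter mu pi u), (Nat.iter mv pi v).
  split; [assumption|]. split; [apply kiter; assumption|].
  split; [|split; [assumption|apply kiter; assumption]].
  destruct (classic (Nat.iter mu pi u = Nat.iter mv pi v)) as [->|Hne]; [apply within_refl|].
  apply within_edge. split; [assumption|]. split; [assumption|]. split; [assumption|].
  apply within_one in Hv. destruct Hv as [<-|[_ [_ [z [Hz1 Hz2]]]]].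
  - exists x. split; apply kiter; assumption.
  - exists z. split; apply kiter; assumption.
Qed.

(** Each further step of the path is paid by another [k1] levels: the first step stays below the
    deep [u], and the other [j] steps project to a path starting at [u]. *)
Lemma deep_of_thick j : thick pi K d ->
  exists k, forall w, exists u, Nat.iter k pi u = w /\
    forall v, within adjK j u v -> Nat.iter k pi v = w.
Proof.
  intros Hth. destruct (deep_one_of_thick Hth) as [k1 H1]. induction j as [|j [k Hk]].
  - exists 0%nat. intros w. exists w. split; [reflexivity|]. intros v Hv.
    apply within_zero in Hv. simpl. auto.
  - exists (k + k1)%nat. intros w. destruct (Hk w) as [u [Hu Huv]].
    destruct (H1 u) as [u' [Hu' Hu'v]]. exists u'. split; [rewrite iter_add; congruence|].
    intros v Hv. replace (S j) with (1 + j)%nat in Hv by lia. apply within_split in Hv.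
    destruct Hv as [t [Ht1 Ht2]]. rewrite iter_add. apply Huv.
    rewrite <- (Hu'v t Ht1).
    apply (within_adj_iter pi lev K Hlev part_up). assumption.
Qed.

End Sizes.

Theorem frame_of_hypotheses : exists r Cd c0 ct L B, frame pi lev K d r Cd c0 ct L B M.
Proof.
  destruct Hbf as [[B HB] [Huf [Hth [_ [r [C [Hr [HC Hg]]]]]]]].
  assert (Hg' : forall w, / C * rp r (lev w) <= g K d w <= C * rp r (lev w)).
  { intros w. apply Hg. apply Hlevel. reflexivity. }
  assert (HB' : forall w, exists l, listed (fun v => pi v = w) l /\ (length l <= B)%nat).
  { intros w. destruct (HB w) as [l [Hl1 Hl2]]. apply (listed_sub _ (fun _ => True) l); auto. }
  destruct (near_of_adapted r C Hr HC Hg') as [c0 [Hc0 Hnear]].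
  destruct (degree_of_uniformly_finite r C Hr HC Hg' B HB' Huf) as [L HL].
  destruct (deep_of_thick r C Hr HC Hg' M Hth) as [k Hk].
  (* [Cd = 2C] because only half of the diameter is attained by chosen points. A point closer than
     [c0 r^k r^n] to a point of the deep descendant [u] lies in a cell at most [M] steps from [u],
     hence below [w]. *)
  exists r, (2 * C), c0, (c0 * r ^ k), L, B. constructor; auto.
  - lra.
  - apply Rmult_lt_0_compat; [assumption|]. apply pow_lt. lra.
  - apply Htree.
  - apply Htree.
  - apply part_up.
  - apply part_dn.
  - apply part_cov.
  - apply part_min.
  - apply part_end.
  - intros w x y Hx Hy. assert (H := g_ub r C Hr HC Hg' w x y Hx Hy). assert (H' := Hg' w).
    assert (0 < rp r (lev w)) by (apply rp_pos; assumption). nra.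
  - intros w. destruct (g_half r C Hr HC Hg' w) as [x [y [Hx [Hy Hxy]]]].
    exists x, y. repeat split; auto. destruct (Hg' w) as [H _].
    apply Rmult_le_reg_l with (/ C); [apply Rinv_0_lt_compat; assumption|].
    replace (/ C * (2 * C * d x y)) with (2 * d x y) by (field; lra). lra.
  - intros w. destruct (Hk w) as [u [Hu Huv]]. destruct (part_min u) as [x [Hx Hun]].
    exists x. split; [rewrite <- Hu; apply kiter; assumption|].
    intros y v Hxy Hl Hy. destruct (kdown k v y Hy) as [t [Ht Hty]].
    assert (E1 := liter k u). rewrite Hu in E1. assert (E2 := liter k t). rewrite Ht in E2.
    rewrite <- Ht. apply Huv. apply Hnear with x y; auto; [lia|].
    replace (lev u) with (lev w + Z.of_nat k)%Z by lia. rewrite rp_nat by assumption. lra.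
Qed.

End FrameOfHypotheses.


(** * The subtree of the levels divisible by k *)

Section Subtree.
Context {T X : Type}.
Variables (pi : T -> T) (lev : T -> Z) (K : T -> X -> Prop) (d : X -> X -> R).
Variables (r Cd c0 ct : R) (L B M : nat).
Hypothesis HF : frame pi lev K d r Cd c0 ct L B M.
Variable k : nat.
Hypothesis Hk : (1 <= k)%nat.

Let Hlev := fr_lev HF.
Let Hup := fr_up HF.
Let Hdn := fr_dn HF.
Let Hr := fr_r HF.
Let liter := lev_iter pi lev Hlev.

Definition sublevel (w : T) : Prop := (lev w mod Z.of_nat k = 0)%Z.

Definition subT : Type := {w : T | sublevel w}.

Definition subT_val (w : subT) : T := proj1_sig w.

Lemma subT_val_inj (w v : subT) : subT_val w = subT_val v -> w = v.
Proof.
  destruct w as [w Hw], v as [v Hv]. simpl. intros E. subst v.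
  f_equal. apply proof_irrelevance.
Qed.

Lemma sublevel_parent (w : subT) : sublevel (Nat.iter k pi (subT_val w)).
Proof.
  destruct w as [w Hw]. unfold sublevel in *. simpl. rewrite liter.
  replace (lev w - Z.of_nat k)%Z with (lev w + (-1) * Z.of_nat k)%Z by lia.
  rewrite Z_mod_plus_full. assumption.
Qed.

Definition subT_pi (w : subT) : subT := exist _ (Nat.iter k pi (subT_val w)) (sublevel_parent w).

Definition subT_lev (w : subT) : Z := (lev (subT_val w) / Z.of_nat k)%Z.

Definition subT_K (w : subT) : X -> Prop := K (subT_val w).

Lemma subT_lev_val w : lev (subT_val w) = (Z.of_nat k * subT_lev w)%Z.
Proof.
  destruct w as [w Hw]. unfold subT_lev, sublevel in *. simpl.
  assert (H := Z_div_mod_eq_full (lev w) (Z.of_nat k)). lia.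
Qed.

Lemma subT_iter n w : subT_val (Nat.iter n subT_pi w) = Nat.iter (n * k) pi (subT_val w).
Proof.
  induction n as [|n IH]; [reflexivity|]. simpl Nat.iter at 1.
  change (subT_val (subT_pi (Nat.iter n subT_pi w)))
    with (Nat.iter k pi (subT_val (Nat.iter n subT_pi w))).
  rewrite IH, <- iter_add. f_equal.
Qed.

Lemma subT_lift w j : lev w = (Z.of_nat k * j)%Z -> exists w', subT_val w' = w /\ subT_lev w' = j.
Proof.
  intros H. assert (Hw : sublevel w).
  { unfold sublevel. rewrite H, Z.mul_comm. apply Z_mod_mult. }
  exists (exist _ w Hw). split; [reflexivity|]. unfold subT_lev. simpl.
  rewrite H, Z.mul_comm. apply Z_div_mult_full. lia.
Qed.

Lemma subT_adj w v : adj subT_lev subT_K w v <-> adj lev K (subT_val w) (subT_val v).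
Proof.
  unfold adj, subT_K. rewrite !subT_lev_val. split.
  - intros [H1 [H2 H3]]. repeat split; [congruence| |assumption].
    intros E. apply H2, subT_val_inj, E.
  - intros [H1 [H2 H3]]. repeat split; [|congruence|assumption].
    apply Z.mul_reg_l with (Z.of_nat k); [lia|assumption].
Qed.

(** A path never leaves its level, so a path between two cells of the subtree consists of cells of
    the subtree. *)
Lemma subT_within n w v :
  within (adj subT_lev subT_K) n w v <-> within (adj lev K) n (subT_val w) (subT_val v).
Proof.
  split.
  - apply within_map. intros a b Hab. right. apply subT_adj. assumption.
  - remember (subT_val w) as a eqn:Ea. remember (subT_val v) as b eqn:Eb.
    intros H. revert w v Ea Eb. induction H as [n a|n a u b Hau Hub IH]; intros w v Ea Eb.
    + replace v with w by (apply subT_val_inj; congruence). apply within_refl.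
    + destruct (subT_lift u (subT_lev w)) as [u' [Hu' _]].
      { rewrite <- subT_lev_val. destruct Hau as [E _]. congruence. }
      apply within_step with u'; [|apply IH; auto].
      apply subT_adj. rewrite Hu', <- Ea. assumption.
Qed.

Lemma rp_pow j : rp (r ^ k) j = rp r (Z.of_nat k * j).
Proof.
  assert (H : forall n : nat, rp (r ^ k) (Z.of_nat n) = rp r (Z.of_nat k * Z.of_nat n)).
  { intros n. unfold rp. rewrite <- Nat2Z.inj_mul, <- !pow_powerRZ, pow_mult. reflexivity. }
  destruct (Z_le_gt_dec 0 j) as [Hj|Hj].
  - rewrite <- (Z2Nat.id j) by assumption. apply H.
  - replace j with (- Z.of_nat (Z.to_nat (- j)))%Z by lia.
    rewrite Z.mul_opp_r. unfold rp in *. rewrite !powerRZ_neg', H. reflexivity.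
Qed.

Lemma listed_subT (P : subT -> Prop) (l : list T) n :
  (forall w, P w -> In (subT_val w) l) -> (length l <= n)%nat ->
  exists l', listed P l' /\ (length l' <= n)%nat.
Proof.
  intros HP Hn. destruct (classic (exists w0, P w0)) as [[w0 _]|He].
  - set (lift := fun a => match excluded_middle_informative (sublevel a) with
      left h => exist _ a h | right _ => w0 end).
    apply (listed_sub _ (fun _ => True) (map lift l)); [rewrite length_map; assumption|].
    intros w Hw. replace w with (lift (subT_val w)); [apply in_map; auto|].
    unfold lift. destruct (excluded_middle_informative (sublevel (subT_val w))) as [h|h].
    + apply subT_val_inj. reflexivity.
    + destruct w; contradiction.
  - exists nil. split; [split|simpl; lia]; [constructor|]. intros a. split; [intros []|].
    intros Ha. apply He. exists a. assumption.
Qed.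

(** [Cd], [c0], [ct], [L] and [M] are unchanged, so they are available before [k] is chosen. *)
Theorem frame_subT : frame subT_pi subT_lev subT_K d (r ^ k) Cd c0 ct L (B ^ k) M.
Proof.
  assert (Hkz : Z.of_nat k <> 0%Z) by lia.
  constructor; try apply HF.
  - split; [apply pow_lt; lra|]. destruct k as [|k']; [lia|].
    apply (pow_lt_1_compat r (S k')); [lra|lia].
  - intros w. apply Z.mul_reg_l with (Z.of_nat k); [assumption|].
    rewrite Z.mul_sub_distr_l, <- !subT_lev_val. simpl. rewrite liter. lia.
  - intros w v. destruct (fr_anc HF (subT_val w) (subT_val v)) as [n [m E]].
    assert (E1 := liter n (subT_val w)). rewrite E, liter, !subT_lev_val in E1.
    (* A common ancestor [n] levels above [w] need not have a level divisible by [k]; the one [n k]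
       levels above [w] does. *)
    exists n, (Z.to_nat (Z.of_nat n + subT_lev v - subT_lev w)).
    apply subT_val_inj. rewrite !subT_iter.
    replace (n * k)%nat with (n * k - n + n)%nat by nia.
    rewrite iter_add, E, <- iter_add. f_equal.
    assert (Z.of_nat m = Z.of_nat n + Z.of_nat k * (subT_lev v - subT_lev w))%Z by lia.
    assert (0 <= Z.of_nat n + subT_lev v - subT_lev w)%Z by nia.
    apply Nat2Z.inj. rewrite Nat2Z.inj_mul, Z2Nat.id by assumption. nia.
  - destruct (fr_cnt HF) as [f Hf]. exists (fun w => f (subT_val w)).
    intros a b E. apply subT_val_inj. auto.
  - intros w x Hx. apply (K_iter pi K Hup k). assumption.
  - intros w x Hx. destruct (K_down pi K Hdn k (subT_val w) x Hx) as [v [Hv Hvx]].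
    destruct (subT_lift v (subT_lev w + 1)) as [v' [Hv' Hl]].
    { assert (E := liter k v). rewrite Hv, subT_lev_val in E. lia. }
    exists v'. split; [|unfold subT_K; rewrite Hv'; assumption].
    apply subT_val_inj. simpl. rewrite Hv'. assumption.
  - intros x n. destruct (fr_cov HF x (Z.of_nat k * n)%Z) as [w [Hw Hx]].
    destruct (subT_lift w n Hw) as [w' [Hw' Hl]]. exists w'. split; [assumption|].
    unfold subT_K. rewrite Hw'. assumption.
  - intros w. destruct (fr_min HF (subT_val w)) as [x [Hx Hun]].
    exists x. split; [assumption|]. intros v Hv Hvx. apply subT_val_inj, Hun; [|assumption].
    rewrite !subT_lev_val, Hv. reflexivity.
  - intros om Hom.
    (* The ray in the subtree skips levels. Its interpolation has as term [m] the node [m] levels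
       below the origin, found by climbing [m k - m] levels from [om m], which is [m k] levels
       below. *)
    destruct (fr_end HF
      (fun m => Nat.iter (m * k - m) pi (subT_val (om m)))) as [x Hx].
    + intros n. rewrite <- (Hom n). simpl subT_val.
      change (pi (Nat.iter (S n * k - S n) pi (subT_val (om (S n)))))
        with (Nat.iter (S (S n * k - S n)) pi (subT_val (om (S n)))).
      rewrite <- iter_add. f_equal. nia.
    + assert (Hm : forall m n, subT_val (om n) = Nat.iter (m * k) pi (subT_val (om (n + m)%nat))).
      { induction m as [|m IH]; intros n; [simpl; do 2 f_equal; lia|].
        rewrite (IH n), <- (Hom (n + m)%nat). simpl subT_val. rewrite <- iter_add.
        replace (n + S m)%nat with (S (n + m)) by lia. f_equal. nia. }
      exists x. intros n. unfold subT_K.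
      (* The term [n k] of the interpolated ray is the node [om n], reached there from
         [om (n k)]. *)
      specialize (Hx (n * k)%nat).
      rewrite (Hm (n * k - n)%nat n). replace (n + (n * k - n))%nat with (n * k)%nat by nia.
      replace ((n * k - n) * k)%nat with (n * k * k - n * k)%nat by nia. assumption.
  - intros w x y Hx Hy. rewrite rp_pow, <- subT_lev_val. apply HF; assumption.
  - intros w. rewrite rp_pow, <- subT_lev_val. apply HF.
  - intros w v x y Hl Hx Hy Hxy. apply subT_within. rewrite rp_pow, <- subT_lev_val in Hxy.
    apply (fr_near HF _ _ x y); auto. rewrite !subT_lev_val, Hl. reflexivity.
  - intros w. destruct (fr_deg HF (subT_val w)) as [l [[Hd Hl] Hlen]].
    apply (listed_subT _ l); [|assumption]. intros v Hv. apply Hl. apply subT_within. assumption.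
  - intros w. destruct (listed_desc pi B (fr_chl HF) k (subT_val w))
      as [l [[Hd Hl] Hlen]].
    apply (listed_subT _ l); [|assumption]. intros v <-. apply Hl. reflexivity.
  - intros w. rewrite rp_pow, <- subT_lev_val.
    destruct (fr_deep HF (subT_val w)) as [x [Hx Hdeep]].
    exists x. split; [assumption|]. intros y v Hxy Hl Hy. apply subT_val_inj.
    apply (Hdeep y); auto. rewrite !subT_lev_val, Hl. reflexivity.
Qed.

End Subtree.


(** * Masses on the tree with comparable values at neighbouring cells *)

Lemma harnack_within {T : Type} (E : T -> T -> Prop) (mu : T -> R) (H : R) :
  1 <= H -> (forall w, 0 < mu w) -> (forall w v, E w v -> mu v <= H * mu w) ->
  forall n w v, within E n w v -> mu v <= H ^ n * mu w.
Proof.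
  intros HH Hpos Hh n w v Hw. induction Hw as [n w|n w u v Hwu Huv IH].
  - assert (1 <= H ^ n) by (apply pow_R1_Rle; assumption). specialize (Hpos w). nra.
  - simpl. specialize (Hh _ _ Hwu). assert (0 < H ^ n) by (apply pow_lt; lra). nra.
Qed.

(** Truncated resolvent of the averaging operator of a graph: [resolvent b i] is the sum of
    [(2 L)^-j] times the [j]-step neighbour sums of [b] over [j <= i].  It spreads [b] so that
    neighbouring values are comparable, up to an error of order [2^-i]. *)
Section Resolvent.
Context {T : Type}.
Variable E : T -> T -> Prop.
Hypothesis Esym : forall a b, E a b -> E b a.
Variable nb : T -> list T.
Variable L : nat.
Hypothesis HL : (1 <= L)%nat.
Hypothesis Hnb : forall w, listed (within E 1 w) (nb w) /\ (length (nb w) <= L)%nat.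

Fixpoint resolvent (b : T -> R) (i : nat) (v : T) : R :=
  match i with
  | O => b v
  | S i' => b v + / (2 * INR L) * lsum (resolvent b i') (nb v)
  end.

Let LR : 1 <= INR L := le_INR 1 L HL.

Lemma two_L_pos : 0 < / (2 * INR L).
Proof. apply Rinv_0_lt_compat. assert (H := LR). lra. Qed.

Lemma in_nb w v : In v (nb w) <-> within E 1 w v.
Proof. apply (proj1 (Hnb w)). Qed.

Lemma resolvent_nonneg b i v : (forall u, 0 <= b u) -> 0 <= resolvent b i v.
Proof.
  intros Hb. revert v. induction i as [|i IH]; intros v; simpl; [auto|].
  assert (H := two_L_pos). assert (0 <= lsum (resolvent b i) (nb v)) by (apply lsum_nonneg; auto).
  specialize (Hb v). nra.
Qed.

Lemma resolvent_ge b i v : (forall u, 0 <= b u) -> b v <= resolvent b i v.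
Proof.
  intros Hb. destruct i as [|i]; simpl; [lra|].
  assert (H := two_L_pos).
  assert (0 <= lsum (resolvent b i) (nb v)) by (apply lsum_nonneg; intros; now apply resolvent_nonneg).
  nra.
Qed.

(** Only the last term of the truncated series is new. Each of its averaging steps has at most [L]
    neighbours with the weight [1/(2L)], so it contributes a factor at most [1/2]. *)
Lemma resolvent_increment b bb i v : 0 <= bb -> (forall u, within E (S i) v u -> b u <= bb) ->
  resolvent b (S i) v <= resolvent b i v + (/ 2) ^ S i * bb.
Proof.
  intros Hbb. assert (Hq := two_L_pos). revert v. induction i as [|i IH]; intros v Hv.
  - simpl. rewrite Rmult_1_r. apply Rplus_le_compat_l.
    apply Rle_trans with (/ (2 * INR L) * (INR L * bb)).
    + apply Rmult_le_compat_l; [lra|]. apply lsum_le_const; [|assumption|apply Hnb].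
      intros a Ha. apply Hv. apply in_nb. assumption.
    + assert (H := LR). right. field. lra.
  - change (resolvent b (S (S i)) v) with (b v + / (2 * INR L) * lsum (resolvent b (S i)) (nb v)).
    change (resolvent b (S i) v) with (b v + / (2 * INR L) * lsum (resolvent b i) (nb v)).
    assert (Hs : lsum (resolvent b (S i)) (nb v)
      <= lsum (resolvent b i) (nb v) + INR L * ((/ 2) ^ S i * bb)).
    { apply Rle_trans with (lsum (fun u => resolvent b i u + (/ 2) ^ S i * bb) (nb v)).
      - apply lsum_le. intros u Hu. apply IH. intros t Ht. apply Hv.
        change (S (S i)) with (1 + S i)%nat. apply within_trans with u; [|assumption].
        apply in_nb. assumption.
      - rewrite lsum_plus. apply Rplus_le_compat_l. apply lsum_le_const; [intros; lra| |apply Hnb].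
        apply Rmult_le_pos; [|assumption]. apply pow_le. lra. }
    apply Rmult_le_compat_l with (r := / (2 * INR L)) in Hs; [|lra].
    assert (Heq : / (2 * INR L) * (INR L * ((/ 2) ^ S i * bb)) = (/ 2) ^ S (S i) * bb).
    { simpl. assert (H := LR). field. lra. }
    rewrite Rmult_plus_distr_l, Heq in Hs. lra.
Qed.

(** Up to the last term, the value at [v'] is the resolvent of order [i], and that is one of the
    summands, with weight [1/(2L)], of the resolvent of order [i + 1] at its neighbour [v]. *)
Lemma resolvent_harnack b bb i v v' : 0 <= bb -> (forall u, 0 <= b u) ->
  (forall u, within E (S i) v' u -> b u <= bb) -> E v v' ->
  resolvent b (S i) v' <= 2 * INR L * resolvent b (S i) v + (/ 2) ^ S i * bb.
Proof.
  intros Hbb Hb Hbv Hvv'.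
  eapply Rle_trans; [apply (resolvent_increment b bb i v'); assumption|].
  apply Rplus_le_compat_r.
  assert (H1 : resolvent b i v' <= lsum (resolvent b i) (nb v)).
  { apply lsum_in_le; [apply in_nb, within_edge; assumption|]. intros. now apply resolvent_nonneg. }
  simpl. rewrite Rmult_plus_distr_l, <- Rmult_assoc.
  assert (H := LR). rewrite Rinv_r, Rmult_1_l by lra. specialize (Hb v). nra.
Qed.

Lemma resolvent_zero b i v : (forall u, within E i v u -> b u = 0) -> resolvent b i v = 0.
Proof.
  revert v. induction i as [|i IH]; intros v Hv; simpl.
  - apply Hv, within_refl.
  - rewrite (Hv v) by apply within_refl.
    rewrite (lsum_ext _ (fun _ => 0)); [rewrite lsum_const; lra|].
    intros u Hu. apply IH. intros t Ht. apply Hv.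
    change (S i) with (1 + i)%nat. apply within_trans with u; [|assumption].
    apply in_nb. assumption.
Qed.

(** The graph being symmetric, each averaging step at most halves the total mass; the bound 2 is the
    sum of the geometric series. [Z] has to contain everything that can flow into [V] in [i]
    steps. *)
Lemma resolvent_sum b Z i V : (forall u, 0 <= b u) -> NoDup V ->
  (forall v u, In v V -> within E i v u -> In u Z) ->
  lsum (resolvent b i) V <= 2 * lsum b Z.
Proof.
  intros Hb. assert (Hq := two_L_pos).
  assert (HVZ : forall V, NoDup V -> incl V Z -> lsum b V <= lsum b Z).
  { intros V0 Hd Hi. apply lsum_incl; auto. }
  assert (HZ : 0 <= lsum b Z) by (apply lsum_nonneg; auto).
  revert V. induction i as [|i IH]; intros V Hd HV.
  - change (lsum (resolvent b 0) V) with (lsum b V).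
    assert (lsum b V <= lsum b Z); [|lra]. apply HVZ; [assumption|].
    intros v Hv. apply (HV v); [assumption|apply within_refl].
  - change (lsum (resolvent b (S i)) V) with
      (lsum (fun v => b v + / (2 * INR L) * lsum (resolvent b i) (nb v)) V).
    rewrite lsum_plus, lsum_scal.
    assert (H1 : lsum b V <= lsum b Z).
    { apply HVZ; [assumption|]. intros v Hv. apply (HV v); [assumption|apply within_refl]. }
    set (W := nodup eq_dec_cl (flat_map nb V)).
    assert (H2 : lsum (fun a => lsum (resolvent b i) (nb a)) V <= INR L * lsum (resolvent b i) W).
    { apply (lsum_double_count nb nb); [assumption| | | |].
      - intros a _. apply Hnb.
      - intros a c Ha Hc. split.
        + apply nodup_In, in_flat_map. exists a. auto.
        + apply in_nb. apply within_sym; [assumption|]. apply in_nb. assumption.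
      - intros c. apply Hnb.
      - intros c _. apply resolvent_nonneg. assumption. }
    assert (H3 : lsum (resolvent b i) W <= 2 * lsum b Z).
    { apply IH; [apply NoDup_nodup|]. intros v u Hv Hu. unfold W in Hv.
      apply nodup_In, in_flat_map in Hv. destruct Hv as [a [Ha Hav]].
      apply (HV a); [assumption|]. change (S i) with (1 + i)%nat.
      apply within_trans with v; [apply in_nb; assumption|assumption]. }
    assert (H := LR).
    assert (H4 : / (2 * INR L) * lsum (fun a => lsum (resolvent b i) (nb a)) V
      <= / (2 * INR L) * (INR L * (2 * lsum b Z))).
    { apply Rmult_le_compat_l; [lra|]. nra. }
    replace (/ (2 * INR L) * (INR L * (2 * lsum b Z))) with (lsum b Z) in H4 by (field; lra).
    lra.
Qed.

End Resolvent.

Section MassStep.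
Context {T : Type}.
Variable pi : T -> T.
Variable E : T -> T -> Prop.
Hypothesis Esym : forall a b, E a b -> E b a.
Hypothesis Epi : forall a b, E a b -> pi a = pi b \/ E (pi a) (pi b).
Variables (nb ch : T -> list T) (L M i0 : nat).
Hypothesis HL : (1 <= L)%nat.
Hypothesis Hnb : forall w, listed (within E 1 w) (nb w) /\ (length (nb w) <= L)%nat.
Hypothesis Hch : forall w, listed (fun v => pi v = w) (ch w).
Hypothesis Hball : forall w, exists l, listed (within E M w) l /\ (length l <= L ^ M)%nat.
Variable e : T -> R.
Variables (delta eps : R) (z : T -> T).
Let i1 := S i0.
Let H := 2 * INR L + 2.
Hypothesis Hdelta : 0 < delta.
Hypothesis He : forall u, delta <= e u <= 1.
Hypothesis Hsum : forall w, lsum e (ch w) <= eps.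
Hypothesis Heps : 2 * (INR (L ^ M) * (eps * H ^ M)) <= / 2.
Hypothesis Hsep : forall v u, within E i1 v u -> within E M (pi v) (pi u).
Hypothesis Hz : forall w v, within E i1 (z w) v -> pi v = w.
Hypothesis Hi : H ^ S M * (/ 2) ^ i1 <= delta.

Definition base_mass (mu : T -> R) : T -> R := resolvent nb L (fun u => e u * mu (pi u)) i1.

Definition bump (w : T) : T -> R := resolvent nb L (fun u => ind (u = z w)) i1.

(** The base mass carries the prescribed lower bound; the missing mass of each [w] is put on a
    bump deep inside [w], whose truncation error is hidden under the base mass. *)
Definition mass_step (mu : T -> R) (v : T) : R :=
  base_mass mu v +
  (mu (pi v) - lsum (base_mass mu) (ch (pi v))) * (bump (pi v) v / lsum (bump (pi v)) (ch (pi v))).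

Definition harnack (mu : T -> R) : Prop :=
  (forall w, 0 < mu w) /\ forall w v, E w v -> mu v <= H * mu w.

Let LR : 1 <= INR L := le_INR 1 L HL.

Lemma H_ge_one : 1 <= H.
Proof. unfold H. assert (HH := LR). lra. Qed.

Lemma bump_nonneg w v : 0 <= bump w v.
Proof. apply (resolvent_nonneg nb L HL). intros u. apply ind_bounds. Qed.

Lemma bump_sum_ge_one w : 1 <= lsum (bump w) (ch w).
Proof.
  apply Rle_trans with (bump w (z w)).
  - rewrite <- (ind_true (z w = z w) eq_refl) at 1.
    apply (resolvent_ge nb L HL (fun u => ind (u = z w))). intros u. apply ind_bounds.
  - apply lsum_in_le.
    + apply (proj2 (Hch w)). apply (Hz w). apply within_refl.
    + intros. apply bump_nonneg.
Qed.

(** All cells within the range of the smoothing around [z w] are children of [w], so the bumps of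
    different parents do not overlap and the deficit of [w] is spent on children of [w] only. *)
Lemma bump_support w v : pi v <> w -> bump w v = 0.
Proof.
  intros Hne. apply (resolvent_zero E nb L Hnb). intros u Hu.
  apply ind_false. intros ->. apply Hne. apply Hz. apply within_sym; assumption.
Qed.

Lemma bump_harnack w v v' : E v v' -> bump w v' <= 2 * INR L * bump w v + (/ 2) ^ i1.
Proof.
  intros Hv. rewrite <- (Rmult_1_r ((/ 2) ^ i1)).
  apply (resolvent_harnack E nb L HL Hnb); auto; try lra.
  - intros u. apply ind_bounds.
  - intros u _. apply ind_bounds.
Qed.

Section Step.
Variable mu : T -> R.
Hypothesis Hmu : harnack mu.

Let mupos : forall w, 0 < mu w := proj1 Hmu.
Let muM := harnack_within E mu H H_ge_one mupos (proj2 Hmu) M.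

Lemma e_mu_nonneg u : 0 <= e u * mu (pi u).
Proof. apply Rmult_le_pos; [|left; apply mupos]. specialize (He u). lra. Qed.

Lemma base_mass_ge v : e v * mu (pi v) <= base_mass mu v.
Proof. apply (resolvent_ge nb L HL (fun u => e u * mu (pi u))). apply e_mu_nonneg. Qed.

Lemma base_mass_pos v : 0 < base_mass mu v.
Proof.
  eapply Rlt_le_trans; [|apply base_mass_ge]. apply Rmult_lt_0_compat; [|apply mupos].
  specialize (He v). lra.
Qed.

Lemma mu_parent_le v v' : E v v' -> mu (pi v') <= H * mu (pi v).
Proof.
  intros Hv. destruct (Epi _ _ Hv) as [->|Hp]; [|apply Hmu; assumption].
  assert (Hpos := mupos (pi v')). assert (HH := H_ge_one). nra.
Qed.

(** The left side bounds the truncation error at [v']. Passing from [v'] to [v] costs one more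
    factor [H], and the choice of [i1] puts the result below [delta] times the mass of the parent of
    [v]. *)
Lemma error_le v v' : E v v' -> (/ 2) ^ i1 * (H ^ M * mu (pi v')) <= base_mass mu v.
Proof.
  intros Hv. apply Rle_trans with (e v * mu (pi v)); [|apply base_mass_ge].
  apply Rle_trans with (delta * mu (pi v)).
  - apply Rle_trans with (H ^ S M * (/ 2) ^ i1 * mu (pi v)).
    + assert (Hp := mu_parent_le v v' Hv).
      assert (0 < (/ 2) ^ i1) by (apply pow_lt; lra).
      assert (0 < H ^ M) by (apply pow_lt; assert (HH := H_ge_one); lra).
      replace (H ^ S M * (/ 2) ^ i1 * mu (pi v)) with ((/ 2) ^ i1 * (H ^ M * (H * mu (pi v))))
        by (simpl; ring).
      apply Rmult_le_compat_l; [lra|]. apply Rmult_le_compat_l; [lra|assumption].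
    + apply Rmult_le_compat_r; [left; apply mupos|assumption].
  - apply Rmult_le_compat_r; [left; apply mupos|apply He].
Qed.

Lemma base_mass_harnack v v' : E v v' -> base_mass mu v' <= (2 * INR L + 1) * base_mass mu v.
Proof.
  intros Hv. rewrite Rmult_plus_distr_r, Rmult_1_l.
  eapply Rle_trans; [|apply Rplus_le_compat_l; apply (error_le v v' Hv)].
  apply (resolvent_harnack E nb L HL Hnb); auto.
  - apply Rmult_le_pos; [|left; apply mupos]. apply pow_le. assert (HH := H_ge_one). lra.
  - apply e_mu_nonneg.
  - intros u Hu. assert (Hm := muM _ _ (Hsep _ _ Hu)). assert (Hp := mupos (pi u)).
    specialize (He u). nra.
Qed.

(** What reaches the children of [w] comes from children of the at most [L^M] cells within [M] steps
    of [w]. Each of these has mass at most [H^M mu w] and hands on a fraction at most [eps]; the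
    resolvent adds a factor 2. *)
Lemma base_mass_sum w : lsum (base_mass mu) (ch w) <= / 2 * mu w.
Proof.
  destruct (Hball w) as [l [[Hd Hl] Hlen]].
  apply Rle_trans with (2 * lsum (fun u => e u * mu (pi u)) (flat_map ch l)).
  - apply (resolvent_sum E Esym nb L HL Hnb); [apply e_mu_nonneg|apply Hch|].
    intros v u Hv Hu. apply in_flat_map. exists (pi u). split; [|apply (proj2 (Hch _)); reflexivity].
    apply Hl. apply (proj2 (Hch w)) in Hv. rewrite <- Hv. apply Hsep. assumption.
  - rewrite lsum_flat_map.
    assert (HM : 0 <= H ^ M) by (apply pow_le; assert (HH := H_ge_one); lra).
    assert (He0 : 0 <= eps).
    { eapply Rle_trans; [|apply (Hsum w)]. apply lsum_nonneg. intros u _. specialize (He u). lra. }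
    assert (Hs : lsum (fun a => lsum (fun u => e u * mu (pi u)) (ch a)) l
      <= INR (L ^ M) * (eps * (H ^ M * mu w))).
    { apply lsum_le_const; [| |assumption].
      - intros a Ha. apply Rle_trans with (mu a * lsum e (ch a)).
        + rewrite <- lsum_scal. apply lsum_le. intros u Hu. apply (proj2 (Hch a)) in Hu.
          rewrite Hu. lra.
        + apply Hl in Ha. apply muM in Ha. specialize (Hsum a). assert (Hp := mupos a).
          apply Rle_trans with (mu a * eps); [apply Rmult_le_compat_l; lra|nra].
      - apply Rmult_le_pos; [assumption|]. apply Rmult_le_pos; [assumption|left; apply mupos]. }
    assert (Hpos := mupos w).
    apply Rmult_le_compat_r with (r := mu w) in Heps; [|lra]. lra.
Qed.

Lemma deficit_bounds w : 0 <= mu w - lsum (base_mass mu) (ch w) <= mu w.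
Proof.
  assert (Hs := base_mass_sum w). assert (Hp := mupos w).
  assert (0 <= lsum (base_mass mu) (ch w)).
  { apply lsum_nonneg. intros u _. left. apply base_mass_pos. }
  lra.
Qed.

Lemma mass_step_ge v : e v * mu (pi v) <= mass_step mu v.
Proof.
  unfold mass_step. assert (Hb := base_mass_ge v). assert (Hd := deficit_bounds (pi v)).
  assert (0 <= bump (pi v) v / lsum (bump (pi v)) (ch (pi v))).
  { apply Rmult_le_pos; [apply bump_nonneg|]. left. apply Rinv_0_lt_compat.
    assert (Hs := bump_sum_ge_one (pi v)). lra. }
  nra.
Qed.

Lemma mass_step_sum w : lsum (mass_step mu) (ch w) = mu w.
Proof.
  unfold mass_step. rewrite lsum_plus.
  rewrite (lsum_ext (fun v => _ * (bump (pi v) v / _))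
    (fun v => (mu w - lsum (base_mass mu) (ch w)) / lsum (bump w) (ch w) * bump w v)).
  - rewrite lsum_scal. field. assert (Hs := bump_sum_ge_one w). lra.
  - intros v Hv. apply (proj2 (Hch w)) in Hv. rewrite Hv. unfold Rdiv. ring.
Qed.

(** The constant reproduces itself: [2L] from the resolvent, plus 1 for the truncation error of the
    base mass and 1 for that of the bump, both absorbed by the base mass at [v]. If [v] and [v']
    have different parents, the bump at [v'] consists of the error alone. *)
Lemma mass_step_harnack : harnack (mass_step mu).
Proof.
  split.
  - intros v. eapply Rlt_le_trans; [|apply mass_step_ge].
    apply Rmult_lt_0_compat; [|apply mupos]. specialize (He v). lra.
  - intros v v' Hv. unfold mass_step, H.
    assert (Hb := base_mass_harnack v v' Hv). assert (Her := error_le v v' Hv).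
    set (w' := pi v') in *.
    set (D := fun w => mu w - lsum (base_mass mu) (ch w)).
    fold (D w') (D (pi v)).
    assert (HD := deficit_bounds w'). fold (D w') in HD.
    assert (HD' := deficit_bounds (pi v)). fold (D (pi v)) in HD'.
    set (nn := fun w => lsum (bump w) (ch w)). fold (nn w') (nn (pi v)).
    assert (Hn : forall w, 0 < / nn w <= 1).
    { intros w. assert (Hs := bump_sum_ge_one w). fold (nn w) in Hs. split.
      - apply Rinv_0_lt_compat. lra.
      - rewrite <- Rinv_1. apply Rinv_le_contravar; lra. }
    assert (HM : 1 <= H ^ M) by (apply pow_R1_Rle, H_ge_one).
    assert (Hq : 0 < (/ 2) ^ i1) by (apply pow_lt; lra).
    assert (Hbw : D w' * (bump w' v' / nn w')
      <= D w' * (2 * INR L * (bump w' v / nn w')) + base_mass mu v).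
    { assert (H1 := bump_harnack w' v v' Hv). specialize (Hn w').
      assert (H2 : bump w' v' / nn w' <= 2 * INR L * (bump w' v / nn w') + (/ 2) ^ i1).
      { unfold Rdiv. apply Rle_trans with ((2 * INR L * bump w' v + (/ 2) ^ i1) * / nn w').
        - apply Rmult_le_compat_r; lra.
        - nra. }
      apply Rle_trans with (D w' * (2 * INR L * (bump w' v / nn w')) + D w' * (/ 2) ^ i1).
      - rewrite <- Rmult_plus_distr_l. apply Rmult_le_compat_l; lra.
      - apply Rplus_le_compat_l. eapply Rle_trans; [|apply Her].
        assert (Hpos := mupos w').
        apply Rle_trans with (mu w' * (/ 2) ^ i1); [apply Rmult_le_compat_r; lra|].
        rewrite Rmult_comm. apply Rmult_le_compat_l; [lra|]. nra. }
    assert (Hbv : D w' * (2 * INR L * (bump w' v / nn w'))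
      <= 2 * INR L * (D (pi v) * (bump (pi v) v / nn (pi v)))).
    { destruct (classic (pi v = w')) as [Hp|Hp].
      - rewrite Hp. lra.
      - rewrite (bump_support w' v Hp). unfold Rdiv. rewrite Rmult_0_l, !Rmult_0_r.
        assert (0 <= bump (pi v) v * / nn (pi v)).
        { apply Rmult_le_pos; [apply bump_nonneg|]. specialize (Hn (pi v)). lra. }
        assert (HH := LR). apply Rmult_le_pos; [lra|]. apply Rmult_le_pos; lra. }
    assert (0 <= D (pi v) * (bump (pi v) v / nn (pi v))).
    { apply Rmult_le_pos; [lra|]. apply Rmult_le_pos; [apply bump_nonneg|].
      specialize (Hn (pi v)). lra. }
    lra.
Qed.

End Step.

(** The iterate [n] is relevant for the cells [n] levels below the one where all masses are set to
    1; being defined on the whole tree, it does not need to mention that level. *)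
Fixpoint mass_iter (n : nat) : T -> R :=
  match n with O => fun _ => 1 | S n' => mass_step (mass_iter n') end.

Lemma mass_iter_harnack n : harnack (mass_iter n).
Proof.
  induction n as [|n IH].
  - simpl. split; [intros; lra|]. intros. assert (HH := H_ge_one). lra.
  - apply mass_step_harnack; assumption.
Qed.

Lemma mass_iter_sum n w : lsum (mass_iter (S n)) (ch w) = mass_iter n w.
Proof. apply mass_step_sum. Qed.

Lemma mass_iter_ge n v : e v * mass_iter n (pi v) <= mass_iter (S n) v.
Proof. apply mass_step_ge. apply mass_iter_harnack. Qed.

Lemma mass_iter_le n v : mass_iter (S n) v <= mass_iter n (pi v).
Proof.
  rewrite <- (mass_iter_sum n (pi v)).
  apply lsum_in_le; [apply (proj2 (Hch _)); reflexivity|].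
  intros u _. left. apply mass_iter_harnack.
Qed.

End MassStep.


(** * The limit over the starting level *)

Lemma bounded_subsequence (u : nat -> R) B : (forall n, 0 <= u n <= B) ->
  exists (psi : nat -> nat) (l : R), (forall n, (n <= psi n)%nat) /\
    forall n, Rabs (u (psi n) - l) < / (INR n + 1).
Proof.
  intros Hu.
  destruct (Bolzano_Weierstrass u (fun c => 0 <= c <= B) (compact_P3 0 B) Hu) as [l Hl].
  destruct (fun_choice (fun n p => (n <= p)%nat /\ Rabs (u p - l) < / (INR n + 1))) as [psi Hpsi].
  - intros n. assert (Hn : 0 < / (INR n + 1)).
    { apply Rinv_0_lt_compat. assert (H := pos_INR n). lra. }
    destruct (Hl (disc l (mkposreal _ Hn)) n) as [p [Hp1 Hp2]].
    + exists (mkposreal _ Hn). intros x Hx. exact Hx.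
    + exists p. split; assumption.
  - exists psi, l. split; intros n; apply Hpsi.
Qed.

Lemma diagonal_limit {A : Type} (f : A -> nat) (a : nat -> A -> R) (Bd : A -> R) :
  (forall x y, f x = f y -> x = y) ->
  (forall t, exists m0, forall m, (m0 <= m)%nat -> 0 <= a m t <= Bd t) ->
  exists (D : nat -> nat) (l : A -> R), (forall n, (n <= D n)%nat) /\
    forall t, is_lim_seq (fun n => a (D n) t) (l t).
Proof.
  intros Hf Hb.
  assert (HBd : forall t, 0 <= Bd t).
  { intros t. destruct (Hb t) as [m0 H]. specialize (H m0 (Nat.le_refl _)). lra. }
  (* The index set is transported to the integers by [f], and the values, bounded only eventually,
     are clipped so that they are bounded from the start. *)
  set (b := fun m i => match excluded_middle_informative (exists t, f t = i) with
    | left h => let t := proj1_sig (constructive_indefinite_description _ h) in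
        Rmax 0 (Rmin (a m t) (Bd t))
    | right _ => 0 end).
  assert (Hbt : forall m t, b m (f t) = Rmax 0 (Rmin (a m t) (Bd t))).
  { intros m t. unfold b. destruct (excluded_middle_informative _) as [h|h].
    - destruct (constructive_indefinite_description _ h) as [t' Ht']. simpl.
      apply Hf in Ht'. subst. reflexivity.
    - destruct h. exists t. reflexivity. }
  assert (Hbb : forall i, exists B, forall m, 0 <= b m i <= B).
  { intros i. unfold b. destruct (excluded_middle_informative _) as [h|h].
    - destruct (constructive_indefinite_description _ h) as [t Ht]. simpl.
      exists (Bd t). intros m. specialize (HBd t). split; [apply Rmax_l|].
      apply Rmax_lub; [assumption|apply Rmin_r].
    - exists 0. intros; lra. }
  destruct (fun_choice (fun (sub_i : (nat -> nat) * nat) psi => exists l : R,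
    (forall n, (n <= psi n)%nat) /\
    forall n, Rabs (b (fst sub_i (psi n)) (snd sub_i) - l) < / (INR n + 1))) as [Psi HPsi].
  { intros [sub i]. destruct (Hbb i) as [B HB].
    destruct (bounded_subsequence (fun n => b (sub n) i) B) as [psi [l H]]; [intros; apply HB|].
    exists psi, l. exact H. }
  (* [sub i] is a subsequence of all earlier ones; the diagonal [sub n n] is, from [n = i] on, a
     rearranged part of [sub i] with indices at least [n], which suffices for the limit. *)
  set (sub := nat_rect (fun _ => nat -> nat) (fun n => n) (fun i s n => s (Psi (s, i) n))).
  assert (Hsub : forall i j n, exists m, (n <= m)%nat /\ sub (j + i)%nat n = sub i m).
  { intros i j. induction j as [|j IH]; intros n; [exists n; auto|].
    destruct (IH (Psi (sub (j + i)%nat, (j + i)%nat) n)) as [m [Hm1 Hm2]].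
    exists m. split; [|exact Hm2].
    destruct (HPsi (sub (j + i)%nat, (j + i)%nat)) as [l [H _]]. specialize (H n). lia. }
  assert (Hge : forall i n, (n <= sub i n)%nat).
  { intros i. induction i as [|i IH]; intros n; [reflexivity|].
    simpl. destruct (HPsi (sub i, i)) as [l [H _]]. specialize (H n).
    specialize (IH (Psi (sub i, i) n)). fold (sub i). lia. }
  destruct (fun_choice (fun i l => forall n, Rabs (b (sub (S i) n) i - l) < / (INR n + 1)))
    as [lim Hlim].
  { intros i. destruct (HPsi (sub i, i)) as [l [_ H]]. exists l. exact H. }
  exists (fun n => sub n n), (fun t => lim (f t)). split; [intros; apply Hge|]. intros t.
  apply is_lim_seq_ext_loc with (u := fun n => b (sub n n) (f t)).
  - destruct (Hb t) as [m0 Hm0]. exists m0. intros n Hn. rewrite Hbt.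
    specialize (Hge n n). specialize (Hm0 (sub n n)).
    rewrite Rmin_left, Rmax_right; auto; apply Hm0; lia.
  - apply is_lim_seq_spec. intros eps.
    destruct (archimed_cor1 eps) as [N [HN HN0]]; [apply cond_pos|].
    exists (Nat.max N (S (f t))). intros n Hn.
    destruct (Hsub (S (f t)) (n - S (f t))%nat n) as [m [Hm1 Hm2]].
    replace (n - S (f t) + S (f t))%nat with n in Hm2 by lia. rewrite Hm2.
    eapply Rlt_trans; [apply Hlim|]. eapply Rle_lt_trans; [|apply HN].
    apply Rinv_le_contravar; [apply lt_0_INR; assumption|].
    assert (INR N <= INR m) by (apply le_INR; lia). lra.
Qed.

Lemma is_lim_seq_lsum {A : Type} (a : nat -> A -> R) (l : A -> R) (s : list A) :
  (forall t, is_lim_seq (fun n => a n t) (l t)) ->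
  is_lim_seq (fun n => lsum (a n) s) (lsum l s).
Proof.
  intros H. induction s as [|t s IH].
  - apply is_lim_seq_const.
  - apply (is_lim_seq_plus' (fun n => a n t) (fun n => lsum (a n) s)); auto.
Qed.

Section InvariantMass.
Context {T : Type}.
Variable pi : T -> T.
Variable lev : T -> Z.
Variable E : T -> T -> Prop.
Hypothesis Esym : forall a b, E a b -> E b a.
Hypothesis Epi : forall a b, E a b -> pi a = pi b \/ E (pi a) (pi b).
Hypothesis Elev : forall a b, E a b -> lev a = lev b.
Hypothesis Hlev : forall w, lev (pi w) = (lev w - 1)%Z.
Hypothesis Hanc : forall w v, exists n m, Nat.iter n pi w = Nat.iter m pi v.
Hypothesis Hcnt : exists f : T -> nat, forall a b, f a = f b -> a = b.
Variable phi : T.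
Variables (nb ch : T -> list T) (L M i0 : nat).
Hypothesis HL : (1 <= L)%nat.
Hypothesis Hnb : forall w, listed (within E 1 w) (nb w) /\ (length (nb w) <= L)%nat.
Hypothesis Hch : forall w, listed (fun v => pi v = w) (ch w).
Hypothesis Hball : forall w, exists l, listed (within E M w) l /\ (length l <= L ^ M)%nat.
Variable e : T -> R.
Variables (delta eps : R) (z : T -> T).
Let H := 2 * INR L + 2.
Hypothesis Hdelta : 0 < delta.
Hypothesis He : forall u, delta <= e u <= 1.
Hypothesis Hsum : forall w, lsum e (ch w) <= eps.
Hypothesis Heps : 2 * (INR (L ^ M) * (eps * H ^ M)) <= / 2.
Hypothesis Hsep : forall v u, within E (S i0) v u -> within E M (pi v) (pi u).
Hypothesis Hz : forall w v, within E (S i0) (z w) v -> pi v = w.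
Hypothesis Hi : H ^ S M * (/ 2) ^ S i0 <= delta.

Let W := mass_iter pi nb ch L i0 e z.

Let W_harnack n : harnack E L (W n).
Proof. apply mass_iter_harnack with M delta eps; assumption. Qed.

Let W_pos n v : 0 < W n v.
Proof. apply W_harnack. Qed.

Let W_up n a v : W (n + a)%nat v <= W n (Nat.iter a pi v).
Proof.
  revert v. induction a as [|a IH]; intros v; [replace (n + 0)%nat with n by lia; simpl; lra|].
  rewrite Nat.add_succ_r. eapply Rle_trans.
  - apply (mass_iter_le pi E Esym Epi nb ch L M i0 HL Hnb Hch Hball e delta eps z); assumption.
  - simpl. rewrite <- iter_swap. apply IH.
Qed.

Let W_down n a v : delta ^ a * W n (Nat.iter a pi v) <= W (n + a)%nat v.
Proof.
  revert v. induction a as [|a IH]; intros v; [replace (n + 0)%nat with n by lia; simpl; lra|].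
  rewrite Nat.add_succ_r.
  assert (Hge : e v * W (n + a)%nat (pi v) <= W (S (n + a)) v)
    by (apply mass_iter_ge with E M delta eps; assumption).
  eapply Rle_trans; [|apply Hge]. simpl. rewrite <- iter_swap.
  specialize (IH (pi v)). assert (Hev := He v). assert (Hp := W_pos (n + a)%nat (pi v)).
  assert (0 < delta ^ a) by (apply pow_lt; assumption).
  assert (Hp' := W_pos n (Nat.iter a pi (pi v))).
  apply Rle_trans with (delta * W (n + a)%nat (pi v)); [|apply Rmult_le_compat_r; lra].
  rewrite Rmult_assoc. apply Rmult_le_compat_l; lra.
Qed.

(** The iterates started on the level [-m] and normalised at [phi] stay in a fixed compact interval
    at every node. Comparability, additivity and the lower bound involve finitely many nodes each,
    so they pass to a pointwise limit. *)
Theorem invariant_mass : exists mu : T -> R, harnack E L mu /\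
  (forall w, lsum mu (ch w) = mu w) /\ forall v, e v * mu (pi v) <= mu v.
Proof.
  (* [idx m v] is the depth of [v] below the level [-m]. It is cut to 0 above that level, so the
     relations between a node and its children hold only for large [m]. *)
  set (idx := fun (m : nat) (v : T) => Z.to_nat (lev v + Z.of_nat m)).
  set (a := fun m v => W (idx m v) v / W (idx m phi) phi).
  (* Both [v] and [phi] are compared with a common ancestor, [p] levels above [v] and [q] levels
     above [phi]; going down one level multiplies the mass by a factor between [delta] and 1. *)
  assert (Hab : forall v, exists c C, 0 < c /\ exists m0, forall m, (m0 <= m)%nat -> c <= a m v <= C).
  { intros v. destruct (Hanc v phi) as [p [q Hpq]].
    assert (El := lev_iter pi lev Hlev p v). rewrite Hpq, (lev_iter pi lev Hlev) in El.
    exists (delta ^ p), (/ delta ^ q).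
    assert (Hdp : 0 < delta ^ p) by (apply pow_lt; assumption).
    assert (Hdq : 0 < delta ^ q) by (apply pow_lt; assumption).
    split; [assumption|].
    exists (Z.to_nat (Z.of_nat p + Z.of_nat q + Z.abs (lev v) + Z.abs (lev phi))).
    intros m Hm. unfold a.
    set (n := Z.to_nat (lev v + Z.of_nat m - Z.of_nat p)).
    replace (idx m v) with (n + p)%nat by (unfold n, idx; lia).
    replace (idx m phi) with (n + q)%nat by (unfold n, idx; lia).
    assert (H1 := W_up n p v). assert (H2 := W_down n p v).
    assert (H3 := W_up n q phi). assert (H4 := W_down n q phi). rewrite Hpq in *.
    assert (Hpn := W_pos (n + q)%nat phi). assert (Hpm := W_pos n (Nat.iter q pi phi)).
    split.
    - apply Rmult_le_reg_r with (W (n + q)%nat phi); [assumption|].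
      unfold Rdiv. rewrite Rmult_assoc, Rinv_l, Rmult_1_r by lra. nra.
    - apply Rmult_le_reg_r with (W (n + q)%nat phi); [assumption|].
      unfold Rdiv. rewrite Rmult_assoc, Rinv_l, Rmult_1_r by lra.
      apply Rmult_le_reg_l with (delta ^ q); [assumption|].
      rewrite <- Rmult_assoc, Rinv_r, Rmult_1_l by lra. nra. }
  destruct (fun_choice _ Hab) as [lo Hlo]. destruct (fun_choice _ Hlo) as [hi Hhi].
  destruct Hcnt as [f Hf].
  destruct (diagonal_limit f a hi Hf) as [D [mu [HD Hmu]]].
  { intros t. destruct (Hhi t) as [Hp [m0 Hm]]. exists m0. intros m Hle. specialize (Hm m Hle). lra. }
  assert (Hlarge : forall v, exists N, forall n, (N <= n)%nat -> (0 <= lev v + Z.of_nat (D n))%Z).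
  { intros v. exists (Z.to_nat (Z.abs (lev v))). intros n Hn. specialize (HD n). lia. }
  assert (Hpi : forall v, exists N, forall n, (N <= n)%nat -> idx (D n) v = S (idx (D n) (pi v))).
  { intros v. destruct (Hlarge (pi v)) as [N HN]. exists N. intros n Hn. specialize (HN n Hn).
    unfold idx. rewrite Hlev in *. lia. }
  assert (Hinv : forall m, 0 < / W (idx m phi) phi) by (intros m; apply Rinv_0_lt_compat, W_pos).
  exists mu. split; [split|split].
  - intros w. destruct (Hhi w) as [Hp [m0 Hm]].
    apply Rlt_le_trans with (lo w); [assumption|].
    apply (is_lim_seq_le_loc (fun _ => lo w) (fun n => a (D n) w) (lo w) (mu w)).
    + exists m0. intros n Hn. specialize (HD n). apply Hm. lia.
    + apply is_lim_seq_const.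
    + apply Hmu.
  - intros w v Hwv.
    apply (is_lim_seq_le (fun n => a (D n) v) (fun n => (2 * INR L + 2) * a (D n) w)
      (mu v) ((2 * INR L + 2) * mu w)).
    + intros n. unfold a. unfold Rdiv; rewrite <- Rmult_assoc. apply Rmult_le_compat_r; [left; apply Hinv|].
      replace (idx (D n) v) with (idx (D n) w) by (unfold idx; rewrite (Elev w v Hwv); reflexivity).
      apply W_harnack. assumption.
    + apply Hmu.
    + apply (is_lim_seq_scal_l (fun n => a (D n) w) (2 * INR L + 2) (mu w)). apply Hmu.
  - intros w.
    assert (H1 : is_lim_seq (fun n => lsum (a (D n)) (ch w)) (lsum mu (ch w))).
    { apply is_lim_seq_lsum. assumption. }
    assert (H2 : is_lim_seq (fun n => lsum (a (D n)) (ch w)) (mu w)).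
    { apply is_lim_seq_ext_loc with (u := fun n => a (D n) w); [|apply Hmu].
      destruct (Hlarge w) as [N HN]. exists N. intros n Hn. specialize (HN n Hn). unfold a.
      rewrite (lsum_ext (fun v => W (idx (D n) v) v / _)
        (fun v => / W (idx (D n) phi) phi * W (S (idx (D n) w)) v)).
      - assert (Es : lsum (W (S (idx (D n) w))) (ch w) = W (idx (D n) w) w)
          by (apply mass_iter_sum with E; assumption).
        rewrite lsum_scal, Es. unfold Rdiv. rewrite Rmult_comm. reflexivity.
      - intros v Hv. apply (proj2 (Hch w)) in Hv. subst w.
        replace (idx (D n) v) with (S (idx (D n) (pi v))); [unfold Rdiv; ring|].
        unfold idx. rewrite Hlev in *. lia. }
    apply is_lim_seq_unique in H1. apply is_lim_seq_unique in H2. rewrite H1 in H2.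
    injection H2. auto.
  - intros v.
    apply (is_lim_seq_le_loc (fun n => e v * a (D n) (pi v)) (fun n => a (D n) v)
      (e v * mu (pi v)) (mu v)).
    + destruct (Hpi v) as [N HN]. exists N. intros n Hn. unfold a. rewrite (HN n Hn).
      unfold Rdiv. rewrite <- Rmult_assoc. apply Rmult_le_compat_r; [left; apply Hinv|].
      apply mass_iter_ge with E M delta eps; assumption.
    + apply (is_lim_seq_scal_l (fun n => a (D n) (pi v)) (e v) (mu (pi v))). apply Hmu.
    + apply Hmu.
Qed.

End InvariantMass.


(** * The chain metric *)

Section FrameGeometry.
Context {T X : Type} {pi : T -> T} {lev : T -> Z} {K : T -> X -> Prop} {d : X -> X -> R}.
Context {r Cd c0 ct : R} {L B M : nat}.
Hypothesis HF : frame pi lev K d r Cd c0 ct L B M.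

Lemma cell_inhabited w : exists x, K w x.
Proof. destruct (fr_min HF w) as [x [Hx _]]. exists x. assumption. Qed.

Lemma frame_dist_sym x y : d x y = d y x.
Proof. apply (fr_met HF). Qed.

Lemma frame_dist_tri x y z : d x z <= d x y + d y z.
Proof. apply (fr_met HF). Qed.

Lemma frame_dist_nonneg x y : 0 <= d x y.
Proof. apply (fr_met HF). Qed.

Lemma frame_rp_pos n : 0 < rp r n.
Proof. apply rp_pos, (fr_r HF). Qed.

Lemma frame_lev_iter n w : lev (Nat.iter n pi w) = (lev w - Z.of_nat n)%Z.
Proof. apply lev_iter. apply (fr_lev HF). Qed.

Lemma frame_K_iter n w x : K w x -> K (Nat.iter n pi w) x.
Proof. apply K_iter, (fr_up HF). Qed.

Lemma frame_within_iter k n w v :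
  within (adj lev K) n w v -> within (adj lev K) n (Nat.iter k pi w) (Nat.iter k pi v).
Proof. apply within_adj_iter; [apply (fr_lev HF)|apply (fr_up HF)]. Qed.

Lemma frame_within_pi n w v : within (adj lev K) n w v -> within (adj lev K) n (pi w) (pi v).
Proof. apply (frame_within_iter 1). Qed.

Lemma within_dist n w v x y : within (adj lev K) n w v -> K w x -> K v y ->
  d x y <= (INR n + 1) * (Cd * rp r (lev w)).
Proof.
  assert (HC := fr_Cd HF). intros H. revert x y.
  induction H as [n w|n w u v Hwu Huv IH]; intros x y Hx Hy.
  - assert (H := fr_diam HF w x y Hx Hy). assert (Hp := frame_rp_pos (lev w)).
    assert (0 <= INR n * (Cd * rp r (lev w))); [|lra].
    apply Rmult_le_pos; [apply pos_INR|nra].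
  - destruct Hwu as [Hl [_ [z [Hz1 Hz2]]]].
    assert (H1 := fr_diam HF w x z Hx Hz1). specialize (IH z y Hz2 Hy). rewrite <- Hl in IH.
    assert (H2 := frame_dist_tri x z y). rewrite S_INR. lra.
Qed.

Lemma common_ancestor_cell x y : exists u, K u x /\ K u y.
Proof.
  destruct (fr_cov HF x 0) as [w [_ Hw]]. destruct (fr_cov HF y 0) as [v [_ Hv]].
  destruct (fr_anc HF w v) as [n [m E]]. exists (Nat.iter n pi w).
  split; [|rewrite E]; apply frame_K_iter; assumption.
Qed.

(** Going up [s] levels divides the scale by [r^s], which brings the distance under the threshold
    [c0] for proximity in the graph. *)
Lemma ancestors_near D : 0 < D -> exists s : nat, forall w v x y, lev w = lev v ->
  K w x -> K v y -> d x y <= D * rp r (lev w) ->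
  within (adj lev K) M (Nat.iter s pi w) (Nat.iter s pi v).
Proof.
  intros HD. assert (Hr := fr_r HF). assert (Hc := fr_c0 HF).
  destruct (pow_eventually_lt r Hr (c0 / D)) as [s Hs]; [apply Rdiv_lt_0_compat; assumption|].
  specialize (Hs s (Nat.le_refl s)). exists s. intros w v x y Hl Hx Hy Hxy.
  apply (fr_near HF) with x y; try (apply frame_K_iter; assumption).
  - rewrite !frame_lev_iter, Hl. reflexivity.
  - eapply Rle_lt_trans; [apply Hxy|]. rewrite frame_lev_iter.
    replace (rp r (lev w)) with (rp r (lev w - Z.of_nat s) * r ^ s)
      by (rewrite <- rp_nat by assumption; f_equal; lia).
    assert (Hp := frame_rp_pos (lev w - Z.of_nat s)).
    apply Rmult_lt_compat_l with (r := D) in Hs; [|assumption].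
    replace (D * (c0 / D)) with c0 in Hs by (field; lra). nra.
Qed.

End FrameGeometry.

Section ChainMetric.
Context {T X : Type} {pi : T -> T} {lev : T -> Z} {K : T -> X -> Prop} {d : X -> X -> R}.
Context {r Cd c0 ct : R} {L B M : nat}.
Hypothesis HF : frame pi lev K d r Cd c0 ct L B M.
Variable N2 : nat.
Variable f : T -> T -> R.
Variables (sg : T -> R) (Kh lam eta : R).
Let adjK := adj lev K.
Let N := S N2.
(** The increase along [N] steps, in units of [sg] at the end of the path, of a function that
    changes by at most [Kh sg] over one edge. *)
Let C := INR N * Kh ^ S N.
Hypothesis Hf01 : forall w u, 0 <= f w u <= 1.
Hypothesis Hf1 : forall w u, pi u = w -> f w u = 1.
Hypothesis Hf0 : forall w u, lev (pi u) = lev w -> ~ within adjK N2 w (pi u) -> f w u = 0.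
Hypothesis Hsg : forall w, 0 < sg w.
Hypothesis HKh : 1 <= Kh.
Hypothesis Hharn : forall w v, adjK w v -> sg v <= Kh * sg w.
Hypothesis Hgrad : forall u u' w, adjK u u' -> within adjK N (pi u) w ->
  C * sg w * Rabs (f w u' - f w u) <= sg u.
Hypothesis Hlam : 0 < lam < 1.
Hypothesis Hdec : forall u, sg u <= lam * sg (pi u).
Hypothesis Heta : 0 < eta.
Hypothesis Hfloor : forall u, eta * sg (pi u) <= sg u.

Let sg_within := harnack_within adjK sg Kh HKh Hsg Hharn.

Lemma sg_iter_le t v : sg v <= lam ^ t * sg (Nat.iter t pi v).
Proof.
  revert v. induction t as [|t IH]; intros v; [simpl; lra|].
  simpl. rewrite <- iter_swap. eapply Rle_trans; [apply Hdec|]. rewrite Rmult_assoc.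
  apply Rmult_le_compat_l; [lra|]. apply IH.
Qed.

Lemma sg_iter_le_one t v : sg v <= sg (Nat.iter t pi v).
Proof.
  eapply Rle_trans; [apply (sg_iter_le t)|]. assert (Hsgp := Hsg (Nat.iter t pi v)).
  assert (lam ^ t <= 1) by (rewrite <- (pow1 t); apply pow_incr; lra). nra.
Qed.

Lemma sg_iter_ge t v : eta ^ t * sg (Nat.iter t pi v) <= sg v.
Proof.
  revert v. induction t as [|t IH]; intros v; [simpl; lra|].
  simpl. rewrite <- iter_swap. eapply Rle_trans; [|apply Hfloor]. rewrite Rmult_assoc.
  apply Rmult_le_compat_l; [lra|]. apply IH.
Qed.

Lemma C_nonneg : 0 <= C.
Proof. apply Rmult_le_pos; [apply pos_INR|]. apply pow_le. lra. Qed.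

Section Potential.
Variable bl : T -> list T.
Hypothesis Hbl : forall w v, In v (bl w) <-> within adjK N w v.
Variable w0 : T.

(** A lower bound for the cost of the chains that leave [K w0]: a function on each level that is
    Lipschitz for the weights [sg] and changes little from a cell to its descendants.  The test
    functions [f w] interpolate between consecutive levels, as in McShane's extension. *)
Fixpoint potential (i : nat) (u : T) : R :=
  match i with
  | O => sg w0 * ind (u = w0)
  | S i' => lmax (fun w => potential i' w - C * sg w * (1 - f w u)) (potential i' (pi u)) (bl (pi u))
  end.

Lemma potential_ge i u : potential i (pi u) <= potential (S i) u.
Proof. apply lmax_ge_init. Qed.

Lemma potential_iter_ge i t u : potential i (Nat.iter t pi u) <= potential (t + i) u.
Proof.
  revert u. induction t as [|t IH]; intros u; [simpl; lra|].
  eapply Rle_trans; [|apply (potential_ge (t + i) u)]. simpl Nat.iter. rewrite <- iter_swap. apply IH.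
Qed.

Lemma potential_nonneg i u : 0 <= potential i u.
Proof.
  revert u. induction i as [|i IH]; intros u.
  - simpl. assert (H := ind_bounds (u = w0)). assert (Hsgp := Hsg w0). nra.
  - eapply Rle_trans; [apply (IH (pi u))|apply potential_ge].
Qed.

Definition lipschitz_at (i : nat) : Prop :=
  forall a b, adjK a b -> potential i b <= potential i a + Kh * sg a.

Lemma lipschitz_within i n a b : lipschitz_at i -> within adjK n a b ->
  potential i b <= potential i a + INR n * Kh ^ S n * sg a /\
  potential i b <= potential i a + INR n * Kh ^ S n * sg b.
Proof.
  intros Hlip H. induction H as [n a|n a u b Hau Hub [IH1 IH2]].
  - assert (0 <= INR n * Kh ^ S n * sg a); [|lra].
    apply Rmult_le_pos; [|left; apply Hsg]. apply Rmult_le_pos; [apply pos_INR|apply pow_le; lra].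
  - specialize (Hlip a u Hau). assert (Hu := Hharn a u Hau).
    assert (Hpn : 1 <= Kh ^ n) by (apply pow_R1_Rle; assumption).
    assert (Hn := pos_INR n). rewrite S_INR.
    assert (Ha := Hsg a). assert (Hb := Hsg b). assert (Hsu := Hsg u).
    assert (Hab : sg a <= Kh ^ S n * sg b).
    { apply sg_within. apply within_sym; [apply adj_sym|]. apply within_step with u; assumption. }
    simpl pow in *. set (q := Kh ^ n) in *.
    assert (Hq : 0 <= INR n * (Kh * q)) by (apply Rmult_le_pos; nra).
    split.
    + apply Rle_trans with (potential i a + Kh * sg a + INR n * (Kh * q) * (Kh * sg a)).
      { assert (INR n * (Kh * q) * sg u <= INR n * (Kh * q) * (Kh * sg a)) by (apply Rmult_le_compat_l; lra).
        lra. }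
      assert (Kh * sg a <= Kh * (Kh * q) * sg a) by (apply Rmult_le_compat_r; nra). lra.
    + assert (Kh * sg a <= Kh * (Kh * q * sg b)) by (apply Rmult_le_compat_l; lra).
      assert (INR n * (Kh * q) * sg b <= INR n * (Kh * q) * sg b * Kh).
      { rewrite <- (Rmult_1_r (INR n * (Kh * q) * sg b)) at 1. apply Rmult_le_compat_l; [|assumption].
        apply Rmult_le_pos; lra. }
      lra.
Qed.

(** A candidate [w] within [N2] of the parent of [u'] is also within [N = N2 + 1] of the parent of
    [u], so it competes for [u] too, and the gradient bound pays for the difference of the test
    functions. For a candidate farther away the test function vanishes, and the penalty [C sg w]
    outweighs what it could gain over [N] steps; it never beats the parent. *)
Lemma potential_lipschitz i : lipschitz_at i.
Proof.
  induction i as [|i IH].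
  - intros a b Hab. simpl. assert (Ha := Hsg a). assert (H0 := Hsg w0).
    assert (H1 := ind_bounds (a = w0)). assert (H2 := ind_bounds (b = w0)).
    destruct (classic (b = w0)) as [->|Hne].
    + assert (H := Hharn a w0 Hab). nra.
    + rewrite (ind_false _ Hne). nra.
  - intros u u' Huu.
    assert (Hpi : within adjK 1 (pi u) (pi u')).
    { apply (frame_within_pi HF), within_edge. assumption. }
    assert (Hgood : forall w, within adjK N2 (pi u') w ->
      potential i w - C * sg w * (1 - f w u') <= potential (S i) u + Kh * sg u).
    { intros w Hw.
      assert (Hw' : within adjK N (pi u) w).
      { change N with (1 + N2)%nat. apply within_trans with (pi u'); assumption. }
      assert (H1 : potential i w - C * sg w * (1 - f w u) <= potential (S i) u).
      { simpl. apply (lmax_ge (fun w => potential i w - C * sg w * (1 - f w u))).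
        apply Hbl. assumption. }
      assert (H2 := Hgrad u u' w Huu Hw').
      assert (H3 : C * sg w * (f w u' - f w u) <= C * sg w * Rabs (f w u' - f w u)).
      { apply Rmult_le_compat_l; [|apply Rle_abs].
        apply Rmult_le_pos; [apply C_nonneg|left; apply Hsg]. }
      assert (Hu := Hsg u). nra. }
    assert (Hpar : potential i (pi u') <= potential (S i) u + Kh * sg u).
    { specialize (Hgood (pi u') (within_refl _ _ _)). rewrite Hf1 in Hgood by reflexivity. lra. }
    simpl potential at 1.
    destruct (lmax_attained (fun w => potential i w - C * sg w * (1 - f w u'))
      (potential i (pi u')) (bl (pi u'))) as [->|[w [Hw ->]]]; [exact Hpar|].
    apply Hbl in Hw. destruct (classic (within adjK N2 (pi u') w)) as [Hin|Hout]; [auto|].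
    assert (Hl := within_adj_lev _ _ _ _ _ Hw).
    rewrite Hf0; [|assumption|].
    + destruct (lipschitz_within i N (pi u') w IH Hw) as [_ H]. fold C in H. lra.
    + intros Hc. apply Hout. apply within_sym; [apply adj_sym|assumption].
Qed.

Lemma potential_le i u : potential (S i) u <= potential i (pi u) + C * sg (pi u).
Proof.
  assert (HC := C_nonneg). assert (Hp := Hsg (pi u)). simpl.
  destruct (lmax_attained (fun w => potential i w - C * sg w * (1 - f w u))
      (potential i (pi u)) (bl (pi u))) as [->|[w [Hw ->]]]; [nra|].
  apply Hbl in Hw. destruct (lipschitz_within i N (pi u) w (potential_lipschitz i) Hw) as [H _].
  fold C in H. assert (0 <= C * sg w * (1 - f w u)).
  { specialize (Hf01 w u). apply Rmult_le_pos; [|lra].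
    apply Rmult_le_pos; [assumption|left; apply Hsg]. }
  lra.
Qed.

Let C2 := C / (1 - lam).

Lemma C2_nonneg : 0 <= C2.
Proof.
  apply Rmult_le_pos; [apply C_nonneg|]. left. apply Rinv_0_lt_compat. lra.
Qed.

(** Each level adds at most [C] times a weight; the weights decay like [lam^t], and [C2] is the sum
    of the geometric series. *)
Lemma potential_iter_le i t u :
  potential (t + i) u <= potential i (Nat.iter t pi u) + C2 * sg (Nat.iter t pi u).
Proof.
  assert (Hmain : potential (t + i) u <=
    potential i (Nat.iter t pi u) + C2 * (1 - lam ^ t) * sg (Nat.iter t pi u)).
  { revert u. induction t as [|t IH]; intros u; [simpl; lra|].
    assert (H1 := potential_le (t + i) u). specialize (IH (pi u)).
    assert (H2 := sg_iter_le t (pi u)).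
    rewrite iter_swap in *. change (Nat.iter (S t) pi u) with (pi (Nat.iter t pi u)).
    change (S t + i)%nat with (S (t + i)). simpl pow.
    set (s := sg (pi (Nat.iter t pi u))) in *.
    assert (HC := C_nonneg).
    assert (C * sg (pi u) <= C * (lam ^ t * s)) by (apply Rmult_le_compat_l; assumption).
    assert (EC : C = C2 * (1 - lam)) by (unfold C2; field; lra).
    rewrite EC in *. lra. }
  eapply Rle_trans; [apply Hmain|]. apply Rplus_le_compat_l.
  apply Rmult_le_compat_r; [left; apply Hsg|].
  assert (0 <= lam ^ t) by (apply pow_le; lra). assert (HC2 := C2_nonneg). nra.
Qed.

(** A positive value is inherited from a cell at most [N] steps away on the previous level, so the
    support spreads by a multiple of [r^i] at the step [i], in total by a convergent geometric
    sum. *)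
Lemma potential_support i u : 0 < potential i u ->
  lev u = (lev w0 + Z.of_nat i)%Z /\ forall x x0, K u x -> K w0 x0 ->
  d x x0 <= (Cd + (INR N + 1) * Cd / (1 - r) * (1 - r ^ i)) * rp r (lev w0).
Proof.
  assert (HCd := fr_Cd HF). assert (Hr := fr_r HF). revert u. induction i as [|i IH]; intros u Hu.
  - simpl in Hu. destruct (classic (u = w0)) as [->|Hne].
    + split; [lia|]. intros x x0 Hx Hx0. assert (H := fr_diam HF w0 x x0 Hx Hx0). simpl. lra.
    + rewrite ind_false in Hu by assumption. lra.
  - assert (Hex : exists w, within adjK N (pi u) w /\ 0 < potential i w).
    { simpl in Hu. destruct (lmax_attained (fun w => potential i w - C * sg w * (1 - f w u))
        (potential i (pi u)) (bl (pi u))) as [E|[w [Hw E]]]; rewrite E in Hu.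
      - exists (pi u). split; [apply within_refl|assumption].
      - exists w. split; [apply Hbl; assumption|].
        assert (0 <= C * sg w * (1 - f w u)); [|lra].
        specialize (Hf01 w u). apply Rmult_le_pos; [|lra].
        apply Rmult_le_pos; [apply C_nonneg|left; apply Hsg]. }
    destruct Hex as [w [Hw Hpw]]. destruct (IH w Hpw) as [Hl Hdist].
    assert (Hlw := within_adj_lev _ _ _ _ _ Hw). rewrite (fr_lev HF) in Hlw.
    split; [lia|]. intros x x0 Hx Hx0. destruct (cell_inhabited HF w) as [y Hy].
    assert (H1 := within_dist HF N (pi u) w x y Hw (fr_up HF _ _ Hx) Hy).
    specialize (Hdist y x0 Hy Hx0). assert (H2 := frame_dist_tri HF x y x0).
    rewrite (fr_lev HF) in H1. replace (lev u - 1)%Z with (lev w0 + Z.of_nat i)%Z in H1 by lia.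
    rewrite rp_nat in H1 by assumption.
    replace ((Cd + (INR N + 1) * Cd / (1 - r) * (1 - r ^ S i)) * rp r (lev w0))
      with ((Cd + (INR N + 1) * Cd / (1 - r) * (1 - r ^ i)) * rp r (lev w0)
            + (INR N + 1) * (Cd * (rp r (lev w0) * r ^ i))); [lra|].
    simpl pow. field. lra.
Qed.

Let D := Cd + (INR N + 1) * Cd / (1 - r).

Lemma potential_support_dist i u x x0 : 0 < potential i u -> K u x -> K w0 x0 ->
  d x x0 <= D * rp r (lev w0).
Proof.
  intros Hu Hx Hx0. destruct (potential_support i u Hu) as [_ H].
  eapply Rle_trans; [apply (H x x0 Hx Hx0)|].
  apply Rmult_le_compat_r; [left; apply (frame_rp_pos HF)|]. unfold D.
  assert (HCd := fr_Cd HF). assert (Hr := fr_r HF).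
  assert (0 <= r ^ i) by (apply pow_le; lra). assert (HN := pos_INR N).
  assert (0 <= (INR N + 1) * Cd / (1 - r)).
  { apply Rmult_le_pos; [nra|]. left. apply Rinv_0_lt_compat. lra. }
  nra.
Qed.

(** If [u] lies at or below the level of [w0], the ancestors of [c] and [c'] on the level of [u] are
    two steps apart through [u]: the Lipschitz bound applies there and the rest is the change along
    descendants. If [u] is higher, the potential is bounded by [sg w0] plus [C2] times the weight of
    an ancestor of [c]; by [C4] both are at most a multiple of [sg u]. *)
Lemma potential_oscillation C4 :
  (forall v x x0, lev v = lev w0 -> K v x -> K w0 x0 -> d x x0 <= D * rp r (lev w0) ->
    sg w0 <= C4 * sg v) -> 0 <= C4 ->
  forall J u c c' x y, lev c = (lev w0 + Z.of_nat J)%Z -> lev c' = lev c ->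
  (lev u <= lev c)%Z -> K c x -> K u x -> K c' y -> K u y ->
  potential J c - potential J c' <= (2 * Kh ^ 4 + C2 * Kh + (C4 + C2) * Kh) * sg u.
Proof.
  intros HC4 HC4p J u c c' x y Hc Hc' Hu Hcx Hux Hcy Huy.
  assert (HC2 := C2_nonneg). assert (Hsu := Hsg u).
  assert (HK4 : 0 <= Kh ^ 4) by (apply pow_le; lra).
  destruct (Z_le_gt_dec (lev w0) (lev u)) as [Hge|Hlt].
  - set (t := Z.to_nat (lev c - lev u)). set (i := Z.to_nat (lev u - lev w0)).
    replace J with (t + i)%nat by (unfold t, i; lia).
    assert (H1 := potential_iter_le i t c). assert (H2 := potential_iter_ge i t c').
    set (a := Nat.iter t pi c) in *. set (a' := Nat.iter t pi c') in *.
    assert (Hau : within adjK 1 u a).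
    { apply adj_share with x; [|assumption|apply (frame_K_iter HF); assumption].
      unfold a. rewrite (frame_lev_iter HF). unfold t. lia. }
    assert (Hua' : within adjK 1 a' u).
    { apply adj_share with y; [|apply (frame_K_iter HF); assumption|assumption].
      unfold a'. rewrite (frame_lev_iter HF). unfold t. lia. }
    destruct (lipschitz_within i 2 a' a (potential_lipschitz i)) as [_ H3].
    { apply (within_trans adjK 1 1) with u; assumption. }
    assert (H4 := sg_within 1 u a Hau). simpl pow in *. simpl INR in H3.
    assert (C2 * sg a <= C2 * (Kh * 1 * sg u)) by (apply Rmult_le_compat_l; assumption).
    assert ((1 + 1) * (Kh * (Kh * (Kh * 1))) * sg a
      <= (1 + 1) * (Kh * (Kh * (Kh * 1))) * (Kh * 1 * sg u)) by (apply Rmult_le_compat_l; nra).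
    assert (0 <= (C4 + C2) * Kh * sg u) by (apply Rmult_le_pos; nra).
    lra.
  - assert (H1 := potential_nonneg J c').
    assert (Hrhs : 0 <= 2 * Kh ^ 4 * sg u + C2 * Kh * sg u).
    { assert (0 <= Kh ^ 4 * sg u) by nra. assert (0 <= C2 * Kh * sg u) by (apply Rmult_le_pos; nra).
      lra. }
    destruct (Rle_lt_dec (potential J c) 0) as [Hz|Hpos].
    + assert (0 <= (C4 + C2) * Kh * sg u) by (apply Rmult_le_pos; nra). lra.
    + assert (H2 := potential_iter_le 0 J c). rewrite Nat.add_0_r in H2.
      set (v0 := Nat.iter J pi c) in *. simpl potential in H2.
      assert (Hl0 : lev v0 = lev w0) by (unfold v0; rewrite (frame_lev_iter HF); lia).
      destruct (cell_inhabited HF w0) as [x0 Hx0].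
      assert (H3 : sg w0 <= C4 * sg v0).
      { apply (HC4 v0 x x0); auto; [apply (frame_K_iter HF); assumption|].
        apply potential_support_dist with J c; assumption. }
      assert (H4 : sg v0 <= Kh * sg u).
      { set (t := Z.to_nat (lev w0 - lev u)).
        eapply Rle_trans; [apply (sg_iter_le_one t v0)|].
        rewrite <- (pow_1 Kh). apply sg_within. apply adj_share with x.
        - rewrite (frame_lev_iter HF). unfold t. lia.
        - assumption.
        - apply (frame_K_iter HF). apply (frame_K_iter HF). assumption. }
      assert (H5 := ind_bounds (v0 = w0)). assert (H0 := Hsg w0).
      assert (sg w0 * ind (v0 = w0) <= sg w0) by nra.
      assert ((C4 + C2) * sg v0 <= (C4 + C2) * (Kh * sg u)) by (apply Rmult_le_compat_l; lra).
      lra.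
Qed.

End Potential.

Inductive chain : X -> list T -> X -> Prop :=
| chain_nil : forall x, chain x nil x
| chain_cons : forall x y z u l, K u x -> K u y -> chain y l z -> chain x (u :: l) z.

Lemma chain_app x y z l l' : chain x l y -> chain y l' z -> chain x (l ++ l') z.
Proof. intros H1 H2. induction H1; [assumption|]. simpl. apply chain_cons with y; auto. Qed.

Lemma chain_sym x y l : chain x l y -> chain y (rev l) x.
Proof.
  intros H. induction H; [apply chain_nil|]. simpl. apply chain_app with y; [assumption|].
  apply chain_cons with x; auto. apply chain_nil.
Qed.

Lemma lsum_rev l : lsum sg (rev l) = lsum sg l.
Proof.
  induction l as [|u l IH]; [reflexivity|]. simpl rev. rewrite lsum_app, IH, !lsum_cons.
  unfold lsum at 2. simpl. lra.
Qed.

Definition rho (x y : X) : R := real (Glb_Rbar (fun s => exists l, chain x l y /\ s = lsum sg l)).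

Lemma lsum_sg_nonneg l : 0 <= lsum sg l.
Proof. apply lsum_nonneg. intros. left. apply Hsg. Qed.

(** Two points always have a cell in common, high enough in the tree, so a chain exists and the
    infimum is finite; [real] loses nothing. *)
Lemma rho_glb x y : is_glb_Rbar (fun s => exists l, chain x l y /\ s = lsum sg l) (Finite (rho x y)).
Proof.
  unfold rho. set (S := fun s => exists l, chain x l y /\ s = lsum sg l).
  assert (H := Glb_Rbar_correct S). destruct (common_ancestor_cell HF x y) as [u [Hx Hy]].
  assert (Hu : S (lsum sg (u :: nil))).
  { exists (u :: nil). split; [|reflexivity]. apply chain_cons with y; auto. apply chain_nil. }
  destruct H as [H1 H2]. assert (Hle := H1 _ Hu).
  assert (Hge : Rbar_le (Finite 0) (Glb_Rbar S)).
  { apply H2. intros s [l [_ ->]]. simpl. apply lsum_sg_nonneg. }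
  split; destruct (Glb_Rbar S); simpl in *; try contradiction; assumption.
Qed.

Lemma rho_le x y l : chain x l y -> rho x y <= lsum sg l.
Proof. intros H. apply (proj1 (rho_glb x y)). exists l. auto. Qed.

Lemma rho_ge x y s : (forall l, chain x l y -> s <= lsum sg l) -> s <= rho x y.
Proof. intros H. apply (proj2 (rho_glb x y) (Finite s)). intros t [l [Hl ->]]. simpl. auto. Qed.

Lemma rho_tri x y z : rho x z <= rho x y + rho y z.
Proof.
  assert (H : rho x z - rho x y <= rho y z); [|lra].
  apply rho_ge. intros l Hl. assert (H : rho x z - lsum sg l <= rho x y); [|lra].
  apply rho_ge. intros l' Hl'.
  assert (H : rho x z <= lsum sg (l' ++ l)) by (apply rho_le; eapply chain_app; eauto).
  rewrite lsum_app in H. lra.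
Qed.

Lemma rho_sym_le x y : rho x y <= rho y x.
Proof.
  apply rho_ge. intros l Hl. rewrite <- lsum_rev. apply rho_le, chain_sym. assumption.
Qed.

Lemma rho_within n w v x y : within adjK n w v -> K w x -> K v y ->
  rho x y <= (INR n + 1) * Kh ^ n * sg w.
Proof.
  intros H. revert x y. assert (Hpn : forall n, 1 <= Kh ^ n) by (intros; apply pow_R1_Rle; assumption).
  induction H as [n w|n w u v Hwu Huv IH]; intros x y Hx Hy.
  - apply Rle_trans with (lsum sg (w :: nil)).
    + apply rho_le. apply chain_cons with y; auto. apply chain_nil.
    + unfold lsum. simpl. rewrite Rplus_0_r. rewrite <- (Rmult_1_l (sg w)) at 1.
      apply Rmult_le_compat_r; [left; apply Hsg|]. specialize (Hpn n). assert (Hn := pos_INR n). nra.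
  - assert (Hh := Hharn _ _ Hwu). destruct Hwu as [_ [_ [z [Hz1 Hz2]]]].
    specialize (IH z y Hz2 Hy).
    assert (H1 : rho x z <= sg w).
    { replace (sg w) with (lsum sg (w :: nil)) by (unfold lsum; simpl; lra).
      apply rho_le. apply chain_cons with z; auto. apply chain_nil. }
    assert (H2 := rho_tri x z y). rewrite S_INR. simpl.
    assert (Hn := pos_INR n). assert (Hw := Hsg w). specialize (Hpn n).
    set (q := Kh ^ n) in *.
    assert (Ha : (INR n + 1) * q * sg u <= (INR n + 1) * q * (Kh * sg w))
      by (apply Rmult_le_compat_l; nra).
    assert (Hb : 1 * sg w <= Kh * q * sg w) by (apply Rmult_le_compat_r; nra).
    lra.
Qed.

(** The potential started at [w0] is at least [sg w0] at [x] and vanishes beyond the distance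
    [D r^n], while each cell of a chain changes it by at most [C5] times its weight. *)
Lemma rho_lower : exists D c, 0 < D /\ 0 < c /\
  forall w x y, K w x -> D * rp r (lev w) < d x y -> c * sg w <= rho x y.
Proof.
  assert (HCd := fr_Cd HF). assert (Hr := fr_r HF).
  assert (Hbl : exists bl : T -> list T, forall w v, In v (bl w) <-> within adjK N w v).
  { destruct (fun_choice (fun w l => listed (within adjK N w) l)) as [bl Hbl].
    - intros w. destruct (ball_listed adjK L (fr_deg HF) N w) as [l [Hl _]]. exists l. assumption.
    - exists bl. intros w v. apply Hbl. }
  destruct Hbl as [bl Hbl].
  set (D := Cd + (INR N + 1) * Cd / (1 - r)).
  assert (HD : 0 < D).
  { unfold D. assert (HN := pos_INR N). assert (0 <= (INR N + 1) * Cd / (1 - r)); [|lra].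
    apply Rmult_le_pos; [nra|]. left. apply Rinv_0_lt_compat. lra. }
  destruct (ancestors_near HF D HD) as [s Hs].
  set (C4 := Kh ^ M * / eta ^ s).
  assert (Hes : 0 < eta ^ s) by (apply pow_lt; assumption).
  assert (HC4p : 0 <= C4).
  { apply Rmult_le_pos; [apply pow_le; lra|]. left. apply Rinv_0_lt_compat; assumption. }
  set (C5 := 2 * Kh ^ 4 + C / (1 - lam) * Kh + (C4 + C / (1 - lam)) * Kh).
  assert (HC5 : 0 < C5).
  { unfold C5. assert (1 <= Kh ^ 4) by (apply pow_R1_Rle; assumption).
    assert (H2 := C2_nonneg). assert (0 <= C / (1 - lam) * Kh) by (apply Rmult_le_pos; lra).
    assert (0 <= (C4 + C / (1 - lam)) * Kh) by (apply Rmult_le_pos; lra). lra. }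
  exists D, (/ C5). split; [assumption|]. split; [apply Rinv_0_lt_compat; assumption|].
  intros w0 x y Hx Hxy. apply rho_ge. intros l Hl.
  (* The ancestors [s] levels up are within [M] steps, where the weights are comparable; coming back
     down to [v] costs [eta] per level. *)
  assert (HC4 : forall v x x0, lev v = lev w0 -> K v x -> K w0 x0 -> d x x0 <= D * rp r (lev w0) ->
    sg w0 <= C4 * sg v).
  { intros v z x0 Hv Hz Hx0 Hzx.
    assert (Hn : within adjK M (Nat.iter s pi v) (Nat.iter s pi w0)).
    { apply Hs with z x0; auto. rewrite Hv. assumption. }
    apply sg_within in Hn. assert (H1 := sg_iter_le_one s w0). assert (H2 := sg_iter_ge s v).
    unfold C4. apply Rle_trans with (Kh ^ M * sg (Nat.iter s pi v)); [lra|].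
    rewrite Rmult_assoc. apply Rmult_le_compat_l; [apply pow_le; lra|].
    apply Rmult_le_reg_l with (eta ^ s); [assumption|].
    rewrite <- Rmult_assoc, Rinv_r, Rmult_1_l by lra. assumption. }
  (* The potential is read on a level at least as deep as every cell of the chain, so that each link
     is seen as an oscillation inside one cell. *)
  assert (HJ : exists J : nat, forall u, In u l -> (lev u <= lev w0 + Z.of_nat J)%Z).
  { clear Hl. induction l as [|u l [J HJ]]; [exists 0%nat; intros u []|].
    exists (J + Z.to_nat (Z.abs (lev u) + Z.abs (lev w0)))%nat.
    intros v [<-|Hv]; [lia|]. specialize (HJ v Hv). lia. }
  destruct HJ as [J HJ].
  assert (Hchain : forall c, lev c = (lev w0 + Z.of_nat J)%Z -> K c x ->
    exists c', lev c' = lev c /\ K c' y /\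
      potential bl w0 J c - potential bl w0 J c' <= C5 * lsum sg l).
  { clear Hxy Hx. induction Hl as [x|x y' z u l Hux Huy Hl IH]; intros c Hc Hcx.
    - exists c. repeat split; auto. unfold lsum. simpl. lra.
    - destruct (fr_cov HF y' (lev c)) as [c1 [Hc1 Hc1y]].
      destruct IH with c1 as [c' [Hc' [Hcy Hle]]]; auto.
      { intros v Hv. apply HJ. now right. }
      { congruence. }
      exists c'. split; [congruence|]. split; [assumption|]. rewrite lsum_cons.
      assert (Ho := potential_oscillation bl Hbl w0 C4 HC4 HC4p J u c c1 x y' Hc Hc1).
      fold C5 in Ho. assert (Hul : (lev u <= lev c)%Z) by (rewrite Hc; apply HJ; now left).
      specialize (Ho Hul Hcx Hux Hc1y Huy). lra. }
  destruct (K_down pi K (fr_dn HF) J w0 x Hx) as [c [Hc Hcx]].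
  assert (Hlc : lev c = (lev w0 + Z.of_nat J)%Z).
  { assert (E := frame_lev_iter HF J c). rewrite Hc in E. lia. }
  destruct (Hchain c Hlc Hcx) as [c' [Hc' [Hcy Hle]]].
  assert (H1 := potential_iter_ge bl w0 0 J c). rewrite Nat.add_0_r, Hc in H1.
  simpl potential at 1 in H1. rewrite ind_true in H1 by reflexivity.
  assert (H2 : potential bl w0 J c' <= 0).
  { apply Rnot_lt_le. intros Hpos.
    assert (H := potential_support_dist bl Hbl w0 J c' y x Hpos Hcy Hx). fold D in H.
    rewrite (frame_dist_sym HF) in H. lra. }
  apply Rmult_le_reg_l with C5; [assumption|].
  rewrite <- Rmult_assoc, Rinv_r, Rmult_1_l by lra. lra.
Qed.

Theorem rho_is_metric : is_metric rho.
Proof.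
  assert (H0 : forall x y, 0 <= rho x y).
  { intros x y. apply rho_ge. intros l _. apply lsum_sg_nonneg. }
  split; [assumption|]. split; [|split; [|apply rho_tri]].
  - intros x y. split.
    + intros E. destruct rho_lower as [D [c [HD [Hc Hlow]]]].
      apply NNPP. intros Hne. assert (Hd : 0 < d x y).
      { destruct (fr_met HF) as [Hp [Hz _]]. specialize (Hp x y).
        destruct (Rle_lt_or_eq_dec _ _ Hp) as [|E']; [assumption|]. destruct Hne. apply Hz. auto. }
      destruct (rp_small r (fr_r HF) (d x y / D)) as [n [Hn _]].
      { apply Rdiv_lt_0_compat; assumption. }
      destruct (fr_cov HF x n) as [w [Hw Hx]].
      assert (H := Hlow w x y Hx). rewrite Hw, E in H. assert (Hsgp := Hsg w).
      assert (D * rp r n < d x y).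
      { apply Rmult_lt_compat_l with (r := D) in Hn; [|assumption].
        replace (D * (d x y / D)) with (d x y) in Hn by (field; lra). assumption. }
      specialize (H H1). nra.
    + intros <-. apply Rle_antisym; [|apply H0]. apply (rho_le x x nil). apply chain_nil.
  - intros x y. apply Rle_antisym; apply rho_sym_le.
Qed.

End ChainMetric.


(** * The measure carried by the ends of the tree *)

Fixpoint partial (s : nat -> R) (n : nat) : R :=
  match n with O => 0 | S n' => partial s n' + s n' end.

Lemma partial_le s t n : (forall i, (i < n)%nat -> s i <= t i) -> partial s n <= partial t n.
Proof.
  induction n as [|n IH]; intros H; simpl; [lra|].
  assert (partial s n <= partial t n) by (apply IH; intros; apply H; lia).
  specialize (H n (Nat.lt_succ_diag_r n)). lra.
Qed.

Lemma partial_plus s t n : partial (fun i => s i + t i) n = partial s n + partial t n.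
Proof. induction n as [|n IH]; simpl; [lra|]. rewrite IH. lra. Qed.

Lemma partial_geom e n : 0 < e -> partial (fun i => e * (/ 2) ^ S i) n <= e.
Proof.
  intros He. assert (H : partial (fun i => e * (/ 2) ^ S i) n = e * (1 - (/ 2) ^ n)).
  { induction n as [|n IH]; simpl in *; [lra|]. rewrite IH. lra. }
  rewrite H. assert (0 < (/ 2) ^ n) by (apply pow_lt; lra). nra.
Qed.

(* The outer measure is given by its upper bounds [cov A s], so that the arithmetic stays in [R];
   [meas] is Caratheodory's criterion up to [eps]. *)
Section Caratheodory.
Context {Om : Type}.
Variable cov : (Om -> Prop) -> R -> Prop.
Hypothesis cov_nonneg : forall A s, cov A s -> 0 <= s.
Hypothesis cov_mono : forall A B s, (forall w, A w -> B w) -> cov B s -> cov A s.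
Hypothesis cov_empty : cov (fun _ => False) 0.
Hypothesis cov_union : forall (A : nat -> Om -> Prop) s S, (forall n, cov (A n) (s n)) ->
  (forall n, partial s n <= S) -> cov (fun w => exists n, A n w) S.

Definition outer (A : Om -> Prop) : Rbar := Glb_Rbar (cov A).
Definition fin (A : Om -> Prop) : Prop := exists s, cov A s.
Definition mr (A : Om -> Prop) : R := real (outer A).
Definition meas (E : Om -> Prop) : Prop := forall A s eps, cov A s -> 0 < eps ->
  exists s1 s2, cov (fun w => A w /\ E w) s1 /\ cov (fun w => A w /\ ~ E w) s2 /\ s1 + s2 <= s + eps.

Lemma outer_fin A : fin A -> outer A = Finite (mr A) /\ 0 <= mr A.
Proof.
  intros [s Hs]. unfold mr, outer. destruct (Glb_Rbar_correct (cov A)) as [H1 H2].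
  specialize (H1 s Hs). assert (H0 : Rbar_le (Finite 0) (Glb_Rbar (cov A))).
  { apply H2. intros t Ht. simpl. eapply cov_nonneg. eassumption. }
  destruct (Glb_Rbar (cov A)); simpl in *; try contradiction. auto.
Qed.

Lemma outer_inf A : ~ fin A -> outer A = p_infty.
Proof.
  intros H. unfold outer. apply is_glb_Rbar_unique. split.
  - intros s Hs. destruct H. exists s. assumption.
  - intros b _. destruct b; simpl; auto.
Qed.

Lemma outer_nonneg A : Rbar_le (Finite 0) (outer A).
Proof. apply Glb_Rbar_correct. intros s Hs. simpl. eapply cov_nonneg. eassumption. Qed.

Lemma mr_le A s : cov A s -> mr A <= s.
Proof.
  intros Hs. destruct (outer_fin A) as [E _]; [exists s; assumption|].
  assert (H := proj1 (Glb_Rbar_correct (cov A)) s Hs). fold (outer A) in H. rewrite E in H. exact H.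
Qed.

Lemma mr_approx A eps : fin A -> 0 < eps -> exists s, cov A s /\ s <= mr A + eps.
Proof.
  intros Hf He. apply NNPP. intros Hn. destruct (outer_fin A Hf) as [E _].
  assert (H : Rbar_le (Finite (mr A + eps)) (outer A)).
  { apply Glb_Rbar_correct. intros s Hs. simpl. apply Rnot_lt_le. intros Hlt. apply Hn.
    exists s. split; [assumption|lra]. }
  rewrite E in H. simpl in H. lra.
Qed.

Lemma outer_ext A B : (forall w, A w <-> B w) -> outer A = outer B.
Proof.
  intros H. unfold outer. apply Glb_Rbar_eqset. intros s. split; apply cov_mono; firstorder.
Qed.

Lemma mr_ext A B : (forall w, A w <-> B w) -> mr A = mr B.
Proof. intros H. unfold mr. f_equal. apply outer_ext. assumption. Qed.

Lemma fin_mono A B : (forall w, A w -> B w) -> fin B -> fin A.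
Proof. intros H [s Hs]. exists s. eapply cov_mono; eauto. Qed.

Lemma cov_union2 A B s t : cov A s -> cov B t -> cov (fun w => A w \/ B w) (s + t).
Proof.
  intros Hs Ht. assert (H0 := cov_nonneg _ _ Hs). assert (H1 := cov_nonneg _ _ Ht).
  apply (cov_mono _ (fun w => exists n : nat,
    match n with O => A w | S O => B w | _ => False end)).
  - intros w [Hw|Hw]; [exists 0%nat|exists 1%nat]; assumption.
  - apply (cov_union (fun n w => match n with O => A w | S O => B w | _ => False end)
      (fun n => match n with O => s | S O => t | _ => 0 end)).
    + intros [|[|n]]; [assumption|assumption|exact cov_empty].
    + intros [|[|n]]; [simpl; lra|simpl; lra|]. induction n as [|n IH]; simpl in *; lra.
Qed.

Lemma meas_split E A : meas E -> fin A ->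
  mr A = mr (fun w => A w /\ E w) + mr (fun w => A w /\ ~ E w).
Proof.
  intros HE Hf. apply Rle_antisym.
  - apply le_epsilon. intros eps He.
    destruct (mr_approx (fun w => A w /\ E w) (eps / 2)) as [s1 [H1 H1']]; [|lra|].
    { apply fin_mono with A; [tauto|assumption]. }
    destruct (mr_approx (fun w => A w /\ ~ E w) (eps / 2)) as [s2 [H2 H2']]; [|lra|].
    { apply fin_mono with A; [tauto|assumption]. }
    assert (H : mr A <= s1 + s2); [|lra].
    apply mr_le. eapply cov_mono; [|apply (cov_union2 _ _ _ _ H1 H2)].
    intros w Hw. destruct (classic (E w)); tauto.
  - apply le_epsilon. intros eps He. destruct (mr_approx A (eps / 2) Hf) as [s [Hs Hs']]; [lra|].
    destruct (HE A s (eps / 2) Hs) as [s1 [s2 [H1 [H2 H3]]]]; [lra|].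
    apply mr_le in H1, H2. lra.
Qed.

Lemma meas_ext E F : (forall w, E w <-> F w) -> meas E -> meas F.
Proof.
  intros H HE A s eps Hs He. destruct (HE A s eps Hs He) as [s1 [s2 [H1 [H2 H3]]]].
  exists s1, s2. split; [|split; [|assumption]];
    [apply cov_mono with (2 := H1)|apply cov_mono with (2 := H2)];
    intros w [Hw Hx]; specialize (H w); tauto.
Qed.

Lemma meas_empty : meas (fun _ => False).
Proof.
  intros A s eps Hs He. exists 0, s. split; [|split; [|lra]].
  - eapply cov_mono; [|exact cov_empty]. tauto.
  - eapply cov_mono; [|exact Hs]. tauto.
Qed.

Lemma meas_compl E : meas E -> meas (fun w => ~ E w).
Proof.
  intros HE A s eps Hs He. destruct (HE A s eps Hs He) as [s1 [s2 [H1 [H2 H3]]]].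
  exists s2, s1. split; [assumption|]. split; [|lra].
  eapply cov_mono; [|exact H1]. intros w [Hw Hn]. split; [assumption|]. apply NNPP. assumption.
Qed.

Lemma meas_union2 E F : meas E -> meas F -> meas (fun w => E w \/ F w).
Proof.
  intros HE HF A s eps Hs He. destruct (HE A s (eps / 2) Hs) as [s1 [s2 [H1 [H2 H3]]]]; [lra|].
  destruct (HF _ s2 (eps / 2) H2) as [s3 [s4 [H4 [H5 H6]]]]; [lra|].
  exists (s1 + s3), s4. split; [|split; [|lra]].
  - eapply cov_mono; [|apply (cov_union2 _ _ _ _ H1 H4)].
    intros w [Hw HEF]. destruct (classic (E w)); tauto.
  - eapply cov_mono; [|exact H5]. tauto.
Qed.

Section Sequence.
Variable E : nat -> Om -> Prop.
Hypothesis HE : forall n, meas (E n).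

Let below (n : nat) (w : Om) : Prop := exists i, (i < n)%nat /\ E i w.
Let fresh (n : nat) (w : Om) : Prop := E n w /\ ~ below n w.

Lemma meas_below n : meas (below n).
Proof.
  induction n as [|n IH].
  - apply meas_ext with (fun _ => False); [|apply meas_empty].
    intros w. split; [tauto|]. intros [i [Hi _]]. lia.
  - apply meas_ext with (fun w => below n w \/ E n w); [|apply meas_union2; auto].
    intros w. split.
    + intros [[i [Hi Hw]]|Hw]; [exists i; split; [lia|assumption]|exists n; split; [lia|assumption]].
    + intros [i [Hi Hw]]. destruct (Nat.eq_dec i n) as [->|]; [now right|].
      left. exists i. split; [lia|assumption].
Qed.

Lemma mr_below A n : fin A ->
  mr (fun w => A w /\ below n w) = partial (fun i => mr (fun w => A w /\ fresh i w)) n.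
Proof.
  intros Hf. induction n as [|n IH].
  - simpl. apply Rle_antisym.
    + apply mr_le. eapply cov_mono; [|exact cov_empty]. intros w [_ [i [Hi _]]]. lia.
    + apply outer_fin. apply fin_mono with A; [tauto|assumption].
  - simpl. rewrite <- IH.
    rewrite (meas_split (below n) (fun w => A w /\ below (S n) w)).
    + f_equal; apply mr_ext; intros w; split.
      * tauto.
      * intros [Hw [i [Hi Hb]]]. repeat split; auto; exists i; split; auto; lia.
      * intros [[Hw [i [Hi Hb]]] Hn]. split; [assumption|]. split; [|assumption].
        destruct (Nat.eq_dec i n) as [->|]; [assumption|]. destruct Hn. exists i. split; [lia|assumption].
      * intros [Hw [Hn Hb]]. repeat split; auto. exists n. split; [lia|assumption].
    + apply meas_below.
    + apply fin_mono with A; [tauto|assumption].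
Qed.

(** Split [A] by the measurable set [below n]; its complement contains the complement of the whole
    union. *)
Lemma mr_fresh_le A n : fin A ->
  partial (fun i => mr (fun w => A w /\ fresh i w)) n + mr (fun w => A w /\ ~ exists i, E i w) <= mr A.
Proof.
  intros Hf. rewrite <- mr_below by assumption. rewrite (meas_split (below n) A (meas_below n) Hf).
  apply Rplus_le_compat_l. apply le_epsilon. intros eps He.
  destruct (mr_approx (fun w => A w /\ ~ below n w) eps) as [s [Hs Hs']]; [|assumption|].
  { apply fin_mono with A; [tauto|assumption]. }
  eapply Rle_trans; [|exact Hs']. apply mr_le. eapply cov_mono; [|exact Hs].
  intros w [Hw Hn]. split; [assumption|]. intros [i [_ Hi]]. apply Hn. exists i. assumption.
Qed.

(** Every point of the union is fresh at its first index; the covers of the fresh parts are optimal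
    up to [eps 2^-(i+1)], with total error at most [eps]. *)
Lemma cov_fresh A eps S0 : fin A -> 0 < eps ->
  (forall n, partial (fun i => mr (fun w => A w /\ fresh i w)) n <= S0) ->
  cov (fun w => A w /\ exists i, E i w) (S0 + eps).
Proof.
  intros Hf He HS.
  destruct (fun_choice (fun i s => cov (fun w => A w /\ fresh i w) s /\
    s <= mr (fun w => A w /\ fresh i w) + eps * (/ 2) ^ S i)) as [s Hs].
  { intros i. apply mr_approx; [apply fin_mono with A; [tauto|assumption]|].
    apply Rmult_lt_0_compat; [assumption|]. apply pow_lt. lra. }
  apply (cov_mono _ (fun w => exists n, A w /\ fresh n w)).
  - intros w [Hw [i Hi]]. revert Hi.
    induction i as [i IH] using (well_founded_induction Wf_nat.lt_wf). intros Hi.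
    destruct (classic (below i w)) as [[j [Hj Hjw]]|Hn]; [apply (IH j); assumption|].
    exists i. split; [assumption|]. split; assumption.
  - apply (cov_union (fun n w => A w /\ fresh n w) s); [intros; apply Hs|]. intros n.
    apply Rle_trans with (partial (fun i => mr (fun w => A w /\ fresh i w) + eps * (/ 2) ^ S i) n).
    + apply partial_le. intros i _. apply Hs.
    + rewrite partial_plus. specialize (HS n). assert (H := partial_geom eps n He). lra.
Qed.

Lemma meas_union : meas (fun w => exists n, E n w).
Proof.
  intros A s eps Hs He. assert (Hf : fin A) by (exists s; assumption).
  destruct (mr_approx (fun w => A w /\ ~ exists i, E i w) (eps / 2)) as [s2 [H2 H2']]; [|lra|].
  { apply fin_mono with A; [tauto|assumption]. }
  exists (mr A - mr (fun w => A w /\ ~ exists i, E i w) + eps / 2), s2.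
  split; [|split; [exact H2|]].
  - apply cov_fresh; [assumption|lra|]. intros n. assert (H := mr_fresh_le A n Hf). lra.
  - apply mr_le in Hs. lra.
Qed.

Hypothesis Hdisj : forall i j w, i <> j -> E i w -> E j w -> False.

Lemma fresh_disjoint i w : fresh i w <-> E i w.
Proof.
  split; [intros [H _]; exact H|]. intros H. split; [exact H|].
  intros [j [Hj Hjw]]. apply (Hdisj j i w); auto; lia.
Qed.

Lemma psum_outer n : (forall i, (i < n)%nat -> fin (E i)) ->
  psum (fun i => outer (E i)) n = Finite (partial (fun i => mr (E i)) n).
Proof.
  induction n as [|n IH]; intros H; [reflexivity|]. simpl.
  rewrite IH by (intros; apply H; lia).
  destruct (outer_fin (E n)) as [-> _]; [apply H; lia|]. reflexivity.
Qed.

Lemma psum_outer_infinite i : ~ fin (E i) -> psum (fun i => outer (E i)) (S i) = p_infty.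
Proof.
  intros H. simpl. rewrite (outer_inf _ H).
  assert (Hp : forall n, Rbar_le (Finite 0) (psum (fun i => outer (E i)) n)).
  { induction n as [|n IH]; [simpl; lra|]. simpl. assert (H1 := outer_nonneg (E n)).
    destruct (psum _ n), (outer (E n)); simpl in *; try contradiction; auto; lra. }
  specialize (Hp i). destruct (psum _ i); simpl in *; try contradiction; reflexivity.
Qed.

(** If the union has infinite outer measure, the partial sums are unbounded: either some piece is
    infinite already, or a bound on the sums and covers with summable errors would give a finite
    cover of the union. *)
Lemma outer_union : outer (fun w => exists n, E n w)
  = Rbar_lub (fun y => exists n, y = psum (fun i => outer (E i)) n).
Proof.
  symmetry. apply Rbar_is_lub_unique.
  destruct (classic (fin (fun w => exists n, E n w))) as [Hf|Hf].
  - assert (HfE : forall i, fin (E i)).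
    { intros i. apply fin_mono with (2 := Hf). intros w Hw. exists i. assumption. }
    assert (Heq : forall i, mr (fun w => (exists n, E n w) /\ fresh i w) = mr (E i)).
    { intros i. apply mr_ext. intros w. rewrite fresh_disjoint. firstorder. }
    assert (Hpart : forall n, partial (fun i => mr (fun w => (exists n, E n w) /\ fresh i w)) n
      = partial (fun i => mr (E i)) n).
    { induction n as [|n IH]; [reflexivity|]. simpl. rewrite IH, Heq. reflexivity. }
    destruct (outer_fin _ Hf) as [-> H0]. split.
    + intros y [n ->]. rewrite psum_outer by auto. simpl. rewrite <- Hpart.
      assert (H := mr_fresh_le _ n Hf).
      destruct (outer_fin (fun w => (exists n, E n w) /\ ~ exists i, E i w)) as [_ Hz].
      { apply fin_mono with (2 := Hf). tauto. }
      lra.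
    + intros b Hb. destruct b as [b| |]; simpl; auto.
      * apply le_epsilon. intros eps He.
        assert (Hc : cov (fun w => (exists n, E n w) /\ exists i, E i w) (b + eps)).
        { apply cov_fresh; [assumption|assumption|]. intros n. rewrite Hpart.
          assert (H := Hb _ (ex_intro _ n eq_refl)). rewrite psum_outer in H by auto. exact H. }
        apply mr_le. eapply cov_mono; [|exact Hc]. intros w Hw; split; exact Hw.
      * assert (H := Hb _ (ex_intro _ 0%nat eq_refl)). exact H.
  - rewrite (outer_inf _ Hf). split.
    + intros y _. destruct y; simpl; auto.
    + intros b Hb. destruct b as [b| |]; simpl; auto.
      * destruct Hf. destruct (classic (forall i, fin (E i))) as [Ha|Hn].
        -- destruct (fun_choice (fun i s => cov (E i) s /\ s <= mr (E i) + 1 * (/ 2) ^ S i)) as [s Hs].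
           { intros i. apply mr_approx; [apply Ha|].
             apply Rmult_lt_0_compat; [lra|]. apply pow_lt. lra. }
           exists (b + 1). apply (cov_union E s); [intros; apply Hs|]. intros n.
           apply Rle_trans with (partial (fun i => mr (E i) + 1 * (/ 2) ^ S i) n).
           { apply partial_le. intros i _. apply Hs. }
           rewrite partial_plus. assert (H1 := partial_geom 1 n Rlt_0_1).
           assert (H := Hb _ (ex_intro _ n eq_refl)). rewrite psum_outer in H by auto.
           simpl in H. lra.
        -- apply not_all_ex_not in Hn. destruct Hn as [i Hi].
           assert (H := Hb _ (ex_intro _ (S i) eq_refl)). rewrite psum_outer_infinite in H by assumption.
           destruct H.
      * assert (H := Hb _ (ex_intro _ 0%nat eq_refl)). exact H.
Qed.

End Sequence.

Section Pushforward.
Context {X : Type}.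
Variable rho : X -> X -> R.
Variable code : Om -> X.
Hypothesis Hopen : forall U, metric_open rho U -> meas (fun w => U (code w)).

Theorem borel_measure_pushforward :
  borel_measure rho (fun A => outer (fun w => A (code w))).
Proof.
  assert (Hb : forall A, borel rho A -> meas (fun w => A (code w))).
  { intros A HA. induction HA as [U HU|A HA IH|A HA IH|A B HA IH HAB].
    - apply Hopen. assumption.
    - apply (meas_compl (fun w => A (code w))). assumption.
    - apply (meas_union (fun n w => A n (code w))). assumption.
    - apply meas_ext with (fun w => A (code w)); [intros; apply HAB|assumption]. }
  split; [|split; [|split]].
  - intros A B HAB. apply outer_ext. intros w. apply HAB.
  - destruct (outer_fin (fun _ => False)) as [-> H0]; [exists 0; apply cov_empty|].
    f_equal. apply Rle_antisym; [|assumption]. apply mr_le. apply cov_empty.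
  - intros A _. apply outer_nonneg.
  - intros A HA Hdisj. apply (outer_union (fun n w => A n (code w))).
    + intros n. apply Hb, HA.
    + intros i j w. apply Hdisj.
Qed.

End Pushforward.

End Caratheodory.


Lemma lsum_fibers {A B : Type} (f : A -> R) (a : A -> B) l : NoDup l -> (forall x, In x l -> 0 <= f x) ->
  lsum f l <= lsum (fun u => lsum f (cfilter (fun x => a x = u) l)) (nodup eq_dec_cl (map a l)).
Proof.
  intros Hd Hf. rewrite <- lsum_flat_map. apply lsum_incl; [assumption| |].
  - intros x Hx. apply in_flat_map. exists (a x). split.
    + apply nodup_In, in_map. assumption.
    + apply in_cfilter. auto.
  - intros x Hx. apply in_flat_map in Hx. destruct Hx as [u [_ Hx]]. apply in_cfilter in Hx.
    apply Hf. tauto.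
Qed.

Lemma nodup_flat_map {A B : Type} (g : A -> list B) l : NoDup l -> (forall a, In a l -> NoDup (g a)) ->
  (forall a a' b, In a l -> In a' l -> In b (g a) -> In b (g a') -> a = a') -> NoDup (flat_map g l).
Proof.
  intros Hd Hg Hdis. induction l as [|a l IH]; simpl; [constructor|].
  inversion Hd as [|? ? Hna Hdl]; subst.
  assert (IH' : NoDup (flat_map g l)).
  { apply IH; auto.
    - intros; apply Hg; now right.
    - intros a1 a2 b H1 H2. apply Hdis; now right. }
  apply NoDup_app; [apply Hg; now left|assumption|].
  intros b Hb Hin. apply in_flat_map in Hin. destruct Hin as [a' [Ha' Hb']].
  assert (a = a') by (apply (Hdis a a' b); auto; [now left|now right]). subst. contradiction.
Qed.

Section EndsMeasure.
Context {T X : Type} {pi : T -> T} {lev : T -> Z} {K : T -> X -> Prop} {d : X -> X -> R}.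
Context {r Cd c0 ct : R} {L B M : nat}.
Hypothesis HF : frame pi lev K d r Cd c0 ct L B M.
Variable ch : T -> list T.
Hypothesis Hch : forall w, listed (fun v => pi v = w) (ch w).
Variable mu : T -> R.
Hypothesis Hmu : forall w, 0 < mu w.
Hypothesis Hadd : forall w, lsum mu (ch w) = mu w.

(** Enlarge the family to all children of its parents; their masses add up to the masses of the
    parents, a family one level higher. *)
Lemma lsum_desc t w l : NoDup l -> (forall v, In v l -> Nat.iter t pi v = w) -> lsum mu l <= mu w.
Proof.
  revert l. induction t as [|t IH]; intros l Hd Hl.
  - replace (mu w) with (lsum mu (w :: nil)) by (unfold lsum; simpl; lra).
    apply lsum_incl; [assumption| |intros; left; apply Hmu].
    intros v Hv. left. symmetry. apply (Hl v Hv).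
  - set (ps := nodup eq_dec_cl (map pi l)).
    apply Rle_trans with (lsum mu (flat_map ch ps)).
    + apply lsum_incl; [assumption| |intros; left; apply Hmu].
      intros v Hv. apply in_flat_map. exists (pi v). split.
      * apply nodup_In, in_map. assumption.
      * apply (proj2 (Hch _)). reflexivity.
    + rewrite lsum_flat_map. rewrite (lsum_ext _ mu) by (intros; apply Hadd).
      apply IH; [apply NoDup_nodup|]. intros u Hu. apply nodup_In, in_map_iff in Hu.
      destruct Hu as [v [<- Hv]]. rewrite iter_swap. apply Hl. assumption.
Qed.

Lemma mu_iter t v : mu v <= mu (Nat.iter t pi v).
Proof.
  replace (mu v) with (lsum mu (v :: nil)) by (unfold lsum; simpl; lra).
  apply (lsum_desc t); [repeat constructor; simpl; tauto|]. intros u [<-|[]]. reflexivity.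
Qed.

Definition is_end (om : Z -> T) : Prop := forall n, lev (om n) = n /\ pi (om (n + 1)%Z) = om n.

Definition ends : Type := {om : Z -> T | is_end om}.

Definition node (om : ends) (n : Z) : T := proj1_sig om n.

Definition through (om : ends) (w : T) : Prop := node om (lev w) = w.

Lemma node_lev om n : lev (node om n) = n.
Proof. apply (proj2_sig om). Qed.

Lemma node_iter om n t : Nat.iter t pi (node om (n + Z.of_nat t)) = node om n.
Proof.
  revert n. induction t as [|t IH]; intros n; [simpl; f_equal; lia|].
  replace (n + Z.of_nat (S t))%Z with (n + Z.of_nat t + 1)%Z by lia.
  simpl Nat.iter. rewrite <- iter_swap.
  assert (H := proj2 (proj2_sig om (n + Z.of_nat t)%Z)). unfold node in *. rewrite H. apply IH.
Qed.

Lemma through_iter om w t : through om w -> through om (Nat.iter t pi w).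
Proof.
  unfold through. intros H. rewrite (frame_lev_iter HF).
  rewrite <- (node_iter om _ t). replace (lev w - Z.of_nat t + Z.of_nat t)%Z with (lev w) by lia.
  rewrite H. reflexivity.
Qed.

Lemma through_unique om w v : lev w = lev v -> through om w -> through om v -> w = v.
Proof. unfold through. intros E H1 H2. rewrite <- H1, <- H2, E. reflexivity. Qed.

(** The cover [W] may be infinite; its total mass is expressed by a common bound on the finite
    partial sums, which avoids enumerations and series. *)
Definition cov (A : ends -> Prop) (s : R) : Prop := exists W : T -> Prop,
  (forall om, A om -> exists w, W w /\ through om w) /\
  forall l, NoDup l -> (forall w, In w l -> W w) -> lsum mu l <= s.

Lemma cov_nonneg A s : cov A s -> 0 <= s.
Proof.
  intros [W [_ H]]. specialize (H nil (NoDup_nil _)). apply H. intros w [].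
Qed.

Lemma cov_mono A A' s : (forall om, A om -> A' om) -> cov A' s -> cov A s.
Proof. intros H [W [H1 H2]]. exists W. split; auto. Qed.

Lemma cov_empty : cov (fun _ => False) 0.
Proof.
  exists (fun _ => False). split; [tauto|]. intros [|w l] _ H; [unfold lsum; simpl; lra|].
  destruct (H w). now left.
Qed.

Lemma cov_union (A : nat -> ends -> Prop) s s0 : (forall n, cov (A n) (s n)) ->
  (forall n, partial s n <= s0) -> cov (fun om => exists n, A n om) s0.
Proof.
  intros HA HS. destruct (fun_choice _ HA) as [W HW]. exists (fun w => exists n, W n w). split.
  - intros om [n Hn]. destruct (proj1 (HW n) om Hn) as [w [Hw Ht]]. exists w. split; [exists n|]; auto.
  - assert (Hpart : forall N l, NoDup l -> (forall w, In w l -> exists n, (n < N)%nat /\ W n w) ->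
      lsum mu l <= partial s N).
    { induction N as [|N IH]; intros l Hd Hl.
      - destruct l as [|w l]; [unfold lsum; simpl; lra|]. destruct (Hl w) as [n [Hn _]]; [now left|lia].
      - simpl. rewrite (lsum_cfilter mu (W N)).
        assert (H1 : lsum mu (cfilter (W N) l) <= s N).
        { apply (proj2 (HW N)); [apply nodup_cfilter; assumption|]. intros w Hw.
          apply in_cfilter in Hw. tauto. }
        assert (H2 : lsum mu (cfilter (fun w => ~ W N w) l) <= partial s N).
        { apply IH; [apply nodup_cfilter; assumption|]. intros w Hw. apply in_cfilter in Hw.
          destruct Hw as [Hw Hn]. destruct (Hl w Hw) as [n [Hn1 Hn2]].
          exists n. split; [|assumption]. destruct (Nat.eq_dec n N) as [->|]; [contradiction|lia]. }
        lra. }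
    intros l Hd Hl. assert (HN : exists N, forall w, In w l -> exists n, (n < N)%nat /\ W n w).
    { clear Hd. induction l as [|w l IH]; [exists 0%nat; intros w []|].
      destruct IH as [N HN]; [intros; apply Hl; now right|]. destruct (Hl w) as [n Hn]; [now left|].
      exists (S n + N)%nat. intros v [<-|Hv]; [exists n; split; [lia|assumption]|].
      destruct (HN v Hv) as [m [Hm1 Hm2]]. exists m. split; [lia|assumption]. }
    destruct HN as [N HN]. eapply Rle_trans; [apply (Hpart N); assumption|apply HS].
Qed.

(** Nodes of the cover above the level [n0] are replaced by their descendants on that level, whose
    total mass is not larger. *)
Lemma cov_refine A s n0 : cov A s -> exists W : T -> Prop,
  (forall w, W w -> (n0 <= lev w)%Z) /\
  (forall om, A om -> exists w, W w /\ through om w) /\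
  forall l, NoDup l -> (forall w, In w l -> W w) -> lsum mu l <= s.
Proof.
  intros [W [H1 H2]].
  set (Wa := fun v u => exists t, (1 <= t)%nat /\ Nat.iter t pi v = u /\ W u).
  exists (fun v => (W v /\ (n0 <= lev v)%Z) \/ (lev v = n0 /\ exists u, Wa v u)). split; [|split].
  - intros w [[_ H]|[H _]]; lia.
  - intros om Hom. destruct (H1 om Hom) as [w [Hw Ht]].
    destruct (Z_le_gt_dec n0 (lev w)) as [Hle|Hgt]; [exists w; auto|].
    exists (node om n0). split; [right|unfold through; rewrite node_lev; reflexivity].
    split; [apply node_lev|]. exists w. exists (Z.to_nat (n0 - lev w)). split; [lia|].
    split; [|assumption]. rewrite <- Ht at 2. rewrite <- (node_iter om (lev w) (Z.to_nat (n0 - lev w))).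
    do 2 f_equal. lia.
  - intros l Hd Hl. rewrite (lsum_cfilter mu (fun v => W v /\ (n0 <= lev v)%Z)).
    set (l1 := cfilter (fun v => W v /\ (n0 <= lev v)%Z) l).
    set (l2 := cfilter (fun v => ~ (W v /\ (n0 <= lev v)%Z)) l).
    assert (Hl2 : forall v, In v l2 -> lev v = n0 /\ exists u, Wa v u).
    { intros v Hv. apply in_cfilter in Hv. destruct Hv as [Hv Hn].
      destruct (Hl v Hv); [contradiction|assumption]. }
    (* A new node may lie below several nodes of [W]. It is charged to one of them, so the fibres
       are disjoint and each sums to at most the mass of the node charged. *)
    destruct (fun_choice (fun v u => (exists u', Wa v u') -> Wa v u)) as [a Ha].
    { intros v. destruct (classic (exists u', Wa v u')) as [[u Hu]|Hn];
        [exists u; auto|exists v; tauto]. }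
    set (ps := nodup eq_dec_cl (map a l2)).
    assert (Hps : forall u, In u ps -> W u /\ (lev u < n0)%Z).
    { intros u Hu. apply nodup_In, in_map_iff in Hu. destruct Hu as [v [<- Hv]].
      destruct (Hl2 v Hv) as [Hlv Hex]. destruct (Ha v Hex) as [t [Ht [Ev Hw]]].
      split; [assumption|]. rewrite <- Ev, (frame_lev_iter HF). lia. }
    assert (Hd2 : NoDup l2) by (apply nodup_cfilter; assumption).
    assert (H3 : lsum mu l2 <= lsum mu ps).
    { eapply Rle_trans; [apply (lsum_fibers mu a); [assumption|intros; left; apply Hmu]|].
      apply lsum_le. intros u Hu.
      apply (lsum_desc (Z.to_nat (n0 - lev u))); [apply nodup_cfilter; assumption|].
      intros v Hv. apply in_cfilter in Hv. destruct Hv as [Hv Eu].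
      destruct (Hl2 v Hv) as [Hlv Hex]. destruct (Ha v Hex) as [t [Ht [Ev Hw]]].
      rewrite Eu in Ev. rewrite <- Ev at 2. f_equal.
      rewrite <- Ev, (frame_lev_iter HF). lia. }
    assert (H4 : lsum mu (l1 ++ ps) <= s).
    { apply H2.
      - apply NoDup_app; [apply nodup_cfilter; assumption|apply NoDup_nodup|].
        intros v Hv Hp. apply in_cfilter in Hv. apply Hps in Hp. lia.
      - intros v Hv. apply in_app_or in Hv. destruct Hv as [Hv|Hv].
        + apply in_cfilter in Hv. tauto.
        + apply Hps. assumption. }
    rewrite lsum_app in H4. lra.
Qed.

(** In a cover by nodes no higher than [w], each node either lies below [w] or carries no end
    through [w], so the cover splits into two. The supremum [s1] of the first part leaves [s - s1]
    for the second. *)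
Lemma meas_cylinder w : meas cov (fun om => through om w).
Proof.
  intros A s eps Hs He. destruct (cov_refine A s (lev w) Hs) as [W [H0 [H1 H2]]].
  set (below := fun v => Nat.iter (Z.to_nat (lev v - lev w)) pi v = w).
  assert (Hbel : forall om v, (lev w <= lev v)%Z -> through om v -> (through om w <-> below v)).
  { intros om v Hl Hv.
    assert (Ha := through_iter om v (Z.to_nat (lev v - lev w)) Hv).
    assert (El := frame_lev_iter HF (Z.to_nat (lev v - lev w)) v). split.
    - intros Hw. apply (through_unique om); auto. lia.
    - intros Hb. unfold below in Hb. rewrite Hb in Ha. assumption. }
  set (Ssum := fun t => exists l, NoDup l /\ (forall v, In v l -> W v /\ below v) /\ t = lsum mu l).
  destruct (completeness Ssum) as [s1 Hs1].
  - exists s. intros t [l [Hd [Hl ->]]]. apply H2; [assumption|]. intros v Hv. apply Hl. assumption.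
  - exists 0, nil. split; [constructor|]. split; [intros v []|reflexivity].
  - exists s1, (s - s1). split; [|split; [|lra]].
    + exists (fun v => W v /\ below v). split.
      * intros om [HA Hw]. destruct (H1 om HA) as [v [Hv Ht]]. exists v. split; [|assumption].
        split; [assumption|]. apply (Hbel om); auto.
      * intros l Hd Hl. apply Hs1. exists l. auto.
    + exists (fun v => W v /\ ~ below v). split.
      * intros om [HA Hw]. destruct (H1 om HA) as [v [Hv Ht]]. exists v. split; [|assumption].
        split; [assumption|]. intros Hb. apply Hw. apply (Hbel om v); auto.
      * intros l Hd Hl. assert (s1 <= s - lsum mu l); [|lra]. apply Hs1.
        intros t [l' [Hd' [Hl' ->]]]. assert (H : lsum mu (l' ++ l) <= s); [|rewrite lsum_app in H; lra].
        apply H2.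
        -- apply NoDup_app; auto. intros v Hv Hv'. apply Hl' in Hv. apply Hl in Hv'. tauto.
        -- intros v Hv. apply in_app_or in Hv. destruct Hv as [Hv|Hv]; [apply Hl'|apply Hl]; assumption.
Qed.

Lemma end_through (om : nat -> T) : (forall n, pi (om (S n)) = om n) ->
  exists e : ends, forall n, through e (om n).
Proof.
  intros Hom. set (j := lev (om 0%nat)).
  assert (Hlom : forall n, lev (om n) = (j + Z.of_nat n)%Z).
  { induction n as [|n IH]; [unfold j; lia|]. rewrite <- (Hom n), (fr_lev HF) in IH. lia. }
  set (Om := fun n : Z => if Z_le_gt_dec j n then om (Z.to_nat (n - j))
                          else Nat.iter (Z.to_nat (j - n)) pi (om 0%nat)).
  assert (HOm : is_end Om).
  { intros n. unfold Om. destruct (Z_le_gt_dec j (n + 1)), (Z_le_gt_dec j n); try lia; split.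
    - rewrite Hlom. lia.
    - replace (Z.to_nat (n + 1 - j)) with (S (Z.to_nat (n - j))) by lia. apply Hom.
    - rewrite (frame_lev_iter HF). fold j. lia.
    - replace (Z.to_nat (n + 1 - j)) with 0%nat by lia.
      replace (Z.to_nat (j - n)) with 1%nat by lia. reflexivity.
    - rewrite (frame_lev_iter HF). fold j. lia.
    - replace (Z.to_nat (j - n)) with (S (Z.to_nat (j - (n + 1)))) by lia. reflexivity. }
  exists (exist _ Om HOm). intros n. unfold through, node. simpl. rewrite Hlom. unfold Om.
  destruct (Z_le_gt_dec j (j + Z.of_nat n)) as [_|]; [|lia]. f_equal. lia.
Qed.

Definition uncovered (W : T -> Prop) (v : T) : Prop := exists s, s < mu v /\
  forall l, NoDup l -> (forall u, In u l -> W u /\ exists t, Nat.iter t pi u = v) -> lsum mu l <= s.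

(* Koenig: if the mass of the covering nodes below [v] is less than [mu v], the same holds for
   some child of [v], since the masses add up. *)
Lemma uncovered_child W v : uncovered W v -> exists u, pi u = v /\ uncovered W u.
Proof.
  intros [s [Hs Hl]]. apply NNPP. intros Hn.
  set (n := INR (length (ch v)) + 1). assert (Hn1 : 0 < n) by (unfold n; assert (H := pos_INR (length (ch v))); lra).
  (* If every child were covered up to less than [e], the covered mass below [v] would exceed [mu v]
     minus [e] times the number of children, hence [s]; the extra 1 in [n] keeps the divisor
     positive. *)
  set (e := (mu v - s) / n). assert (He : 0 < e) by (apply Rdiv_lt_0_compat; lra).
  assert (Hu : forall u, exists l, In u (ch v) -> NoDup l /\
    (forall x, In x l -> W x /\ exists t, Nat.iter t pi x = u) /\ mu u - e < lsum mu l).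
  { intros u. apply NNPP. intros Hno. apply Hn. exists u. assert (Huv : pi u = v).
    { apply (proj2 (Hch v)). apply NNPP. intros Hin. apply Hno. exists nil. tauto. }
    split; [assumption|]. exists (mu u - e). split; [lra|]. intros l Hd Hx.
    apply Rnot_lt_le. intros Hlt. apply Hno. exists l. auto. }
  destruct (fun_choice _ Hu) as [lu Hlu].
  assert (H : lsum mu (flat_map lu (ch v)) <= s).
  { apply Hl.
    - apply nodup_flat_map; [apply Hch|intros a Ha; apply Hlu; assumption|].
      intros a a' b Ha Ha' Hb Hb'. destruct (Hlu a Ha) as [_ [H1 _]]. destruct (Hlu a' Ha') as [_ [H2 _]].
      destruct (H1 b Hb) as [_ [t Ht]]. destruct (H2 b Hb') as [_ [t' Ht']].
      apply (proj2 (Hch v)) in Ha, Ha'.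
      assert (E1 := fr_lev HF a). assert (E2 := fr_lev HF a'). rewrite Ha in E1. rewrite Ha' in E2.
      assert (E3 := frame_lev_iter HF t b). assert (E4 := frame_lev_iter HF t' b).
      rewrite Ht in E3. rewrite Ht' in E4. replace t' with t in Ht' by lia. congruence.
    - intros x Hx. apply in_flat_map in Hx. destruct Hx as [a [Ha Hx]].
      destruct (Hlu a Ha) as [_ [H1 _]]. destruct (H1 x Hx) as [HW [t Ht]]. split; [assumption|].
      exists (S t). simpl. rewrite Ht. apply (proj2 (Hch v)). assumption. }
  rewrite lsum_flat_map in H.
  assert (H' : lsum (fun u => mu u + - e) (ch v) <= lsum (fun u => lsum mu (lu u)) (ch v)).
  { apply lsum_le. intros u Hin. destruct (Hlu u Hin) as [_ [_ H1]]. lra. }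
  rewrite lsum_plus, lsum_const, Hadd in H'.
  assert (E : n * e = mu v - s) by (unfold e; field; lra). unfold n in E. lra.
Qed.

(** Otherwise one could descend forever through uncovered nodes to an end through [w]. A node of the
    cover on this end cannot lie below [w], since it would cover itself, nor above, since its mass
    would be at least [mu w]. *)
Lemma cov_cylinder_ge w s : cov (fun om => through om w) s -> mu w <= s.
Proof.
  intros [W [H1 H2]]. apply Rnot_lt_le. intros Hs.
  assert (Hw : uncovered W w).
  { exists s. split; [assumption|]. intros l Hd Hl. apply H2; [assumption|]. intros u Hu. apply Hl. assumption. }
  destruct (fun_choice (fun v u => uncovered W v -> pi u = v /\ uncovered W u)) as [nx Hnx].
  { intros v. destruct (classic (uncovered W v)) as [Hv|Hv].
    - destruct (uncovered_child W v Hv) as [u Hu]. exists u. auto.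
    - exists v. tauto. }
  set (om := fun n => Nat.iter n nx w).
  assert (Hom : forall n, uncovered W (om n)).
  { induction n as [|n IH]; [exact Hw|]. apply (Hnx (om n)). exact IH. }
  destruct (end_through om) as [e He].
  { intros n. apply (Hnx (om n)). apply Hom. }
  destruct (H1 e) as [v [Hv Ht]]; [apply (He 0%nat)|].
  destruct (Z_le_gt_dec (lev w) (lev v)) as [Hle|Hgt].
  - assert (Hlom : forall n, lev (om n) = (lev w + Z.of_nat n)%Z).
    { induction n as [|n IH]; [unfold om; simpl; lia|].
      assert (E := fr_lev HF (om (S n))). destruct (Hnx (om n) (Hom n)) as [E' _].
      change (nx (om n)) with (om (S n)) in E'. rewrite E' in E. lia. }
    set (n := Z.to_nat (lev v - lev w)).
    assert (E : om n = v).
    { apply (through_unique e); [rewrite Hlom; unfold n; lia|apply He|assumption]. }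
    destruct (Hom n) as [s' [Hs' Hl]]. rewrite E in *.
    assert (H : lsum mu (v :: nil) <= s').
    { apply Hl; [repeat constructor; simpl; tauto|]. intros u [<-|[]].
      split; [assumption|]. exists 0%nat. reflexivity. }
    unfold lsum in H. simpl in H. lra.
  - assert (E : Nat.iter (Z.to_nat (lev w - lev v)) pi w = v).
    { apply (through_unique e); [|apply through_iter; apply (He 0%nat)|assumption].
      rewrite (frame_lev_iter HF). lia. }
    assert (H := mu_iter (Z.to_nat (lev w - lev v)) w). rewrite E in H.
    assert (H' : lsum mu (v :: nil) <= s).
    { apply H2; [repeat constructor; simpl; tauto|]. intros u [<-|[]]. assumption. }
    unfold lsum in H'. simpl in H'. lra.
Qed.

(** The measure is the image of the outer measure on ends under a choice of a point in all cells of
    each end. Since the cells along an end become small, the preimage of an open set is a union of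
    cylinders, and there are countably many of these. *)
Theorem ends_measure (rho : X -> X -> R) :
  (forall om : nat -> T, (forall n, pi (om (S n)) = om n) -> forall eps, 0 < eps ->
    exists n, forall x y, K (om n) x -> K (om n) y -> rho x y < eps) ->
  exists nu, borel_measure rho nu /\
    (forall w (A : X -> Prop), (forall x, K w x -> A x) -> Rbar_le (Finite (mu w)) (nu A)) /\
    (forall n l (A : X -> Prop), (forall v x, lev v = n -> K v x -> A x -> In v l) ->
      Rbar_le (nu A) (Finite (lsum mu l))).
Proof.
  intros Hsmall.
  assert (Hnat : forall (om : ends) n, pi (node om (Z.of_nat (S n))) = node om (Z.of_nat n)).
  { intros om n. rewrite <- (node_iter om (Z.of_nat n) 1). simpl. do 2 f_equal. lia. }
  destruct (fun_choice (fun (om : ends) x => forall n, K (node om n) x)) as [code Hcode].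
  { intros om. destruct (fr_end HF (fun n => node om (Z.of_nat n)) (Hnat om)) as [x Hx].
    exists x. intros n. destruct (Z_le_gt_dec 0 n) as [Hn|Hn].
    - specialize (Hx (Z.to_nat n)). rewrite Z2Nat.id in Hx; assumption.
    - rewrite <- (node_iter om n (Z.to_nat (- n))). apply (frame_K_iter HF).
      specialize (Hx 0%nat). replace (n + Z.of_nat (Z.to_nat (- n)))%Z with 0%Z by lia. exact Hx. }
  exists (fun A => outer cov (fun om => A (code om))). split; [|split].
  - apply borel_measure_pushforward;
      [apply cov_nonneg|apply cov_mono|apply cov_empty|apply cov_union|].
    intros U HU. destruct (fr_cnt HF) as [f Hf].
    apply (meas_ext cov cov_mono
      (fun om => exists n, exists w, f w = n /\ (forall x, K w x -> U x) /\ through om w)).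
    + intros om. split.
      * intros [n [w [_ [Hw Ht]]]]. apply Hw. rewrite <- Ht. apply Hcode.
      * intros Hom. destruct (HU _ Hom) as [eps [He Hball]].
        destruct (Hsmall (fun n => node om (Z.of_nat n)) (Hnat om) eps He) as [n Hn].
        exists (f (node om (Z.of_nat n))), (node om (Z.of_nat n)).
        split; [reflexivity|]. split.
        -- intros x Hx. apply Hball. apply Hn; [apply Hcode|assumption].
        -- unfold through. rewrite node_lev. reflexivity.
    + apply (meas_union cov cov_nonneg cov_mono cov_empty cov_union
        (fun n om => exists w, f w = n /\ (forall x, K w x -> U x) /\ through om w)).
      intros n. destruct (classic (exists w, f w = n /\ forall x, K w x -> U x)) as [[w [Hw HwU]]|Hn].
      * apply (meas_ext cov cov_mono (fun om => through om w)); [|apply meas_cylinder].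
        intros om. split; [intros Ht; exists w; auto|]. intros [v [Hv [_ Ht]]].
        replace w with v; [assumption|]. apply Hf. congruence.
      * apply (meas_ext cov cov_mono (fun _ => False)).
        -- intros om. split; [tauto|]. intros [w [H1 [H2 _]]]. apply Hn. exists w. auto.
        -- exact (meas_empty cov cov_mono cov_empty).
  - intros w A HA. apply Glb_Rbar_correct. intros s Hs. simpl. apply cov_cylinder_ge.
    eapply cov_mono; [|exact Hs]. intros om Ht. apply HA. rewrite <- Ht. apply Hcode.
  - intros n l A Hl. apply (proj1 (Glb_Rbar_correct (cov (fun om => A (code om))))).
    exists (fun w => In w l). split.
    + intros om Hom. exists (node om n). split; [|unfold through; rewrite node_lev; reflexivity].
      apply Hl with (code om); [apply node_lev|apply Hcode|assumption].
    + intros l' Hd Hl'. apply lsum_incl; [assumption|exact Hl'|intros; left; apply Hmu].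
Qed.

End EndsMeasure.


(** * Quasisymmetry and Ahlfors regularity of the chain metric *)

(* Unlike [Rpower], [pw] takes the value [0] at [t = 0]. *)
Definition pw (t a : R) : R := if Rle_dec t 0 then 0 else Rpower t a.

Lemma pw_pos t a : 0 < t -> pw t a = Rpower t a.
Proof. intros H. unfold pw. destruct (Rle_dec t 0); [lra|reflexivity]. Qed.

Lemma pw_zero a : pw 0 a = 0.
Proof. unfold pw. destruct (Rle_dec 0 0); [reflexivity|lra]. Qed.

Lemma Rpower_pos t a : 0 < Rpower t a.
Proof. apply exp_pos. Qed.

Lemma pw_nonneg t a : 0 <= pw t a.
Proof. unfold pw. destruct (Rle_dec t 0); [lra|]. left. apply Rpower_pos. Qed.

Lemma pw_le s t a : 0 < a -> 0 <= s <= t -> pw s a <= pw t a.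
Proof.
  intros Ha [Hs Hst]. destruct (Rle_lt_or_eq_dec 0 s Hs) as [Hs'|<-].
  - rewrite !pw_pos by lra. apply Rle_Rpower_l; lra.
  - rewrite pw_zero. apply pw_nonneg.
Qed.

Lemma pw_lt s t a : 0 < a -> 0 <= s < t -> pw s a < pw t a.
Proof.
  intros Ha [Hs Hst]. destruct (Rle_lt_or_eq_dec 0 s Hs) as [Hs'|<-].
  - rewrite !pw_pos by lra. apply Rlt_Rpower_l; lra.
  - rewrite pw_zero, pw_pos by lra. apply Rpower_pos.
Qed.

Lemma pw_comp t a b : 0 <= t -> pw (pw t a) b = pw t (a * b).
Proof.
  intros Ht. destruct (Rle_lt_or_eq_dec 0 t Ht) as [Ht'|<-].
  - rewrite (pw_pos t) by lra. rewrite pw_pos by apply Rpower_pos.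
    rewrite Rpower_mult, pw_pos by lra. reflexivity.
  - rewrite !pw_zero. reflexivity.
Qed.

Lemma pw_one t : 0 <= t -> pw t 1 = t.
Proof.
  intros Ht. destruct (Rle_lt_or_eq_dec 0 t Ht) as [Ht'|<-].
  - rewrite pw_pos by lra. apply Rpower_1. lra.
  - apply pw_zero.
Qed.

Lemma pw_one_l a : pw 1 a = 1.
Proof. rewrite pw_pos by lra. unfold Rpower. rewrite ln_1, Rmult_0_r, exp_0. reflexivity. Qed.

Lemma pw_le_one t a : 0 < a -> 0 <= t <= 1 -> pw t a <= 1.
Proof. intros Ha Ht. rewrite <- (pw_one_l a). apply pw_le; assumption. Qed.

Lemma pw_ge_one t a : 0 < a -> 1 <= t -> 1 <= pw t a.
Proof. intros Ha Ht. rewrite <- (pw_one_l a) at 1. apply pw_le; lra. Qed.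

Lemma Rpower_anti_exp t a b : 0 < t <= 1 -> a <= b -> Rpower t b <= Rpower t a.
Proof.
  intros Ht Hab. unfold Rpower. assert (Hl : ln t <= 0).
  { rewrite <- ln_1. destruct (Rle_lt_or_eq_dec t 1) as [H| ->]; [lra| |lra].
    left. apply ln_increasing; lra. }
  destruct (Rle_lt_or_eq_dec (b * ln t) (a * ln t)) as [H|H]; [nra| |].
  - left. apply exp_increasing. assumption.
  - rewrite H. lra.
Qed.

Lemma pw_exp_small t a b : a <= b -> 0 <= t <= 1 -> pw t b <= pw t a.
Proof.
  intros Hab Ht. destruct (Rle_lt_or_eq_dec 0 t) as [Ht'|<-]; [lra| |rewrite !pw_zero; lra].
  rewrite !pw_pos by lra. apply Rpower_anti_exp; lra.
Qed.

Lemma pw_exp_large t a b : a <= b -> 1 <= t -> pw t a <= pw t b.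
Proof.
  intros Hab Ht. rewrite !pw_pos by lra. destruct (Rle_lt_or_eq_dec 1 t Ht) as [H|<-].
  - apply Rle_Rpower; lra.
  - unfold Rpower. rewrite ln_1, !Rmult_0_r. lra.
Qed.

Lemma pw_cont a : 0 < a -> cont_nonneg (fun t => pw t a).
Proof.
  intros Ha t Ht e He. destruct (Rle_lt_or_eq_dec 0 t Ht) as [Ht'|<-].
  - assert (Hc : continuity_pt (fun x => Rpower x a) t).
    { apply derivable_continuous_pt. exists (a * Rpower t (a - 1)). apply derivable_pt_lim_power. assumption. }
    destruct (Hc e He) as [delta [Hd H]]. exists (Rmin delta t).
    split; [apply Rmin_glb_lt; assumption|]. intros u Hu Hut.
    assert (Hut1 : Rabs (u - t) < delta) by (eapply Rlt_le_trans; [exact Hut|apply Rmin_l]).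
    assert (Hut2 : Rabs (u - t) < t) by (eapply Rlt_le_trans; [exact Hut|apply Rmin_r]).
    assert (0 < u) by (apply Rabs_def2 in Hut2; lra).
    rewrite !pw_pos by lra. destruct (Req_dec u t) as [->|Hne].
    + rewrite Rminus_diag, Rabs_R0. assumption.
    + apply (H u). split; [|exact Hut1]. split; [exact I|auto].
  - exists (pw e (/ a)). assert (Hp : 0 < pw e (/ a)) by (rewrite pw_pos by lra; apply Rpower_pos).
    split; [assumption|]. intros u Hu Hut. rewrite pw_zero, Rminus_0_r in *.
    rewrite Rabs_pos_eq in Hut by assumption. rewrite Rabs_pos_eq by apply pw_nonneg.
    rewrite <- (pw_one e), <- (Rinv_l a), <- pw_comp by lra. apply pw_lt; lra.
Qed.

Lemma cont_nonneg_max f h : cont_nonneg f -> cont_nonneg h -> cont_nonneg (fun t => Rmax (f t) (h t)).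
Proof.
  intros Hf Hh t Ht e He. destruct (Hf t Ht e He) as [a [Ha H1]]. destruct (Hh t Ht e He) as [b [Hb H2]].
  exists (Rmin a b). split; [apply Rmin_glb_lt; assumption|]. intros u Hu Hut.
  specialize (H1 u Hu (Rlt_le_trans _ _ _ Hut (Rmin_l a b))).
  specialize (H2 u Hu (Rlt_le_trans _ _ _ Hut (Rmin_r a b))).
  apply Rabs_def2 in H1, H2. unfold Rmax.
  destruct (Rle_dec (f u) (h u)), (Rle_dec (f t) (h t)); apply Rabs_def1; lra.
Qed.

Lemma cont_nonneg_min f h : cont_nonneg f -> cont_nonneg h -> cont_nonneg (fun t => Rmin (f t) (h t)).
Proof.
  intros Hf Hh t Ht e He. destruct (Hf t Ht e He) as [a [Ha H1]]. destruct (Hh t Ht e He) as [b [Hb H2]].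
  exists (Rmin a b). split; [apply Rmin_glb_lt; assumption|]. intros u Hu Hut.
  specialize (H1 u Hu (Rlt_le_trans _ _ _ Hut (Rmin_l a b))).
  specialize (H2 u Hu (Rlt_le_trans _ _ _ Hut (Rmin_r a b))).
  apply Rabs_def2 in H1, H2. unfold Rmin.
  destruct (Rle_dec (f u) (h u)), (Rle_dec (f t) (h t)); apply Rabs_def1; lra.
Qed.

(** The maximum is [t^{1/b}] on [[0,1]] and [t^b] beyond. The inverse exchanges the two exponents,
    hence the minimum. *)
Lemma power_homeo A b : 0 < A -> 1 <= b -> homeo_nonneg (fun t => A * Rmax (pw t (/ b)) (pw t b)).
Proof.
  intros HA Hb. assert (Hib : 0 < / b <= 1).
  { split; [apply Rinv_0_lt_compat; lra|]. rewrite <- Rinv_1. apply Rinv_le_contravar; lra. }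
  assert (HT1 : forall t, 0 <= t <= 1 -> Rmax (pw t (/ b)) (pw t b) = pw t (/ b)).
  { intros t Ht. apply Rmax_left, pw_exp_small; lra. }
  assert (HT2 : forall t, 1 <= t -> Rmax (pw t (/ b)) (pw t b) = pw t b).
  { intros t Ht. apply Rmax_right, pw_exp_large; lra. }
  assert (HS1 : forall t, 0 <= t <= 1 -> Rmin (pw t (/ b)) (pw t b) = pw t b).
  { intros t Ht. apply Rmin_right, pw_exp_small; lra. }
  assert (HS2 : forall t, 1 <= t -> Rmin (pw t (/ b)) (pw t b) = pw t (/ b)).
  { intros t Ht. apply Rmin_left, pw_exp_large; lra. }
  assert (Hcomp1 : forall t, 0 <= t -> pw (pw t (/ b)) b = t).
  { intros t Ht. rewrite pw_comp, Rinv_l, pw_one by lra. reflexivity. }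
  assert (Hcomp2 : forall t, 0 <= t -> pw (pw t b) (/ b) = t).
  { intros t Ht. rewrite pw_comp, Rinv_r, pw_one by lra. reflexivity. }
  split; [|split].
  - intros t Ht. apply Rmult_le_pos; [lra|]. eapply Rle_trans; [|apply Rmax_l]. apply pw_nonneg.
  - intros t Ht e He.
    destruct (cont_nonneg_max _ _ (pw_cont (/ b) (proj1 Hib)) (pw_cont b ltac:(lra)) t Ht (e / A))
      as [delta [Hd H]]; [apply Rdiv_lt_0_compat; assumption|].
    exists delta. split; [assumption|]. intros u Hu Hut. specialize (H u Hu Hut).
    rewrite <- Rmult_minus_distr_l, Rabs_mult, (Rabs_pos_eq A) by lra.
    apply Rmult_lt_compat_l with (r := A) in H; [|assumption].
    replace (A * (e / A)) with e in H by (field; lra). exact H.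
  - exists (fun s => Rmin (pw (s / A) (/ b)) (pw (s / A) b)). split.
    + intros s Hs e He.
      assert (HsA : 0 <= s / A) by (apply Rmult_le_pos; [assumption|left; apply Rinv_0_lt_compat; lra]).
      destruct (cont_nonneg_min _ _ (pw_cont (/ b) (proj1 Hib)) (pw_cont b ltac:(lra)) (s / A) HsA e He)
        as [delta [Hd H]].
      exists (A * delta). split; [apply Rmult_lt_0_compat; assumption|]. intros u Hu Hus. apply H.
      * apply Rmult_le_pos; [assumption|left; apply Rinv_0_lt_compat; lra].
      * unfold Rdiv. rewrite <- Rmult_minus_distr_r, Rabs_mult, (Rabs_pos_eq (/ A))
          by (left; apply Rinv_0_lt_compat; lra).
        apply Rmult_lt_reg_r with A; [assumption|].
        rewrite Rmult_assoc, Rinv_l, Rmult_1_r by lra. lra.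
    + intros t Ht.
      assert (HtA : 0 <= t / A) by (apply Rmult_le_pos; [assumption|left; apply Rinv_0_lt_compat; lra]).
      split; [apply Rmin_glb; apply pw_nonneg|]. split.
      * replace (A * Rmax (pw t (/ b)) (pw t b) / A) with (Rmax (pw t (/ b)) (pw t b)) by (field; lra).
        destruct (Rle_dec t 1) as [H1|H1].
        -- rewrite HT1 by lra. rewrite HS1; [apply Hcomp1; assumption|].
           split; [apply pw_nonneg|apply pw_le_one; lra].
        -- rewrite HT2 by lra. rewrite HS2; [apply Hcomp2; assumption|]. apply pw_ge_one; lra.
      * destruct (Rle_dec (t / A) 1) as [H1|H1].
        -- rewrite HS1 by lra. rewrite HT1; [|split; [apply pw_nonneg|apply pw_le_one; lra]].
           rewrite Hcomp2 by assumption. field. lra.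
        -- rewrite HS2 by lra. rewrite HT2 by (apply pw_ge_one; lra).
           rewrite Hcomp1 by assumption. field. lra.
Qed.

Lemma Rpower_pow_base t a (n : nat) : 0 < t -> Rpower t a ^ n = Rpower (t ^ n) a.
Proof.
  intros Ht. rewrite <- (Rpower_pow n t), <- (Rpower_pow n (Rpower t a)), !Rpower_mult
    by (try apply Rpower_pos; assumption).
  f_equal. ring.
Qed.

Lemma Rpower_inv t a : 0 < t -> Rpower (/ t) a = / Rpower t a.
Proof. intros Ht. unfold Rpower. rewrite ln_Rinv, <- exp_Ropp by assumption. f_equal. ring. Qed.

Section RegularMetric.
Context {T X : Type} {pi : T -> T} {lev : T -> Z} {K : T -> X -> Prop} {d : X -> X -> R}.
Context {r Cd c0 ct : R} {L B M : nat}.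
Hypothesis HF : frame pi lev K d r Cd c0 ct L B M.
Variables (sg : T -> R) (Kh lam eta p : R).
Let adjK := adj lev K.
Hypothesis Hp : 0 < p.
Hypothesis Hsg : forall w, 0 < sg w.
Hypothesis HKh : 1 <= Kh.
Hypothesis Hharn : forall w v, adjK w v -> sg v <= Kh * sg w.
Hypothesis Hlam : 0 < lam < 1.
Hypothesis Hdec : forall u, sg u <= lam * sg (pi u).
Hypothesis Heta : 0 < eta.
Hypothesis Hfloor : forall u, eta * sg (pi u) <= sg u.
Variable rho : X -> X -> R.
Hypothesis Hrho : is_metric rho.
Hypothesis Hupper : forall n w v x y, within adjK n w v -> K w x -> K v y ->
  rho x y <= (INR n + 1) * Kh ^ n * sg w.
Variables (D c : R).
Hypothesis HD : 0 < D.
Hypothesis Hc : 0 < c.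
Hypothesis Hlower : forall w x y, K w x -> D * rp r (lev w) < d x y -> c * sg w <= rho x y.

Lemma rho_pos x y : x <> y -> 0 < rho x y.
Proof.
  intros Hne. destruct Hrho as [H0 [H1 _]]. destruct (Rle_lt_or_eq_dec _ _ (H0 x y)) as [H|H]; [assumption|].
  destruct Hne. apply H1. auto.
Qed.

Lemma d_pos x y : x <> y -> 0 < d x y.
Proof.
  intros Hne. destruct (fr_met HF) as [H0 [H1 _]].
  destruct (Rle_lt_or_eq_dec _ _ (H0 x y)) as [H|H]; [assumption|]. destruct Hne. apply H1. auto.
Qed.

(** Both geometric rates of the weights, [lam] from above and [eta] from below, are compared with
    powers of the metric rate [r]; [b] becomes the exponent of the quasisymmetry. *)
Lemma exponent_exists : exists b, 1 <= b /\ lam <= Rpower r (/ b) /\ / eta <= Rpower (/ r) b.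
Proof.
  assert (Hr := fr_r HF).
  assert (Hlr : ln r < 0) by (rewrite <- ln_1; apply ln_increasing; lra).
  assert (Hll : ln lam < 0) by (rewrite <- ln_1; apply ln_increasing; lra).
  assert (Hq : 0 < ln r / ln lam).
  { replace (ln r / ln lam) with ((- ln r) / (- ln lam)) by (field; lra).
    apply Rdiv_lt_0_compat; lra. }
  exists (1 + Rabs (ln eta / ln r) + ln r / ln lam).
  assert (Ha := Rabs_pos (ln eta / ln r)). set (b := 1 + Rabs (ln eta / ln r) + ln r / ln lam).
  assert (Hb : 1 <= b) by (unfold b; lra). split; [assumption|]. split.
  - rewrite <- (exp_ln lam) at 1 by lra. unfold Rpower.
    assert (Hle : ln lam <= / b * ln r).
    { apply Rmult_le_reg_l with b; [lra|]. rewrite <- Rmult_assoc, Rinv_r, Rmult_1_l by lra.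
      assert (E : ln r / ln lam * ln lam = ln r) by (field; lra).
      assert (ln r / ln lam <= b) by (unfold b; lra). nra. }
    destruct Hle as [Hlt| ->]; [left; apply exp_increasing; assumption|lra].
  - rewrite <- (exp_ln (/ eta)) at 1 by (apply Rinv_0_lt_compat; assumption). unfold Rpower.
    rewrite !ln_Rinv by lra. assert (Hle : - ln eta <= b * - ln r).
    { assert (E : ln eta / ln r * - ln r = - ln eta) by (field; lra).
      assert (ln eta / ln r <= b) by (unfold b; assert (Hx := Rle_abs (ln eta / ln r)); lra). nra. }
    destruct Hle as [Hlt| ->]; [left; apply exp_increasing; assumption|lra].
Qed.

(** Choose a level [m] at which [x] and [y] are near and a level [n] at which [x] and [z] are far.
    Then the ratio of the [rho]-distances is at most a multiple of the ratio of the weights of the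
    cells of [x] on these levels, which is geometric in [m - n], as is the ratio of the
    [d]-distances. *)
Theorem rho_quasisymmetric : quasisymmetric d rho.
Proof.
  assert (Hr := fr_r HF). assert (Hc0 := fr_c0 HF).
  destruct exponent_exists as [b [Hb [Hlb Heb]]].
  (* One factor [r] for each rounding of a distance to a level; the factor 2 makes the separation of
     [x] and [z] strict. *)
  set (kap := c0 * r * r / (2 * D)).
  assert (Hkap : 0 < kap) by (unfold kap; apply Rdiv_lt_0_compat; [repeat apply Rmult_lt_0_compat|]; lra).
  set (C1 := (INR M + 1) * Kh ^ M / c).
  assert (HC1 : 0 < C1).
  { unfold C1. apply Rdiv_lt_0_compat; [|assumption]. apply Rmult_lt_0_compat; [|apply pow_lt; lra].
    assert (H := pos_INR M). lra. }
  assert (Hik : 0 < / kap) by (apply Rinv_0_lt_compat; assumption).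
  set (A := C1 * (Rpower (/ kap) (/ b) + Rpower (/ kap) b)).
  assert (HA : 0 < A).
  { apply Rmult_lt_0_compat; [assumption|]. apply Rplus_lt_0_compat; apply Rpower_pos. }
  exists (fun t => A * Rmax (pw t (/ b)) (pw t b)). split; [apply power_homeo; assumption|].
  intros x y z Hxz. assert (Hdxz := d_pos x z Hxz). assert (Hrxz := rho_pos x z Hxz).
  destruct (classic (x = y)) as [<-|Hxy].
  - replace (rho x x) with 0 by (symmetry; apply Hrho; reflexivity).
    unfold Rdiv at 1. rewrite Rmult_0_l. apply Rmult_le_pos; [lra|].
    eapply Rle_trans; [|apply Rmax_l]. apply pw_nonneg.
  - assert (Hdxy := d_pos x y Hxy).
    destruct (rp_between r Hr (2 * D) (d x z)) as [n0 [Hn1 Hn2]]; [lra|assumption|].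
    destruct (rp_between r Hr c0 (d x y)) as [m [Hm1 Hm2]]; [assumption|assumption|].
    set (n := (n0 + 1)%Z) in *. assert (Hpn := frame_rp_pos HF n). assert (Hpm := frame_rp_pos HF m).
    assert (En : rp r n0 * r = rp r n).
    { replace n0 with (n - 1)%Z by (unfold n; lia). apply rp_pred; assumption. }
    assert (Em : rp r m * r = rp r (m + 1)).
    { replace m with (m + 1 - 1)%Z at 1 by lia. apply rp_pred; assumption. }
    assert (Hratio : forall w w', K w x -> K w' x -> lev w = m -> lev w' = n -> forall q,
      sg w <= q * sg w' -> rho x y / rho x z <= C1 * q).
    { intros w w' Hw Hw' Hlw Hlw' q Hq.
      assert (H1 : rho x y <= (INR M + 1) * Kh ^ M * sg w).
      { destruct (fr_cov HF y m) as [v [Hv Hvy]]. apply (Hupper M w v); auto.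
        apply (fr_near HF) with x y; auto; congruence. }
      assert (H2 : c * sg w' <= rho x z).
      { apply Hlower; [assumption|]. rewrite Hlw'. assert (Hdp : 0 < D * rp r n) by (apply Rmult_lt_0_compat; assumption). lra. }
      apply Rmult_le_reg_r with (rho x z); [assumption|].
      unfold Rdiv. rewrite Rmult_assoc, Rinv_l, Rmult_1_r by lra.
      assert (Hq0 : 0 < q).
      { assert (H3 := Hsg w). assert (H4 := Hsg w'). apply Rnot_le_lt. intros Hneg. nra. }
      apply Rle_trans with (C1 * q * (c * sg w')).
      - eapply Rle_trans; [apply H1|]. unfold C1.
        replace ((INR M + 1) * Kh ^ M / c * q * (c * sg w'))
          with ((INR M + 1) * Kh ^ M * (q * sg w')) by (field; lra).
        apply Rmult_le_compat_l; [|assumption]. apply Rmult_le_pos; [assert (H := pos_INR M); lra|].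
        apply pow_le. lra.
      - apply Rmult_le_compat_l; [|assumption]. apply Rmult_le_pos; lra. }
    set (t := d x y / d x z). assert (Ht : 0 < t) by (apply Rdiv_lt_0_compat; assumption).
    assert (Hdz : d x z < 2 * D / r * rp r n).
    { rewrite <- En. replace (2 * D / r * (rp r n0 * r)) with (2 * D * rp r n0) by (field; lra). lra. }
    assert (Htk : kap * rp r m <= t * rp r n).
    { unfold t, kap. apply Rmult_le_reg_r with (d x z); [assumption|].
      replace (d x y / d x z * rp r n * d x z) with (d x y * rp r n) by (field; lra).
      apply Rle_trans with (c0 * (rp r m * r) * rp r n).
      - apply Rle_trans with (c0 * r * r / (2 * D) * rp r m * (2 * D / r * rp r n)).
        + apply Rmult_le_compat_l; [|lra]. apply Rmult_le_pos; [fold kap; lra|lra].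
        + right. field. lra.
      - rewrite Em. apply Rmult_le_compat_r; lra. }
    rewrite !pw_pos by assumption.
    destruct (Z_le_gt_dec n m) as [Hnm|Hnm].
    + destruct (fr_cov HF x m) as [w [Hw Hwx]]. set (k := Z.to_nat (m - n)).
      eapply Rle_trans; [apply (Hratio w (Nat.iter k pi w)) with (q := lam ^ k)|].
      * assumption.
      * apply (frame_K_iter HF). assumption.
      * assumption.
      * rewrite (frame_lev_iter HF). unfold k. lia.
      * apply sg_iter_le; assumption.
      * assert (Hk : r ^ k <= / kap * t).
        { replace m with (n + Z.of_nat k)%Z in Htk by (unfold k; lia). rewrite rp_nat in Htk by assumption.
          apply Rmult_le_reg_l with kap; [assumption|].
          rewrite <- Rmult_assoc, Rinv_r, Rmult_1_l by lra.
          apply Rmult_le_reg_r with (rp r n); [assumption|]. lra. }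
        unfold A. rewrite Rmult_assoc. apply Rmult_le_compat_l; [lra|].
        apply Rle_trans with (Rpower (/ kap) (/ b) * Rpower t (/ b)).
        -- rewrite Rpower_mult_distr by assumption.
           apply Rle_trans with (Rpower (r ^ k) (/ b)).
           ++ rewrite <- Rpower_pow_base by lra. apply pow_incr. lra.
           ++ apply Rle_Rpower_l; [left; apply Rinv_0_lt_compat; lra|].
              split; [apply pow_lt; lra|assumption].
        -- assert (H1 := Rpower_pos (/ kap) (/ b)). assert (H2 := Rpower_pos (/ kap) b).
           assert (H3 := Rmax_l (Rpower t (/ b)) (Rpower t b)). assert (H4 := Rpower_pos t (/ b)). nra.
    + destruct (fr_cov HF x n) as [w [Hw Hwx]]. set (k := Z.to_nat (n - m)).
      eapply Rle_trans; [apply (Hratio (Nat.iter k pi w) w) with (q := (/ eta) ^ k)|].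
      * apply (frame_K_iter HF). assumption.
      * assumption.
      * rewrite (frame_lev_iter HF). unfold k. lia.
      * assumption.
      * assert (He := sg_iter_ge sg eta Heta Hfloor k w).
        rewrite pow_inv. apply Rmult_le_reg_l with (eta ^ k); [apply pow_lt; assumption|].
        rewrite <- Rmult_assoc, Rinv_r, Rmult_1_l; [assumption|]. apply pow_nonzero. lra.
      * assert (Hk : (/ r) ^ k <= / kap * t).
        { replace n with (m + Z.of_nat k)%Z in Htk by (unfold k; lia). rewrite rp_nat in Htk by assumption.
          assert (Hrk : 0 < r ^ k) by (apply pow_lt; lra).
          rewrite pow_inv. apply Rmult_le_reg_l with (kap * r ^ k); [apply Rmult_lt_0_compat; assumption|].
          replace (kap * r ^ k * / r ^ k) with kap by (field; lra).
          replace (kap * r ^ k * (/ kap * t)) with (t * r ^ k) by (field; lra).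
          apply Rmult_le_reg_r with (rp r m); [assumption|]. lra. }
        assert (Hir : 0 < / r) by (apply Rinv_0_lt_compat; lra).
        unfold A. rewrite Rmult_assoc. apply Rmult_le_compat_l; [lra|].
        apply Rle_trans with (Rpower (/ kap) b * Rpower t b).
        -- rewrite Rpower_mult_distr by assumption.
           apply Rle_trans with (Rpower ((/ r) ^ k) b).
           ++ rewrite <- Rpower_pow_base by assumption. apply pow_incr.
              split; [left; apply Rinv_0_lt_compat; assumption|assumption].
           ++ apply Rle_Rpower_l; [lra|]. split; [apply pow_lt; assumption|assumption].
        -- assert (H1 := Rpower_pos (/ kap) (/ b)). assert (H2 := Rpower_pos (/ kap) b).
           assert (H3 := Rmax_r (Rpower t (/ b)) (Rpower t b)). assert (H4 := Rpower_pos t b). nra.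
Qed.

Lemma cell_of_size x s : 0 < s -> exists w, K w x /\ sg w < s <= sg (pi w).
Proof.
  intros Hs. destruct (fr_cov HF x 0) as [w0 [_ Hw0]].
  assert (Hsmall : exists w, K w x /\ sg w < s).
  { destruct (pow_eventually_lt lam Hlam (s / sg w0)) as [k Hk]; [apply Rdiv_lt_0_compat; auto|].
    specialize (Hk k (Nat.le_refl k)). destruct (K_down pi K (fr_dn HF) k w0 x Hw0) as [w [Hw Hwx]].
    exists w. split; [assumption|]. eapply Rle_lt_trans; [apply (sg_iter_le sg lam Hlam Hdec k)|].
    rewrite Hw. assert (H0 := Hsg w0). apply Rmult_lt_compat_r with (r := sg w0) in Hk; [|assumption].
    replace (s / sg w0 * sg w0) with s in Hk by (field; lra). exact Hk. }
  destruct Hsmall as [w [Hw Hws]].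
  destruct (pow_eventually_lt lam Hlam (sg w / s)) as [k Hk]; [apply Rdiv_lt_0_compat; auto|].
  specialize (Hk k (Nat.le_refl k)).
  assert (Hbig : s <= sg (Nat.iter k pi w)).
  { assert (H := sg_iter_le sg lam Hlam Hdec k w).
    apply Rmult_lt_compat_r with (r := s) in Hk; [|assumption].
    replace (sg w / s * s) with (sg w) in Hk by (field; lra).
    apply Rnot_lt_le. intros Hlt. assert (0 < lam ^ k) by (apply pow_lt; lra). nra. }
  clear Hk. induction k as [|k IH]; [simpl in Hbig; lra|].
  destruct (Rle_lt_dec s (sg (Nat.iter k pi w))) as [Hle|Hlt]; [auto|].
  exists (Nat.iter k pi w). split; [apply (frame_K_iter HF); assumption|]. split; assumption.
Qed.

Variable nu : (X -> Prop) -> Rbar.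
Hypothesis Hnu_ge : forall w (A : X -> Prop), (forall x, K w x -> A x) ->
  Rbar_le (Finite (Rpower (sg w) p)) (nu A).
Hypothesis Hnu_le : forall n l (A : X -> Prop), (forall v x, lev v = n -> K v x -> A x -> In v l) ->
  Rbar_le (nu A) (Finite (lsum (fun w => Rpower (sg w) p) l)).

(** From below, a cell of weight just under [s] lies in the ball. From above, take a cell of weight
    at least [s / c]: by [Hlower] the ball stays within [D] times its scale, so it is covered by the
    [M]-neighbourhood of its ancestor [s0] levels up. *)
Theorem rho_ahlfors_regular : ahlfors_regular rho p nu.
Proof.
  destruct (ancestors_near HF D HD) as [s0 Hs0].
  set (q := Kh ^ M * ((/ eta) ^ s0 * (/ eta * / c))).
  assert (Hie : 0 < / eta) by (apply Rinv_0_lt_compat; assumption).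
  assert (Hic : 0 < / c) by (apply Rinv_0_lt_compat; assumption).
  assert (Hq : 0 < q).
  { unfold q. repeat apply Rmult_lt_0_compat; auto; apply pow_lt; lra. }
  set (C1 := Rpower (/ eta) p). set (C2 := INR (L ^ M) * Rpower q p).
  assert (HC2 : 0 <= C2) by (apply Rmult_le_pos; [apply pos_INR|left; apply Rpower_pos]).
  assert (HC1 : 0 < C1) by apply Rpower_pos.
  exists (C1 + C2). split; [lra|]. intros x s Hs _ _.
  assert (Hsp : 0 < Rpower s p) by apply Rpower_pos. split.
  - destruct (cell_of_size x s Hs) as [w [Hw [Hw1 Hw2]]].
    apply Rbar_le_trans with (Finite (Rpower (sg w) p)).
    + simpl. apply Rle_trans with (/ C1 * Rpower s p).
      * apply Rmult_le_compat_r; [lra|]. apply Rinv_le_contravar; lra.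
      * unfold C1. rewrite <- Rpower_inv, Rinv_inv, Rpower_mult_distr by assumption.
        apply Rle_Rpower_l; [lra|]. split; [apply Rmult_lt_0_compat; assumption|].
        eapply Rle_trans; [|apply Hfloor]. apply Rmult_le_compat_l; lra.
    + apply Hnu_ge. intros y Hy. unfold ball.
      assert (H := Hupper 0 w w x y (within_refl _ _ _) Hw Hy). simpl in H. lra.
  - destruct (cell_of_size x (s / c)) as [w [Hw [Hw1 Hw2]]]; [apply Rdiv_lt_0_compat; assumption|].
    set (w' := pi w) in *. assert (Hw' : K w' x) by (apply (fr_up HF); assumption).
    assert (Hfl := Hfloor w). fold w' in Hfl.
    assert (Hsw : sg w' <= / eta * / c * s).
    { apply Rmult_le_reg_l with eta; [assumption|].
      replace (eta * (/ eta * / c * s)) with (s / c) by (field; lra). lra. }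
    destruct (ball_listed adjK L (fr_deg HF) M (Nat.iter s0 pi w')) as [l [[Hd Hl] Hlen]].
    apply Rbar_le_trans with (Finite (lsum (fun w => Rpower (sg w) p) l)).
    + apply (Hnu_le (lev w' - Z.of_nat s0)). intros v y Hv Hvy Hy. apply Hl.
      destruct (K_down pi K (fr_dn HF) s0 v y Hvy) as [v' [Hv' Hvy']].
      rewrite <- Hv'. assert (El := frame_lev_iter HF s0 v'). rewrite Hv' in El.
      apply Hs0 with x y; auto; [lia|].
      apply Rnot_lt_le. intros Hlt. apply Hlower in Hlt; [|assumption]. unfold ball in Hy.
      apply Rmult_le_compat_r with (r := c) in Hw2; [|lra].
      replace (s / c * c) with s in Hw2 by (field; lra). lra.
    + simpl. apply Rle_trans with (C2 * Rpower s p); [|apply Rmult_le_compat_r; lra].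
      unfold C2. rewrite Rmult_assoc. apply lsum_le_const; [| |assumption].
      * intros v Hv. apply Hl in Hv. rewrite Rpower_mult_distr by assumption.
        apply Rle_Rpower_l; [lra|]. split; [apply Hsg|].
        apply (harnack_within adjK sg Kh HKh Hsg Hharn) in Hv.
        eapply Rle_trans; [exact Hv|]. unfold q. rewrite Rmult_assoc.
        apply Rmult_le_compat_l; [apply pow_le; lra|].
        assert (He := sg_iter_ge sg eta Heta Hfloor s0 w').
        assert (Hep : 0 < eta ^ s0) by (apply pow_lt; assumption).
        rewrite Rmult_assoc, pow_inv. apply Rmult_le_reg_l with (eta ^ s0); [assumption|].
        rewrite <- Rmult_assoc, Rinv_r, Rmult_1_l by lra. lra.
      * left. apply Rmult_lt_0_compat; apply Rpower_pos.
Qed.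

Lemma small_cells (om : nat -> T) : (forall n, pi (om (S n)) = om n) -> forall eps, 0 < eps ->
  exists n, forall x y, K (om n) x -> K (om n) y -> rho x y < eps.
Proof.
  intros Hom eps He.
  destruct (pow_eventually_lt lam Hlam (eps / sg (om 0%nat))) as [n Hn]; [apply Rdiv_lt_0_compat; auto|].
  exists n. intros x y Hx Hy. specialize (Hn n (Nat.le_refl n)).
  assert (H := Hupper 0 _ _ x y (within_refl _ _ _) Hx Hy). simpl in H.
  assert (Hit : Nat.iter n pi (om n) = om 0%nat).
  { clear Hn Hx Hy H. induction n as [|n IH]; [reflexivity|]. simpl. rewrite <- iter_swap, Hom. assumption. }
  assert (Hs := sg_iter_le sg lam Hlam Hdec n (om n)). rewrite Hit in Hs.
  assert (H0 := Hsg (om 0%nat)). apply Rmult_lt_compat_r with (r := sg (om 0%nat)) in Hn; [|assumption].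
  replace (eps / sg (om 0%nat) * sg (om 0%nat)) with eps in Hn by (field; lra). lra.
Qed.

End RegularMetric.


Lemma abspow_nonneg t p : 0 <= abspow t p.
Proof. unfold abspow. destruct (Req_EM_T t 0); [lra|]. left. apply exp_pos. Qed.

Lemma abspow_pw t p : abspow t p = pw (Rabs t) p.
Proof.
  unfold abspow. destruct (Req_EM_T t 0) as [->|H].
  - rewrite Rabs_R0, pw_zero. reflexivity.
  - rewrite pw_pos by (apply Rabs_pos_lt; assumption). reflexivity.
Qed.

Lemma abspow_zero p : abspow 0 p = 0.
Proof. rewrite abspow_pw, Rabs_R0. apply pw_zero. Qed.

Lemma Rpower_inv_exp x p : 0 < x -> p <> 0 -> Rpower (Rpower x p) (/ p) = x.
Proof. intros Hx Hp. rewrite Rpower_mult, Rinv_r, Rpower_1; auto. Qed.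

Lemma Rpower_exp_inv x p : 0 < x -> p <> 0 -> Rpower (Rpower x (/ p)) p = x.
Proof. intros Hx Hp. rewrite Rpower_mult, Rinv_l, Rpower_1; auto. Qed.

(** * Sufficiency: a regular metric from small energies *)

Section OneStep.
Context {T X : Type} {pi : T -> T} {lev : T -> Z} {K : T -> X -> Prop} {d : X -> X -> R}.
Context {r Cd c0 ct : R} {L B M : nat}.
Hypothesis HF : frame pi lev K d r Cd c0 ct L B M.
Variable phi : T.
Variables (N2 i0 : nat) (p eps delta : R) (f : T -> T -> R).
Let adjK := adj lev K.
Let N := S N2.
Let H := 2 * INR L + 2.
Let Kh := Rpower H (/ p).
Let C := INR N * Kh ^ S N.
Let A := H ^ N * Rpower C p.
Let eps1 := A * (INR (L ^ N) * eps) + delta * INR B.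
Hypothesis Hp : 0 < p.
Hypothesis Hdelta : 0 < delta.
Hypothesis Hf01 : forall w u, 0 <= f w u <= 1.
Hypothesis Hf1 : forall w u, pi u = w -> f w u = 1.
Hypothesis Hf0 : forall w u, lev (pi u) = lev w -> ~ within adjK N2 w (pi u) -> f w u = 0.
Hypothesis Henergy : forall w l, NoDup l ->
  (forall uv, In uv l -> lev (fst uv) = (lev w + 1)%Z /\ adjK (fst uv) (snd uv)) ->
  lsum (fun uv => abspow (f w (fst uv) - f w (snd uv)) p) l <= eps.
Hypothesis Heps1 : 2 * (INR (L ^ M) * (eps1 * H ^ M)) <= / 2.
Hypothesis Hi : H ^ S M * (/ 2) ^ S i0 <= delta.
Hypothesis Hgeo0 : (INR (S i0) + 1) * Cd * r < c0.
Hypothesis Hgeot : (INR (S i0) + 1) * Cd * r < ct.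
Hypothesis Htwo : Cd * Cd * r < 1.

Variables (nb ch bl : T -> list T).
Hypothesis Hnb : forall w, listed (within adjK 1 w) (nb w) /\ (length (nb w) <= L)%nat.
Hypothesis Hch : forall w, listed (fun v => pi v = w) (ch w) /\ (length (ch w) <= B)%nat.
Hypothesis Hbl : forall w, listed (within adjK N w) (bl w) /\ (length (bl w) <= L ^ N)%nat.

Let Hr := fr_r HF.

Lemma degree_ge_one : (1 <= L)%nat.
Proof.
  destruct (Hnb phi) as [[_ Hin] Hlen].
  assert (Hphi : In phi (nb phi)) by (apply Hin, within_refl).
  destruct (nb phi); [destruct Hphi|simpl in Hlen; lia].
Qed.

Let LR : 1 <= INR L := le_INR 1 L degree_ge_one.

Let H1 : 1 <= H.
Proof. unfold H. assert (HH := LR). lra. Qed.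

Lemma child_dist v u x y i : within adjK i v u -> K v x -> K u y ->
  d x y <= (INR i + 1) * Cd * r * rp r (lev (pi v)).
Proof.
  intros Hvu Hx Hy. eapply Rle_trans; [apply (within_dist HF i v u x y Hvu Hx Hy)|].
  rewrite (fr_lev HF). rewrite <- (rp_pred r Hr (lev v)). lra.
Qed.

Lemma step_separation v u : within adjK (S i0) v u -> within adjK M (pi v) (pi u).
Proof.
  intros Hvu. destruct (cell_inhabited HF v) as [x Hx]. destruct (cell_inhabited HF u) as [y Hy].
  apply (fr_near HF) with x y.
  - rewrite !(fr_lev HF). apply within_adj_lev in Hvu. lia.
  - apply (fr_up HF). assumption.
  - apply (fr_up HF). assumption.
  - eapply Rle_lt_trans; [apply (child_dist v u x y (S i0)); assumption|].
    apply Rmult_lt_compat_r; [apply (frame_rp_pos HF)|assumption].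
Qed.

Lemma deep_child w : exists z, forall v, within adjK (S i0) z v -> pi v = w.
Proof.
  destruct (fr_deep HF w) as [x [Hx Hdeep]]. destruct (fr_dn HF w x Hx) as [z [Hz Hzx]].
  exists z. intros v Hv. destruct (cell_inhabited HF v) as [y Hy].
  apply (Hdeep y).
  - rewrite <- Hz. eapply Rle_lt_trans; [apply (child_dist z v x y (S i0)); assumption|].
    apply Rmult_lt_compat_r; [apply (frame_rp_pos HF)|assumption].
  - rewrite <- Hz, !(fr_lev HF). apply within_adj_lev in Hv. lia.
  - apply (fr_up HF). assumption.
Qed.

(** An only child would have the same cell as its parent, but its diameter is at most [Cd r] times
    the parent's scale, too small by [Cd Cd r < 1]. The sibling is what makes the weights decay
    strictly. *)
Lemma sibling u : exists u', pi u' = pi u /\ u' <> u.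
Proof.
  apply NNPP. intros Hn. set (w := pi u) in *.
  destruct (fr_two HF w) as [x [y [Hx [Hy Hxy]]]].
  assert (Hall : forall z, K w z -> K u z).
  { intros z Hz. destruct (fr_dn HF w z Hz) as [v [Hv Hvz]].
    destruct (classic (v = u)) as [->|Hne]; [assumption|]. destruct Hn. exists v. auto. }
  assert (Hd := fr_diam HF u x y (Hall x Hx) (Hall y Hy)).
  assert (Hpw := frame_rp_pos HF (lev w)). assert (HCd := fr_Cd HF).
  assert (E := rp_pred r Hr (lev u)). rewrite <- (fr_lev HF) in E. fold w in E. rewrite <- E in Hd.
  assert (rp r (lev w) <= Cd * (Cd * (rp r (lev w) * r))) by nra. nra.
Qed.

(** The prescribed lower bound for [mu u / mu (pi u)]. In the factor [A = H^N C^p], [C^p] matches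
    the constant in the gradient condition of the chain metric and [H^N] compares [mu w] with the
    mass of the parent of [u]. *)
Definition density (u : T) : R :=
  A * lsum (fun w => lsum (fun u' => abspow (f w u - f w u') p) (nb u)) (bl (pi u)) + delta.

Let Kh1 : 1 <= Kh.
Proof.
  unfold Kh. rewrite <- (Rpower_O H) by lra. apply Rle_Rpower; [lra|].
  left. apply Rinv_0_lt_compat. assumption.
Qed.

Let C_pos : 0 < C.
Proof.
  unfold C. apply Rmult_lt_0_compat; [apply lt_0_INR; unfold N; lia|]. apply pow_lt.
  assert (HH := Kh1). lra.
Qed.

Let A_pos : 0 < A.
Proof. unfold A. apply Rmult_lt_0_compat; [apply pow_lt; lra|apply Rpower_pos]. Qed.

Lemma density_ge u : delta <= density u.
Proof.
  unfold density. assert (HA := A_pos).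
  assert (0 <= lsum (fun w => lsum (fun u' => abspow (f w u - f w u') p) (nb u)) (bl (pi u))).
  { apply lsum_nonneg. intros w _. apply lsum_nonneg. intros u' _. apply abspow_nonneg. }
  nra.
Qed.

Lemma density_ge_grad u u' w : adjK u u' -> within adjK N (pi u) w ->
  A * abspow (f w u' - f w u) p <= density u.
Proof.
  intros Hu Hw. unfold density. assert (HA := A_pos).
  assert (Hle : abspow (f w u' - f w u) p <=
    lsum (fun w => lsum (fun u' => abspow (f w u - f w u') p) (nb u)) (bl (pi u))).
  { apply Rle_trans with (lsum (fun u' => abspow (f w u - f w u') p) (nb u)).
    - rewrite abspow_pw, Rabs_minus_sym, <- abspow_pw.
      apply (lsum_in_le (fun u' => abspow (f w u - f w u') p)).
      + apply (proj2 (proj1 (Hnb u))), within_edge. assumption.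
      + intros. apply abspow_nonneg.
    - apply (lsum_in_le (fun w => lsum (fun u' => abspow (f w u - f w u') p) (nb u))).
      + apply (proj2 (proj1 (Hbl (pi u)))). assumption.
      + intros. apply lsum_nonneg. intros. apply abspow_nonneg. }
  apply Rmult_le_compat_l with (r := A) in Hle; lra.
Qed.

(** After exchanging sums, for each of the at most [L^N] cells [w'] near [w] the terms form a part
    of the energy of [f w']. *)
Lemma density_sum w : lsum density (ch w) <= eps1.
Proof.
  unfold density, eps1. rewrite lsum_plus, lsum_scal. assert (HA := A_pos).
  destruct (Hch w) as [[Hcd Hcin] Hclen]. destruct (Hbl w) as [[Hbd Hbin] Hblen].
  apply Rplus_le_compat.
  - apply Rmult_le_compat_l; [lra|].
    rewrite (lsum_ext _ (fun u => lsum (fun w' => lsum (fun u' => abspow (f w' u - f w' u') p) (nb u)) (bl w))).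
    + rewrite lsum_swap. apply lsum_le_const; [| |assumption].
      * intros w' Hw'. apply Hbin in Hw'. apply within_adj_lev in Hw'.
        (* The list [nb u] contains [u] itself; these pairs are dropped, since the energy bound is
           about edges, and they contribute 0. *)
        set (pairs := flat_map (fun u => map (fun u' => (u, u')) (cfilter (fun u' => u' <> u) (nb u))) (ch w)).
        eapply Rle_trans; [|apply (Henergy w' pairs)].
        -- unfold pairs. rewrite lsum_flat_map. apply lsum_le. intros u Hu. rewrite lsum_map.
           rewrite (lsum_cfilter _ (fun u' => u' <> u)). simpl fst. simpl snd.
           assert (lsum (fun u' => abspow (f w' u - f w' u') p) (cfilter (fun u' => ~ u' <> u) (nb u)) = 0); [|lra].
           rewrite (lsum_ext _ (fun _ => 0)); [rewrite lsum_const; lra|].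
           intros u' Hu'. apply in_cfilter in Hu'. destruct Hu' as [_ Hne]. apply NNPP in Hne. subst u'.
           rewrite Rminus_diag. apply abspow_zero.
        -- apply nodup_flat_map; [assumption| |].
           ++ intros u _. apply Injective_map_NoDup; [intros a b E; congruence|].
              apply nodup_cfilter, Hnb.
           ++ intros u u' uv _ _ Hu Hu'. apply in_map_iff in Hu, Hu'.
              destruct Hu as [a [<- _]], Hu' as [b [E _]]. congruence.
        -- intros uv Huv. apply in_flat_map in Huv. destruct Huv as [u [Hu Huv]].
           apply in_map_iff in Huv. destruct Huv as [u' [<- Hu']]. apply in_cfilter in Hu'.
           destruct Hu' as [Hu' Hne]. simpl. apply Hcin in Hu. split.
           ++ rewrite <- Hw', <- Hu, (fr_lev HF). lia.
           ++ apply (proj2 (proj1 (Hnb u))) in Hu'. apply within_one in Hu'.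
              destruct Hu' as [E|]; [congruence|assumption].
      * apply Rle_trans with (2 := Henergy w nil (NoDup_nil _) (fun uv (h : In uv nil) => match h with end)).
        unfold lsum. simpl. lra.
    + intros u Hu. apply Hcin in Hu. rewrite Hu. reflexivity.
  - rewrite Rmult_comm. apply lsum_le_const; [intros; lra|lra|assumption].
Qed.

Lemma eps1_le : eps1 <= / 4.
Proof.
  assert (HL : 1 <= INR (L ^ M)).
  { rewrite pow_INR. apply pow_R1_Rle. apply LR. }
  assert (HM : 1 <= H ^ M) by (apply pow_R1_Rle; apply H1).
  assert (Hs := density_sum phi).
  assert (H0 : 0 <= lsum density (ch phi)).
  { apply lsum_nonneg. intros u _. assert (Hd := density_ge u). lra. }
  assert (eps1 <= eps1 * H ^ M) by nra. assert (eps1 * H ^ M <= INR (L ^ M) * (eps1 * H ^ M)) by nra. lra.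
Qed.

Lemma density_le u : density u <= / 4.
Proof.
  eapply Rle_trans; [|apply eps1_le]. eapply Rle_trans; [|apply (density_sum (pi u))].
  apply lsum_in_le; [apply (proj2 (proj1 (Hch _))); reflexivity|].
  intros v _. assert (Hd := density_ge v). lra.
Qed.

Theorem regular_metric_of_step : exists rho nu,
  is_metric rho /\ borel_measure rho nu /\ ahlfors_regular rho p nu /\ quasisymmetric d rho.
Proof.
  destruct (fun_choice _ deep_child) as [z Hz].
  destruct (invariant_mass pi lev adjK) with (nb := nb) (ch := ch) (L := L) (M := M)
    (i0 := i0) (e := density) (delta := delta) (eps := eps1) (z := z) as [mu [[Hmu Hmuh] [Hadd Hmue]]];
    try assumption.
  { apply adj_sym. }
  { intros a b Hab. apply within_one. apply (frame_within_pi HF), within_edge. assumption. }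
  { intros a b Hab. apply Hab. }
  { apply (fr_lev HF). }
  { apply (fr_anc HF). }
  { apply (fr_cnt HF). }
  { apply degree_ge_one. }
  { apply Hch. }
  { apply (ball_listed adjK L (fr_deg HF) M). }
  { intros u. assert (Ha := density_ge u). assert (Hb := density_le u). lra. }
  { apply density_sum. }
  { apply step_separation. }
  fold H in Hmuh.
  assert (Hip : 0 < / p) by (apply Rinv_0_lt_compat; assumption).
  set (sg := fun w => Rpower (mu w) (/ p)).
  set (lam := Rpower (1 - delta) (/ p)). set (eta := Rpower delta (/ p)).
  assert (Hd4 : delta <= / 4).
  { eapply Rle_trans; [apply (density_ge phi)|apply density_le]. }
  assert (Hsg : forall w, 0 < sg w) by (intros; apply Rpower_pos).
  assert (Hscale : forall q w v, 0 < q -> mu v <= q * mu w -> sg v <= Rpower q (/ p) * sg w).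
  { intros q w v Hq Hle. unfold sg. rewrite Rpower_mult_distr by auto.
    apply Rle_Rpower_l; [lra|]. split; auto. }
  assert (Hharn : forall w v, adjK w v -> sg v <= Kh * sg w).
  { intros w v Hwv. apply Hscale; [lra|auto]. }
  assert (Hlam : 0 < lam < 1).
  { split; [apply Rpower_pos|].
    assert (Hln : ln (1 - delta) < 0) by (rewrite <- ln_1; apply ln_increasing; lra).
    assert (Hneg : / p * ln (1 - delta) < 0) by nra.
    apply exp_increasing in Hneg. rewrite exp_0 in Hneg. exact Hneg. }
  assert (Hdec : forall u, sg u <= lam * sg (pi u)).
  (* The sibling keeps at least the fraction [delta] of the mass of the parent, so [u] gets at most
     [1 - delta]. *)
  { intros u. apply Hscale; [lra|]. destruct (sibling u) as [u' [Hu' Hne]].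
    assert (Hs : lsum mu (u :: u' :: nil) <= lsum mu (ch (pi u))).
    { apply lsum_incl; [repeat constructor; simpl; intuition congruence| |intros; left; apply Hmu].
      intros v [<-|[<-|[]]]; apply (proj2 (proj1 (Hch _))); auto. }
    rewrite Hadd in Hs. unfold lsum in Hs. simpl in Hs.
    assert (He := Hmue u'). rewrite Hu' in He. assert (Hg := density_ge u'). assert (Hpp := Hmu (pi u)). nra. }
  assert (Hfloor : forall u, eta * sg (pi u) <= sg u).
  { intros u. unfold eta, sg. rewrite Rpower_mult_distr by auto. apply Rle_Rpower_l; [lra|].
    split; [apply Rmult_lt_0_compat; auto|]. eapply Rle_trans; [|apply Hmue].
    apply Rmult_le_compat_r; [left; apply Hmu|apply density_ge]. }
  assert (Hgrad : forall u u' w, adjK u u' -> within adjK N (pi u) w ->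
    C * sg w * Rabs (f w u' - f w u) <= sg u).
  { intros u u' w Hu Hw. assert (Hg := density_ge_grad u u' w Hu Hw).
    assert (Hmw : mu w <= H ^ N * mu (pi u)).
    { apply (harnack_within adjK mu H H1 Hmu Hmuh). assumption. }
    rewrite abspow_pw in Hg. set (a := Rabs (f w u' - f w u)) in *.
    destruct (Rle_lt_or_eq_dec 0 a) as [Ha|<-]; [apply Rabs_pos| |].
    - rewrite pw_pos in Hg by assumption. assert (HCp := C_pos).
      assert (E : C * sg w * a = Rpower (Rpower C p * Rpower a p * mu w) (/ p)).
      { rewrite <- !Rpower_mult_distr; auto; try apply Rpower_pos.
        - rewrite !Rpower_inv_exp by lra. unfold sg. ring.
        - apply Rmult_lt_0_compat; apply Rpower_pos. }
      rewrite E. apply Rle_Rpower_l; [lra|]. split.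
      + repeat apply Rmult_lt_0_compat; auto; apply Rpower_pos.
      + eapply Rle_trans; [|apply Hmue].
        apply Rle_trans with (Rpower C p * Rpower a p * (H ^ N * mu (pi u))).
        * apply Rmult_le_compat_l; [|assumption]. left. apply Rmult_lt_0_compat; apply Rpower_pos.
        * apply Rle_trans with (A * Rpower a p * mu (pi u)); [unfold A; right; ring|].
          apply Rmult_le_compat_r; [left; apply Hmu|assumption].
    - rewrite Rmult_0_r. left. apply Hsg. }
  assert (Heta : 0 < eta) by apply Rpower_pos.
  set (rh := @rho T X K sg).
  assert (Hmet : is_metric rh).
  { apply (rho_is_metric HF N2 f sg Kh lam eta); assumption. }
  assert (Hup : forall n w v x y, within adjK n w v -> K w x -> K v y ->
    rh x y <= (INR n + 1) * Kh ^ n * sg w).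
  { intros. eapply (rho_within HF sg Kh); eassumption. }
  destruct (rho_lower HF N2 f sg Kh lam eta) as [D [c [HD [Hc Hlow]]]]; try assumption.
  destruct (ends_measure HF ch (fun w => proj1 (Hch w)) mu Hmu Hadd rh) as [nu [Hnu [Hge Hle]]].
  { eapply (@small_cells T X pi lev K sg Kh lam); eassumption. }
  exists rh, nu. split; [assumption|]. split; [assumption|].
  (* This is where regularity of exponent exactly [p] arises: the [p]-th power of the weight is the
     additive mass. *)
  assert (Emu : forall w, Rpower (sg w) p = mu w) by (intros; apply Rpower_exp_inv; auto; lra).
  split.
  - apply (rho_ahlfors_regular HF sg Kh lam eta p) with (D := D) (c := c); try assumption.
    + intros w A0 HA0. rewrite Emu. apply Hge. assumption.
    + intros n l A0 HA0. rewrite (lsum_ext _ mu) by (intros; apply Emu). apply (Hle n). assumption.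
  - apply (rho_quasisymmetric HF sg Kh lam eta) with (D := D) (c := c); assumption.
Qed.

End OneStep.


(** * The choice of the depth k and of the constants *)

(** Write [r^k = s^k s^k] with [s] the square root of [r]: by Bernoulli's inequality one factor
    absorbs the linear growth, and the other tends to 0. *)
Lemma linear_times_pow_small r a b c : 0 < r < 1 -> 0 <= a -> 0 <= b -> 0 < c ->
  exists k0 : nat, forall k, (k0 <= k)%nat -> (a + b * INR k) * r ^ k < c.
Proof.
  intros Hr Ha Hb Hc. set (s := sqrt r).
  assert (Hs0 : 0 < s) by (apply sqrt_lt_R0; lra).
  assert (Hss : s * s = r) by (apply sqrt_sqrt; lra).
  assert (Hs : 0 < s < 1) by (split; [assumption|nra]).
  assert (His : 0 < / s - 1).
  { assert (1 < / s); [|lra]. rewrite <- Rinv_1. apply Rinv_lt_contravar; lra. }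
  set (q := a + b * / (/ s - 1)).
  assert (Hiq : 0 < / (/ s - 1)) by (apply Rinv_0_lt_compat; assumption).
  assert (Hq : 0 <= q) by (unfold q; nra).
  destruct (pow_eventually_lt s Hs (c / (q + 1))) as [k0 Hk0]; [apply Rdiv_lt_0_compat; lra|].
  exists k0. intros k Hk. specialize (Hk0 k Hk). rewrite <- Hss, Rpow_mult_distr.
  assert (Hsk : 0 < s ^ k) by (apply pow_lt; assumption).
  assert (Hsk1 : s ^ k <= 1) by (rewrite <- (pow1 k); apply pow_incr; lra).
  assert (Hbern : INR k * (/ s - 1) * s ^ k <= 1).
  { assert (HB := poly k (/ s - 1) His). replace (1 + (/ s - 1)) with (/ s) in HB by ring.
    rewrite pow_inv in HB. apply Rmult_le_compat_r with (r := s ^ k) in HB; [|lra].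
    rewrite Rinv_l in HB by lra. lra. }
  assert (Hks : INR k * s ^ k <= / (/ s - 1)).
  { apply Rmult_le_reg_r with (/ s - 1); [assumption|]. rewrite Rinv_l by lra. lra. }
  assert (Hle : (a + b * INR k) * s ^ k <= q).
  { unfold q. rewrite Rmult_plus_distr_r. apply Rplus_le_compat; [nra|].
    rewrite Rmult_assoc. apply Rmult_le_compat_l; assumption. }
  rewrite <- Rmult_assoc. apply Rle_lt_trans with (q * s ^ k); [apply Rmult_le_compat_r; lra|].
  apply Rle_lt_trans with ((q + 1) * s ^ k); [nra|].
  apply Rmult_lt_compat_l with (r := q + 1) in Hk0; [|lra].
  replace ((q + 1) * (c / (q + 1))) with c in Hk0 by (field; lra). exact Hk0.
Qed.

(** Admissible functions of small energy need not take values in [[0,1]], which the potential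
    requires; truncation does not increase the energy. *)
Definition clamp (t : R) : R := Rmax 0 (Rmin t 1).

Lemma clamp_bounds t : 0 <= clamp t <= 1.
Proof. unfold clamp. split; [apply Rmax_l|]. apply Rmax_lub; [lra|apply Rmin_r]. Qed.

Lemma clamp_contraction s t : Rabs (clamp s - clamp t) <= Rabs (s - t).
Proof.
  unfold clamp, Rmax, Rmin. destruct (Rle_dec s 1), (Rle_dec t 1); repeat destruct (Rle_dec _ _);
    unfold Rabs; repeat destruct (Rcase_abs _); lra.
Qed.

Lemma clamp_one : clamp 1 = 1.
Proof. unfold clamp. rewrite Rmin_left, Rmax_right; lra. Qed.

Lemma clamp_zero : clamp 0 = 0.
Proof. unfold clamp. rewrite Rmin_left, Rmax_left; lra. Qed.

Lemma pow_two_ge n : INR n <= 2 ^ n.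
Proof.
  induction n as [|n IH]; [simpl; lra|]. rewrite S_INR. simpl.
  assert (1 <= 2 ^ n) by (apply pow_R1_Rle; lra). lra.
Qed.

Theorem regular_metric_of_energy {T X : Type} (pi : T -> T) (lev : T -> Z) (K : T -> X -> Prop)
  (d : X -> X -> R) (r Cd c0 ct : R) (L B M N2 : nat) (p : R) (phi : T) :
  frame pi lev K d r Cd c0 ct L B M -> 0 < p ->
  (forall eps k0, 0 < eps -> exists k, (k0 <= k)%nat /\ forall w, exists f : T -> R,
    (forall v, Nat.iter k pi v = w -> f v = 1) /\
    (forall v, lev v = (lev w + Z.of_nat k)%Z -> ~ within (adj lev K) N2 w (Nat.iter k pi v) -> f v = 0) /\
    forall l, NoDup l ->
      (forall uv, In uv l -> lev (fst uv) = (lev w + Z.of_nat k)%Z /\ adj lev K (fst uv) (snd uv)) ->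
      lsum (fun uv => abspow (f (fst uv) - f (snd uv)) p) l <= eps) ->
  exists rho nu,
  is_metric rho /\ borel_measure rho nu /\ ahlfors_regular rho p nu /\ quasisymmetric d rho.
Proof.
  intros HF Hp Hen. assert (Hr := fr_r HF). assert (HCd := fr_Cd HF).
  set (N := S N2). set (H := 2 * INR L + 2). set (Kh := Rpower H (/ p)).
  set (C := INR N * Kh ^ S N). set (A := H ^ N * Rpower C p).
  assert (H1 : 1 <= H) by (unfold H; assert (HL := pos_INR L); lra).
  assert (HA : 0 < A) by (apply Rmult_lt_0_compat; [apply pow_lt; lra|apply Rpower_pos]).
  set (Q := INR (S L ^ M) * H ^ M).
  assert (HQ : 1 <= Q).
  { unfold Q. rewrite pow_INR. assert (1 <= INR (S L) ^ M).
    { apply pow_R1_Rle. apply (le_INR 1). lia. }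
    assert (1 <= H ^ M) by (apply pow_R1_Rle; assumption). nra. }
  (* [tau] is the admissible value of the total density of the children: half of it is for the
     gradients, through [eps], and half for the floor [delta]. *)
  set (tau := / (4 * Q)). assert (Htau : 0 < tau) by (apply Rinv_0_lt_compat; lra).
  set (V := A * INR (S L ^ N)).
  assert (HV : 0 < V).
  { apply Rmult_lt_0_compat; [assumption|]. apply lt_0_INR. apply Nat.neq_0_lt_0, Nat.pow_nonzero. lia. }
  set (eps := tau / (2 * V)). assert (Heps : 0 < eps) by (apply Rdiv_lt_0_compat; lra).
  assert (Hhalf : 0 < / 2 < 1) by lra.
  assert (HHM : 0 < H ^ S M) by (apply pow_lt; lra).
  destruct (pow_eventually_lt (/ 2) Hhalf (tau / 2 / H ^ S M)) as [a0 Ha0].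
  { apply Rdiv_lt_0_compat; lra. }
  set (B' := S B).
  (* The slope [B'] gives [2^-(B' k) <= B'^-k], because [B' <= 2^B'], so the truncation error stays
     below [delta]; [a0] takes care of the factors that do not depend on [k]. *)
  set (idx := fun k => (a0 + B' * k)%nat).
  assert (Hidx : forall k, INR (S (idx k)) + 1 = INR a0 + 2 + INR B' * INR k).
  { intros k. unfold idx. rewrite S_INR, plus_INR, mult_INR. lra. }
  assert (Hgeo : forall c, 0 < c -> exists k0, forall k, (k0 <= k)%nat ->
    (INR (S (idx k)) + 1) * Cd * r ^ k < c).
  { intros c Hc. destruct (linear_times_pow_small r (INR a0 + 2) (INR B') (c / Cd) Hr) as [k0 Hk0].
    - assert (HH := pos_INR a0). lra.
    - apply pos_INR.
    - apply Rdiv_lt_0_compat; assumption.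
    - exists k0. intros k Hk. specialize (Hk0 k Hk). rewrite Hidx.
      apply Rmult_lt_compat_l with (r := Cd) in Hk0; [|assumption].
      replace (Cd * (c / Cd)) with c in Hk0 by (field; lra). lra. }
  destruct (Hgeo c0 (fr_c0 HF)) as [k1 Hk1]. destruct (Hgeo ct (fr_ct HF)) as [k2 Hk2].
  destruct (pow_eventually_lt r Hr (/ (Cd * Cd))) as [k3 Hk3].
  { apply Rinv_0_lt_compat. nra. }
  destruct (Hen eps (1 + k1 + k2 + k3)%nat Heps) as [k [Hk Hfk]].
  assert (Hk1' : (1 <= k)%nat) by lia.
  destruct (fun_choice _ Hfk) as [f Hf].
  assert (HF' := frame_subT pi lev K d r Cd c0 ct L B M HF k Hk1').
  set (pi' := subT_pi pi lev K d r Cd c0 ct L B M HF k Hk1') in *.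
  set (lev' := subT_lev lev k) in *.
  set (K' := subT_K lev K k) in *.
  destruct (cell_inhabited HF phi) as [x Hx].
  destruct (fr_cov HF' x 0) as [phi' _].
  destruct (fun_choice (fun w l => listed (within (adj lev' K') 1 w) l /\ (length l <= L)%nat) (fr_deg HF'))
    as [nb Hnb].
  destruct (fun_choice (fun w l => listed (fun v => pi' v = w) l /\ (length l <= B ^ k)%nat) (fr_chl HF'))
    as [ch Hch].
  destruct (fun_choice (fun w l => listed (within (adj lev' K') N w) l /\ (length l <= L ^ N)%nat)
    (ball_listed _ L (fr_deg HF') N)) as [bl Hbl].
  (* A node of the subtree has at most [B^k] children, so the floors of the children sum to at most
     [tau / 2]. *)
  set (delta := tau / (2 * INR B' ^ k)).
  assert (HBk : 0 < INR B' ^ k) by (apply pow_lt, lt_0_INR; unfold B'; lia).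
  assert (Hdelta : 0 < delta) by (apply Rdiv_lt_0_compat; lra).
  apply (regular_metric_of_step HF' phi' N2 (idx k) p eps delta
    (fun w u => clamp (f (subT_val lev k w) (subT_val lev k u)))) with (nb := nb) (ch := ch) (bl := bl);
    try assumption.
  - intros w u. apply clamp_bounds.
  - intros w u Hu. rewrite (proj1 (Hf _)); [apply clamp_one|]. rewrite <- Hu. reflexivity.
  - intros w u Hl Hn. rewrite (proj1 (proj2 (Hf _))); [apply clamp_zero| |].
    + assert (E := fr_lev HF' u). rewrite (subT_lev_val lev k Hk1' u), (subT_lev_val lev k Hk1' w).
      fold lev' in E |- *. rewrite Hl in E. rewrite E. lia.
    + intros Hc. apply Hn. apply (subT_within lev K k Hk1'). exact Hc.
  - intros w l Hd Hl.
    eapply Rle_trans; [|apply (proj2 (proj2 (Hf (subT_val lev k w)))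
      (map (fun uv => (subT_val lev k (fst uv), subT_val lev k (snd uv))) l))].
    + rewrite lsum_map. apply lsum_le. intros uv _. rewrite !abspow_pw. apply pw_le; [assumption|].
      split; [apply Rabs_pos|apply clamp_contraction].
    + apply Injective_map_NoDup; [|assumption]. intros [a b] [a' b'] E. simpl in E. injection E as E1 E2.
      f_equal; apply subT_val_inj; assumption.
    + intros uv Huv. apply in_map_iff in Huv. destruct Huv as [[a b] [<- Hab]].
      destruct (Hl _ Hab) as [Hla Hadj]. simpl in *. split.
      * rewrite !(subT_lev_val lev k Hk1'). fold lev'. rewrite Hla. lia.
      * apply (subT_adj lev K k Hk1'). assumption.
  - fold H.
    assert (HLM : INR (L ^ M) <= INR (S L ^ M)) by (apply le_INR, Nat.pow_le_mono_l; lia).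
    assert (HLN : INR (L ^ N) <= INR (S L ^ N)) by (apply le_INR, Nat.pow_le_mono_l; lia).
    set (e1 := _ * (INR (L ^ S N2) * eps) + delta * INR (B ^ k)).
    assert (He1 : e1 <= tau).
    { unfold e1. replace tau with (tau / 2 + tau / 2) by field. apply Rplus_le_compat.
      - fold N. fold H. fold Kh. fold C. fold A. apply Rle_trans with (A * (INR (S L ^ N) * eps)).
        + apply Rmult_le_compat_l; [lra|]. apply Rmult_le_compat_r; lra.
        + unfold eps, V. right. field. fold V in HV. unfold V in HV. split; [|nra].
          intros E0. rewrite E0 in HV. lra.
      - assert (HBB : INR (B ^ k) <= INR B' ^ k).
        { rewrite <- pow_INR. apply le_INR, Nat.pow_le_mono_l. unfold B'. lia. }
        apply Rle_trans with (delta * INR B' ^ k); [apply Rmult_le_compat_l; lra|].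
        unfold delta. right. field. lra. }
    assert (HHM' : 0 < H ^ M) by (apply pow_lt; lra).
    apply Rle_trans with (2 * (INR (S L ^ M) * (tau * H ^ M))).
    + apply Rmult_le_compat_l; [lra|].
      apply Rle_trans with (INR (L ^ M) * (tau * H ^ M)).
      * apply Rmult_le_compat_l; [apply pos_INR|]. apply Rmult_le_compat_r; lra.
      * apply Rmult_le_compat_r; [|assumption]. left. apply Rmult_lt_0_compat; assumption.
    + replace (2 * (INR (S L ^ M) * (tau * H ^ M))) with (2 * tau * Q) by (unfold Q; ring).
      unfold tau. right. field. lra.
  - fold H. unfold delta.
    specialize (Ha0 (S a0) ltac:(lia)).
    replace (S (idx k)) with (S a0 + B' * k)%nat by (unfold idx; lia).
    rewrite pow_add, pow_mult.
    assert (Hb : ((/ 2) ^ B') ^ k <= / INR B' ^ k).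
    { rewrite pow_inv, pow_inv, <- pow_mult. apply Rinv_le_contravar; [assumption|].
      rewrite pow_mult. apply pow_incr. split; [apply pos_INR|apply pow_two_ge]. }
    assert (Ha : H ^ S M * (/ 2) ^ S a0 <= tau / 2).
    { apply Rmult_lt_compat_l with (r := H ^ S M) in Ha0; [|assumption].
      replace (H ^ S M * (tau / 2 / H ^ S M)) with (tau / 2) in Ha0 by (field; lra). lra. }
    rewrite <- Rmult_assoc.
    apply Rle_trans with (tau / 2 * / INR B' ^ k).
    + apply Rmult_le_compat; [| |assumption|assumption].
      * apply Rmult_le_pos; [lra|]. apply pow_le. lra.
      * apply pow_le, pow_le. lra.
    + right. field. lra.
  - apply Hk1. lia.
  - apply Hk2. lia.
  - specialize (Hk3 k ltac:(lia)). assert (HCC : 0 < Cd * Cd) by nra.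
    apply Rmult_lt_compat_l with (r := Cd * Cd) in Hk3; [|assumption].
    rewrite Rinv_r in Hk3 by lra. exact Hk3.
Qed.


(** * Necessity: energies bounded by a quasisymmetric regular metric *)

Section HomeoNonneg.
Variable theta : R -> R.
Hypothesis Hth : homeo_nonneg theta.

Let ext (t : R) : R := theta (Rmax 0 t).

Lemma homeo_ext_continuous t : continuity_pt ext t.
Proof.
  intros e He. destruct Hth as [_ [Hc _]].
  destruct (Hc (Rmax 0 t) (Rmax_l 0 t) e He) as [delta [Hd H]].
  exists delta. split; [assumption|]. intros u [_ Hu]. simpl in *. unfold Rdist in *. unfold ext.
  apply H; [apply Rmax_l|]. eapply Rle_lt_trans; [|exact Hu].
  unfold Rmax, Rabs. repeat destruct (Rle_dec _ _); repeat destruct (Rcase_abs _); lra.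
Qed.

Lemma homeo_bounded t : exists C, 0 < C /\ forall u, 0 <= u <= t -> theta u <= C.
Proof.
  destruct (Rle_lt_dec 0 t) as [Ht|Ht].
  - destruct (continuity_ab_maj ext 0 t Ht) as [m [Hm _]]; [intros; apply homeo_ext_continuous|].
    exists (Rmax 1 (ext m)). split; [apply Rlt_le_trans with 1; [lra|apply Rmax_l]|].
    intros u Hu. specialize (Hm u Hu). unfold ext at 1 in Hm. rewrite Rmax_right in Hm by lra.
    eapply Rle_trans; [exact Hm|apply Rmax_r].
  - exists 1. split; [lra|]. intros; lra.
Qed.

(** If [theta] vanished at some [a > 0] instead, the intermediate value theorem would give a small
    positive value on both sides of [a], against injectivity. *)
Lemma homeo_zero : theta 0 = 0.
Proof.
  destruct Hth as [Hpos [_ [th' [_ Hinv]]]]. destruct (Hinv 0 (Rle_refl 0)) as [Ha [_ E]].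
  set (a := th' 0) in *. destruct (Rle_lt_or_eq_dec 0 a Ha) as [Hap|E0]; [exfalso|congruence].
  assert (Hinj : forall s t, 0 <= s -> 0 <= t -> theta s = theta t -> s = t).
  { intros s t Hs Ht Est. destruct (Hinv s Hs) as [_ [E1 _]]. destruct (Hinv t Ht) as [_ [E2 _]].
    rewrite <- E1, <- E2, Est. reflexivity. }
  assert (H0 : 0 < theta 0).
  { destruct (Rle_lt_or_eq_dec 0 (theta 0)) as [H|H]; [apply Hpos; lra|assumption|].
    assert (0 = a); [apply Hinj; lra|lra]. }
  assert (H2 : 0 < theta (2 * a)).
  { destruct (Rle_lt_or_eq_dec 0 (theta (2 * a))) as [H|H]; [apply Hpos; lra|assumption|].
    assert (2 * a = a); [apply Hinj; lra|lra]. }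
  set (m := Rmin (theta 0) (theta (2 * a)) / 2).
  assert (Hm : 0 < m /\ m < theta 0 /\ m < theta (2 * a)).
  { unfold m, Rmin. destruct (Rle_dec (theta 0) (theta (2 * a))); lra. }
  assert (Eext : forall t, 0 <= t -> ext t = theta t).
  { intros t Ht. unfold ext. rewrite Rmax_right by lra. reflexivity. }
  destruct (IVT_gen ext 0 a m) as [t1 [Ht1 E1]]; [intros t; apply homeo_ext_continuous| |].
  { rewrite !Eext by lra. rewrite E. rewrite Rmin_right, Rmax_left by lra. lra. }
  destruct (IVT_gen ext a (2 * a) m) as [t2 [Ht2 E2]]; [intros t; apply homeo_ext_continuous| |].
  { rewrite !Eext by lra. rewrite E. rewrite Rmin_left, Rmax_right by lra. lra. }
  rewrite Rmin_left, Rmax_right in Ht1, Ht2 by lra. rewrite Eext in E1, E2 by lra.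
  assert (t1 = t2) by (apply Hinj; lra). subst t2. assert (t1 = a) by lra. subst t1. lra.
Qed.

Lemma homeo_small e : 0 < e -> exists delta, 0 < delta /\ forall u, 0 <= u <= delta -> theta u <= e.
Proof.
  intros He. destruct Hth as [_ [Hc _]]. destruct (Hc 0 (Rle_refl 0) e He) as [delta [Hd H]].
  exists (delta / 2). split; [lra|]. intros u Hu. specialize (H u). rewrite homeo_zero in H.
  rewrite !Rminus_0_r, (Rabs_pos_eq u) in H by lra.
  assert (Hlt : Rabs (theta u) < e) by (apply H; lra). apply Rabs_def2 in Hlt. lra.
Qed.

End HomeoNonneg.

Lemma quasisymmetric_refl {X : Type} (d : X -> X -> R) : quasisymmetric d d.
Proof.
  exists (fun t => t). assert (Hc : cont_nonneg (fun t => t)).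
  { intros t Ht e He. exists e. auto. }
  split; [|intros; lra]. split; [auto|]. split; [assumption|]. exists (fun t => t). auto.
Qed.

Section Sizes.
Context {T X : Type} {pi : T -> T} {lev : T -> Z} {K : T -> X -> Prop} {d : X -> X -> R}.
Context {r Cd c0 ct : R} {L B M : nat}.
Hypothesis HF : frame pi lev K d r Cd c0 ct L B M.
Variable rho : X -> X -> R.
Hypothesis Hrho : is_metric rho.
Hypothesis Hqs : quasisymmetric d rho.
Variables xa za : T -> X.
Hypothesis Hxa : forall w, K w (xa w).
Hypothesis Hza : forall w, K w (za w).
Hypothesis Hxz : forall w, rp r (lev w) <= Cd * d (xa w) (za w).

Definition sz (w : T) : R := rho (xa w) (za w).

Let Hr := fr_r HF.
Let HCd := fr_Cd HF.
Let rpp := fun n => frame_rp_pos HF n.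

Lemma rho_symm x y : rho x y = rho y x.
Proof. apply Hrho. Qed.

Lemma rho_triangle x y z : rho x z <= rho x y + rho y z.
Proof. apply Hrho. Qed.

Lemma qs_bound t : exists C, 0 < C /\ forall x y z, x <> z -> d x y <= t * d x z -> rho x y <= C * rho x z.
Proof.
  destruct Hqs as [theta [Hth H]]. destruct (homeo_bounded theta Hth t) as [C [HC Hb]].
  exists C. split; [assumption|]. intros x y z Hne Hd. specialize (H x y z Hne).
  assert (Hdp := d_pos HF x z Hne). assert (Hrp := rho_pos rho Hrho x z Hne).
  assert (Hu : theta (d x y / d x z) <= C).
  { apply Hb. split.
    - apply Rmult_le_pos; [apply (frame_dist_nonneg HF)|]. left. apply Rinv_0_lt_compat. assumption.
    - apply Rmult_le_reg_r with (d x z); [assumption|].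
      unfold Rdiv. rewrite Rmult_assoc, Rinv_l, Rmult_1_r by lra. assumption. }
  apply Rmult_le_reg_r with (/ rho x z); [apply Rinv_0_lt_compat; assumption|].
  rewrite Rmult_assoc, Rinv_r, Rmult_1_r by lra. unfold Rdiv in H. lra.
Qed.

Lemma qs_small e : 0 < e -> exists delta, 0 < delta /\
  forall x y z, x <> z -> d x y <= delta * d x z -> rho x y <= e * rho x z.
Proof.
  intros He. destruct Hqs as [theta [Hth H]]. destruct (homeo_small theta Hth e He) as [delta [Hdl Hb]].
  exists delta. split; [assumption|]. intros x y z Hne Hd. specialize (H x y z Hne).
  assert (Hdp := d_pos HF x z Hne). assert (Hrp := rho_pos rho Hrho x z Hne).
  assert (Hu : theta (d x y / d x z) <= e).
  { apply Hb. split.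
    - apply Rmult_le_pos; [apply (frame_dist_nonneg HF)|]. left. apply Rinv_0_lt_compat. assumption.
    - apply Rmult_le_reg_r with (d x z); [assumption|].
      unfold Rdiv. rewrite Rmult_assoc, Rinv_l, Rmult_1_r by lra. assumption. }
  apply Rmult_le_reg_r with (/ rho x z); [apply Rinv_0_lt_compat; assumption|].
  rewrite Rmult_assoc, Rinv_r, Rmult_1_r by lra. unfold Rdiv in H. lra.
Qed.

Lemma xa_ne_za w : xa w <> za w.
Proof.
  intros E. assert (H := Hxz w). rewrite E in H.
  replace (d (za w) (za w)) with 0 in H by (symmetry; apply (fr_met HF); reflexivity).
  assert (Hp := rpp (lev w)). lra.
Qed.

Lemma sz_pos w : 0 < sz w.
Proof. apply (rho_pos rho Hrho). apply xa_ne_za. Qed.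

(** Apply quasisymmetry at [xa w]: every point concerned is at most a fixed multiple of the distance
    from [xa w] to [za w] away. *)
Lemma sz_upper t : exists C, 0 < C /\ forall w v x y, lev w = lev v -> K w x -> K v y ->
  d x y <= t * rp r (lev w) -> rho x y <= C * sz w /\ sz v <= C * sz w.
Proof.
  destruct (qs_bound ((2 * Cd + Rabs t) * Cd)) as [C [HC H]]. exists (2 * C). split; [lra|].
  intros w v x y Hl Hx Hy Hxy. assert (Hp := rpp (lev w)). assert (Ht := Rle_abs t). assert (Ht0 := Rabs_pos t).
  assert (Hnear : forall u, d (xa w) u <= (2 * Cd + Rabs t) * rp r (lev w) -> rho (xa w) u <= C * sz w).
  { intros u Hu. apply H; [apply xa_ne_za|]. eapply Rle_trans; [exact Hu|]. rewrite Rmult_assoc.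
    apply Rmult_le_compat_l; [lra|apply Hxz]. }
  assert (H1 : d (xa w) x <= Cd * rp r (lev w)) by (apply (fr_diam HF); auto).
  assert (Hty : t * rp r (lev w) <= Rabs t * rp r (lev w)) by (apply Rmult_le_compat_r; lra).
  assert (Hcp : 0 <= Cd * rp r (lev w)) by nra.
  assert (Htp : 0 <= Rabs t * rp r (lev w)) by (apply Rmult_le_pos; lra).
  assert (H2 := frame_dist_tri HF (xa w) x y).
  assert (Hv : forall u, K v u -> rho (xa w) u <= C * sz w).
  { intros u Hu. apply Hnear. assert (H3 : d y u <= Cd * rp r (lev w)).
    { rewrite Hl. apply (fr_diam HF); assumption. }
    assert (H4 := frame_dist_tri HF (xa w) y u). lra. }
  split.
  - assert (Hx' : rho (xa w) x <= C * sz w) by (apply Hnear; lra).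
    assert (Ht1 := rho_triangle x (xa w) y). rewrite (rho_symm x (xa w)) in Ht1. assert (Hvy := Hv y Hy). lra.
  - unfold sz at 1. assert (Ht1 := rho_triangle (xa v) (xa w) (za v)). rewrite (rho_symm (xa v) (xa w)) in Ht1.
    assert (Hva := Hv _ (Hxa v)). assert (Hvz := Hv _ (Hza v)). lra.
Qed.

(** Apply quasisymmetry at [x]: the distances from [x] to [xa w] and to [za w] are at most a
    multiple of that from [x] to [y]. *)
Lemma sz_lower t : 0 < t -> exists c, 0 < c /\ forall w x y, K w x -> t * rp r (lev w) <= d x y ->
  c * sz w <= rho x y.
Proof.
  intros Ht. destruct (qs_bound (Cd / t)) as [C [HC H]]. exists (/ (2 * C)).
  split; [apply Rinv_0_lt_compat; lra|]. intros w x y Hx Hxy. assert (Hp := rpp (lev w)).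
  assert (Hne : x <> y).
  { intros ->. replace (d y y) with 0 in Hxy by (symmetry; apply (fr_met HF); reflexivity). nra. }
  assert (Hu : forall u, K w u -> rho x u <= C * rho x y).
  { intros u Hu. apply H; [assumption|].
    eapply Rle_trans; [apply (fr_diam HF w); assumption|].
    apply Rle_trans with (Cd / t * (t * rp r (lev w))); [right; field; lra|].
    apply Rmult_le_compat_l; [|assumption]. left. apply Rdiv_lt_0_compat; assumption. }
  assert (H1 := Hu _ (Hxa w)). assert (H2 := Hu _ (Hza w)).
  assert (H3 := rho_triangle (xa w) x (za w)). rewrite (rho_symm (xa w) x) in H3. fold (sz w) in H3.
  apply Rmult_le_reg_l with (2 * C); [lra|]. rewrite <- Rmult_assoc, Rinv_r, Rmult_1_l by lra. lra.
Qed.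

Lemma sz_cell : exists C, 1 <= C /\ (forall w x y, K w x -> K w y -> rho x y <= C * sz w) /\
  (forall k v, sz v <= C * sz (Nat.iter k pi v)) /\
  (forall w v, adj lev K w v -> sz v <= C * sz w).
Proof.
  destruct (sz_upper (2 * Cd)) as [C [HC H]].
  assert (Hd : forall w x y, K w x -> K w y -> d x y <= 2 * Cd * rp r (lev w)).
  { intros w x y Hx Hy. assert (H1 := fr_diam HF w x y Hx Hy). assert (Hp := rpp (lev w)). nra. }
  assert (Hc : forall w x y, K w x -> K w y -> rho x y <= C * sz w).
  { intros w x y Hx Hy. apply (H w w); auto. }
  exists (1 + C). split; [lra|]. split; [|split].
  - intros w x y Hx Hy. assert (H1 := Hc w x y Hx Hy). assert (Hp := sz_pos w). lra.
  - intros k v. assert (Hp := sz_pos (Nat.iter k pi v)).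
    assert (H1 : sz v <= C * sz (Nat.iter k pi v)).
    { apply Hc; apply (frame_K_iter HF); auto. }
    lra.
  - intros w v [Hl [_ [z [Hz1 Hz2]]]]. assert (Hp := sz_pos w).
    destruct (H w v z z Hl Hz1 Hz2 (Hd w z z Hz1 Hz1)) as [_ H1]. lra.
Qed.

(** At a fixed depth [k2] a cell is so small against its ancestor in [d] that, by [theta] tending to
    0 at 0, its [rho]-size is at most half of the ancestor's. Iteration gives decay along the
    multiples of [k2]. *)
Lemma sz_decay : exists lam C, 0 < lam < 1 /\ 0 < C /\
  forall k v, sz v <= C * lam ^ k * sz (Nat.iter k pi v).
Proof.
  destruct sz_cell as [C [HC1 [Hcell [Hit _]]]].
  destruct (qs_small (/ (2 * C))) as [delta [Hdl Hsm]]; [apply Rinv_0_lt_compat; lra|].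
  destruct (pow_eventually_lt r Hr (delta / (2 * Cd * Cd))) as [k1 Hk1].
  { apply Rdiv_lt_0_compat; [assumption|]. nra. }
  specialize (Hk1 (S k1) ltac:(lia)). set (k2 := S k1) in *.
  assert (Hhalf : forall v, sz v <= / 2 * sz (Nat.iter k2 pi v)).
  { intros v. set (w := Nat.iter k2 pi v).
    assert (Hlw : lev v = (lev w + Z.of_nat k2)%Z) by (unfold w; rewrite (frame_lev_iter HF); lia).
    assert (Hp := rpp (lev w)).
    (* One of the two marked points of [w] is at least half their mutual distance away from
       [xa v]. *)
    assert (Hy : exists y, K w y /\ rp r (lev w) <= 2 * Cd * d (xa v) y).
    { assert (H1 := Hxz w). assert (H2 := frame_dist_tri HF (xa w) (xa v) (za w)).
      rewrite (frame_dist_sym HF (xa w) (xa v)) in H2.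
      destruct (Rle_lt_dec (d (xa v) (za w)) (d (xa v) (xa w))).
      - exists (xa w). split; [apply Hxa|]. nra.
      - exists (za w). split; [apply Hza|]. nra. }
    destruct Hy as [y [Hy Hyd]].
    assert (Hne : xa v <> y).
    { intros <-. replace (d (xa v) (xa v)) with 0 in Hyd by (symmetry; apply (fr_met HF); reflexivity). lra. }
    assert (H1 : sz v <= / (2 * C) * rho (xa v) y).
    { apply Hsm; [assumption|]. eapply Rle_trans; [apply (fr_diam HF v); auto|].
      rewrite Hlw, rp_nat by assumption.
      apply Rle_trans with (Cd * (2 * Cd * d (xa v) y * r ^ k2)).
      - apply Rmult_le_compat_l; [lra|]. apply Rmult_le_compat_r; [apply pow_le; lra|assumption].
      - apply Rmult_lt_compat_l with (r := 2 * Cd * Cd) in Hk1; [|nra].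
        replace (2 * Cd * Cd * (delta / (2 * Cd * Cd))) with delta in Hk1 by (field; lra).
        assert (Hdn := frame_dist_nonneg HF (xa v) y). nra. }
    assert (H2 : rho (xa v) y <= C * sz w).
    { apply Hcell; [|assumption]. apply (frame_K_iter HF). apply Hxa. }
    apply Rmult_le_compat_l with (r := / (2 * C)) in H2; [|left; apply Rinv_0_lt_compat; lra].
    replace (/ (2 * C) * (C * sz w)) with (/ 2 * sz w) in H2 by (field; lra). lra. }
  (* With [lam^k2 = 1/2], the remainder of [k] modulo [k2] costs at most a factor 2, which enters
     the constant [2 C]. *)
  set (lam := Rpower (/ 2) (/ INR k2)).
  assert (Hk2 : 0 < INR k2) by (apply lt_0_INR; unfold k2; lia).
  assert (Elam : lam ^ k2 = / 2).
  { unfold lam. rewrite <- Rpower_pow by apply Rpower_pos. rewrite Rpower_mult, Rinv_l, Rpower_1 by lra. reflexivity. }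
  assert (Hlam : 0 < lam < 1).
  { split; [apply Rpower_pos|]. apply Rnot_le_lt. intros Hge.
    assert (H1 := pow_R1_Rle lam k2 Hge). lra. }
  exists lam, (2 * C). split; [assumption|]. split; [lra|]. intros k v.
  assert (Hq : forall q v, sz v <= (/ 2) ^ q * sz (Nat.iter (q * k2) pi v)).
  { induction q as [|q IH]; intros u; [simpl; lra|]. replace (S q * k2)%nat with (k2 + q * k2)%nat by lia. rewrite iter_add.
    assert (H1 := Hhalf (Nat.iter (q * k2) pi u)). specialize (IH u). simpl pow.
    assert (H2 : 0 < (/ 2) ^ q) by (apply pow_lt; lra). nra. }
  set (q := (k / k2)%nat). set (s := (k mod k2)%nat).
  assert (Ek : k = (s + q * k2)%nat).
  { unfold q, s. assert (E := Nat.div_mod k k2 ltac:(unfold k2; lia)). lia. }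
  assert (Hs : (s < k2)%nat) by (apply Nat.mod_upper_bound; unfold k2; lia).
  specialize (Hq q v). rewrite Ek, iter_add, pow_add, (Nat.mul_comm q), pow_mult, Elam.
  assert (H1 := Hit s (Nat.iter (q * k2) pi v)). rewrite (Nat.mul_comm k2).
  set (u := sz (Nat.iter s pi (Nat.iter (q * k2) pi v))) in *.
  assert (Hu : 0 < u) by apply sz_pos.
  assert (H2 : 0 < (/ 2) ^ q) by (apply pow_lt; lra).
  assert (H3 : / 2 <= lam ^ s) by (rewrite <- Elam; apply pow_anti; [assumption|lia]).
  apply Rle_trans with ((/ 2) ^ q * (C * u)); [nra|].
  replace (2 * C * (lam ^ s * (/ 2) ^ q) * u) with ((/ 2) ^ q * (C * u) * (2 * lam ^ s)) by ring.
  assert (H4 : 0 < (/ 2) ^ q * (C * u)) by (repeat apply Rmult_lt_0_compat; lra). nra.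
Qed.


(** The sizes tend to 0 downwards and to infinity upwards, so every positive radius is in the range
    where regularity gives estimates. *)
Lemma radius_admissible x s : 0 < s ->
  Rbar_le (rx rho x) (Finite s) /\ Rbar_le (Finite s) (diam rho (fun _ => True)).
Proof.
  intros Hs. destruct sz_decay as [lam [C [Hlam [HC Hdec]]]].
  destruct sz_cell as [C1 [HC1 [Hcell _]]].
  destruct (fr_cov HF x 0) as [w [_ Hw]]. assert (Hszw := sz_pos w). split.
  - destruct (pow_eventually_lt lam Hlam (s / (C1 * C * sz w))) as [k Hk].
    { apply Rdiv_lt_0_compat; [assumption|]. repeat apply Rmult_lt_0_compat; lra. }
    specialize (Hk k (Nat.le_refl k)). destruct (K_down pi K (fr_dn HF) k w x Hw) as [v [Hv Hvx]].
    assert (Hy : exists y, y <> x /\ K v y).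
    { destruct (classic (xa v = x)) as [E|Hne]; [|exists (xa v); auto].
      exists (za v). split; [|apply Hza]. intros E'. apply (xa_ne_za v). congruence. }
    destruct Hy as [y [Hyx Hy]].
    assert (Hle : rho x y <= s).
    { eapply Rle_trans; [apply (Hcell v); assumption|].
      assert (H1 := Hdec k v). rewrite Hv in H1.
      apply Rmult_lt_compat_l with (r := C1 * C * sz w) in Hk; [|repeat apply Rmult_lt_0_compat; lra].
      replace (C1 * C * sz w * (s / (C1 * C * sz w))) with s in Hk by (field; lra).
      apply Rmult_le_compat_l with (r := C1) in H1; lra. }
    apply Rbar_le_trans with (Finite (rho x y)); [|exact Hle].
    apply (proj1 (Glb_Rbar_correct (fun t => exists y, y <> x /\ t = rho x y))). exists y. auto.
  - destruct (pow_eventually_lt lam Hlam (sz w / (C * s))) as [k Hk].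
    { apply Rdiv_lt_0_compat; [assumption|]. apply Rmult_lt_0_compat; lra. }
    specialize (Hk k (Nat.le_refl k)). specialize (Hdec k w). set (u := Nat.iter k pi w) in *.
    apply Rbar_le_trans with (Finite (sz u)).
    + simpl. apply Rmult_lt_compat_l with (r := C * s) in Hk; [|apply Rmult_lt_0_compat; lra].
      replace (C * s * (sz w / (C * s))) with (sz w) in Hk by (field; lra).
      apply Rnot_lt_le. intros Hlt. assert (Hl : 0 < C * lam ^ k) by (apply Rmult_lt_0_compat; [lra|apply pow_lt; lra]).
      assert (Hu := sz_pos u). nra.
    + apply (proj1 (Lub_Rbar_correct (fun t => exists x y, True /\ True /\ t = rho x y))).
      exists (xa u), (za u). auto.
Qed.

(** Cells [k1] levels below [w] are too small to contain both marked points of [w], so there are two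
    different descendants at that depth; iterate. *)
Lemma descendants_double : exists k1, (1 <= k1)%nat /\ forall j w, exists l, NoDup l /\
  (forall v, In v l -> Nat.iter (j * k1) pi v = w) /\ length l = (2 ^ j)%nat.
Proof.
  destruct (pow_eventually_lt r Hr (/ (Cd * Cd))) as [k Hk].
  { apply Rinv_0_lt_compat. nra. }
  specialize (Hk (S k) ltac:(lia)). set (k1 := S k) in *. exists k1. split; [unfold k1; lia|].
  assert (Htwo : forall w, exists u v, u <> v /\ Nat.iter k1 pi u = w /\ Nat.iter k1 pi v = w).
  { intros w. destruct (K_down pi K (fr_dn HF) k1 w _ (Hxa w)) as [u [Hu Hux]].
    destruct (K_down pi K (fr_dn HF) k1 w _ (Hza w)) as [v [Hv Hvx]].
    exists u, v. split; [|auto]. intros <-.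
    assert (H1 := fr_diam HF u _ _ Hux Hvx). assert (H2 := Hxz w). assert (Hp := rpp (lev w)).
    assert (E := frame_lev_iter HF k1 u). rewrite Hu in E.
    replace (lev u) with (lev w + Z.of_nat k1)%Z in H1 by lia. rewrite rp_nat in H1 by assumption.
    assert (HCC : 0 < Cd * Cd) by nra.
    apply Rmult_lt_compat_l with (r := Cd * Cd) in Hk; [|assumption]. rewrite Rinv_r in Hk by lra.
    assert (rp r (lev w) <= Cd * (Cd * (rp r (lev w) * r ^ k1))) by nra. nra. }
  destruct (fun_choice (fun w l => NoDup l /\ (forall v, In v l -> Nat.iter k1 pi v = w) /\ length l = 2%nat))
    as [pr Hpr].
  { intros w. destruct (Htwo w) as [u [v [Hne [Hu Hv]]]]. exists (u :: v :: nil).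
    split; [repeat constructor; simpl; intuition|]. split; [|reflexivity].
    intros t [<-|[<-|[]]]; assumption. }
  induction j as [|j IH]; intros w.
  - exists (w :: nil). split; [repeat constructor; simpl; tauto|]. split; [|reflexivity].
    intros v [<-|[]]. reflexivity.
  - destruct (IH w) as [l [Hd [Hl Hlen]]]. exists (flat_map pr l). split; [|split].
    + apply nodup_flat_map; [assumption|intros; apply Hpr|]. intros a a' b _ _ Ha Ha'.
      apply Hpr in Ha, Ha'. congruence.
    + intros v Hv. apply in_flat_map in Hv. destruct Hv as [u [Hu Hv]]. apply Hpr in Hv.
      replace (S j * k1)%nat with (j * k1 + k1)%nat by lia. rewrite iter_add, Hv. auto.
    + change (2 ^ S j)%nat with (2 * 2 ^ j)%nat. rewrite <- Hlen. clear - Hpr.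
      induction l as [|a l IHl]; [reflexivity|]. simpl flat_map.
      rewrite length_app, IHl. destruct (Hpr a) as [_ [_ E]]. rewrite E. simpl length. lia.
Qed.

Section Measure.
Variable nu : (X -> Prop) -> Rbar.
Hypothesis Hnu : borel_measure rho nu.

Lemma borel_inter (A A' : X -> Prop) : borel rho A -> borel rho A' -> borel rho (fun x => A x /\ A' x).
Proof.
  intros HA HA'. apply borel_ext with (fun x => ~ exists n : nat, match n with O => ~ A x | _ => ~ A' x end).
  - apply borel_compl, (borel_union rho (fun n x => match n with O => ~ A x | _ => ~ A' x end)).
    intros [|n]; apply borel_compl; assumption.
  - intros x. split.
    + intros H. split; apply NNPP; intros Hn; apply H; [exists 0%nat|exists 1%nat]; assumption.
    + intros [H H'] [[|n] Hn]; contradiction.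
Qed.

Lemma borel_ball x s : borel rho (ball rho x s).
Proof.
  apply borel_open. intros y Hy. exists (s - rho x y). unfold ball in *. split; [lra|].
  intros z Hz. assert (H := rho_triangle x y z). lra.
Qed.

Lemma measure_packing {I : Type} (l : list I) (E : I -> X -> Prop) (A : X -> Prop) (c : I -> R) :
  NoDup l -> (forall i, In i l -> borel rho (E i)) -> borel rho A ->
  (forall i j x, In i l -> In j l -> E i x -> E j x -> i = j) ->
  (forall i x, In i l -> E i x -> A x) ->
  (forall i, In i l -> Rbar_le (Finite (c i)) (nu (E i))) ->
  Rbar_le (Finite (lsum c l)) (nu A).
Proof.
  intros Hd HE HA Hdis Hsub Hc. destruct Hnu as [Hext [H0 [Hpos Hadd]]].
  set (n := length l).
  (* Countable additivity needs a sequence that partitions [A]: the sets of the list, then the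
     remainder of [A] at index [n], then empty sets. *)
  set (Esq := fun (i : nat) (x : X) => match nth_error l i with Some a => E a x
    | None => i = n /\ A x /\ ~ exists a, In a l /\ E a x end).
  assert (Hfalse : borel rho (fun _ => False)).
  { apply borel_open. intros x []. }
  assert (Hun : forall l' : list I, (forall a, In a l' -> In a l) -> borel rho (fun x => exists a, In a l' /\ E a x)).
  { induction l' as [|a l' IH]; intros Hl'.
    - apply borel_ext with (fun _ => False); [assumption|]. intros x. split; [tauto|]. intros [b [[] _]].
    - apply borel_ext with (fun x => exists m : nat, match m with O => E a x | _ => exists b, In b l' /\ E b x end).
      + apply (borel_union rho (fun m x => match m with O => E a x | _ => exists b, In b l' /\ E b x end)).
        intros [|m]; [apply HE, Hl'; now left|apply IH; intros; apply Hl'; now right].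
      + intros x. split.
        * intros [[|m] Hm]; [exists a; split; [now left|assumption]|].
          destruct Hm as [b [Hb Hbx]]. exists b. split; [now right|assumption].
        * intros [b [[<-|Hb] Hbx]]; [exists 0%nat; assumption|exists 1%nat; exists b; auto]. }
  assert (HEsq : forall i, borel rho (Esq i)).
  { intros i. unfold Esq. destruct (nth_error l i) as [a|] eqn:Ei.
    - apply HE. apply nth_error_In in Ei. assumption.
    - destruct (Nat.eq_dec i n) as [E'|Hne].
      + apply borel_ext with (fun x => A x /\ ~ exists a, In a l /\ E a x).
        * apply borel_inter; [assumption|]. apply borel_compl. apply Hun. auto.
        * intros x. tauto.
      + apply borel_ext with (fun _ => False); [assumption|]. intros x. tauto. }
  assert (Hsum : nu A = Rbar_lub (fun y => exists m, y = psum (fun i => nu (Esq i)) m)).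
  { rewrite <- Hadd.
    - apply Hext. intros x. split.
      + intros Hx. destruct (classic (exists a, In a l /\ E a x)) as [[a [Ha Hax]]|Hn].
        * apply In_nth_error in Ha. destruct Ha as [i Hi]. exists i. unfold Esq. rewrite Hi. assumption.
        * exists n. unfold Esq. replace (nth_error l n) with (@None I); [auto|].
          symmetry. apply nth_error_None. unfold n. lia.
      + intros [i Hi]. unfold Esq in Hi. destruct (nth_error l i) as [a|] eqn:Ei.
        * apply (Hsub a x); [apply nth_error_In in Ei; assumption|assumption].
        * tauto.
    - assumption.
    - intros i j x Hij Hi Hj. unfold Esq in Hi, Hj.
      destruct (nth_error l i) as [a|] eqn:Ei, (nth_error l j) as [b|] eqn:Ej.
      + apply Hij. assert (Eab : a = b).
        { apply (Hdis a b x); auto; [apply nth_error_In in Ei|apply nth_error_In in Ej]; assumption. }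
        subst b. apply (proj1 (NoDup_nth_error l) Hd); [|congruence].
        apply nth_error_Some. congruence.
      + destruct Hj as [_ [_ Hn]]. apply Hn. exists a. split; [apply nth_error_In in Ei|]; assumption.
      + destruct Hi as [_ [_ Hn]]. apply Hn. exists b. split; [apply nth_error_In in Ej|]; assumption.
      + lia. }
  rewrite Hsum. eapply Rbar_le_trans; [|apply (proj1 (proj2_sig (Rbar_ex_lub _)) _ (ex_intro _ n eq_refl))].
  assert (Hpart : forall m, (m <= n)%nat ->
    Rbar_le (Finite (lsum c (firstn m l))) (psum (fun i => nu (Esq i)) m)).
  { induction m as [|m IH]; intros Hm; [simpl; unfold lsum; simpl; lra|].
    destruct (nth_error l m) as [a|] eqn:Em.
    - assert (Ef : firstn (S m) l = firstn m l ++ a :: nil).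
      { clear - Em. revert m Em. induction l as [|b l IHl]; intros [|m] Em; simpl in *; try discriminate.
        - congruence.
        - f_equal. apply IHl. assumption. }
      rewrite Ef, lsum_app, lsum_cons. unfold lsum at 2. simpl fold_right. rewrite Rplus_0_r.
      assert (Ha : In a l) by (apply nth_error_In in Em; assumption).
      specialize (IH ltac:(lia)). specialize (Hc a Ha).
      assert (EE : nu (Esq m) = nu (E a)).
      { apply Hext. intros x. unfold Esq. rewrite Em. tauto. }
      simpl psum. rewrite EE. apply (Rbar_plus_le_compat (Finite _) _ (Finite _) _ IH Hc).
    - apply nth_error_None in Em. unfold n in Hm. lia. }
  specialize (Hpart n (Nat.le_refl n)). unfold n in Hpart at 1. rewrite firstn_all in Hpart. exact Hpart.
Qed.

Variable al : R.
Hypothesis Hal : ahlfors_regular rho al nu.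

(** Around the deep point of [v], a [rho]-ball of radius [c sz v] meets no other cell of the level,
    by [sz_lower] at the depth [ct]. These balls are thus disjoint and lie in one ball of radius
    comparable to [sz w]; compare their measures. *)
Lemma sz_sum : exists C, 0 < C /\ forall k w l, NoDup l -> (forall v, In v l -> Nat.iter k pi v = w) ->
  lsum (fun v => Rpower (sz v) al) l <= C * Rpower (sz w) al.
Proof.
  destruct Hal as [C0 [HC0 Hreg]]. destruct sz_cell as [C1 [HC1 [Hcell _]]].
  destruct (sz_lower ct (fr_ct HF)) as [c [Hc Hlow]].
  destruct (fun_choice (fun v x => K v x /\ forall y u, d x y < ct * rp r (lev v) -> lev u = lev v ->
    K u y -> u = v) (fr_deep HF)) as [ya Hya].
  assert (HiC0 : 0 < / C0) by (apply Rinv_0_lt_compat; assumption).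
  assert (H2C : 0 < 2 * C1) by lra.
  exists (C0 * C0 * Rpower (2 * C1) al * / Rpower c al).
  split; [repeat apply Rmult_lt_0_compat; try assumption; [apply Rpower_pos|apply Rinv_0_lt_compat, Rpower_pos]|].
  intros k w l Hd Hl.
  assert (Hin : forall v x, In v l -> ball rho (ya v) (c * sz v) x -> forall u, lev u = lev v -> K u x -> u = v).
  { intros v x Hv Hx u Hlu Hu. apply (proj2 (Hya v) x); auto. apply Rnot_le_lt. intros Hle.
    unfold ball in Hx. apply (Hlow v) in Hle; [lra|apply Hya]. }
  assert (Hlev : forall v, In v l -> lev v = (lev w + Z.of_nat k)%Z).
  { intros v Hv. assert (E := frame_lev_iter HF k v). rewrite (Hl v Hv) in E. lia. }
  assert (HKv : forall v x, In v l -> ball rho (ya v) (c * sz v) x -> K v x).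
  { intros v x Hv Hx. destruct (fr_cov HF x (lev v)) as [u [Hu Hux]].
    rewrite <- (Hin v x Hv Hx u Hu Hux). assumption. }
  assert (Hpack : Rbar_le (Finite (lsum (fun v => / C0 * Rpower (c * sz v) al) l))
    (nu (ball rho (xa w) (2 * C1 * sz w)))).
  { apply (measure_packing l (fun v => ball rho (ya v) (c * sz v))); auto.
    - intros v _. apply borel_ball.
    - apply borel_ball.
    - intros v v' x Hv Hv' Hx Hx'. destruct (fr_cov HF x (lev w + Z.of_nat k)) as [u [Hu Hux]].
      transitivity u.
      + symmetry. apply (Hin v x); auto. rewrite (Hlev v Hv). assumption.
      + apply (Hin v' x); auto. rewrite (Hlev v' Hv'). assumption.
    - intros v x Hv Hx. unfold ball.
      assert (H1 : rho (xa w) x <= C1 * sz w).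
      { apply Hcell; [apply Hxa|]. rewrite <- (Hl v Hv). apply (frame_K_iter HF). apply HKv; assumption. }
      assert (Hw := sz_pos w). nra.
    - intros v Hv. assert (Hs : 0 < c * sz v) by (apply Rmult_lt_0_compat; [assumption|apply sz_pos]).
      destruct (radius_admissible (ya v) (c * sz v) Hs) as [Ha Hb]. apply Hreg; assumption. }
  assert (Hs : 0 < 2 * C1 * sz w) by (apply Rmult_lt_0_compat; [lra|apply sz_pos]).
  destruct (radius_admissible (xa w) _ Hs) as [Ha Hb].
  destruct (Hreg (xa w) _ Hs Ha Hb) as [_ Hup].
  assert (Hle := Rbar_le_trans _ _ _ Hpack Hup). simpl in Hle.
  rewrite lsum_scal in Hle.
  rewrite (lsum_ext _ (fun v => Rpower c al * Rpower (sz v) al)) in Hle.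
  - rewrite lsum_scal, <- Rpower_mult_distr in Hle; [|lra|apply sz_pos].
    assert (Hcp := Rpower_pos c al).
    apply Rmult_le_reg_l with (/ C0 * Rpower c al); [apply Rmult_lt_0_compat; assumption|].
    replace (/ C0 * Rpower c al * (C0 * C0 * Rpower (2 * C1) al * / Rpower c al * Rpower (sz w) al))
      with (C0 * (Rpower (2 * C1) al * Rpower (sz w) al)) by (field; lra).
    lra.
  - intros v _. rewrite Rpower_mult_distr; [reflexivity|assumption|apply sz_pos].
Qed.

(** For a nonpositive exponent each descendant would contribute at least a fixed amount to the
    bounded sum of [sz_sum], while the number of descendants grows like [2^j]. *)
Theorem dimension_pos (phi : T) : 0 < al.
Proof.
  destruct sz_sum as [C [HC Hsum]]. destruct sz_cell as [C1 [HC1 [_ [Hit _]]]].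
  destruct descendants_double as [k1 [_ Hdbl]]. apply Rnot_le_lt. intros Hneg.
  assert (HC1p := Rpower_pos C1 al).
  destruct (pow_eventually_lt (/ 2)) with (c := Rpower C1 al / C) as [j Hj]; [lra|apply Rdiv_lt_0_compat; lra|].
  specialize (Hj j (Nat.le_refl j)). destruct (Hdbl j phi) as [l [Hd [Hl Hlen]]].
  specialize (Hsum _ phi l Hd Hl). assert (Hp := sz_pos phi). assert (Hpp := Rpower_pos (sz phi) al).
  assert (Hlow : INR (2 ^ j) * (Rpower C1 al * Rpower (sz phi) al) <= lsum (fun v => Rpower (sz v) al) l).
  { rewrite <- Hlen, <- lsum_const. apply lsum_le. intros v Hv.
    rewrite Rpower_mult_distr by lra. assert (H1 := Hit (j * k1)%nat v). rewrite (Hl v Hv) in H1.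
    assert (Hv0 := sz_pos v).
    rewrite <- (Ropp_involutive al), !(Rpower_Ropp _ (- al)).
    apply Rinv_le_contravar; [apply Rpower_pos|]. apply Rle_Rpower_l; lra. }
  rewrite pow_INR in Hlow. simpl (INR 2) in Hlow. rewrite pow_inv in Hj.
  assert (H2 : 0 < 2 ^ j) by (apply pow_lt; lra).
  assert (H3 : 2 ^ j * Rpower C1 al <= C).
  { apply Rmult_le_reg_r with (Rpower (sz phi) al); [assumption|].
    replace (1 + 1) with 2 in Hlow by ring. lra. }
  apply Rmult_lt_compat_l with (r := C * 2 ^ j) in Hj; [|apply Rmult_lt_0_compat; assumption].
  replace (C * 2 ^ j * / 2 ^ j) with C in Hj by (field; lra).
  replace (C * 2 ^ j * (Rpower C1 al / C)) with (2 ^ j * Rpower C1 al) in Hj by (field; lra). lra.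
Qed.

End Measure.

End Sizes.


(** * Test functions from a quasisymmetric metric *)

Lemma lsum_pairs_le {A : Type} (side other : A * A -> A) (nbr : A -> list A) (W : A -> R) (V : list A) n l :
  (forall uv uv', side uv = side uv' -> other uv = other uv' -> uv = uv') ->
  NoDup l -> (forall a, 0 <= W a) -> (forall a, (length (nbr a) <= n)%nat) ->
  (forall uv, In uv l -> In (side uv) V /\ In (other uv) (nbr (side uv))) ->
  lsum (fun uv => W (side uv)) l <= INR n * lsum W V.
Proof.
  intros Hinj Hd HW Hn Hl.
  set (pr := fun uv => (side uv, other uv)).
  replace (lsum (fun uv => W (side uv)) l) with (lsum (fun ab : A * A => W (fst ab)) (map pr l))
    by (rewrite lsum_map; reflexivity).
  apply Rle_trans with (lsum (fun ab : A * A => W (fst ab)) (flat_map (fun a => map (pair a) (nbr a)) V)).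
  - apply lsum_incl; [|  |intros; apply HW].
    + apply Injective_map_NoDup; [|assumption]. intros uv uv' E. injection E. auto.
    + intros ab Hab. apply in_map_iff in Hab. destruct Hab as [uv [<- Huv]]. destruct (Hl uv Huv) as [H1 H2].
      apply in_flat_map. exists (side uv). split; [assumption|]. unfold pr. apply in_map. assumption.
  - rewrite lsum_flat_map, <- lsum_scal. apply lsum_le. intros a _. rewrite lsum_map. simpl fst.
    rewrite lsum_const. apply Rmult_le_compat_r; [apply HW|apply le_INR, Hn].
Qed.

Section TestFunction.
Context {T X : Type} {pi : T -> T} {lev : T -> Z} {K : T -> X -> Prop} {d : X -> X -> R}.
Context {r Cd c0 ct : R} {L B M : nat}.
Hypothesis HF : frame pi lev K d r Cd c0 ct L B M.
Variable rho : X -> X -> R.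
Hypothesis Hrho : is_metric rho.
Hypothesis Hqs : quasisymmetric d rho.
Variables xa za : T -> X.
Hypothesis Hxa : forall w, K w (xa w).
Hypothesis Hza : forall w, K w (za w).
Hypothesis Hxz : forall w, rp r (lev w) <= Cd * d (xa w) (za w).
Let s := sz rho xa za.
Let adjK := adj lev K.
Variables N1 N2 N : nat.
Hypothesis HN : (N1 + M <= N2)%nat.

Let s_pos : forall w, 0 < s w := sz_pos HF rho Hrho xa za Hxz.

(** The [rho]-distance between [K v] and the union of the cells within [N1] steps of [w]. *)
Definition gap (w v : T) : R := real (Glb_Rbar (fun t => exists a x u,
  within adjK N1 w u /\ K u a /\ K v x /\ t = rho a x)).

Lemma gap_glb w v : is_glb_Rbar (fun t => exists a x u,
  within adjK N1 w u /\ K u a /\ K v x /\ t = rho a x) (Finite (gap w v)).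
Proof.
  unfold gap. match goal with |- is_glb_Rbar ?E _ => set (S := E) end.
  assert (Hg := Glb_Rbar_correct S).
  assert (H0 : Rbar_le (Finite 0) (Glb_Rbar S)).
  { apply Hg. intros t [a [x [u [_ [_ [_ ->]]]]]]. simpl. apply Hrho. }
  assert (HS : S (rho (xa w) (xa v))).
  { exists (xa w), (xa v), w. split; [apply within_refl|]. auto. }
  apply (proj1 Hg) in HS. destruct (Glb_Rbar S); simpl in *; try contradiction. exact Hg.
Qed.

Lemma gap_le w v u a x : within adjK N1 w u -> K u a -> K v x -> gap w v <= rho a x.
Proof. intros Hu Ha Hx. apply (proj1 (gap_glb w v)). exists a, x, u. auto. Qed.

Lemma gap_ge w v t : (forall u a x, within adjK N1 w u -> K u a -> K v x -> t <= rho a x) -> t <= gap w v.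
Proof.
  intros H. apply (proj2 (gap_glb w v) (Finite t)). intros q [a [x [u [Hu [Ha [Hx ->]]]]]].
  simpl. eapply H; eassumption.
Qed.

Lemma gap_adj w v v' C1 : (forall w x y, K w x -> K w y -> rho x y <= C1 * s w) ->
  adjK v v' -> gap w v <= gap w v' + C1 * s v'.
Proof.
  intros HC [_ [_ [z [Hz Hz']]]]. assert (H : gap w v - C1 * s v' <= gap w v'); [|lra].
  apply gap_ge. intros u a x Hu Ha Hx. assert (H1 := gap_le w v u a z Hu Ha Hz).
  assert (H2 := HC v' x z Hx Hz'). assert (H3 : rho a z <= rho a x + rho x z) by apply Hrho. lra.
Qed.

Lemma gap_within w C1 : 1 <= C1 -> (forall w x y, K w x -> K w y -> rho x y <= C1 * s w) ->
  (forall w v, adjK w v -> s v <= C1 * s w) ->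
  forall n v v', within adjK n v v' -> gap w v <= gap w v' + INR n * C1 ^ S n * s v'.
Proof.
  intros HC1 Hcell Hadj n v v' H. induction H as [n v|n v u v' Hvu Huv IH].
  - assert (0 <= INR n * C1 ^ S n * s v); [|lra].
    apply Rmult_le_pos; [|left; apply s_pos]. apply Rmult_le_pos; [apply pos_INR|apply pow_le; lra].
  - assert (H1 := gap_adj w v u C1 Hcell Hvu).
    assert (H2 : s u <= C1 ^ n * s v').
    { apply (harnack_within adjK s C1 HC1 s_pos Hadj). apply within_sym; [apply adj_sym|assumption]. }
    assert (Hs := s_pos v'). rewrite S_INR. simpl pow in *. set (q := C1 ^ n) in *.
    assert (Hq : 1 <= q) by (apply pow_R1_Rle; assumption). assert (Hn := pos_INR n).
    assert (H3 : C1 * s u <= C1 * (q * s v')) by (apply Rmult_le_compat_l; lra).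
    assert (H4 : 0 <= (INR n + 1) * (C1 * q) * s v').
    { apply Rmult_le_pos; [|lra]. apply Rmult_le_pos; [lra|]. apply Rmult_le_pos; lra. }
    assert (H5 : (INR n + 1) * (C1 * q) * s v' * 1 <= (INR n + 1) * (C1 * q) * s v' * C1).
    { apply Rmult_le_compat_l; assumption. }
    lra.
Qed.

Theorem test_function p : 0 < p -> exists C, 0 < C /\ forall k w Sm,
  (forall u, within adjK N2 w u -> forall l, NoDup l -> (forall v, In v l -> Nat.iter k pi v = u) ->
    lsum (fun v => Rpower (s v / s u) p) l <= Sm) ->
  exists f : T -> R,
    (forall v, within adjK N1 w (Nat.iter k pi v) -> f v = 1) /\
    (forall v, lev v = (lev w + Z.of_nat k)%Z -> ~ within adjK N2 w (Nat.iter k pi v) -> f v = 0) /\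
    forall l, NoDup l -> (forall uv, In uv l -> lev (fst uv) = (lev w + Z.of_nat k)%Z /\
        within adjK N (fst uv) (snd uv)) ->
      lsum (fun uv => abspow (f (fst uv) - f (snd uv)) p) l <= C * Sm.
Proof.
  intros Hp. destruct (sz_cell HF rho Hrho Hqs xa za Hxa Hza Hxz) as [C1 [HC1 [Hcell [Hit Hadj]]]].
  fold s in Hcell, Hit, Hadj.
  destruct (sz_lower HF rho Hrho Hqs xa za Hxa Hza c0 (fr_c0 HF)) as [c [Hc Hlow]]. fold s in Hlow.
  assert (Hsw := harnack_within adjK s C1 HC1 s_pos Hadj).
  assert (HCp : forall n, 1 <= C1 ^ n) by (intros; apply pow_R1_Rle; assumption).
  set (G := (INR N + 1) * C1 ^ S N * C1 ^ N).
  assert (HG : 0 < G).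
  { unfold G. assert (Hn := pos_INR N). repeat apply Rmult_lt_0_compat; try (apply pow_lt); lra. }
  set (G' := G * C1 ^ N1 / c).
  assert (HG' : 0 < G') by (apply Rdiv_lt_0_compat; [apply Rmult_lt_0_compat; [assumption|apply pow_lt; lra]|assumption]).
  set (Q := Rpower (G' * C1 ^ N2) p). assert (HQ : 0 < Q) by apply Rpower_pos.
  exists (2 * INR (S L ^ N) * INR (S L ^ N2) * Q). split.
  { repeat apply Rmult_lt_0_compat; try assumption; try lra;
      apply lt_0_INR, Nat.neq_0_lt_0, Nat.pow_nonzero; lia. }
  (* [D] is a lower bound for the gap of cells outside the [N2]-neighbourhood: since [N1 + M <= N2],
     these are more than [M] steps from every [u] in the [N1]-neighbourhood, hence at [rho]-distance
     at least [c s u], and [s u] is comparable to [s w]. *)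
  intros k w Sm HS. set (D := c * s w / C1 ^ N1).
  assert (Hw := s_pos w).
  assert (HCN1 : 0 < C1 ^ N1) by (apply pow_lt; lra).
  assert (HD : 0 < D) by (apply Rdiv_lt_0_compat; [apply Rmult_lt_0_compat; assumption|assumption]).
  set (f := fun v => clamp (1 - gap w v / D)). exists f.
  assert (Hf0 : forall v, lev v = (lev w + Z.of_nat k)%Z -> ~ within adjK N2 w (Nat.iter k pi v) -> f v = 0).
  { intros v Hv Hn. assert (Hgap : D <= gap w v).
    { apply gap_ge. intros u a x Hu Ha Hx. apply Rnot_lt_le. intros Hlt. apply Hn.
      apply within_mono with (N1 + M)%nat; [assumption|]. apply within_trans with u; [assumption|].
      assert (Hlu := within_adj_lev _ _ _ _ _ Hu).
      apply (fr_near HF) with a x; [|assumption|apply (frame_K_iter HF); assumption|].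
      - rewrite (frame_lev_iter HF). lia.
      - apply Rnot_le_lt. intros Hle. apply (Hlow u a x Ha) in Hle.
        assert (H1 : s w <= C1 ^ N1 * s u) by (apply Hsw, within_sym; [apply adj_sym|assumption]).
        assert (H2 : D <= c * s u).
        { unfold D. apply Rmult_le_reg_r with (C1 ^ N1); [assumption|].
          unfold Rdiv. rewrite Rmult_assoc, Rinv_l, Rmult_1_r by lra. nra. }
        lra. }
    unfold f. assert (H1 : 1 <= gap w v / D).
    { apply Rmult_le_reg_r with D; [assumption|]. unfold Rdiv. rewrite Rmult_assoc, Rinv_l by lra. lra. }
    unfold clamp. rewrite Rmin_left by lra. apply Rmax_left. lra. }
  split; [|split; [exact Hf0|]].
  { intros v Hv. unfold f. replace (gap w v) with 0.
    - unfold Rdiv. rewrite Rmult_0_l, Rminus_0_r. apply clamp_one.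
    - apply Rle_antisym.
      + apply gap_ge. intros. apply Hrho.
      + rewrite <- (proj2 (proj1 (proj2 Hrho) (xa v) (xa v)) eq_refl).
        apply gap_le with (Nat.iter k pi v); auto. apply (frame_K_iter HF). apply Hxa. }
  intros l Hd Hl.
  (* The gap changes by at most [G s v] along [N] steps from [v]; [W v] is the [p]-th power of this
     bound divided by [D]. *)
  set (W := fun v => Rpower (G' * (s v / s w)) p).
  assert (HW : forall v, 0 <= W v) by (intros; left; apply Rpower_pos).
  assert (Hterm : forall v v', within adjK N v v' -> abspow (f v - f v') p <= W v).
  { intros v v' Hvv. rewrite abspow_pw. assert (Hv := s_pos v).
    assert (Hpos : 0 < G' * (s v / s w)) by (apply Rmult_lt_0_compat; [assumption|apply Rdiv_lt_0_compat; assumption]).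
    unfold W. rewrite <- pw_pos by assumption. apply pw_le; [assumption|]. split; [apply Rabs_pos|].
    eapply Rle_trans; [apply clamp_contraction|].
    assert (Hgap : Rabs (gap w v' - gap w v) <= G * s v).
    { assert (Hvv' : within adjK N v' v) by (apply within_sym; [apply adj_sym|assumption]).
      assert (H1 := gap_within w C1 HC1 Hcell Hadj N v v' Hvv).
      assert (H2 := gap_within w C1 HC1 Hcell Hadj N v' v Hvv').
      assert (H3 := Hsw N v v' Hvv). assert (Hn := pos_INR N).
      assert (HP := HCp N). assert (HP' := HCp (S N)). set (q := C1 ^ N) in *. set (q' := C1 ^ S N) in *.
      assert (Hnq : 0 <= INR N * q') by (apply Rmult_le_pos; lra).
      assert (H4 : INR N * q' * s v' <= INR N * q' * (q * s v)) by (apply Rmult_le_compat_l; assumption).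
      assert (H5 : INR N * q' * s v * 1 <= INR N * q' * s v * q).
      { apply Rmult_le_compat_l; [|assumption]. apply Rmult_le_pos; lra. }
      assert (H6 : 0 <= q' * q * s v) by (apply Rmult_le_pos; [apply Rmult_le_pos|]; lra).
      unfold G. fold q q'. apply Rabs_le. lra. }
    replace (1 - gap w v / D - (1 - gap w v' / D)) with ((gap w v' - gap w v) * / D) by (field; lra).
    rewrite Rabs_mult, (Rabs_pos_eq (/ D)) by (left; apply Rinv_0_lt_compat; assumption).
    apply Rle_trans with (G * s v * / D).
    - apply Rmult_le_compat_r; [left; apply Rinv_0_lt_compat; assumption|assumption].
    - unfold G', D. right. field. repeat split; lra. }
  destruct (fun_choice (fun v lst => listed (within adjK N v) lst /\ (length lst <= L ^ N)%nat)
    (ball_listed adjK L (fr_deg HF) N)) as [bN HbN].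
  destruct (ball_listed adjK L (fr_deg HF) N2 w) as [b2 [[Hb2d Hb2] Hb2len]].
  destruct (fun_choice (fun u lst => listed (fun v => Nat.iter k pi v = u) lst /\ (length lst <= B ^ k)%nat)
    (listed_desc pi B (fr_chl HF) k)) as [ds Hds].
  set (V := flat_map ds b2).
  assert (HV : forall v, lev v = (lev w + Z.of_nat k)%Z -> ~ In v V -> f v = 0).
  { intros v Hv Hn. apply Hf0; [assumption|]. intros Hc'. apply Hn. apply in_flat_map.
    exists (Nat.iter k pi v). split; [apply Hb2; assumption|]. apply (proj2 (proj1 (Hds _))). reflexivity. }
  assert (HsumV : lsum W V <= INR (S L ^ N2) * (Q * Sm)).
  { unfold V. rewrite lsum_flat_map.
    assert (HS0 : 0 <= Sm).
    { eapply Rle_trans; [|apply (HS w (within_refl _ _ _) nil (NoDup_nil _))]; [unfold lsum; simpl; lra|].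
      intros v []. }
    apply lsum_le_const.
    - intros u Hu. apply Hb2 in Hu. destruct (Hds u) as [[Hdu Hdin] _].
      apply Rle_trans with (Q * lsum (fun v => Rpower (s v / s u) p) (ds u)).
      + rewrite <- lsum_scal. apply lsum_le. intros v _. unfold W, Q.
        assert (Hu0 := s_pos u). assert (Hv0 := s_pos v).
        assert (Hvu : 0 < s v / s u) by (apply Rdiv_lt_0_compat; assumption).
        rewrite Rpower_mult_distr; [|apply Rmult_lt_0_compat; [assumption|apply pow_lt; lra]|assumption].
        apply Rle_Rpower_l; [lra|]. split.
        * apply Rmult_lt_0_compat; [assumption|]. apply Rdiv_lt_0_compat; assumption.
        * rewrite Rmult_assoc. apply Rmult_le_compat_l; [lra|].
          apply Hsw in Hu. apply Rmult_le_reg_r with (s w); [assumption|].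
          replace (s v / s w * s w) with (s v / s u * s u) by (field; lra).
          apply Rle_trans with (s v / s u * (C1 ^ N2 * s w)); [apply Rmult_le_compat_l; lra|]. lra.
      + apply Rmult_le_compat_l; [lra|]. apply HS; [assumption|assumption|]. intros v Hv. apply Hdin. assumption.
    - apply Rmult_le_pos; lra.
    - eapply Nat.le_trans; [exact Hb2len|]. apply Nat.pow_le_mono_l. lia. }
  (* The function vanishes off [V], so only pairs with an end in [V] count. Each is charged to such
     an end, the first one if possible, and an end receives at most the number of cells within [N]
     steps. *)
  set (l1 := cfilter (fun uv => In (fst uv) V) l).
  set (l2 := cfilter (fun uv => In (snd uv) V) (cfilter (fun uv => ~ In (fst uv) V) l)).
  assert (Hpair : forall uv uv' : T * T, fst uv = fst uv' -> snd uv = snd uv' -> uv = uv').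
  { intros [a b] [a' b'] E1 E2. simpl in *. congruence. }
  assert (HbNl : forall a, (length (bN a) <= S L ^ N)%nat).
  { intros a. eapply Nat.le_trans; [apply HbN|]. apply Nat.pow_le_mono_l. lia. }
  assert (H1 : lsum (fun uv => abspow (f (fst uv) - f (snd uv)) p) l1
    <= INR (S L ^ N) * lsum W V).
  { apply Rle_trans with (lsum (fun uv => W (fst uv)) l1).
    - apply lsum_le. intros uv Huv. apply in_cfilter in Huv. apply Hterm. apply Hl. tauto.
    - apply (lsum_pairs_le fst snd bN); auto.
      + apply nodup_cfilter. assumption.
      + intros uv Huv. apply in_cfilter in Huv. destruct Huv as [Huv HVu]. split; [assumption|].
        apply (proj2 (proj1 (HbN _))). apply Hl. assumption. }
  assert (H2 : lsum (fun uv => abspow (f (fst uv) - f (snd uv)) p) l2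
    <= INR (S L ^ N) * lsum W V).
  { assert (Hin2 : forall uv, In uv l2 -> In uv l /\ In (snd uv) V).
    { intros uv Huv. apply in_cfilter in Huv. destruct Huv as [Huv HVu]. apply in_cfilter in Huv. tauto. }
    apply Rle_trans with (lsum (fun uv => W (snd uv)) l2).
    - apply lsum_le. intros uv Huv. rewrite abspow_pw, Rabs_minus_sym, <- abspow_pw. apply Hterm.
      apply within_sym; [apply adj_sym|]. apply Hl. apply Hin2. assumption.
    - apply (lsum_pairs_le snd fst bN); auto.
      + apply nodup_cfilter, nodup_cfilter. assumption.
      + intros uv Huv. destruct (Hin2 uv Huv) as [Huv1 Huv2]. split; [assumption|].
        apply (proj2 (proj1 (HbN _))). apply within_sym; [apply adj_sym|]. apply Hl. assumption. }
  rewrite (lsum_cfilter _ (fun uv => In (fst uv) V)). fold l1.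
  rewrite (lsum_cfilter _ (fun uv => In (snd uv) V) (cfilter (fun uv => ~ In (fst uv) V) l)). fold l2.
  rewrite (lsum_ext _ (fun _ => 0) (cfilter (fun uv => ~ In (snd uv) V) _)).
  - rewrite lsum_const.
    apply Rmult_le_compat_l with (r := INR (S L ^ N)) in HsumV; [|apply pos_INR].
    lra.
  - intros uv Huv. apply in_cfilter in Huv. destruct Huv as [Huv Hn2]. apply in_cfilter in Huv.
    destruct Huv as [Huv Hn1]. destruct (Hl uv Huv) as [Hlv Hwi].
    rewrite !HV; [rewrite Rminus_diag; apply abspow_zero| |assumption|assumption|assumption].
    apply within_adj_lev in Hwi. congruence.
Qed.

End TestFunction.


(** * Concavity inequalities and bounds for the energies *)

Lemma ln_le_minus_one y : 0 < y -> ln y <= y - 1.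
Proof. intros Hy. assert (H := exp_ineq1_le (ln y)). rewrite exp_ln in H by assumption. lra. Qed.

(** Weighted arithmetic-geometric mean inequality for [u] and 1: add [ln y <= y - 1] at [u / A] and
    at [1 / A] with the weights [s] and [1 - s]. *)
Lemma Rpower_tangent u s : 0 < u -> 0 < s <= 1 -> Rpower u s <= 1 - s + s * u.
Proof.
  intros Hu Hs. set (A := 1 - s + s * u). assert (HA : 0 < A) by (unfold A; nra).
  assert (H1 := ln_le_minus_one (u / A) ltac:(apply Rdiv_lt_0_compat; assumption)).
  assert (H2 := ln_le_minus_one (/ A) ltac:(apply Rinv_0_lt_compat; assumption)).
  unfold Rdiv in H1. rewrite ln_mult, ln_Rinv in H1 by (try apply Rinv_0_lt_compat; assumption).
  rewrite ln_Rinv in H2 by assumption.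
  assert (E : s * (u * / A - 1) + (1 - s) * (/ A - 1) = 0) by (unfold A in *; field; lra).
  assert (Hle : s * ln u <= ln A) by nra.
  unfold Rpower. rewrite <- (exp_ln A) by assumption.
  destruct Hle as [Hlt| ->]; [left; apply exp_increasing; assumption|lra].
Qed.

(* Jensen's inequality for the concave function [t ^ s], by the tangent at the mean [Tot / n]. *)
Lemma lsum_pw_le {I : Type} (l : list I) (a : I -> R) s Tot n :
  0 < s <= 1 -> 0 < Tot -> 0 < n -> (forall i, In i l -> 0 <= a i) -> lsum a l <= Tot ->
  INR (length l) <= n -> lsum (fun i => pw (a i) s) l <= Rpower Tot s * Rpower n (1 - s).
Proof.
  intros Hs HT Hn Ha Hsum Hlen. set (tau := Tot / n).
  assert (Htau : 0 < tau) by (apply Rdiv_lt_0_compat; assumption).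
  assert (Hp := Rpower_pos tau s).
  apply Rle_trans with (lsum (fun i => (1 - s) * Rpower tau s + s * (Rpower tau s / tau) * a i) l).
  - apply lsum_le. intros i Hi. specialize (Ha i Hi).
    destruct (Rle_lt_or_eq_dec 0 (a i) Ha) as [Hpos|Hz].
    + rewrite pw_pos by assumption.
      assert (Hu : 0 < a i / tau) by (apply Rdiv_lt_0_compat; assumption).
      assert (Ht := Rpower_tangent (a i / tau) s Hu Hs).
      replace (a i) with (a i / tau * tau) at 1 by (field; lra).
      rewrite <- Rpower_mult_distr by assumption.
      apply Rmult_le_compat_r with (r := Rpower tau s) in Ht; [|lra].
      replace ((1 - s + s * (a i / tau)) * Rpower tau s)
        with ((1 - s) * Rpower tau s + s * (Rpower tau s / tau) * a i) in Ht by (field; lra).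
      exact Ht.
    + rewrite <- Hz, pw_zero, Rmult_0_r, Rplus_0_r. apply Rmult_le_pos; lra.
  - rewrite lsum_plus, lsum_const, lsum_scal.
    apply Rle_trans with (n * ((1 - s) * Rpower tau s) + s * (Rpower tau s / tau) * Tot).
    + apply Rplus_le_compat.
      * apply Rmult_le_compat_r; [apply Rmult_le_pos; lra|assumption].
      * apply Rmult_le_compat_l; [|assumption]. apply Rmult_le_pos; [lra|].
        left. apply Rdiv_lt_0_compat; assumption.
    + right. replace (s * (Rpower tau s / tau) * Tot) with (s * Rpower tau s * n)
        by (replace Tot with (tau * n) by (unfold tau; field; lra); field; lra).
      transitivity (n * Rpower tau s); [ring|]. unfold tau, Rdiv.
      rewrite <- Rpower_mult_distr by (try apply Rinv_0_lt_compat; assumption).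
      rewrite Rpower_inv by assumption. unfold Rminus. rewrite Rpower_plus, Rpower_Ropp, Rpower_1 by assumption.
      ring.
Qed.

Section Energies.
Context {T X : Type} (pi : T -> T) (lev : T -> Z) (K : T -> X -> Prop) (d : X -> X -> R).
Context (r Cd c0 ct : R) (L B M : nat) (phi : T).
Hypothesis HF : frame pi lev K d r Cd c0 ct L B M.
Hypothesis Hlevel : forall w n, level pi phi w n <-> n = lev w.

Let adjK := adj lev K.

Lemma Jh_adj m w v : Jh pi phi K m w v <-> lev w = m /\ adjK w v.
Proof.
  unfold Jh, adjK, adj. rewrite !Hlevel. split.
  - intros [-> [E H]]. auto.
  - intros [<- [E H]]. auto.
Qed.

Lemma within_Jh m n w v : lev w = m -> (within (Jh pi phi K m) n w v <-> within adjK n w v).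
Proof.
  intros Hw. split.
  - apply within_mono_rel. intros a b H. apply Jh_adj in H. tauto.
  - intros H. revert Hw. induction H as [n w|n w u v Hwu Huv IH]; intros Hw; [apply within_refl|].
    apply within_step with u; [apply Jh_adj; auto|]. apply IH. destruct Hwu. congruence.
Qed.

Lemma Gamma_within n w v : Gamma pi phi K n w v <-> within adjK n w v.
Proof.
  unfold Gamma. split.
  - intros [m [Hw [_ H]]]. apply Hlevel in Hw. apply (within_Jh m); auto.
  - intros H. exists (lev w). split; [apply Hlevel; reflexivity|]. split.
    + apply Hlevel. apply within_adj_lev in H. congruence.
    + apply within_Jh; auto.
Qed.

Lemma JhN_within N m uv : JhN pi phi K N m uv <->
  lev (fst uv) = m /\ fst uv <> snd uv /\ within adjK N (fst uv) (snd uv).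
Proof.
  unfold JhN. rewrite !Hlevel. split.
  - intros [H1 [_ [H2 H3]]]. split; [auto|]. split; [assumption|]. apply (within_Jh m); auto.
  - intros [H1 [H2 H3]]. split; [auto|]. split; [|split; [assumption|apply within_Jh; auto]].
    apply within_adj_lev in H3. congruence.
Qed.

Lemma level_plus_lev w v k : level_plus pi phi w v k <-> lev v = (lev w + Z.of_nat k)%Z.
Proof.
  unfold level_plus. split.
  - intros [n [H1 H2]]. apply Hlevel in H1, H2. congruence.
  - intros H. exists (lev w). rewrite !Hlevel. auto.
Qed.

(** Bounds on all finite sums replace the extended-valued supremum in the energy, so that all
    estimates are about real lists. *)
Definition pairs_sum_le (p : R) (k N : nat) (w : T) (f : T -> R) (S : R) : Prop :=
  forall l, NoDup l -> (forall uv, In uv l -> lev (fst uv) = (lev w + Z.of_nat k)%Z /\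
    fst uv <> snd uv /\ within adjK N (fst uv) (snd uv)) ->
  lsum (fun uv => abspow (f (fst uv) - f (snd uv)) p) l <= S.

Definition admissible_fn (k N1 N2 : nat) (w : T) (f : T -> R) : Prop :=
  (forall v, lev v = (lev w + Z.of_nat k)%Z -> within adjK N1 w (Nat.iter k pi v) -> f v = 1) /\
  (forall v, lev v = (lev w + Z.of_nat k)%Z -> ~ within adjK N2 w (Nat.iter k pi v) -> f v = 0).

Section FixedN.
Variables N1 N2 N : nat.
Let E (p : R) (k : nat) : Rbar := energy pi phi K p k N1 N2 N.

Lemma energy_w_nonneg p k w : Rbar_le (Finite 0) (energy_w pi phi K p k w N1 N2 N).
Proof.
  apply Glb_Rbar_correct. intros e [f [_ [_ He]]]. 
  assert (H0 : Rbar_le (Finite 0) (sum_over (fun xy => exists m, level pi phi w m /\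
    JhN pi phi K N (m + Z.of_nat k) xy) (fun xy => abspow (f (fst xy) - f (snd xy)) p))).
  { apply (proj1 (Lub_Rbar_correct _)). exists nil. split; [constructor|]. split; [intros z []|reflexivity]. }
  destruct (sum_over _ _) as [t| |]; simpl in *.
  - injection He as ->. lra.
  (* A function with infinite sum is no competitor: half of infinity is not the finite value [e]. *)
  - destruct (Rle_dec 0 (/ 2)) as [Hle|Hn]; [|lra]. destruct (Rle_lt_or_eq_dec _ _ Hle); [discriminate|lra].
  - contradiction.
Qed.

Lemma energy_nonneg p k : Rbar_le (Finite 0) (E p k).
Proof.
  eapply Rbar_le_trans; [apply (energy_w_nonneg p k phi)|].
  apply (proj1 (proj2_sig (Rbar_ex_lub _))). exists phi. reflexivity.
Qed.

Lemma energy_w_le p k w f S : admissible_fn k N1 N2 w f -> pairs_sum_le p k N w f S ->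
  Rbar_le (energy_w pi phi K p k w N1 N2 N) (Finite S).
Proof.
  intros [Hf1 Hf0] HS. set (P := fun xy => exists m, level pi phi w m /\ JhN pi phi K N (m + Z.of_nat k) xy).
  set (g0 := fun xy => abspow (f (fst xy) - f (snd xy)) p).
  assert (Hsum : exists t, sum_over P g0 = Finite t /\ 0 <= t <= S).
  { unfold sum_over.
    destruct (Lub_Rbar_correct (fun s => exists l : list (T * T), NoDup l /\ (forall z, In z l -> P z) /\
      s = fold_right Rplus 0 (map g0 l))) as [Hub Hlub].
    assert (H0 := Hub 0 (ex_intro _ nil (conj (NoDup_nil _) (conj (fun z (h : In z nil) => match h with end) eq_refl)))).
    assert (H1 : Rbar_le (Lub_Rbar (fun s => exists l : list (T * T), NoDup l /\ (forall z, In z l -> P z) /\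
      s = fold_right Rplus 0 (map g0 l))) (Finite S)).
    { apply Hlub. intros s [l [Hd [Hl ->]]]. apply HS; [assumption|]. intros uv Huv.
      destruct (Hl uv Huv) as [m [Hm Huv']]. apply Hlevel in Hm. apply JhN_within in Huv'. subst m. exact Huv'. }
    destruct (Lub_Rbar _) as [t| |]; simpl in *; try contradiction. exists t. auto. }
  destruct Hsum as [t [Et Ht]].
  apply Rbar_le_trans with (Finite (/ 2 * t)); [|simpl; lra].
  apply (proj1 (Glb_Rbar_correct _)). exists f. split; [|split].
  - intros v Hv Hs. apply level_plus_lev in Hv. apply Hf1; [assumption|]. apply Gamma_within. exact Hs.
  - intros v Hv Hs. apply level_plus_lev in Hv. apply Hf0; [assumption|]. intros Hc. apply Hs.
    apply Gamma_within. exact Hc.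
  - fold P. fold g0. rewrite Et. reflexivity.
Qed.

Lemma energy_le p k S : (forall w, exists f, admissible_fn k N1 N2 w f /\ pairs_sum_le p k N w f S) ->
  Rbar_le (E p k) (Finite S).
Proof.
  intros H. unfold E, energy. apply (proj2 (proj2_sig (Rbar_ex_lub _))). intros e [w ->].
  destruct (H w) as [f [H1 H2]]. apply energy_w_le with f; assumption.
Qed.

(** The strict inequality provides a competitor for each [w]; the factor 2 undoes the [1/2] in the
    energy, which counts every edge in both directions. *)
Lemma energy_lt p k e : Rbar_lt (E p k) (Finite e) ->
  forall w, exists f, admissible_fn k N1 N2 w f /\ pairs_sum_le p k N w f (2 * e).
Proof.
  intros H w.
  assert (Hw : Rbar_lt (energy_w pi phi K p k w N1 N2 N) (Finite e)).
  { eapply Rbar_le_lt_trans; [|exact H]. apply (proj1 (proj2_sig (Rbar_ex_lub _))). exists w. reflexivity. }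
  apply NNPP. intros Hn. revert Hw. apply Rbar_le_not_lt. apply Glb_Rbar_correct.
  intros s [f [Hf1 [Hf0 Hs]]]. simpl. apply Rnot_lt_le. intros Hlt. apply Hn. exists f. split; [split|].
  - intros v Hv Hin. apply Hf1; [apply level_plus_lev; assumption|]. apply Gamma_within. assumption.
  - intros v Hv Hin. apply Hf0; [apply level_plus_lev; assumption|]. intros Hc. apply Hin.
    apply Gamma_within. exact Hc.
  - intros l Hd Hl.
    assert (Hle : Rbar_le (Finite (lsum (fun uv => abspow (f (fst uv) - f (snd uv)) p) l))
      (sum_over (fun xy => exists m, level pi phi w m /\ JhN pi phi K N (m + Z.of_nat k) xy)
        (fun xy => abspow (f (fst xy) - f (snd xy)) p))).
    { apply (proj1 (Lub_Rbar_correct _)). exists l. split; [assumption|]. split; [|reflexivity].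
      intros uv Huv. exists (lev w). split; [apply Hlevel; reflexivity|]. apply JhN_within. apply Hl. assumption. }
    destruct (sum_over _ _) as [t| |]; simpl in *.
    + injection Hs as ->. lra.
    + destruct (Rle_dec 0 (/ 2)) as [Hle2|]; [|lra]. destruct (Rle_lt_or_eq_dec _ _ Hle2); [discriminate|lra].
    + contradiction.
Qed.

Definition size_bound (k : nat) (n : R) : Prop :=
  forall u l, NoDup l -> (forall v, In v l -> Nat.iter k pi v = u) -> INR (length l) <= n.

Lemma size_bound_B k : size_bound k (INR B ^ k).
Proof.
  intros u l Hd Hl. destruct (listed_desc pi B (fr_chl HF) k u) as [l' [[Hd' Hl'] Hlen]].
  rewrite <- pow_INR. apply le_INR. eapply Nat.le_trans; [|exact Hlen].
  apply NoDup_incl_length; [assumption|]. intros v Hv. apply Hl'. auto.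
Qed.

Section MetricBound.
Variable rho : X -> X -> R.
Hypothesis Hrho : is_metric rho.
Hypothesis Hqs : quasisymmetric d rho.
Hypothesis HN : (N1 + M <= N2)%nat.
Variables xa za : T -> X.
Hypothesis Hxa : forall w, K w (xa w).
Hypothesis Hza : forall w, K w (za w).
Hypothesis Hxz : forall w, rp r (lev w) <= Cd * d (xa w) (za w).
Let s := sz rho xa za.
Let s_pos : forall w, 0 < s w := sz_pos HF rho Hrho xa za Hxz.

Lemma energy_le_sizes p : 0 < p -> exists C, 0 < C /\ forall k S,
  (forall u l, NoDup l -> (forall v, In v l -> Nat.iter k pi v = u) ->
    lsum (fun v => Rpower (s v / s u) p) l <= S) -> Rbar_le (E p k) (Finite (C * S)).
Proof.
  intros Hp.
  destruct (test_function HF rho Hrho Hqs xa za Hxa Hza Hxz N1 N2 N HN p Hp) as [C [HC H]].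
  exists C. split; [assumption|]. intros k S HS. apply energy_le. intros w.
  destruct (H k w S) as [f [Hf1 [Hf0 Hf]]].
  - intros u _. apply HS.
  - exists f. split; [split; auto|]. intros l Hd Hl. apply Hf; [assumption|].
    intros uv Huv. destruct (Hl uv Huv) as [H1 [_ H2]]. auto.
Qed.

Lemma ratio_decay : exists lam C, 0 < lam < 1 /\ 0 < C /\
  forall k v, 0 < s v / s (Nat.iter k pi v) <= C * lam ^ k.
Proof.
  destruct (sz_decay HF rho Hrho Hqs xa za Hxa Hza Hxz) as [lam [C [Hlam [HC H]]]].
  exists lam, C. split; [assumption|]. split; [assumption|]. intros k v. fold s in H.
  assert (H1 := s_pos v). assert (H2 := s_pos (Nat.iter k pi v)). split; [apply Rdiv_lt_0_compat; assumption|].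
  apply Rmult_le_reg_r with (s (Nat.iter k pi v)); [assumption|].
  unfold Rdiv. rewrite Rmult_assoc, Rinv_l, Rmult_1_r by lra. apply H.
Qed.

Lemma Rpower_lt_one lam a : 0 < lam < 1 -> 0 < a -> 0 < Rpower lam a < 1.
Proof.
  intros Hl Ha. split; [apply Rpower_pos|].
  assert (Hln : ln lam < 0) by (rewrite <- ln_1; apply ln_increasing; lra).
  assert (Hneg : a * ln lam < 0) by nra. apply exp_increasing in Hneg. rewrite exp_0 in Hneg. exact Hneg.
Qed.

(** There are at most [B^k] descendants and each ratio is at most a multiple of [lam^k], so any [p]
    with [(B + 1) lam^p < 1] will do. An integer [p] keeps all powers natural. *)
Lemma energy_decay_large_p : exists p C q, 0 < p /\ 0 < C /\ 0 < q < 1 /\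
  forall k, Rbar_le (E p k) (Finite (C * q ^ k)).
Proof.
  destruct ratio_decay as [lam [C1 [Hlam [HC1 Hdec]]]].
  assert (HB : 0 < INR (S B)) by (apply lt_0_INR; lia).
  destruct (pow_eventually_lt lam Hlam (/ INR (S B))) as [m Hm]; [apply Rinv_0_lt_compat; assumption|].
  specialize (Hm (S m) ltac:(lia)). set (p := INR (S m)).
  assert (Hp : 0 < p) by (apply lt_0_INR; lia).
  destruct (energy_le_sizes p Hp) as [C [HC H]].
  exists p, (C * Rpower C1 p), (INR (S B) * lam ^ S m).
  assert (Hlm : 0 < lam ^ S m) by (apply pow_lt; lra).
  split; [assumption|]. split; [apply Rmult_lt_0_compat; [assumption|apply Rpower_pos]|]. split.
  { split; [apply Rmult_lt_0_compat; assumption|].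
    apply Rmult_lt_compat_l with (r := INR (S B)) in Hm; [|assumption]. rewrite Rinv_r in Hm by lra. exact Hm. }
  intros k. rewrite Rmult_assoc. apply H. intros u l Hd Hl.
  apply Rle_trans with (INR (S B) ^ k * (Rpower C1 p * (lam ^ S m) ^ k)); [|right; rewrite Rpow_mult_distr; ring].
  rewrite <- pow_INR.
  apply lsum_le_const.
  - intros v Hv. rewrite <- (Hl v Hv). destruct (Hdec k v) as [H1 H2].
    apply Rle_trans with (Rpower (C1 * lam ^ k) p); [apply Rle_Rpower_l; lra|].
    assert (Hlk : 0 < lam ^ k) by (apply pow_lt; lra).
    rewrite <- Rpower_mult_distr by assumption. right. f_equal. unfold p.
    rewrite Rpower_pow by assumption. rewrite <- !pow_mult. f_equal. lia.
  - apply Rmult_le_pos; [left; apply Rpower_pos|]. apply pow_le. lra.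
  - apply INR_le. eapply Rle_trans; [apply (size_bound_B k u l Hd Hl)|].
    rewrite <- pow_INR. apply le_INR, Nat.pow_le_mono_l. lia.
Qed.

Variable nu : (X -> Prop) -> Rbar.
Hypothesis Hnu : borel_measure rho nu.
Variable al : R.
Hypothesis Hal : ahlfors_regular rho al nu.

Lemma ratio_sum : exists C, 0 < C /\ forall k u l, NoDup l -> (forall v, In v l -> Nat.iter k pi v = u) ->
  lsum (fun v => Rpower (s v / s u) al) l <= C.
Proof.
  destruct (sz_sum HF rho Hrho Hqs xa za Hxa Hza Hxz nu Hnu al Hal) as [C [HC H]]. fold s in H.
  exists C. split; [assumption|]. intros k u l Hd Hl. specialize (H k u l Hd Hl).
  assert (Hu := Rpower_pos (s u) al).
  rewrite (lsum_ext _ (fun v => / Rpower (s u) al * Rpower (s v) al)).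
  - rewrite lsum_scal. apply Rmult_le_reg_l with (Rpower (s u) al); [assumption|].
    rewrite <- Rmult_assoc, Rinv_r, Rmult_1_l by lra. lra.
  - intros v _. unfold Rdiv. rewrite <- Rpower_mult_distr by (try apply Rinv_0_lt_compat; apply s_pos).
    rewrite Rpower_inv by apply s_pos. ring.
Qed.

Lemma energy_decay_above p : al < p -> 0 < p -> exists C q, 0 < C /\ 0 < q < 1 /\
  forall k, Rbar_le (E p k) (Finite (C * q ^ k)).
Proof.
  intros Hap Hp. destruct ratio_decay as [lam [C1 [Hlam [HC1 Hdec]]]].
  destruct ratio_sum as [C2 [HC2 Hsum]]. destruct (energy_le_sizes p Hp) as [C [HC H]].
  exists (C * (Rpower C1 (p - al) * C2)), (Rpower lam (p - al)).
  assert (HR := Rpower_pos C1 (p - al)).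
  split; [repeat apply Rmult_lt_0_compat; assumption|]. split; [apply Rpower_lt_one; [assumption|lra]|].
  intros k. rewrite Rmult_assoc. apply H. intros u l Hd Hl.
  assert (Hlk : 0 < lam ^ k) by (apply pow_lt; lra).
  apply Rle_trans with (lsum (fun v => Rpower (C1 * lam ^ k) (p - al) * Rpower (s v / s u) al) l).
  - apply lsum_le. intros v Hv. rewrite <- (Hl v Hv). destruct (Hdec k v) as [H1 H2].
    replace p with (p - al + al) at 1 by ring. rewrite Rpower_plus.
    apply Rmult_le_compat_r; [left; apply Rpower_pos|]. apply Rle_Rpower_l; lra.
  - rewrite lsum_scal, <- Rpower_mult_distr by assumption. rewrite Rpower_pow_base by lra.
    specialize (Hsum k u l Hd Hl). assert (HQ := Rpower_pos (lam ^ k) (p - al)).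
    apply Rle_trans with (Rpower C1 (p - al) * Rpower (lam ^ k) (p - al) * C2); [|right; ring].
    apply Rmult_le_compat_l; [|assumption]. left. apply Rmult_lt_0_compat; assumption.
Qed.

Lemma energy_growth_below p : 0 < p <= al -> exists C, 0 < C /\ forall k n, 0 < n -> size_bound k n ->
  Rbar_le (E p k) (Finite (C * Rpower n (1 - p / al))).
Proof.
  intros Hp. destruct ratio_sum as [C2 [HC2 Hsum]].
  destruct (energy_le_sizes p (proj1 Hp)) as [C [HC H]].
  exists (C * Rpower C2 (p / al)). split; [apply Rmult_lt_0_compat; [assumption|apply Rpower_pos]|].
  intros k n Hn Hsize. rewrite Rmult_assoc. apply H. intros u l Hd Hl.
  rewrite (lsum_ext _ (fun v => pw (Rpower (s v / s u) al) (p / al))).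
  - apply lsum_pw_le.
    + split; [apply Rdiv_lt_0_compat; lra|]. apply Rmult_le_reg_r with al; [lra|].
      unfold Rdiv. rewrite Rmult_assoc, Rinv_l by lra. lra.
    + assumption.
    + assumption.
    + intros v _. left. apply Rpower_pos.
    + apply (Hsum k); assumption.
    + apply (Hsize u); assumption.
  - intros v _. rewrite pw_pos by apply Rpower_pos. rewrite Rpower_mult. f_equal. field. lra.
Qed.

End MetricBound.

Lemma energy_holder q p : 0 < q <= p -> exists C, 0 < C /\ forall k n e, 0 < n -> size_bound k n -> 0 < e ->
  Rbar_lt (E p k) (Finite e) -> Rbar_le (E q k) (Finite (C * (Rpower e (q / p) * Rpower n (1 - q / p)))).
Proof.
  intros Hqp. set (Q := 2 * INR (S L ^ N) * INR (S L ^ N2)).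
  assert (HQ : 0 < Q).
  { unfold Q. repeat apply Rmult_lt_0_compat; try lra; apply lt_0_INR, Nat.neq_0_lt_0, Nat.pow_nonzero; lia. }
  exists (Rpower 2 (q / p) * Rpower Q (1 - q / p)). split; [apply Rmult_lt_0_compat; apply Rpower_pos|].
  intros k n e Hn Hsize He HE. apply energy_le. intros w.
  destruct (energy_lt p k e HE w) as [f [Hf Hsum]]. exists f. split; [assumption|].
  destruct (fun_choice (fun v lst => listed (within adjK N v) lst /\ (length lst <= L ^ N)%nat)
    (ball_listed adjK L (fr_deg HF) N)) as [bN HbN].
  destruct (ball_listed adjK L (fr_deg HF) N2 w) as [b2 [[Hb2d Hb2] Hb2len]].
  destruct (fun_choice (fun u lst => listed (fun v => Nat.iter k pi v = u) lst /\ (length lst <= B ^ k)%nat)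
    (listed_desc pi B (fr_chl HF) k)) as [ds Hds].
  set (V := flat_map ds b2).
  assert (HV : forall v, lev v = (lev w + Z.of_nat k)%Z -> ~ In v V -> f v = 0).
  { intros v Hv Hni. apply (proj2 Hf); [assumption|]. intros Hc. apply Hni. apply in_flat_map.
    exists (Nat.iter k pi v). split; [apply Hb2; assumption|]. apply (proj2 (proj1 (Hds _))). reflexivity. }
  assert (HVlen : INR (length V) <= INR (S L ^ N2) * n).
  { replace (INR (length V)) with (lsum (fun _ : T => 1) V) by (rewrite lsum_const; ring).
    unfold V. rewrite lsum_flat_map. apply lsum_le_const; [|lra|].
    - intros u _. rewrite lsum_const, Rmult_1_r. destruct (Hds u) as [[Hdu Hdin] _].
      apply (Hsize u); [assumption|]. intros v Hv. apply Hdin. assumption.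
    - eapply Nat.le_trans; [exact Hb2len|]. apply Nat.pow_le_mono_l. lia. }
  assert (HbNl : forall a, (length (bN a) <= S L ^ N)%nat).
  { intros a. eapply Nat.le_trans; [apply HbN|]. apply Nat.pow_le_mono_l. lia. }
  intros l Hd Hl.
  assert (Hpair : forall uv uv' : T * T, fst uv = fst uv' -> snd uv = snd uv' -> uv = uv').
  { intros [a b] [a' b'] E1 E2. simpl in *. congruence. }
  (* Only pairs with an end in the support count; their number [Q n] is the length that enters
     Jensen's inequality. *)
  set (l0 := cfilter (fun uv => In (fst uv) V \/ In (snd uv) V) l).
  assert (Hl0 : INR (length l0) <= Q * n).
  { replace (INR (length l0)) with (lsum (fun _ : T * T => 1) l0) by (rewrite lsum_const; ring).
    rewrite (lsum_cfilter _ (fun uv => In (fst uv) V)).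
    assert (Hd0 : NoDup l0) by (apply nodup_cfilter; assumption).
    assert (H1 : lsum (fun _ : T * T => 1) (cfilter (fun uv => In (fst uv) V) l0)
      <= INR (S L ^ N) * lsum (fun _ : T => 1) V).
    { apply (lsum_pairs_le fst snd bN (fun _ => 1)); auto.
      - apply nodup_cfilter. assumption.
      - intros; lra.
      - intros uv Huv. apply in_cfilter in Huv. destruct Huv as [Huv H1]. apply in_cfilter in Huv.
        split; [assumption|]. apply (proj2 (proj1 (HbN _))). apply Hl. tauto. }
    assert (H2 : lsum (fun _ : T * T => 1) (cfilter (fun uv => ~ In (fst uv) V) l0)
      <= INR (S L ^ N) * lsum (fun _ : T => 1) V).
    { apply (lsum_pairs_le snd fst bN (fun _ => 1)); auto.
      - apply nodup_cfilter. assumption.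
      - intros; lra.
      - intros uv Huv. apply in_cfilter in Huv. destruct Huv as [Huv Hnf]. apply in_cfilter in Huv.
        split; [tauto|]. apply (proj2 (proj1 (HbN _))). apply within_sym; [apply adj_sym|]. apply Hl. tauto. }
    rewrite (lsum_const 1 V), Rmult_1_r in H1, H2.
    apply Rmult_le_compat_l with (r := INR (S L ^ N)) in HVlen; [|apply pos_INR]. unfold Q. lra. }
  assert (El : lsum (fun uv => abspow (f (fst uv) - f (snd uv)) q) l
    = lsum (fun uv => abspow (f (fst uv) - f (snd uv)) q) l0).
  { rewrite (lsum_cfilter _ (fun uv => In (fst uv) V \/ In (snd uv) V)). fold l0.
    rewrite (lsum_ext _ (fun _ => 0) (cfilter _ l)); [rewrite lsum_const; ring|].
    intros uv Huv. apply in_cfilter in Huv. destruct Huv as [Huv Hni]. destruct (Hl uv Huv) as [H1 [_ H2]].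
    apply within_adj_lev in H2.
    rewrite !HV; [rewrite Rminus_diag; apply abspow_zero|congruence|tauto|assumption|tauto]. }
  rewrite El. rewrite (lsum_ext _ (fun uv => pw (abspow (f (fst uv) - f (snd uv)) p) (q / p))).
  - apply Rle_trans with (Rpower (2 * e) (q / p) * Rpower (Q * n) (1 - q / p)).
    + apply lsum_pw_le.
      * split; [apply Rdiv_lt_0_compat; lra|]. apply Rmult_le_reg_r with p; [lra|].
        unfold Rdiv. rewrite Rmult_assoc, Rinv_l by lra. lra.
      * lra.
      * apply Rmult_lt_0_compat; assumption.
      * intros. apply abspow_nonneg.
      * apply Hsum; [apply nodup_cfilter; assumption|]. intros uv Huv. apply in_cfilter in Huv. apply Hl. tauto.
      * assumption.
    + rewrite <- !Rpower_mult_distr by (try assumption; lra). right. ring.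
  - intros uv _. rewrite !abspow_pw, pw_comp by apply Rabs_pos. f_equal. field. lra.
Qed.

Lemma regular_metric_of_liminf p : 0 < p -> (1 <= N)%nat ->
  (forall eps k0, 0 < eps -> exists k, (k0 <= k)%nat /\ Rbar_lt (E p k) (Finite eps)) ->
  exists rho nu, is_metric rho /\ borel_measure rho nu /\ ahlfors_regular rho p nu /\ quasisymmetric d rho.
Proof.
  intros Hp HN1 H. apply (regular_metric_of_energy pi lev K d r Cd c0 ct L B M N2 p phi HF Hp).
  intros eps k0 He. destruct (H (eps / 2) k0) as [k [Hk HE]]; [lra|].
  exists k. split; [assumption|]. intros w. destruct (energy_lt p k _ HE w) as [f [[Hf1 Hf0] Hsum]].
  exists f. split; [|split; [assumption|]].
  - intros v Hv. apply Hf1.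
    + assert (E1 := frame_lev_iter HF k v). rewrite Hv in E1. lia.
    + rewrite Hv. apply within_refl.
  - intros l Hd Hl. replace eps with (2 * (eps / 2)) by field. apply Hsum; [assumption|].
    intros uv Huv. destruct (Hl uv Huv) as [H1 H2]. split; [assumption|]. split; [apply H2|].
    apply within_mono with 1%nat; [assumption|]. apply within_edge. assumption.
Qed.

End FixedN.

End Energies.


(** * Critical exponents and spectral dimensions *)

Lemma Rbar_lub_ub (E : Rbar -> Prop) x : E x -> Rbar_le x (Rbar_lub E).
Proof. intros H. apply (proj1 (proj2_sig (Rbar_ex_lub E))). assumption. Qed.

Lemma Rbar_lub_least (E : Rbar -> Prop) b : (forall x, E x -> Rbar_le x b) -> Rbar_le (Rbar_lub E) b.
Proof. intros H. apply (proj2 (proj2_sig (Rbar_ex_lub E))). exact H. Qed.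

Lemma Rbar_glb_lb (E : Rbar -> Prop) x : E x -> Rbar_le (Rbar_glb E) x.
Proof. intros H. apply (proj1 (proj2_sig (Rbar_ex_glb E))). assumption. Qed.

Lemma Rbar_glb_greatest (E : Rbar -> Prop) b : (forall x, E x -> Rbar_le b x) -> Rbar_le b (Rbar_glb E).
Proof. intros H. apply (proj2 (proj2_sig (Rbar_ex_glb E))). exact H. Qed.

Section LimsupLiminf.
Variable u : nat -> Rbar.

Lemma limsup_le x n : (forall k, (n <= k)%nat -> Rbar_le (u k) x) -> Rbar_le (Rbar_limsup u) x.
Proof.
  intros H. eapply Rbar_le_trans; [apply Rbar_glb_lb; exists n; reflexivity|].
  apply Rbar_lub_least. intros z [k [Hk ->]]. auto.
Qed.

Lemma limsup_lt_eventually x : Rbar_lt (Rbar_limsup u) x ->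
  exists n, forall k, (n <= k)%nat -> Rbar_lt (u k) x.
Proof.
  intros H. apply NNPP. intros Hn. revert H. apply Rbar_le_not_lt. apply Rbar_glb_greatest.
  intros y [n ->]. apply Rbar_not_lt_le. intros Hlt. apply Hn. exists n. intros k Hk.
  eapply Rbar_le_lt_trans; [|exact Hlt]. apply Rbar_lub_ub. exists k. auto.
Qed.

Lemma limsup_ge x : (forall n, exists k, (n <= k)%nat /\ Rbar_le x (u k)) -> Rbar_le x (Rbar_limsup u).
Proof.
  intros H. apply Rbar_glb_greatest. intros y [n ->]. destruct (H n) as [k [Hk Hx]].
  eapply Rbar_le_trans; [exact Hx|]. apply Rbar_lub_ub. exists k. auto.
Qed.

Lemma liminf_ge x n : (forall k, (n <= k)%nat -> Rbar_le x (u k)) -> Rbar_le x (Rbar_liminf u).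
Proof.
  intros H. eapply Rbar_le_trans; [|apply Rbar_lub_ub; exists n; reflexivity].
  apply Rbar_glb_greatest. intros z [k [Hk ->]]. auto.
Qed.

Lemma liminf_lt_frequently x : Rbar_lt (Rbar_liminf u) x ->
  forall n, exists k, (n <= k)%nat /\ Rbar_lt (u k) x.
Proof.
  intros H n. apply NNPP. intros Hn. revert H. apply Rbar_le_not_lt. apply (liminf_ge x n).
  intros k Hk. apply Rbar_not_lt_le. intros Hlt. apply Hn. exists k. auto.
Qed.

Lemma liminf_le_limsup : Rbar_le (Rbar_liminf u) (Rbar_limsup u).
Proof.
  apply Rbar_lub_least. intros y [n ->]. apply limsup_ge. intros m. exists (n + m)%nat. split; [lia|].
  apply Rbar_glb_lb. exists (n + m)%nat. split; [lia|reflexivity].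
Qed.

End LimsupLiminf.

Lemma rootk_nonneg x k : Rbar_le (Finite 0) x -> Rbar_le (Finite 0) (Rbar_rootk x k).
Proof.
  intros H. destruct x as [r| |]; simpl in *; auto. destruct (Rle_dec r 0); [lra|]. left. apply exp_pos.
Qed.

Lemma Rpower_root r k : 0 < r -> (1 <= k)%nat -> Rpower r (/ INR k) ^ k = r.
Proof.
  intros Hr Hk. rewrite <- Rpower_pow by apply Rpower_pos.
  apply Rpower_exp_inv; [assumption|]. apply not_0_INR. lia.
Qed.

Lemma rootk_lt x k b : Rbar_lt (Rbar_rootk x k) (Finite b) -> (1 <= k)%nat -> 0 < b ->
  Rbar_lt x (Finite (b ^ k)).
Proof.
  intros H Hk Hb. assert (Hbk : 0 < b ^ k) by (apply pow_lt; assumption).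
  destruct x as [r| |]; simpl in *; [|contradiction|exact I].
  destruct (Rle_dec r 0); [lra|]. apply Rnot_le_lt. intros Hle.
  assert (Hik : 0 < / INR k) by (apply Rinv_0_lt_compat, lt_0_INR; lia).
  assert (Hc : Rpower (b ^ k) (/ INR k) <= Rpower r (/ INR k)) by (apply Rle_Rpower_l; lra).
  rewrite <- Rpower_pow_base, Rpower_root in Hc by assumption. lra.
Qed.

Lemma rootk_le x k b : Rbar_le x (Finite (b ^ k)) -> (1 <= k)%nat -> 0 < b ->
  Rbar_le (Rbar_rootk x k) (Finite b).
Proof.
  intros H Hk Hb. destruct x as [r| |]; simpl in *; [|contradiction|exact I].
  destruct (Rle_dec r 0); [lra|].
  assert (Hik : 0 < / INR k) by (apply Rinv_0_lt_compat, lt_0_INR; lia).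
  apply Rle_trans with (Rpower (b ^ k) (/ INR k)); [apply Rle_Rpower_l; lra|].
  rewrite <- Rpower_pow_base, Rpower_root by assumption. lra.
Qed.

Lemma Glb_Rbar_le (E : R -> Prop) x : E x -> Rbar_le (Glb_Rbar E) (Finite x).
Proof. apply (proj1 (Glb_Rbar_correct E)). Qed.

Lemma Glb_Rbar_lt (E : R -> Prop) x : Rbar_lt (Glb_Rbar E) x -> exists y, E y /\ Rbar_lt (Finite y) x.
Proof.
  intros H. apply NNPP. intros Hn. revert H. apply Rbar_le_not_lt. apply Glb_Rbar_correct.
  intros y Hy. apply Rbar_not_lt_le. intros Hlt. apply Hn. exists y. auto.
Qed.

Lemma Rbar_le_above x a c : a < c -> (forall b, a < b < c -> Rbar_le x (Finite b)) -> Rbar_le x (Finite a).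
Proof.
  intros Hac H. apply Rbar_not_lt_le. intros Hlt. destruct x as [x| |]; simpl in *.
  - set (b := Rmin ((a + x) / 2) ((a + c) / 2)).
    assert (Hb : a < b < c /\ b < x) by (unfold b, Rmin; destruct (Rle_dec _ _); lra).
    specialize (H b (proj1 Hb)). simpl in H. lra.
  - apply (H ((a + c) / 2)). lra.
  - assumption.
Qed.

(** * Consequences for the exponents from the energy bounds alone *)

Section CriticalExponents.
Variable E : R -> nat -> Rbar.
Variable Adm : R -> Prop.
Variable sb : nat -> R -> Prop.
Variable Nst : R.
Hypothesis E_nonneg : forall p k, Rbar_le (Finite 0) (E p k).
Hypothesis Adm_pos : forall al, Adm al -> 0 < al.
Hypothesis Adm_above : forall al p, Adm al -> al < p -> 0 < p ->
  exists C q, 0 < C /\ 0 < q < 1 /\ forall k, Rbar_le (E p k) (Finite (C * q ^ k)).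
Hypothesis Adm_below : forall al p, Adm al -> 0 < p <= al ->
  exists C, 0 < C /\ forall k n, 0 < n -> sb k n -> Rbar_le (E p k) (Finite (C * Rpower n (1 - p / al))).
Hypothesis E_large : exists p C q, 0 < p /\ 0 < C /\ 0 < q < 1 /\
  forall k, Rbar_le (E p k) (Finite (C * q ^ k)).
Hypothesis Adm_of_small : forall p, 0 < p ->
  (forall eps k0, 0 < eps -> exists k, (k0 <= k)%nat /\ Rbar_lt (E p k) (Finite eps)) -> Adm p.
Hypothesis E_holder : forall q p, 0 < q <= p -> exists C, 0 < C /\ forall k n e,
  0 < n -> sb k n -> 0 < e -> Rbar_lt (E p k) (Finite e) ->
  Rbar_le (E q k) (Finite (C * (Rpower e (q / p) * Rpower n (1 - q / p)))).
Hypothesis HN1 : 1 < Nst.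
Hypothesis HNsb : forall b, Nst < b -> exists k0, forall k, (k0 <= k)%nat -> sb k (b ^ k).

Let dimA : Rbar := Glb_Rbar Adm.
Let Rup (p : R) : Rbar := Rbar_limsup (fun k => Rbar_rootk (E p k) k).
Let Rlo (p : R) : Rbar := Rbar_liminf (fun k => Rbar_rootk (E p k) k).

Lemma ln_Nst_pos : 0 < ln Nst.
Proof. rewrite <- ln_1. apply ln_increasing; lra. Qed.

Lemma decay_small p C q : 0 < C -> 0 < q < 1 -> (forall k, Rbar_le (E p k) (Finite (C * q ^ k))) ->
  forall eps, 0 < eps -> exists n, forall k, (n <= k)%nat -> Rbar_lt (E p k) (Finite eps).
Proof.
  intros HC Hq H eps He. destruct (pow_eventually_lt q Hq (eps / C)) as [n Hn]; [apply Rdiv_lt_0_compat; assumption|].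
  exists n. intros k Hk. eapply Rbar_le_lt_trans; [apply H|]. simpl. specialize (Hn k Hk).
  apply Rmult_lt_compat_l with (r := C) in Hn; [|assumption].
  replace (C * (eps / C)) with eps in Hn by (field; lra). exact Hn.
Qed.

Lemma limsup_zero_of_small p : (forall eps, 0 < eps -> exists n, forall k, (n <= k)%nat -> Rbar_lt (E p k) (Finite eps)) ->
  Rbar_limsup (E p) = Finite 0.
Proof.
  intros H. apply Rbar_le_antisym.
  - apply Rbar_le_above with 1; [lra|]. intros b Hb. destruct (H b) as [n Hn]; [lra|].
    apply limsup_le with n. intros k Hk. apply Rbar_lt_le. auto.
  - apply limsup_ge. intros n. exists n. auto.
Qed.

(** For every [b > g] the constant [C] is absorbed by [(b / g)^k] once [k] is large. *)
Lemma limsup_rootk_le p C g n : 0 < C -> 0 < g ->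
  (forall k, (n <= k)%nat -> Rbar_le (E p k) (Finite (C * g ^ k))) -> Rbar_le (Rup p) (Finite g).
Proof.
  intros HC Hg H. apply Rbar_le_above with (g + 1); [lra|]. intros b Hb.
  assert (Hgb : 0 < g / b < 1).
  { split; [apply Rdiv_lt_0_compat; lra|]. apply Rmult_lt_reg_r with b; [lra|].
    unfold Rdiv. rewrite Rmult_assoc, Rinv_l by lra. lra. }
  destruct (pow_eventually_lt _ Hgb (/ C)) as [m Hm]; [apply Rinv_0_lt_compat; assumption|].
  apply limsup_le with (1 + n + m)%nat. intros k Hk. apply rootk_le; [|lia|lra].
  eapply Rbar_le_trans; [apply H; lia|]. simpl. specialize (Hm k ltac:(lia)).
  assert (Hbk : 0 < b ^ k) by (apply pow_lt; lra).
  unfold Rdiv in Hm. rewrite Rpow_mult_distr, pow_inv in Hm.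
  apply Rmult_lt_compat_l with (r := C * b ^ k) in Hm; [|apply Rmult_lt_0_compat; assumption].
  replace (C * b ^ k * (g ^ k * / b ^ k)) with (C * g ^ k) in Hm by (field; lra).
  replace (C * b ^ k * / C) with (b ^ k) in Hm by (field; lra). lra.
Qed.

Lemma liminf_zero_adm p : 0 < p -> Rbar_liminf (E p) = Finite 0 -> Adm p.
Proof.
  intros Hp H. apply Adm_of_small; [assumption|]. intros eps k0 He.
  apply (liminf_lt_frequently (E p)). rewrite H. exact He.
Qed.

(** A cycle of inequalities: the lower exponent is at most the upper one, which is at most the
    dimension by decay above admissible exponents, which is at most the lower exponent because small
    energies produce a regular metric. *)
Theorem critical_exponents_eq :
  Glb_Rbar (fun p => 0 < p /\ Rbar_liminf (E p) = Finite 0)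
    = Glb_Rbar (fun p => 0 < p /\ Rbar_limsup (E p) = Finite 0) /\
  Glb_Rbar (fun p => 0 < p /\ Rbar_limsup (E p) = Finite 0) = dimA.
Proof.
  set (Il := Glb_Rbar (fun p => 0 < p /\ Rbar_liminf (E p) = Finite 0)).
  set (Iu := Glb_Rbar (fun p => 0 < p /\ Rbar_limsup (E p) = Finite 0)).
  assert (H1 : Rbar_le Il Iu).
  { apply Glb_Rbar_correct. intros p [Hp Hs]. apply Glb_Rbar_le. split; [assumption|].
    apply Rbar_le_antisym.
    - rewrite <- Hs. apply liminf_le_limsup.
    - apply liminf_ge with 0%nat. auto. }
  assert (H2 : Rbar_le Iu dimA).
  { apply Glb_Rbar_correct. intros al Hal. assert (Hp := Adm_pos al Hal).
    apply Rbar_le_above with (al + 1); [lra|]. intros p Hap. apply Glb_Rbar_le. split; [lra|].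
    destruct (Adm_above al p Hal) as [C [q [HC [Hq H]]]]; [lra|lra|].
    apply limsup_zero_of_small. apply (decay_small p C q); assumption. }
  assert (H3 : Rbar_le dimA Il).
  { apply Glb_Rbar_correct. intros p [Hp Hs]. apply Glb_Rbar_le. apply liminf_zero_adm; assumption. }
  split; apply Rbar_le_antisym; auto; eapply Rbar_le_trans; eassumption.
Qed.

(** At [x = 0] the logarithm is minus infinity, the denominator of [dS_formula] is infinite, and the
    quotient is 0. *)
Definition dS_val (p x : R) : R := if Rle_dec x 0 then 0 else p * ln Nst / (ln Nst - ln x).

Lemma dS_formula_val p x : dS_formula p (Finite Nst) (Finite x) = Finite (dS_val p x).
Proof.
  unfold dS_formula, dS_val. simpl Rbar_ln. destruct (Rle_dec Nst 0); [lra|].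
  destruct (Rle_dec x 0).
  - simpl. f_equal. ring.
  - reflexivity.
Qed.

Lemma dS_val_mono p x y : 0 < p -> 0 <= x <= y -> (0 < y -> ln y < ln Nst) -> dS_val p x <= dS_val p y.
Proof.
  intros Hp Hxy Hy. assert (HN := ln_Nst_pos). unfold dS_val.
  destruct (Rle_dec x 0), (Rle_dec y 0); try lra.
  - apply Rmult_le_pos; [apply Rmult_le_pos; lra|]. left. apply Rinv_0_lt_compat.
    assert (ln y < ln Nst) by (apply Hy; lra). lra.
  - apply Rmult_le_compat_l; [apply Rmult_le_pos; lra|]. assert (ln y < ln Nst) by (apply Hy; lra).
    apply Rinv_le_contravar; [lra|].
    assert (ln x <= ln y); [|lra]. destruct (Rle_lt_or_eq_dec x y) as [Hlt|<-]; [lra| |lra].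
    left. apply ln_increasing; lra.
Qed.

Lemma Rup_nonneg p : Rbar_le (Finite 0) (Rup p).
Proof. apply limsup_ge. intros n. exists n. split; [lia|]. apply rootk_nonneg, E_nonneg. Qed.

Lemma Rlo_nonneg p : Rbar_le (Finite 0) (Rlo p).
Proof. apply liminf_ge with 0%nat. intros k _. apply rootk_nonneg, E_nonneg. Qed.

Lemma ln_neg x : 0 < x < 1 -> ln x < 0.
Proof. intros H. rewrite <- ln_1. apply ln_increasing; lra. Qed.

(** For [x > 0], [q] above [dS_val p x] means [x^{q/p} Nst^{1 - q/p} < 1]. The inequality is strict,
    so both bases can be enlarged a little, as limits inferior and superior require. *)
Lemma perturbation p x q : 0 < p -> 0 <= x -> dS_val p x < q < p -> x < 1 ->
  exists b c, x < b /\ 0 < b /\ Nst < c /\ Rpower b (q / p) * Rpower c (1 - q / p) < 1.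
Proof.
  intros Hp Hx Hq Hx1. assert (HN := ln_Nst_pos).
  assert (Hq0 : 0 < q).
  { apply Rle_lt_trans with (dS_val p x); [|lra]. unfold dS_val. destruct (Rle_dec x 0); [lra|].
    apply Rmult_le_pos; [apply Rmult_le_pos; lra|]. left. apply Rinv_0_lt_compat.
    assert (ln x < 0) by (apply ln_neg; lra). lra. }
  set (t := q / p). assert (Ht : 0 < t < 1).
  { unfold t. split; [apply Rdiv_lt_0_compat; lra|]. apply Rmult_lt_reg_r with p; [assumption|].
    unfold Rdiv. rewrite Rmult_assoc, Rinv_l by lra. lra. }
  assert (Hex : exists lb lc, (0 < x -> ln x < lb) /\ ln Nst < lc /\ t * lb + (1 - t) * lc < 0).
  { unfold dS_val in Hq. destruct (Rle_dec x 0) as [Hx0|Hx0].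
    (* For [x = 0] any logarithm is allowed for [b]; this one makes the weighted sum equal to -1. *)
    - exists (- ((1 - t) * (ln Nst + 1) + 1) / t), (ln Nst + 1). split; [lra|]. split; [lra|].
      replace (t * (- ((1 - t) * (ln Nst + 1) + 1) / t)) with (- ((1 - t) * (ln Nst + 1) + 1)) by (field; lra).
      lra.
    - assert (Hlx : ln x < 0) by (apply ln_neg; lra).
      assert (Hneg : t * ln x + (1 - t) * ln Nst < 0).
      { assert (H1 : p * ln Nst < q * (ln Nst - ln x)).
        { destruct Hq as [Hq _]. apply Rmult_lt_compat_r with (r := ln Nst - ln x) in Hq; [|lra].
          replace (p * ln Nst / (ln Nst - ln x) * (ln Nst - ln x)) with (p * ln Nst) in Hq by (field; lra).
          exact Hq. }
        apply Rmult_lt_reg_l with p; [assumption|]. unfold t.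
        replace (p * (q / p * ln x + (1 - q / p) * ln Nst)) with (q * ln x + (p - q) * ln Nst) by (field; lra).
        lra. }
      (* The weights add up to 1, so raising both logarithms by [e] uses exactly half of the
         available defect. *)
      set (e := - (t * ln x + (1 - t) * ln Nst) / 2).
      exists (ln x + e), (ln Nst + e). unfold e. split; [lra|]. split; [lra|]. lra. }
  destruct Hex as [lb [lc [Hlb [Hlc Hsum]]]]. exists (exp lb), (exp lc).
  split; [|split; [apply exp_pos|split]].
  - destruct (Rle_lt_or_eq_dec 0 x Hx) as [Hpos|<-]; [|apply exp_pos].
    rewrite <- (exp_ln x) by assumption. apply exp_increasing. auto.
  - rewrite <- (exp_ln Nst) by lra. apply exp_increasing. assumption.
  - unfold Rpower. rewrite !ln_exp, <- exp_plus. apply exp_increasing in Hsum.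
    rewrite exp_0 in Hsum. exact Hsum.
Qed.

(** For infinitely many [k] the energy of exponent [p] is below [b^k]; Hoelder's inequality turns
    this into [E q k <= C g^k] with [g < 1]. *)
Lemma adm_of_Rlo p x q : 0 < p -> Rlo p = Finite x -> x < 1 -> dS_val p x < q < p -> Adm q.
Proof.
  intros Hp Ex Hx1 Hq.
  assert (Hx : 0 <= x) by (assert (H := Rlo_nonneg p); rewrite Ex in H; exact H).
  destruct (perturbation p x q Hp Hx Hq Hx1) as [b [c [Hxb [Hb [Hc Hbc]]]]].
  assert (Hq0 : 0 < q).
  { apply Rle_lt_trans with (dS_val p x); [|lra]. unfold dS_val. destruct (Rle_dec x 0); [lra|].
    assert (HN := ln_Nst_pos).
    apply Rmult_le_pos; [apply Rmult_le_pos; lra|]. left. apply Rinv_0_lt_compat.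
    assert (ln x < 0) by (apply ln_neg; lra). lra. }
  apply Adm_of_small; [assumption|]. intros eps k0 He.
  destruct (E_holder q p) as [C [HC Hh]]; [lra|].
  destruct (HNsb c Hc) as [k1 Hk1].
  set (g := Rpower b (q / p) * Rpower c (1 - q / p)).
  assert (Hg : 0 < g < 1) by (split; [apply Rmult_lt_0_compat; apply Rpower_pos|exact Hbc]).
  destruct (pow_eventually_lt g Hg (eps / C)) as [k2 Hk2]; [apply Rdiv_lt_0_compat; assumption|].
  destruct (liminf_lt_frequently (fun k => Rbar_rootk (E p k) k) (Finite b)) with (n := (1 + k0 + k1 + k2)%nat)
    as [k [Hk Hlt]].
  { fold (Rlo p). rewrite Ex. exact Hxb. }
  exists k. split; [lia|]. apply rootk_lt in Hlt; [|lia|assumption].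
  assert (Hck : 0 < c ^ k) by (apply pow_lt; lra). assert (Hbk : 0 < b ^ k) by (apply pow_lt; assumption).
  eapply Rbar_le_lt_trans; [apply (Hh k (c ^ k) (b ^ k)); auto; apply Hk1; lia|].
  simpl. rewrite <- !Rpower_pow_base, <- Rpow_mult_distr by lra. fold g.
  specialize (Hk2 k ltac:(lia)). apply Rmult_lt_compat_l with (r := C) in Hk2; [|assumption].
  replace (C * (eps / C)) with eps in Hk2 by (field; lra). exact Hk2.
Qed.

Lemma Rup_lt_one_of_adm p al : 0 < p -> Adm al -> al < p -> Rbar_lt (Rup p) (Finite 1).
Proof.
  intros Hp Hal Hap. destruct (Adm_above al p Hal Hap Hp) as [C [q [HC [Hq H]]]].
  apply Rbar_le_lt_trans with (Finite q); [|apply Hq].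
  apply (limsup_rootk_le p C q 0); [assumption|lra|auto].
Qed.

Lemma Rbar_between x a b : Rbar_le (Finite a) x -> Rbar_le x (Finite b) -> exists r, x = Finite r /\ a <= r <= b.
Proof. destruct x as [r| |]; simpl; try contradiction. intros. exists r. auto. Qed.

Theorem spectral_small p : 0 < p -> Rbar_lt (Rlo p) (Finite 1) ->
  Rbar_le dimA (dS_formula p (Finite Nst) (Rlo p)) /\
  Rbar_le (dS_formula p (Finite Nst) (Rlo p)) (dS_formula p (Finite Nst) (Rup p)) /\
  Rbar_lt (dS_formula p (Finite Nst) (Rup p)) (Finite p).
Proof.
  intros Hp Hlo. assert (HN := ln_Nst_pos).
  destruct (Rbar_between _ _ _ (Rlo_nonneg p) (Rbar_lt_le _ _ Hlo)) as [x [Ex Hx]].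
  assert (Hx1 : x < 1) by (rewrite Ex in Hlo; exact Hlo).
  assert (Hval : forall y, 0 <= y < 1 -> dS_val p y < p).
  { intros y Hy. unfold dS_val. destruct (Rle_dec y 0); [lra|].
    assert (ln y < 0) by (apply ln_neg; lra).
    apply Rmult_lt_reg_r with (ln Nst - ln y); [lra|].
    unfold Rdiv. rewrite Rmult_assoc, Rinv_l by lra. nra. }
  assert (Hdim : Rbar_le dimA (Finite (dS_val p x))).
  { apply Rbar_le_above with p; [apply Hval; lra|]. intros q Hq. apply Glb_Rbar_le.
    apply (adm_of_Rlo p x q); auto. }
  (* The bound on the limit inferior gives an admissible exponent below [p], and this in turn forces
     the limit superior of the roots below 1. *)
  destruct (Glb_Rbar_lt Adm (Finite p)) as [al [Hal Hap]].
  { eapply Rbar_le_lt_trans; [exact Hdim|]. apply Hval. lra. }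
  assert (Hup := Rup_lt_one_of_adm p al Hp Hal Hap).
  destruct (Rbar_between _ _ _ (Rup_nonneg p) (Rbar_lt_le _ _ Hup)) as [y [Ey Hy]].
  assert (Hy1 : y < 1) by (rewrite Ey in Hup; exact Hup).
  assert (Hxy : x <= y).
  { assert (H := liminf_le_limsup (fun k => Rbar_rootk (E p k) k)). fold (Rlo p) (Rup p) in H.
    rewrite Ex, Ey in H. exact H. }
  rewrite Ex, Ey, !dS_formula_val. split; [assumption|]. split.
  - simpl. apply dS_val_mono; [assumption|lra|]. intros Hy0. assert (ln y < 0) by (apply ln_neg; lra). lra.
  - apply Hval. lra.
Qed.

(** The energy bound for [p <= al] gives [b^{1 - p/al}] for every [b > Nst]; let [b] decrease to
    [Nst], in logarithms. *)
Lemma Rup_le_below p al : 0 < p <= al -> Adm al -> exists y, Rup p = Finite y /\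
  (0 < y -> ln y <= (1 - p / al) * ln Nst).
Proof.
  intros Hp Hal. destruct (Adm_below al p Hal Hp) as [C [HC H]].
  assert (Hle : forall b, Nst < b -> Rbar_le (Rup p) (Finite (Rpower b (1 - p / al)))).
  { intros b Hb. destruct (HNsb b Hb) as [k0 Hk0].
    apply (limsup_rootk_le p C _ k0); [assumption|apply Rpower_pos|]. intros k Hk.
    rewrite Rpower_pow_base by lra. apply H; [apply pow_lt; lra|auto]. }
  destruct (Rbar_between _ _ _ (Rup_nonneg p) (Hle (Nst + 1) ltac:(lra))) as [y [Ey Hy]].
  exists y. split; [assumption|]. intros Hy0. apply le_epsilon. intros eps He.
  assert (Ht : 0 <= 1 - p / al < 1).
  { assert (Hpa : 0 < p / al) by (apply Rdiv_lt_0_compat; lra). split; [|lra].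
    assert (p / al <= 1); [|lra]. apply Rmult_le_reg_r with al; [lra|].
    unfold Rdiv. rewrite Rmult_assoc, Rinv_l by lra. lra. }
  assert (Hb : Nst < Nst * exp eps).
  { assert (H1 : 1 < exp eps) by (rewrite <- exp_0; apply exp_increasing; assumption). nra. }
  specialize (Hle _ Hb). rewrite Ey in Hle. simpl in Hle.
  assert (Hln : ln y <= (1 - p / al) * ln (Nst * exp eps)).
  { assert (Hl : ln y <= ln (Rpower (Nst * exp eps) (1 - p / al))).
    { destruct Hle as [Hlt| ->]; [left; apply ln_increasing; assumption|lra]. }
    unfold Rpower in Hl. rewrite ln_exp in Hl. exact Hl. }
  rewrite ln_mult, ln_exp in Hln by (try apply exp_pos; lra). nra.
Qed.

Theorem spectral_large p : 0 < p -> Rbar_le (Finite 1) (Rup p) ->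
  Rbar_le (dS_formula p (Finite Nst) (Rup p)) dimA /\
  Rbar_le (dS_formula p (Finite Nst) (Rlo p)) (dS_formula p (Finite Nst) (Rup p)) /\
  Rbar_le (Finite p) (dS_formula p (Finite Nst) (Rlo p)).
Proof.
  intros Hp Hup. assert (HN := ln_Nst_pos).
  (* An admissible exponent below [p] would give exponential decay of the energies, hence roots with
     limit superior below 1. *)
  assert (Hge : forall al, Adm al -> p <= al).
  { intros al Hal. apply Rnot_lt_le. intros Hlt. apply (Rbar_lt_not_le _ _ (Rup_lt_one_of_adm p al Hp Hal Hlt)).
    assumption. }
  assert (Hex : exists al0, Adm al0).
  { destruct E_large as [p0 [C [q [Hp0 [HC [Hq H]]]]]]. exists p0. apply Adm_of_small; [assumption|].
    intros eps k0 He. destruct (decay_small p0 C q HC Hq H eps He) as [n Hn].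
    exists (k0 + n)%nat. split; [lia|]. apply Hn. lia. }
  destruct Hex as [al0 Hal0].
  destruct (Rup_le_below p al0 (conj Hp (Hge al0 Hal0)) Hal0) as [y [Ey Hy]].
  assert (Hy1 : 1 <= y) by (rewrite Ey in Hup; exact Hup).
  assert (Hlyp : 0 <= ln y).
  { rewrite <- ln_1. destruct Hy1 as [Hlt|<-]; [left; apply ln_increasing; lra|lra]. }
  assert (Hbound : forall al, Adm al -> p / al * ln Nst <= ln Nst - ln y).
  { intros al Hal. destruct (Rup_le_below p al (conj Hp (Hge al Hal)) Hal) as [y' [Ey' Hy']].
    rewrite Ey in Ey'. injection Ey' as <-. specialize (Hy' ltac:(lra)). lra. }
  assert (Hly : ln y < ln Nst).
  { assert (H := Hbound al0 Hal0). assert (Ha := Adm_pos al0 Hal0).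
    assert (0 < p / al0) by (apply Rdiv_lt_0_compat; lra). nra. }
  (* If the lower rate were below 1, the other case of the theorem would put the upper dimension
     below [p], whereas [y >= 1] makes it at least [p]. *)
  assert (Hlo1 : Rbar_le (Finite 1) (Rlo p)).
  { apply Rbar_not_lt_le. intros Hlt. destruct (spectral_small p Hp Hlt) as [_ [_ H3]].
    assert (Hlt' : dS_val p y < p) by (rewrite Ey, dS_formula_val in H3; exact H3).
    unfold dS_val in Hlt'. destruct (Rle_dec y 0); [lra|].
    apply Rmult_lt_compat_r with (r := ln Nst - ln y) in Hlt'; [|lra].
    unfold Rdiv in Hlt'. rewrite Rmult_assoc, Rinv_l in Hlt' by lra. nra. }
  assert (Hlu := liminf_le_limsup (fun k => Rbar_rootk (E p k) k)). fold (Rlo p) (Rup p) in Hlu.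
  rewrite Ey in Hlu. destruct (Rbar_between _ _ _ Hlo1 Hlu) as [x [Ex Hx]].
  assert (Hlx : 0 <= ln x).
  { rewrite <- ln_1. destruct (proj1 Hx) as [Hlt|<-]; [left; apply ln_increasing; lra|lra]. }
  assert (Hxy : ln x <= ln y).
  { destruct (proj2 Hx) as [Hlt| ->]; [left; apply ln_increasing; lra|lra]. }
  rewrite Ex, Ey, !dS_formula_val. split; [|split].
  - apply Glb_Rbar_correct. intros al Hal. simpl. assert (Ha := Adm_pos al Hal).
    assert (H := Hbound al Hal). unfold dS_val. destruct (Rle_dec y 0); [lra|].
    apply Rmult_le_reg_r with (ln Nst - ln y); [lra|].
    unfold Rdiv. rewrite Rmult_assoc, Rinv_l, Rmult_1_r by lra.
    apply Rmult_le_compat_l with (r := al) in H; [|lra].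
    replace (al * (p / al * ln Nst)) with (p * ln Nst) in H by (field; lra). exact H.
  - simpl. apply dS_val_mono; [assumption|lra|auto].
  - simpl. unfold dS_val. destruct (Rle_dec x 0); [lra|].
    apply Rmult_le_reg_r with (ln Nst - ln x); [lra|].
    unfold Rdiv. rewrite Rmult_assoc, Rinv_l, Rmult_1_r by lra. nra.
Qed.

End CriticalExponents.


(** * The growth rate of the tree, and the theorem *)

Lemma rootk_ge x k b : Rbar_le (Finite (b ^ k)) x -> (1 <= k)%nat -> 0 < b ->
  Rbar_le (Finite b) (Rbar_rootk x k).
Proof.
  intros H Hk Hb. apply Rbar_not_lt_le. intros Hlt. apply rootk_lt in Hlt; [|assumption|assumption].
  revert H. apply Rbar_lt_not_le. exact Hlt.
Qed.

Section Branching.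
Context {T X : Type} (pi : T -> T) (lev : T -> Z) (K : T -> X -> Prop) (d : X -> X -> R).
Context (r Cd c0 ct : R) (L B M : nat) (phi : T).
Hypothesis HF : frame pi lev K d r Cd c0 ct L B M.

Lemma card_ge {A : Type} (S : A -> Prop) l : NoDup l -> (forall z, In z l -> S z) ->
  Rbar_le (Finite (INR (length l))) (card S).
Proof. intros Hd Hl. apply (proj1 (Lub_Rbar_correct _)). exists l. auto. Qed.

Lemma card_le {A : Type} (S : A -> Prop) x : (forall l, NoDup l -> (forall z, In z l -> S z) ->
  INR (length l) <= x) -> Rbar_le (card S) (Finite x).
Proof. intros H. apply Lub_Rbar_correct. intros y [l [Hd [Hl ->]]]. simpl. auto. Qed.

Lemma N_star_finite : exists Nst, N_star pi = Finite Nst /\ 1 < Nst /\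
  forall b, Nst < b -> exists k0, forall k, (k0 <= k)%nat -> size_bound pi k (b ^ k).
Proof.
  destruct (fun_choice (fun w x => exists y, K w x /\ K w y /\ rp r (lev w) <= Cd * d x y) (fr_two HF))
    as [xa Hxa].
  destruct (fun_choice _ Hxa) as [za Hza].
  destruct (descendants_double HF xa za) as [k1 [Hk1 Hdbl]]; try (intros; apply Hza).
  (* The number of descendants doubles every [k1] levels, so the growth rate is at least [b1 > 1];
     this makes [ln Nst] positive. *)
  set (b1 := Rpower 2 (/ INR k1)).
  assert (Hb1 : 1 < b1).
  { unfold b1, Rpower. rewrite <- exp_0. apply exp_increasing.
    assert (H1 : 0 < ln 2) by (rewrite <- ln_1; apply ln_increasing; lra).
    assert (H2 : 0 < / INR k1) by (apply Rinv_0_lt_compat, lt_0_INR; lia). nra. }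
  assert (Hlow : Rbar_le (Finite b1) (N_star pi)).
  { apply limsup_ge. intros n. exists (S n * k1)%nat. split; [nia|].
    eapply Rbar_le_trans; [|apply Rbar_lub_ub; exists phi; reflexivity].
    apply rootk_ge; [|nia|lra]. destruct (Hdbl (S n) phi) as [l [Hd [Hl Hlen]]].
    eapply Rbar_le_trans; [|apply (card_ge _ l Hd Hl)]. rewrite Hlen, pow_INR. simpl (INR 2).
    rewrite (Nat.mul_comm (S n) k1), pow_mult. unfold b1. rewrite Rpower_root by (lra || assumption).
    replace (1 + 1) with 2 by ring. apply Rbar_le_refl. }
  assert (Hup : Rbar_le (N_star pi) (Finite (INR (S B)))).
  { apply limsup_le with 1%nat. intros k Hk. apply Rbar_lub_least. intros y [w ->].
    apply rootk_le; [|assumption|apply lt_0_INR; lia]. apply card_le. intros l Hd Hl.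
    eapply Rle_trans; [apply (size_bound_B pi lev K d r Cd c0 ct L B M HF k w l Hd Hl)|].
    apply pow_incr. split; [apply pos_INR|apply le_INR; lia]. }
  destruct (Rbar_between _ _ _ Hlow Hup) as [Nst [EN HNst]]. exists Nst.
  split; [assumption|]. split; [lra|]. intros b Hb.
  assert (Hlt : Rbar_lt (N_star pi) (Finite b)) by (rewrite EN; exact Hb).
  apply limsup_lt_eventually in Hlt. destruct Hlt as [n Hn]. exists (1 + n)%nat. intros k Hk w l Hd Hl.
  assert (H1 : Rbar_lt (Rbar_rootk (card (Sk pi k (fun u => u = w))) k) (Finite b)).
  { eapply Rbar_le_lt_trans; [|apply (Hn k); lia]. apply Rbar_lub_ub. exists w. reflexivity. }
  apply rootk_lt in H1; [|lia|lra].
  assert (H2 := Rbar_le_lt_trans _ _ _ (card_ge (Sk pi k (fun u => u = w)) l Hd Hl) H1).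
  simpl in H2. lra.
Qed.

End Branching.

Theorem theorem3p1
  (X : Type) (O : (X -> Prop) -> Prop)
  (T : Type) (pi : T -> T) (phi : T) (K : T -> X -> Prop)
  (d : X -> X -> R) (Mstar : nat)
  (HXsc : sigma_compact O) (HXiso : no_isolated_points O)
  (Htree : bi_infinite_tree pi) (HTlf : tree_locally_finite pi)
  (HK : K_partition pi phi O K)
  (HKlf : partition_locally_finite pi phi O K)
  (HKmin : partition_minimal pi phi K)
  (Hd : induces d O) (Hdiam : unbounded d)
  (Hbf : basic_framework pi phi K d)
  (Had : adapted pi K d Mstar) :
  forall (N N1 N2 : nat) (p : R),
    (1 <= N)%nat -> (N1 + Mstar <= N2)%nat -> 0 < p ->
    (I_lower pi phi K N1 N2 N = I_upper pi phi K N1 N2 N /\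
     I_upper pi phi K N1 N2 N = dim_AR d) /\
    (Rbar_lt (R_lower pi phi K p N1 N2 N) (Finite 1) ->
       Rbar_le (dim_AR d) (dS_lower pi phi K p N1 N2 N) /\
       Rbar_le (dS_lower pi phi K p N1 N2 N) (dS_upper pi phi K p N1 N2 N) /\
       Rbar_lt (dS_upper pi phi K p N1 N2 N) (Finite p)) /\
    (Rbar_le (Finite 1) (R_upper pi phi K p N1 N2 N) ->
       Rbar_le (dS_upper pi phi K p N1 N2 N) (dim_AR d) /\
       Rbar_le (dS_lower pi phi K p N1 N2 N) (dS_upper pi phi K p N1 N2 N) /\
       Rbar_le (Finite p) (dS_lower pi phi K p N1 N2 N)).
Proof.
  intros N N1 N2 p HN HN12 Hp.
  destruct (level_function pi phi Htree) as [lev [Hlevel Hlev]].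
  destruct (frame_of_hypotheses X O T pi phi K d Mstar lev Htree HK HKmin (proj1 Hd) Hbf Had Hlevel Hlev)
    as [r [Cd [c0 [ct [L [B HF]]]]]].
  destruct (fun_choice (fun w x => exists y, K w x /\ K w y /\ rp r (lev w) <= Cd * d x y) (fr_two HF))
    as [xa Hxa].
  destruct (fun_choice _ Hxa) as [za Hza].
  assert (Hxa1 : forall w, K w (xa w)) by (intros; apply Hza).
  assert (Hza1 : forall w, K w (za w)) by (intros; apply Hza).
  assert (Hxz : forall w, rp r (lev w) <= Cd * d (xa w) (za w)) by (intros; apply Hza).
  destruct (N_star_finite pi lev K d r Cd c0 ct L B Mstar phi HF) as [Nst [EN [HN1 HNsb]]].
  set (E := fun q k => energy pi phi K q k N1 N2 N).
  set (Adm := fun alpha => exists (rho : X -> X -> R) (nu : (X -> Prop) -> Rbar),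
    is_metric rho /\ borel_measure rho nu /\ ahlfors_regular rho alpha nu /\ quasisymmetric d rho).
  assert (H0 : forall q k, Rbar_le (Finite 0) (E q k)).
  { intros q k. apply energy_nonneg. }
  assert (H1 : forall al, Adm al -> 0 < al).
  { intros al [rho [nu [Hrho [Hnu [Hal Hqs]]]]].
    exact (dimension_pos HF rho Hrho Hqs xa za Hxa1 Hza1 Hxz nu Hnu al Hal phi). }
  assert (H2 : forall al q, Adm al -> al < q -> 0 < q ->
    exists C g, 0 < C /\ 0 < g < 1 /\ forall k, Rbar_le (E q k) (Finite (C * g ^ k))).
  { intros al q [rho [nu [Hrho [Hnu [Hal Hqs]]]]] Haq Hq.
    exact (energy_decay_above pi lev K d r Cd c0 ct L B Mstar phi HF Hlevel N1 N2 N rho Hrho Hqs HN12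
      xa za Hxa1 Hza1 Hxz nu Hnu al Hal q Haq Hq). }
  assert (H3 : forall al q, Adm al -> 0 < q <= al -> exists C, 0 < C /\ forall k n, 0 < n ->
    size_bound pi k n -> Rbar_le (E q k) (Finite (C * Rpower n (1 - q / al)))).
  { intros al q [rho [nu [Hrho [Hnu [Hal Hqs]]]]] Hq.
    exact (energy_growth_below pi lev K d r Cd c0 ct L B Mstar phi HF Hlevel N1 N2 N rho Hrho Hqs HN12
      xa za Hxa1 Hza1 Hxz nu Hnu al Hal q Hq). }
  (* Taken with [rho = d]: decay for one large exponent gives, through the construction of metrics,
     a first admissible exponent. *)
  assert (H4 : exists q C g, 0 < q /\ 0 < C /\ 0 < g < 1 /\ forall k, Rbar_le (E q k) (Finite (C * g ^ k))).
  { exact (energy_decay_large_p pi lev K d r Cd c0 ct L B Mstar phi HF Hlevel N1 N2 N d (fr_met HF)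
      (quasisymmetric_refl d) HN12 xa za Hxa1 Hza1 Hxz). }
  assert (H5 : forall q, 0 < q -> (forall eps k0, 0 < eps -> exists k, (k0 <= k)%nat /\
    Rbar_lt (E q k) (Finite eps)) -> Adm q).
  { intros q Hq Hsmall.
    eapply (regular_metric_of_liminf pi lev K d r Cd c0 ct L B Mstar phi HF Hlevel); eassumption. }
  assert (H6 : forall q p, 0 < q <= p -> exists C, 0 < C /\ forall k n e, 0 < n -> size_bound pi k n -> 0 < e ->
    Rbar_lt (E p k) (Finite e) -> Rbar_le (E q k) (Finite (C * (Rpower e (q / p) * Rpower n (1 - q / p))))).
  { intros q p' Hq. apply (energy_holder pi lev K d r Cd c0 ct L B Mstar phi HF Hlevel). assumption. }
  split; [|split].
  - apply (critical_exponents_eq E Adm); assumption.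
  - unfold dS_lower, dS_upper. rewrite EN. apply (spectral_small E Adm (size_bound pi) Nst); assumption.
  - unfold dS_lower, dS_upper. rewrite EN. apply (spectral_large E Adm (size_bound pi) Nst); assumption.
Qed.
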